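(* Let $\tau$ be a parabolic self-map of $\Pi^+$, that is, $\tau(w)=w+w_0$, where $\operatorname{Im} w_0\ge 0$ and $w_0\ne 0$. Then, for all $\alpha>-1$, the composition operator $C_\tau:\mathcal{D}^2_\alpha(\Pi^+)\to\mathcal{D}^2_\alpha(\Pi^+)$, $C_\tau F=F\circ\tau$, satisfies i) $\sigma(C_\tau;\mathcal{D}^2_\alpha(\Pi^+))=\sigma_{ess}(C_\tau;\mathcal{D}^2_\alpha(\Pi^+))=\mathbb{T}$, when $w_0\in\mathbb{R}$; ii) $\sigma(C_\tau;\mathcal{D}^2_\alpha(\Pi^+))=\{e^{iw_0t}:t\in[0,\infty)\}\cup\{0\}$, when $w_0\in\Pi^+$. Moreover, the essential spectrum $\sigma_{ess}(C_\tau;\mathcal{D}^2_\alpha(\Pi^+))$ coincides with the spectrum in both cases.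
   Context: $\Pi^+=\{w\in\mathbb{C}:\operatorname{Im} w>0\}$ is the upper half-plane and $\mathbb{T}=\{z\in\mathbb{C}:|z|=1\}$ is the unit circle. For $\alpha>-1$ the weighted Dirichlet space $\mathcal{D}^2_\alpha(\Pi^+)$ consists of the analytic functions $F:\Pi^+\to\mathbb{C}$ such that $$\int_{\Pi^+}|F'(x+iy)|^2\,y^\alpha\,dx\,dy<\infty,$$ together with the condition that for all $x\in\mathbb{R}$, $F(x+iy)\to 0$ when $y\to\infty$. It is equipped with the norm $$\|F\|_{\mathcal{D}^2_\alpha(\Pi^+)}=\Big(\int_{\Pi^+}|F'(x+iy)|^2\,y^\alpha\,dx\,dy\Big)^{1/2}.$$ The operator $C_\tau$ is bounded on $\mathcal{D}^2_\alpha(\Pi^+)$ for the maps $\tau$ considered. For a bounded linear operator $T$ on a space $\mathcal{H}$: $\sigma(T;\mathcal{H})=\{\lambda\in\mathbb{C}: T-\lambda \text{ is not invertible on }\mathcal{H}\}$, and $\sigma_{ess}(T;\mathcal{H})=\{\lambda\in\mathbb{C}: T-\lambda\text{ is not a Fredholm operator on }\mathcal{H}\}$. *)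

(* Defs.v *)
From HB Require Import structures.
From mathcomp Require Import all_boot all_order all_algebra.
From mathcomp Require Import complex.
From mathcomp Require Import all_classical all_reals all_analysis.

Set Implicit Arguments.
Unset Strict Implicit.
Unset Printing Implicit Defensive.

Import Order.TTheory GRing.Theory Num.Theory.
Import numFieldTopology.Exports numFieldNormedType.Exports.

Local Open Scope classical_set_scope.
Local Open Scope complex_scope.
Local Open Scope ring_scope.

(* The normed space is given by a linear subspace [H] of an ambient complex
   vector space [V] and a function [nrm], whose values outside [H] are
   irrelevant; likewise only the restriction to [H] of an operator [T : V -> V]
   matters. *)
Section Operators.
Context {R : realType} {V : lmodType R[i]}.
Variables (H : set V) (nrm : V -> R).
Implicit Types (T S : V -> V) (l : R[i]) (s : seq V).

Definition bounded_operator T : Prop :=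
  [/\ forall x, H x -> H (T x),
      forall (a : R[i]) x y, H x -> H y -> T (a *: x + y) = a *: T x + T y &
      exists M : R, forall x, H x -> nrm (T x) <= M * nrm x].

Definition invertible T : Prop :=
  exists S, bounded_operator S /\
    forall x, H x -> S (T x) = x /\ T (S x) = x.

Definition lin_comb s (c : nat -> R[i]) : V := \sum_(i < size s) c i *: s`_i.

Definition finite_dim_kernel T : Prop :=
  exists2 s, (forall x, x \in s -> H x) &
    forall x, H x -> T x = 0 -> exists c, x = lin_comb s c.

Definition closed_range T : Prop :=
  forall y, H y ->
    (forall e : R, 0 < e -> exists2 x, H x & nrm (y - T x) < e) ->
    exists2 x, H x & T x = y.

Definition finite_codim_range T : Prop :=
  exists2 s, (forall x, x \in s -> H x) &
    forall y, H y -> exists2 x, H x & exists c, y = T x + lin_comb s c.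

Definition fredholm T : Prop :=
  [/\ finite_dim_kernel T, closed_range T & finite_codim_range T].

Definition shift_op T l : V -> V := fun x => T x - l *: x.

Definition spectrum T : set R[i] := [set l | ~ invertible (shift_op T l)].

Definition essential_spectrum T : set R[i] :=
  [set l | ~ fredholm (shift_op T l)].

End Operators.

Section DirichletSpace.
Variable R : realType.

Definition half_plane := {w : R[i] | 0 < complex.Im w}.

(* A function on the half-plane, extended by 0 so that the library's
   derivatives and limits apply. The half-plane being open, the extension does
   not affect derivatives at its points. *)
Definition ext0 (F : half_plane -> R[i]^o) (w : R[i]^o) : R[i]^o :=
  oapp F 0 (insub w).

(* [derivable] at the complex point [w] along 1, over the scalar field [R[i]],
   is complex differentiability. *)
Definition analytic (F : half_plane -> R[i]^o) : Prop :=
  forall w : half_plane, derivable (ext0 F) (val w : R[i]^o) 1.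

Definition cderiv (F : half_plane -> R[i]^o) (w : R[i]) : R[i] :=
  'D_1 (ext0 F) (w : R[i]^o).

Definition dirichlet_integral (alpha : R) (F : half_plane -> R[i]^o) : \bar R :=
  (\int[lebesgue_measure \x lebesgue_measure]_(p in [set p : R * R | 0 < p.2]%R)
    (ComplexField.Normc.normc (cderiv F (p.1 +i* p.2)) ^+ 2
       * p.2 `^ alpha)%:E)%E.

Definition dirichlet_space (alpha : R) : set (half_plane -> R[i]^o) :=
  [set F | [/\ analytic F,
    (dirichlet_integral alpha F < +oo)%E &
    forall x : R, ext0 F (x +i* y) @[y --> +oo%R] --> (0 : R[i]^o)]].

Definition dirichlet_norm (alpha : R) (F : half_plane -> R[i]^o) : R :=
  Num.sqrt (fine (dirichlet_integral alpha F)).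

Definition parabolic_self_map (tau : half_plane -> half_plane) (w0 : R[i]) :=
  [/\ 0 <= complex.Im w0, w0 <> 0 & forall w, val (tau w) = val w + w0].

Definition composition_operator (tau : half_plane -> half_plane)
    (F : half_plane -> R[i]^o) : half_plane -> R[i]^o :=
  F \o tau.

Definition unit_circle : set R[i] :=
  [set z | ComplexField.Normc.normc z = 1].

Definition cexp (z : R[i]) : R[i] :=
  (expR (complex.Re z))%:C * (cos (complex.Im z) +i* sin (complex.Im z)).

End DirichletSpace.

(* Main.v *)
From HB Require Import structures.
Require Import Defs.
From mathcomp Require Import all_boot all_order all_algebra.
From mathcomp Require Import complex.
From mathcomp Require Import all_classical all_reals all_analysis.
From mathcomp Require Import measurable_realfun ring lra.

Set Implicit Arguments.
Unset Strict Implicit.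
Unset Printing Implicit Defensive.

Import Order.TTheory GRing.Theory Num.Theory.
Import numFieldTopology.Exports numFieldNormedType.Exports.

Local Open Scope classical_set_scope.
Local Open Scope complex_scope.
Local Open Scope ring_scope.

(** [C] is composition with the translation by [w0]. Formally e^{itw} with t > 0 is an eigenfunction
    for the eigenvalue e^{i t w0}, so the spectrum should be the closure of these values: the circle
    when [w0] is real, the spiral together with 0 when Im w0 > 0. Off this set a bounded inverse of
    C - lam is written down explicitly; on this set the range of C - lam is shown to have infinite
    codimension or not to be closed. Invertible operators being Fredholm ([invertible_fredholm]),
    both spectra are squeezed at once.

    Boundedness. The norm sees only f', and translations commute with differentiation. For Im u >= 0
    the translation by u is bounded with a constant that does not depend on u ([energy_shift]):
    above height Im u the weights at z and z + u are comparable; below it |f'(z + u)|^2 is dominated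
    by an area mean, and y^alpha is integrable at 0. Hence every average of translates f(z + sg s)
    against k s is bounded on the space as soon as Im sg >= 0 and |k| (1 + |sg|) has an integrable
    majorant ([conv_indir], [kernel_op_bounded]). All inverses have this form.

    Inverses. For |lam| > 1 the average is the Neumann series ([neumann_conv]); for real [w0] and
    |lam| < 1 the same series serves the inverse of C. If Im w0 > 0, |lam| <= 1 and lam is neither 0
    nor on the spiral, write lam = e^{-c0 w0} and average along a horizontal line against e^{c0 s} /
    (e^{2 pi i s / w0} - 1). This kernel has a simple pole at [w0], is multiplied by lam^-1 under
    translation by [w0], and decays at both ends for a suitable c0, which exists because lam is off
    the spiral. The residue theorem in a strip around the pole then gives the inverse
    ([contour_jump], [invertible_contour]).

    Lower bounds. If lam = e^{i t w0}, the integrals of G'(x + i) e^{-it(x + i)} over [-n, n] tend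
    to 0 for every G in the range of C - lam ([range_functional]), but not for G = e^{itw} / (w + i)
    with t > 0. When [w0] is real and |lam| = 1 there are infinitely many such t, and the
    corresponding functions are independent modulo the range ([not_codim_real]). When Im w0 > 0 and
    t > 0, the same function is a limit of elements of the range ([not_closed_exp]). For lam = 1 a
    power (w + i)^-m is such a limit, and f(z + w0) - f(z) = (z + i)^-m is incompatible with the
    size of f' or with the decay of f up the imaginary axis ([not_closed_one]). For lam = 0,
    elements of the range continue holomorphically below the real axis, which combinations of
    functions with a pole just below it do not ([not_codim_zero]).

    The underlying function theory (Goursat, residues, Cauchy estimates) is developed on rectangles,
    where contour integrals are four ordinary integrals. *)

Section ComplexNorm.
Context {R : realType}.
Implicit Types z w h : R[i].
Local Notation nc := (@ComplexField.Normc.normc R).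

(** * Modulus, real part and imaginary part *)

Lemma nc_ge0 z : 0 <= nc z.
Proof. by case: z => a b; exact: sqrtr_ge0. Qed.

Lemma nc_eq0 z : (nc z == 0) = (z == 0).
Proof.
apply/eqP/eqP => [|->]; first exact: ComplexField.Normc.eq0_normc.
exact: ComplexField.Normc.normc0.
Qed.

Lemma nc_gt0 z : (0 < nc z) = (z != 0).
Proof. by rewrite lt_def nc_ge0 andbT nc_eq0. Qed.

Lemma nc0 : nc 0 = 0. Proof. exact: ComplexField.Normc.normc0. Qed.
Lemma nc1 : nc 1 = 1. Proof. exact: ComplexField.Normc.normc1. Qed.

Lemma ncM z w : nc (z * w) = nc z * nc w.
Proof. exact: ComplexField.Normc.normcM. Qed.

Lemma ncV z : nc z^-1 = (nc z)^-1.
Proof. exact: ComplexField.Normc.normcV. Qed.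

Lemma ncN z : nc (- z) = nc z.
Proof. exact: normcN. Qed.

Lemma ncB z w : nc (z - w) = nc (w - z).
Proof. by rewrite -ncN opprB. Qed.

Lemma ncX z n : nc (z ^+ n) = nc z ^+ n.
Proof.
elim: n => [|n IH]; first by rewrite !expr0 nc1.
by rewrite !exprS ncM IH.
Qed.

Lemma le_ncD z w : nc (z + w) <= nc z + nc w.
Proof. exact: le_normcD. Qed.

Lemma le_ncB z w : nc (z - w) <= nc z + nc w.
Proof. by rewrite -(ncN w) le_ncD. Qed.

Lemma nc_subl z w : nc z - nc w <= nc (z - w).
Proof. by rewrite lerBlDr (le_trans _ (le_ncD _ _))// subrK. Qed.

Lemma nc_real (x : R) : nc x%:C = `|x|.
Proof. by rewrite /= expr0n/= addr0 sqrtr_sqr. Qed.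

Lemma nc_nat n : nc n%:R = n%:R.
Proof. by rewrite -(rmorph_nat (real_complex R)) nc_real ger0_norm. Qed.

Lemma nc_i : nc 'i = 1 :> R.
Proof. by rewrite /= expr0n/= add0r expr1n sqrtr1. Qed.

Lemma nc_sqr z : nc z ^+ 2 = complex.Re z ^+ 2 + complex.Im z ^+ 2.
Proof. by case: z => a b; rewrite sqr_sqrtr// addr_ge0 ?sqr_ge0. Qed.

Lemma Re_le_nc z : `|complex.Re z| <= nc z.
Proof.
rewrite -(@ler_pXn2r _ 2)// ?nnegrE ?nc_ge0// real_normK ?num_real//.
by rewrite nc_sqr lerDl sqr_ge0.
Qed.

Lemma Im_le_nc z : `|complex.Im z| <= nc z.
Proof.
rewrite -(@ler_pXn2r _ 2)// ?nnegrE ?nc_ge0// real_normK ?num_real//.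
by rewrite nc_sqr lerDr sqr_ge0.
Qed.

Lemma nc_le_ReIm z : nc z <= `|complex.Re z| + `|complex.Im z|.
Proof.
rewrite -(@ler_pXn2r _ 2)// ?nnegrE ?nc_ge0 ?addr_ge0//.
rewrite nc_sqr sqrrD !real_normK ?num_real// lerD2r lerDl.
by rewrite mulrn_wge0// mulr_ge0.
Qed.

Lemma complex_eta z : z = complex.Re z +i* complex.Im z.
Proof. by case: z. Qed.

Lemma complexE' (x y : R) : x +i* y = x%:C + 'i * y%:C.
Proof.
rewrite [RHS](complex_eta _) /=.
by congr (_ +i* _); rewrite ?mul0r ?mulr0 ?mul1r ?subr0 ?addr0 ?add0r.
Qed.

Lemma ReD z w : complex.Re (z + w) = complex.Re z + complex.Re w.
Proof. by case: z; case: w. Qed.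
Lemma ImD z w : complex.Im (z + w) = complex.Im z + complex.Im w.
Proof. by case: z; case: w. Qed.
Lemma ReN z : complex.Re (- z) = - complex.Re z. Proof. by case: z. Qed.
Lemma ImN z : complex.Im (- z) = - complex.Im z. Proof. by case: z. Qed.
Lemma ReM z w : complex.Re (z * w) =
  complex.Re z * complex.Re w - complex.Im z * complex.Im w.
Proof. by case: z; case: w. Qed.
Lemma ImM z w : complex.Im (z * w) =
  complex.Re z * complex.Im w + complex.Im z * complex.Re w.
Proof. by case: z; case: w. Qed.

End ComplexNorm.

(** * Complex continuity and differentiability through difference quotients *)

Section ComplexDerivative.
Context {R : realType}.
Implicit Types (z w h d : R[i]) (f g : R[i] -> R[i]) (e : R).
Local Notation nc := (@ComplexField.Normc.normc R).

Definition ccont f z := forall e, 0 < e ->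
  exists2 d, 0 < d & forall w, nc (w - z) < d -> nc (f w - f z) <= e.

Lemma ccont_ext f g z : ccont f z ->
  (exists2 d, 0 < d & forall w, nc (w - z) < d -> f w = g w) -> ccont g z.
Proof.
move=> cf [r r0 fg] e e0; have [d d0 fd] := cf e e0.
exists (Num.min d r); first by rewrite lt_min d0.
move=> w; rewrite lt_min => /andP[wd wr].
by rewrite -!fg ?fd// subrr nc0.
Qed.

Lemma ccont_cst c z : ccont (fun=> c) z.
Proof. by move=> e e0; exists 1 => // w _; rewrite subrr nc0 ltW. Qed.

Lemma ccont_id z : ccont id z.
Proof. by move=> e e0; exists e => // w /ltW. Qed.

Lemma ccontD f g z : ccont f z -> ccont g z -> ccont (fun w => f w + g w) z.
Proof.
move=> cf cg e e0; have e20 : 0 < e / 2 by rewrite divr_gt0.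
have [d d0 fd] := cf _ e20; have [r r0 gr] := cg _ e20.
exists (Num.min d r); first by rewrite lt_min d0.
move=> w; rewrite lt_min => /andP[/fd wd /gr wr].
by rewrite opprD addrACA (le_trans (le_ncD _ _))// (splitr e) lerD.
Qed.

Lemma ccontM f g z : ccont f z -> ccont g z -> ccont (fun w => f w * g w) z.
Proof.
move=> cf cg e e0.
pose A := nc (f z) + 1; pose B := nc (g z) + 1.
have A0 : 0 < A by rewrite ltr_wpDl// nc_ge0.
have B0 : 0 < B by rewrite ltr_wpDl// nc_ge0.
have [d d0 fd] := cf (Num.min 1 (e / 2 / B)) ltac:(by rewrite lt_min ltr01 !divr_gt0).
have [r r0 gr] := cg (e / 2 / A) ltac:(by rewrite !divr_gt0).
exists (Num.min d r); first by rewrite lt_min d0.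
move=> w; rewrite lt_min => /andP[/fd wd /gr wr].
move: wd; rewrite le_min => /andP[w1 wd].
have -> : f w * g w - f z * g z = (f w - f z) * g z + f w * (g w - g z) by ring.
rewrite (le_trans (le_ncD _ _))// (splitr e) lerD// ncM.
- rewrite -[leRHS](@divfK _ B) ?gt_eqF// ler_pM ?nc_ge0//.
  by rewrite lerDl.
- rewrite -[leRHS](@divfK _ A) ?gt_eqF// [leRHS]mulrC ler_pM ?nc_ge0//.
  rewrite /A -lerBlDl (le_trans _ w1)//.
  exact: nc_subl.
Qed.

Lemma ccontN f z : ccont f z -> ccont (fun w => - f w) z.
Proof.
by move=> cf e /cf[d d0 fd]; exists d => // w /fd; rewrite -opprD ncN.
Qed.

Lemma ccontB f g z : ccont f z -> ccont g z -> ccont (fun w => f w - g w) z.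
Proof. by move=> cf cg; apply: ccontD => //; exact: ccontN. Qed.

Lemma ccont_comp f g z : ccont g z -> ccont f (g z) -> ccont (f \o g) z.
Proof.
move=> cg cf e /cf[d d0 fd]; have d20 : 0 < d / 2 by rewrite divr_gt0.
have [r r0 gr] := cg _ d20; exists r => // w /gr wr.
by apply: fd; rewrite (le_lt_trans wr)// ltr_pdivrMr// ltr_pMr// ltr1n.
Qed.

Lemma ccont_inv z : z != 0 -> ccont GRing.inv z.
Proof.
move=> z0 e e0; have nz0 : 0 < nc z by rewrite nc_gt0.
exists (Num.min (nc z / 2) (e * nc z ^+ 2 / 2)).
  by rewrite lt_min !divr_gt0// mulr_gt0// exprn_gt0.
move=> w; rewrite lt_min => /andP[w1 w2].
have wz : nc z / 2 <= nc w.
  have := nc_subl z w; rewrite ncB => H; move: w1 H; lra.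
have w0 : w != 0 by rewrite -nc_gt0 (lt_le_trans _ wz)// divr_gt0.
have -> : w^-1 - z^-1 = (z - w) * (w^-1 * z^-1) by field; rewrite z0 w0.
rewrite !ncM !ncV ncB.
rewrite -[leRHS](mulfK (_ : nc w * nc z != 0)); last by rewrite mulf_neq0 ?nc_eq0.
rewrite -invfM ler_wpM2r ?invr_ge0 ?mulr_ge0 ?nc_ge0//.
rewrite (le_trans (ltW w2))// expr2 -!mulrA ler_wpM2l ?(ltW e0)//.
by rewrite mulrC ler_wpM2r ?nc_ge0// mulrC ler_wpM2r// ltW.
Qed.

Lemma ccontV f z : ccont f z -> f z != 0 -> ccont (fun w => (f w)^-1) z.
Proof. by move=> cf fz; apply: (ccont_comp cf); exact: ccont_inv. Qed.

Lemma ccontX f n z : ccont f z -> ccont (fun w => f w ^+ n) z.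
Proof.
move=> cf; elim: n => [|n IH]; first exact: ccont_cst.
by apply: ccont_ext (ccontM cf IH) _; exists 1 => // w _; rewrite exprS.
Qed.

Definition slope f z d w := if w == z then d else (f w - f z) / (w - z).

(* Caratheodory's form of complex differentiability: the difference quotient,
   completed by [d] at [z], is continuous there. *)
Definition cdiff f z d := ccont (slope f z d) z.

Lemma slopeE f z d w : f w = f z + slope f z d w * (w - z).
Proof.
rewrite /slope; case: eqP => [->|/eqP wz]; first by rewrite subrr mulr0 addr0.
by rewrite divfK ?subr_eq0// addrC subrK.
Qed.

Lemma cdiff_cont f z d : cdiff f z d -> ccont f z.
Proof.
move=> fd; apply: ccont_ext (_ : ccont (fun w => f z + slope f z d w * (w - z)) z) _.
  apply: ccontD; first exact: ccont_cst.
  apply: ccontM => //.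
  by apply: ccontB; [exact: ccont_id|exact: ccont_cst].
by exists 1 => // w _; rewrite -slopeE.
Qed.

Lemma slopexx f z d : slope f z d z = d.
Proof. by rewrite /slope eqxx. Qed.

Lemma cdiff_intro f z d q : ccont q z -> q z = d ->
  (exists2 r, 0 < r & forall w, nc (w - z) < r -> f w = f z + q w * (w - z)) ->
  cdiff f z d.
Proof.
move=> cq qz [r r0 fq]; apply: ccont_ext cq _; exists r => // w /fq fw.
rewrite /slope; case: eqP => [->//|/eqP wz].
by rewrite fw [X in (X - _)]addrC addrK mulfK// subr_eq0.
Qed.

Lemma cdiff_ext f g z d : cdiff f z d ->
  (exists2 r, 0 < r & forall w, nc (w - z) < r -> f w = g w) -> cdiff g z d.
Proof.
move=> fd [r r0 fg].
apply: (@cdiff_intro g z d (slope f z d)) => //; first exact: slopexx.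
exists r => // w wr; rewrite -!fg// -?slopeE//.
by rewrite subrr nc0.
Qed.

Lemma cdiffP f z d : cdiff f z d <-> forall e, 0 < e ->
  exists2 r, 0 < r &
    forall h, nc h < r -> nc (f (z + h) - f z - d * h) <= e * nc h.
Proof.
split=> [fd e e0|H e e0].
- have [r r0 fr] := fd e e0; exists r => // h hr.
  rewrite (slopeE f z d (z + h)) -{2}[z + h]addrC addrK.
  rewrite (_ : _ - _ = (slope f z d (z + h) - slope f z d z) * h).
    by rewrite ncM ler_wpM2r ?nc_ge0// fr// addrAC subrr add0r.
  by rewrite slopexx; ring.
- have [r r0 fr] := H e e0; exists r => // w wr; rewrite slopexx /slope.
  case: eqP => [_|/eqP wz]; first by rewrite subrr nc0 ltW.
  have wz0 : w - z != 0 by rewrite subr_eq0.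
  rewrite -[X in _ - X](mulfK wz0) -mulrBl ncM ncV ler_pdivrMr ?nc_gt0//.
  by have := fr _ wr; rewrite [z + _]addrC subrK.
Qed.

Lemma cdiff_uniq f z d d' : cdiff f z d -> cdiff f z d' -> d = d'.
Proof.
move=> /cdiffP fd /cdiffP fd'; apply/eqP; rewrite -subr_eq0 -nc_eq0.
(* Two errors of a quarter of |d - d'| add up to half of it, which is absurd unless it is 0. *)
apply: contraT => dd'; have e0 : 0 < nc (d - d') / 4.
  by rewrite divr_gt0// lt_def dd' nc_ge0.
have [r r0 fr] := fd _ e0; have [r' r'0 fr'] := fd' _ e0.
pose h := (Num.min r r' / 2)%:C : R[i].
have m0 : 0 < Num.min r r' by rewrite lt_min r0.
have nh : nc h = Num.min r r' / 2 by rewrite nc_real ger0_norm// divr_ge0// ltW.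
have hm : nc h < Num.min r r' by rewrite nh ltr_pdivrMr// ltr_pMr// ltr1n.
move: (hm); rewrite lt_min => /andP[/fr H1 /fr' H2].
have := le_ncB (f (z + h) - f z - d' * h) (f (z + h) - f z - d * h).
rewrite (_ : _ - _ - (_ - _) = (d - d') * h); last by ring.
rewrite ncM => H; have h0 : 0 < nc h by rewrite nh divr_gt0.
have {}H := le_trans H (lerD H2 H1).
have : nc (d - d') * nc h <= (nc (d - d') / 2) * nc h by move: H; lra.
by rewrite ler_pM2r//; move: e0; lra.
Qed.

Lemma cdiff_cst c z : cdiff (fun=> c) z 0.
Proof.
apply: (@cdiff_intro _ _ _ (fun=> 0)) => //; first exact: ccont_cst.
by exists 1 => // w _; rewrite mul0r addr0.
Qed.

Lemma cdiff_id z : cdiff id z 1.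
Proof.
apply: (@cdiff_intro _ _ _ (fun=> 1)) => //; first exact: ccont_cst.
by exists 1 => // w _; rewrite mul1r addrC subrK.
Qed.

Lemma cdiffD f g z d d' : cdiff f z d -> cdiff g z d' ->
  cdiff (fun w => f w + g w) z (d + d').
Proof.
move=> fd gd; apply: (cdiff_intro (ccontD fd gd)); first by rewrite !slopexx.
exists 1 => // w _; rewrite {1}(slopeE f z d) {1}(slopeE g z d'); ring.
Qed.

Lemma cdiffM f g z d d' : cdiff f z d -> cdiff g z d' ->
  cdiff (fun w => f w * g w) z (d * g z + f z * d').
Proof.
move=> fd gd.
have := ccontD (ccontM fd (ccont_cst (g z) z)) (ccontM (cdiff_cont fd) gd).
move=> /cdiff_intro; apply; first by rewrite !slopexx.
exists 1 => // w _; rewrite [in LHS](slopeE g z d') mulrDr.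
by rewrite [in f w * g z](slopeE f z d w); ring.
Qed.

Lemma cdiff_cstM c f z d : cdiff f z d -> cdiff (fun w => c * f w) z (c * d).
Proof. by move=> fd; have := cdiffM (cdiff_cst c z) fd; rewrite mul0r add0r. Qed.

Lemma cdiffN f z d : cdiff f z d -> cdiff (fun w => - f w) z (- d).
Proof.
move=> fd; rewrite -mulN1r; apply: cdiff_ext (cdiff_cstM (-1) fd) _.
by exists 1 => // w _; rewrite mulN1r.
Qed.

Lemma cdiffB f g z d d' : cdiff f z d -> cdiff g z d' ->
  cdiff (fun w => f w - g w) z (d - d').
Proof. by move=> fd gd; apply: cdiffD => //; exact: cdiffN. Qed.

Lemma cdiff_comp f g z d d' : cdiff g z d' -> cdiff f (g z) d ->
  cdiff (f \o g) z (d * d').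
Proof.
move=> gd fd.
have := ccontM (ccont_comp (cdiff_cont gd) fd) gd.
move=> /cdiff_intro; apply; first by rewrite /= !slopexx.
exists 1 => // w _ /=.
by rewrite {1}(slopeE f (g z) d (g w)) {2}(slopeE g z d' w) -mulrA addrAC subrr add0r.
Qed.

Lemma cdiff_inv z : z != 0 -> cdiff GRing.inv z (- z ^- 2).
Proof.
move=> z0.
have /cdiff_intro := ccontM (ccont_cst (- z^-1) z) (ccont_inv z0); apply.
  by rewrite expr2 invfM mulNr.
exists (nc z); first by rewrite nc_gt0.
move=> w wz; have w0 : w != 0.
  by apply: contraTneq wz => ->; rewrite sub0r ncN ltxx.
by field; rewrite z0 w0.
Qed.

Lemma cdiffV f z d : cdiff f z d -> f z != 0 ->
  cdiff (fun w => (f w)^-1) z (- (f z) ^- 2 * d).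
Proof. by move=> fd fz; apply: (cdiff_comp fd); exact: cdiff_inv. Qed.

Lemma cdiffX f n z d : cdiff f z d ->
  cdiff (fun w => f w ^+ n) z (n%:R * f z ^+ n.-1 * d).
Proof.
move=> fd; elim: n => [|n IH]; first by rewrite !mul0r; exact: cdiff_cst.
have := cdiffM fd IH; case: n {IH} => [|n] /= H.
  rewrite expr0 in H; rewrite !mul1r.
  rewrite !mul0r mulr0 addr0 mulr1 in H.
  by apply: cdiff_ext H _; exists 1 => // w _; rewrite expr0 mulr1 expr1.
rewrite (_ : n.+2%:R * _ * _ = d * f z ^+ n.+1 + f z * (n.+1%:R * f z ^+ n * d)).
  by apply: cdiff_ext H _; exists 1 => // w _; rewrite -exprS.
by rewrite -[n.+2]addn1 natrD exprS; ring.
Qed.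

Lemma cdiff_shift f z c d : cdiff f (z + c) d -> cdiff (fun w => f (w + c)) z d.
Proof.
move=> fd; rewrite -[d]mulr1; apply: (@cdiff_comp f (fun w => w + c)) => //.
by rewrite -[1]addr0; apply: cdiffD; [exact: cdiff_id|exact: cdiff_cst].
Qed.

(** The derivative is part of the data, so that the derivative of a translate or of an average is
    again given by a formula. *)
Definition hol f fd := forall z, 0 < complex.Im z -> cdiff f z (fd z).

(** Ties the derivative over the scalar field [R[i]] to the difference quotient. The radii and
    tolerances of that topology are positive elements of [R[i]], hence real. *)
Lemma is_derive_cdiff f z d :
  is_derive (z : R[i]^o) (1 : R[i]^o) (f : R[i]^o -> R[i]^o) d <-> cdiff f z d.
Proof.
have Q (h : R[i]) : h != 0 -> h^-1 *: ((f : R[i]^o -> R[i]^o) (h *: 1 + z) - f z) =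
    slope f z d (z + h).
  move=> h0; rewrite /slope -subr_eq0 [z + h - z]addrAC subrr add0r (negPf h0).
  by rewrite [h *: 1]mulr1 [h + z]addrC [LHS]mulrC.
have ltnc (e : R) x : (`|x : R[i]^o| < e%:C) = (nc x < e).
  by rewrite (_ : `|x : R[i]^o| = (nc x)%:C)// ltcR.
split.
- move=> [fz <-] e e0; move: fz; rewrite /derivable => /cvg_ex[/= l fl].
  have lE : 'D_1 (f : R[i]^o -> R[i]^o) z = l by exact/cvg_lim.
  have /cvgrPdist_lt/(_ e%:C) := fl.
  rewrite ltcR => /(_ e0)[/= r]; rewrite -[r]/(r : R[i]) => r0 H.
  have posE (x : R[i]) : 0 < x -> x = (complex.Re x)%:C.
    by case: x => a b; rewrite ltcE => /andP[/eqP /= ->].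
  have rE : r = (complex.Re r)%:C by exact: posE.
  exists (complex.Re r); first by rewrite -ltcR -rE; exact: r0.
  move=> w wr; rewrite slopexx lE /slope; case: eqP => [|/eqP wz].
    by rewrite subrr nc0 ltW.
  have h0 : w - z != 0 by rewrite subr_eq0.
  have /= := H (w - z).
  rewrite /ball_/= sub0r normrN -[r]/(r : R[i]^o) rE ltnc => /(_ wr h0).
  rewrite ltnc ncB [_ *: 1]mulr1 subrK [_ *: _]mulrC; exact: ltW.
- move=> fd.
  have fl : h^-1 *: ((f : R[i]^o -> R[i]^o) (h *: (1:R[i]^o) + z) - f z) @[h --> (0:R[i]^o)^'] --> (d : R[i]^o).
    apply/cvgrPdist_lt => /= e e0.
    have eE : e = (complex.Re e)%:C.
      by case: e e0 => a b; rewrite ltcE => /andP[/eqP /= ->].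
    have e20 : 0 < complex.Re e / 2 by rewrite divr_gt0// -ltcR -eE.
    have [r r0 H] := fd _ e20.
    exists r%:C => /=; first by rewrite ltcR.
    move=> h /=; rewrite sub0r normrN ltnc => hr h0.
    rewrite eE ltnc Q// ncB.
    have := H (z + h); rewrite slopexx [z + h - z]addrAC subrr add0r => /(_ hr).
    by move=> /le_lt_trans; apply; rewrite ltr_pdivrMr// ltr_pMr ?ltr1n// -ltcR -eE.
  by split; [apply/cvg_ex; exists d|exact/cvg_lim].
Qed.

End ComplexDerivative.

(** * Integrals of complex-valued functions of a real variable *)

Section ComplexIntegral.
Context {R : realType}.
Implicit Types (D E : set (measurableTypeR R)) (f g : R -> R[i]) (c : R[i]) (a b x y M : R).
Local Notation nc := (@ComplexField.Normc.normc R).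
Local Notation mu := (@lebesgue_measure R).
Local Notation Re := (@complex.Re R).
Local Notation Im := (@complex.Im R).

Definition cintegrable D f :=
  mu.-integrable D (EFin \o (Re \o f)) /\ mu.-integrable D (EFin \o (Im \o f)).

Definition cI D f : R[i] :=
  (\int[mu]_(x in D) Re (f x)) +i* (\int[mu]_(x in D) Im (f x)).

Lemma eq_cI D f g : (forall x, D x -> f x = g x) -> cI D f = cI D g.
Proof.
by move=> fg; rewrite /cI; congr (_ +i* _); apply: eq_Rintegral => x /set_mem/fg->.
Qed.

Lemma eq_cintegrable D f g : measurable D -> (forall x, D x -> f x = g x) ->
  cintegrable D f -> cintegrable D g.
Proof.
move=> mD fg [rf jf]; split.
  by apply: eq_integrable rf => // x /set_mem Dx /=; rewrite fg.
by apply: eq_integrable jf => // x /set_mem Dx /=; rewrite fg.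
Qed.

Lemma integrableDR D (u v : R -> R) : measurable D ->
  mu.-integrable D (EFin \o u) -> mu.-integrable D (EFin \o v) ->
  mu.-integrable D (EFin \o (fun x => u x + v x)).
Proof.
by move=> mD iu iv; apply: eq_integrable (integrableD mD iu iv).
Qed.

Lemma integrableZR D k (u : R -> R) : measurable D ->
  mu.-integrable D (EFin \o u) -> mu.-integrable D (EFin \o (fun x => k * u x)).
Proof.
by move=> mD iu; apply: eq_integrable (integrableZl mD k iu).
Qed.

Lemma cintegrableD D f g : measurable D -> cintegrable D f -> cintegrable D g ->
  cintegrable D (fun x => f x + g x).
Proof.
move=> mD [rf jf] [rg jg]; split.
  by apply: eq_integrable (integrableDR mD rf rg) => // x _ /=; rewrite ReD.
by apply: eq_integrable (integrableDR mD jf jg) => // x _ /=; rewrite ImD.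
Qed.

Lemma cintegrableZ D c f : measurable D -> cintegrable D f ->
  cintegrable D (fun x => c * f x).
Proof.
move=> mD [rf jf]; split.
  apply: eq_integrable (integrableDR mD (integrableZR (Re c) mD rf)
    (integrableZR (- Im c) mD jf)) => // x _ /=.
  by rewrite ReM mulNr.
apply: eq_integrable (integrableDR mD (integrableZR (Re c) mD jf)
  (integrableZR (Im c) mD rf)) => // x _ /=.
by rewrite ImM.
Qed.

Lemma cintegrableN D f : measurable D -> cintegrable D f ->
  cintegrable D (fun x => - f x).
Proof.
move=> mD /(cintegrableZ (-1) mD); apply: eq_cintegrable => // x _.
by rewrite mulN1r.
Qed.

Lemma cintegrableB D f g : measurable D -> cintegrable D f -> cintegrable D g ->
  cintegrable D (fun x => f x - g x).
Proof. by move=> mD cf cg; apply: cintegrableD => //; exact: cintegrableN. Qed.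

Lemma cID D f g : measurable D -> cintegrable D f -> cintegrable D g ->
  cI D (fun x => f x + g x) = cI D f + cI D g.
Proof.
move=> mD [rf jf] [rg jg]; rewrite /cI [RHS](complex_eta) /=; congr (_ +i* _).
  rewrite -RintegralD//; apply: eq_Rintegral => x _; exact: ReD.
rewrite -RintegralD//; apply: eq_Rintegral => x _; exact: ImD.
Qed.

Lemma cIZ D c f : measurable D -> cintegrable D f ->
  cI D (fun x => c * f x) = c * cI D f.
Proof.
move=> mD [rf jf]; rewrite /cI [RHS](complex_eta) ReM ImM /=; congr (_ +i* _).
  rewrite -!RintegralZl// -RintegralB//; first by apply: eq_Rintegral => x _; exact: ReM.
    exact: integrableZR.
  exact: integrableZR.
rewrite -!RintegralZl// -RintegralD//; first by apply: eq_Rintegral => x _; exact: ImM.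
  exact: integrableZR.
exact: integrableZR.
Qed.

Lemma cIN D f : measurable D -> cintegrable D f ->
  cI D (fun x => - f x) = - cI D f.
Proof.
move=> mD fi; rewrite -mulN1r -cIZ//; apply: eq_cI => x _; exact/esym/mulN1r.
Qed.

Lemma cIB D f g : measurable D -> cintegrable D f -> cintegrable D g ->
  cI D (fun x => f x - g x) = cI D f - cI D g.
Proof. by move=> mD fi gi; rewrite cID// ?cIN//; exact: cintegrableN. Qed.

(** The factor 2 comes from estimating the real and imaginary parts separately; it recurs in most
    constants below. *)
Lemma cI_le D f (u : R -> R) : measurable D -> cintegrable D f ->
  mu.-integrable D (EFin \o u) -> (forall x, D x -> nc (f x) <= u x) ->
  nc (cI D f) <= 2 * \int[mu]_(x in D) u x.
Proof.
move=> mD [rf jf] iu fu; rewrite (le_trans (nc_le_ReIm _))// mulr_natl mulr2n.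
have H (v : R -> R) : mu.-integrable D (EFin \o v) ->
    (forall x, D x -> `|v x| <= u x) ->
    `|\int[mu]_(x in D) v x| <= \int[mu]_(x in D) u x.
  move=> iv vu; rewrite (le_trans (le_normr_Rintegral _ _))//.
  apply: le_Rintegral => //.
  by apply: eq_integrable (integrable_abse iv) => // x.
apply: lerD; apply: H => // x Dx; rewrite (le_trans _ (fu _ Dx))//.
  exact: Re_le_nc.
exact: Im_le_nc.
Qed.

Definition pcont f x := forall e, 0 < e ->
  exists2 d, 0 < d & forall y, `|y - x| < d -> nc (f y - f x) <= e.

Definition pdiff f x c := forall e, 0 < e ->
  exists2 d, 0 < d & forall h, `|h| < d ->
    nc (f (x + h) - f x - c * h%:C) <= e * `|h|.

Lemma real_cont (u : R -> R) x :
  (forall e, 0 < e -> exists2 d, 0 < d & forall y, `|y - x| < d -> `|u y - u x| <= e) ->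
  {for x, continuous u}.
Proof.
move=> H; apply/cvgrPdist_le => /= e /H[d d0 ud].
exists d => //= y yd; rewrite distrC; apply: ud.
by rewrite distrC.
Qed.

Lemma pcont_Re f x : pcont f x -> {for x, continuous (Re \o f)}.
Proof.
move=> fx; apply: real_cont => e /fx[d d0 fd]; exists d => // y /fd.
by apply: le_trans; rewrite /= -ReN -ReD Re_le_nc.
Qed.

Lemma pcont_Im f x : pcont f x -> {for x, continuous (Im \o f)}.
Proof.
move=> fx; apply: real_cont => e /fx[d d0 fd]; exists d => // y /fd.
by apply: le_trans; rewrite /= -ImN -ImD Im_le_nc.
Qed.

Lemma within_itv_cont (u : R -> R) a b :
  (forall x, a <= x <= b -> {for x, continuous u}) ->
  {within `[a, b], continuous u}.
Proof.
move=> H; apply: continuous_in_subspaceT => x; rewrite inE/= in_itv/=; exact: H.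
Qed.

Lemma pcont_cintegrable f a b : (forall x, a <= x <= b -> pcont f x) ->
  cintegrable `[a, b] f.
Proof.
move=> H; split; apply: continuous_compact_integrable;
  [exact: segment_compact| |exact: segment_compact| ];
  apply: within_itv_cont => x /H; [exact: pcont_Re|exact: pcont_Im].
Qed.

Lemma Rintegral_split a b (c' : R) (u : R -> R) : a <= b -> b <= c' ->
  mu.-integrable `[a, c'] (EFin \o u) ->
  \int[mu]_(x in `[a, c']) u x =
  \int[mu]_(x in `[a, b]) u x + \int[mu]_(x in `[b, c']) u x.
Proof.
move=> ab bc iu.
have := @Rintegral_itvB R u (BLeft a) (BRight c') b iu.
rewrite !bnd_simp => /(_ ab bc) H; rewrite -[LHS](subrK (\int[mu]_(x in `[a, b]) u x)) H addrC.
congr (_ + _); apply: Rintegral_itv_obnd_cbnd.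
by apply: integrableS iu => //; apply: subset_itvr; rewrite bnd_simp.
Qed.

Lemma cI_split a b (c' : R) f : a <= b -> b <= c' -> cintegrable `[a, c'] f ->
  cI `[a, c'] f = cI `[a, b] f + cI `[b, c'] f.
Proof.
move=> ab bc [rf jf]; rewrite /cI [RHS](complex_eta) /=.
by congr (_ +i* _); exact: Rintegral_split.
Qed.

Lemma Rintegral_itv_cst a b M : a <= b -> \int[mu]_(x in `[a, b]) M = M * (b - a).
Proof.
move=> ab; rewrite Rintegral_cst//= lebesgue_measure_itv/= lte_fin.
move: ab; rewrite le_eqVlt => /predU1P[->|->//].
by rewrite ltxx subrr.
Qed.

Lemma integrable_itv_cst a b M : mu.-integrable `[a, b] (EFin \o (fun=> M)).
Proof.
apply: continuous_compact_integrable; first exact: segment_compact.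
by move=> x; exact: cst_continuous.
Qed.

Lemma cI_le_cst a b f M : a <= b -> cintegrable `[a, b] f ->
  (forall x, a <= x <= b -> nc (f x) <= M) ->
  nc (cI `[a, b] f) <= 2 * (M * (b - a)).
Proof.
move=> ab fi fM; rewrite -Rintegral_itv_cst//; apply: cI_le => //.
exact: integrable_itv_cst.
Qed.

Lemma pdiff_pcont f x c : pdiff f x c -> pcont f x.
Proof.
move=> fd e e0; have [d d0 H] := fd 1 ltr01.
pose K := nc c + 1; have K0 : 0 < K by rewrite ltr_wpDl// nc_ge0.
exists (Num.min d (e / K)); first by rewrite lt_min d0 divr_gt0.
move=> y; rewrite lt_min => /andP[/H yd ye].
rewrite [x + _]addrC subrK in yd.
rewrite -(subrK (c * (y - x)%:C) (f y - f x)).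
rewrite (le_trans (le_ncD _ _))// (le_trans (lerD yd (lexx _)))// ncM nc_real.
rewrite -mulrDl addrC -/K mulrC -ler_pdivlMr//; exact: ltW.
Qed.

Lemma pdiff_Re f x c : pdiff f x c -> is_derive x 1 (Re \o f) (Re c).
Proof.
move=> fd.
have fl : h^-1 *: ((Re \o f) (h *: 1 + x) - (Re \o f) x) @[h --> 0^'] --> Re c.
  apply/cvgrPdist_le => /= e /fd[d d0 H]; exists d => //= h.
  rewrite /ball_/= sub0r normrN => hd h0; have := H h hd.
  rewrite [h *: 1]mulr1 [h + x]addrC distrC => {}H.
  rewrite -(ler_pM2r (_ : 0 < `|h|)) ?normr_gt0// (le_trans _ H)//.
  rewrite -normrM mulrBl -[_ *: _]/(_ * _) mulrAC mulVf// mul1r.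
  rewrite (le_trans _ (Re_le_nc _))// ReD ReN ReM ReD ReN /= mulr0 subr0.
  by rewrite mulrC.
by split; [apply/cvg_ex; exists (Re c)|exact/cvg_lim].
Qed.

Lemma pdiff_Im f x c : pdiff f x c -> is_derive x 1 (Im \o f) (Im c).
Proof.
move=> fd.
have fl : h^-1 *: ((Im \o f) (h *: 1 + x) - (Im \o f) x) @[h --> 0^'] --> Im c.
  apply/cvgrPdist_le => /= e /fd[d d0 H]; exists d => //= h.
  rewrite /ball_/= sub0r normrN => hd h0; have := H h hd.
  rewrite [h *: 1]mulr1 [h + x]addrC distrC => {}H.
  rewrite -(ler_pM2r (_ : 0 < `|h|)) ?normr_gt0// (le_trans _ H)//.
  rewrite -normrM mulrBl -[_ *: _]/(_ * _) mulrAC mulVf// mul1r.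
  rewrite (le_trans _ (Im_le_nc _))// ImD ImN ImM ImD ImN /= mulr0 add0r.
  by rewrite mulrC.
by split; [apply/cvg_ex; exists (Im c)|exact/cvg_lim].
Qed.

Lemma real_FTC (u v : R -> R) a b : a <= b ->
  (forall x, a <= x <= b -> is_derive x 1 u (v x)) ->
  (forall x, a <= x <= b -> {for x, continuous v}) ->
  \int[mu]_(x in `[a, b]) v x = u b - u a.
Proof.
rewrite le_eqVlt => /predU1P[->|ab] uv cv.
  by rewrite set_itv1 Rintegral_set1 subrr.
have cu x : a <= x <= b -> {for x, continuous u}.
  move=> xab; apply: differentiable_continuous; apply/derivable1_diffP.
  by have [] := uv x xab.
rewrite /Rintegral (@continuous_FTC2 R v u)//.
- exact: within_itv_cont.
- split.
  + by move=> x; rewrite in_itv/= => /andP[ax xb]; have [] := uv x ltac:(by rewrite !ltW).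
  + by apply/cvg_at_right_filter/cu; rewrite lexx ltW.
  + by apply/cvg_at_left_filter/cu; rewrite lexx ltW.
- move=> x; rewrite in_itv/= => /andP[ax xb].
  by rewrite derive1E; have [_ ->] := uv x ltac:(by rewrite !ltW).
Qed.

Lemma cI_FTC f g a b : a <= b -> (forall x, a <= x <= b -> pdiff g x (f x)) ->
  (forall x, a <= x <= b -> pcont f x) -> cI `[a, b] f = g b - g a.
Proof.
move=> ab gf cf; rewrite /cI [RHS]complex_eta ReD ReN ImD ImN; congr (_ +i* _).
  apply: (@real_FTC (Re \o g)) => // x xab.
    exact/pdiff_Re/gf.
  exact/pcont_Re/cf.
apply: (@real_FTC (Im \o g)) => // x xab.
  exact/pdiff_Im/gf.
exact/pcont_Im/cf.
Qed.

(** The real and imaginary parts attain their mean values at different points, whence again a factor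
    2. *)
Lemma MVI f g a b M : a <= b -> (forall x, a <= x <= b -> pdiff g x (f x)) ->
  (forall x, a <= x <= b -> nc (f x) <= M) -> nc (g b - g a) <= 2 * (M * (b - a)).
Proof.
move=> ab gf fM; rewrite mulr_natl mulr2n (le_trans (nc_le_ReIm _))//.
have cg x : a <= x <= b -> pcont g x by move/gf/pdiff_pcont.
apply: lerD.
  have [x xab|?|x] := @MVT_segment R (Re \o g) (Re \o f) a b ab.
  - by apply: pdiff_Re; apply: gf; move: xab; rewrite in_itv/= => /andP[/ltW-> /ltW->].
  - by apply: within_itv_cont => y /cg /pcont_Re.
  rewrite in_itv/= => xab H; rewrite ReD ReN {}H normrM (ger0_norm (_ : 0 <= b - a)) ?subr_ge0//.
  by rewrite ler_wpM2r ?subr_ge0// (le_trans (Re_le_nc _))// fM.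
have [x xab|?|x] := @MVT_segment R (Im \o g) (Im \o f) a b ab.
- by apply: pdiff_Im; apply: gf; move: xab; rewrite in_itv/= => /andP[/ltW-> /ltW->].
- by apply: within_itv_cont => y /cg /pcont_Im.
rewrite in_itv/= => xab H; rewrite ImD ImN {}H normrM (ger0_norm (_ : 0 <= b - a)) ?subr_ge0//.
by rewrite ler_wpM2r ?subr_ge0// (le_trans (Im_le_nc _))// fM.
Qed.

End ComplexIntegral.

(** * Restriction of complex functions to segments *)

Section Paths.
Context {R : realType}.
Implicit Types (F : R[i] -> R[i]) (z h d : R[i]) (x y t : R).
Local Notation nc := (@ComplexField.Normc.normc R).

Lemma ccont_seg F z h t : ccont F (z + h * t%:C) -> pcont (fun s => F (z + h * s%:C)) t.
Proof.
move=> cF e /cF[d d0 Fd]; pose K := nc h + 1.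
have K0 : 0 < K by rewrite ltr_wpDl// nc_ge0.
exists (d / K); first by rewrite divr_gt0.
move=> s sd; apply: Fd.
rewrite (_ : _ - _ = h * (s - t)%:C); last by rewrite rmorphB; ring.
rewrite ncM nc_real (le_lt_trans (_ : _ <= K * `|s - t|))//.
  by rewrite ler_wpM2r// lerDl.
by rewrite mulrC -ltr_pdivlMr.
Qed.

Lemma cdiff_seg F z h t d : cdiff F (z + h * t%:C) d ->
  pdiff (fun s => F (z + h * s%:C)) t (d * h).
Proof.
move=> /cdiffP cF e e0; pose K := nc h + 1.
have K0 : 0 < K by rewrite ltr_wpDl// nc_ge0.
have [r r0 Fr] := cF (e / K) ltac:(by rewrite divr_gt0).
exists (r / K); first by rewrite divr_gt0.
move=> s sr.
have hs : nc (h * s%:C) <= K * `|s| by rewrite ncM nc_real ler_wpM2r// lerDl.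
have Kr : K * `|s| < r by rewrite mulrC -ltr_pdivlMr.
have := Fr _ (le_lt_trans hs Kr).
rewrite mulrA rmorphD mulrDr addrA => /le_trans; apply.
by rewrite -[e in leRHS](divfK (lt0r_neq0 K0)) -[leRHS]mulrA ler_wpM2l// divr_ge0// ltW.
Qed.

Lemma hor_seg x y : x +i* y = (0 +i* y) + 1 * x%:C.
Proof. by rewrite mul1r [RHS](complex_eta) /= add0r addr0. Qed.

Lemma ver_seg x y : x +i* y = x%:C + 'i * y%:C.
Proof. exact: complexE'. Qed.

Lemma ccont_hor F x y : ccont F (x +i* y) -> pcont (fun s => F (s +i* y)) x.
Proof.
rewrite hor_seg => /ccont_seg cF.
by under [fun s => _]eq_fun do rewrite hor_seg.
Qed.

Lemma ccont_ver F x y : ccont F (x +i* y) -> pcont (fun s => F (x +i* s)) y.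
Proof.
rewrite ver_seg => /ccont_seg cF.
by under [fun s => _]eq_fun do rewrite ver_seg.
Qed.

Lemma cdiff_hor F x y d : cdiff F (x +i* y) d -> pdiff (fun s => F (s +i* y)) x d.
Proof.
rewrite hor_seg => /cdiff_seg; rewrite mulr1 => cF.
by under [fun s => _]eq_fun do rewrite hor_seg.
Qed.

Lemma cdiff_ver F x y d : cdiff F (x +i* y) d ->
  pdiff (fun s => F (x +i* s)) y (d * 'i).
Proof.
rewrite ver_seg => /cdiff_seg cF.
by under [fun s => _]eq_fun do rewrite ver_seg.
Qed.

Lemma cdiff_MVI F fd z h M :
  (forall t, 0 <= t <= 1 -> cdiff F (z + h * t%:C) (fd (z + h * t%:C))) ->
  (forall t, 0 <= t <= 1 -> nc (fd (z + h * t%:C)) <= M) ->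
  nc (F (z + h) - F z) <= 2 * (M * nc h).
Proof.
move=> Fd fM.
have := @MVI R (fun t => fd (z + h * t%:C) * h) (fun t => F (z + h * t%:C)) 0 1 (M * nc h) ler01.
rewrite mulr1 mulr0 addr0 subr0 mulr1; apply.
  by move=> t /Fd/cdiff_seg.
by move=> t /fM H; rewrite ncM ler_wpM2r// nc_ge0.
Qed.

End Paths.

(** * Contour integrals over rectangles and Goursat's theorem *)

Section Rectangles.
Context {R : realType}.
Implicit Types (f g : R[i] -> R[i]) (z : R[i]) (x y e M : R).
Local Notation nc := (@ComplexField.Normc.normc R).

(** The integral of f(z) dz along the boundary of the rectangle, counterclockwise. *)
Definition rint f (x1 x2 y1 y2 : R) : R[i] :=
  cI `[x1, x2] (fun x => f (x +i* y1)) - cI `[x1, x2] (fun x => f (x +i* y2)) +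
  'i * (cI `[y1, y2] (fun y => f (x2 +i* y)) - cI `[y1, y2] (fun y => f (x1 +i* y))).

Definition bcont f (x1 x2 y1 y2 : R) :=
  [/\ forall x, x1 <= x <= x2 -> ccont f (x +i* y1),
      forall x, x1 <= x <= x2 -> ccont f (x +i* y2),
      forall y, y1 <= y <= y2 -> ccont f (x1 +i* y) &
      forall y, y1 <= y <= y2 -> ccont f (x2 +i* y)].

Lemma hor_cint f x1 x2 y : (forall x, x1 <= x <= x2 -> ccont f (x +i* y)) ->
  cintegrable `[x1, x2] (fun x => f (x +i* y)).
Proof. by move=> H; apply: pcont_cintegrable => x /H/ccont_hor. Qed.

Lemma ver_cint f y1 y2 x : (forall y, y1 <= y <= y2 -> ccont f (x +i* y)) ->
  cintegrable `[y1, y2] (fun y => f (x +i* y)).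
Proof. by move=> H; apply: pcont_cintegrable => y /H/ccont_ver. Qed.

Lemma rint_splitx f x1 x x2 y1 y2 : x1 <= x -> x <= x2 ->
  (forall t, x1 <= t <= x2 -> ccont f (t +i* y1)) ->
  (forall t, x1 <= t <= x2 -> ccont f (t +i* y2)) ->
  rint f x1 x2 y1 y2 = rint f x1 x y1 y2 + rint f x x2 y1 y2.
Proof.
move=> a b c1 c2; rewrite /rint.
rewrite (cI_split a b (hor_cint c1)) (cI_split a b (hor_cint c2)); ring.
Qed.

Lemma rint_splity f x1 x2 y1 y y2 : y1 <= y -> y <= y2 ->
  (forall t, y1 <= t <= y2 -> ccont f (x1 +i* t)) ->
  (forall t, y1 <= t <= y2 -> ccont f (x2 +i* t)) ->
  rint f x1 x2 y1 y2 = rint f x1 x2 y1 y + rint f x1 x2 y y2.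
Proof.
move=> a b c1 c2; rewrite /rint.
rewrite (cI_split a b (ver_cint c1)) (cI_split a b (ver_cint c2)); ring.
Qed.

Lemma rintD f g x1 x2 y1 y2 : bcont f x1 x2 y1 y2 -> bcont g x1 x2 y1 y2 ->
  rint (fun z => f z + g z) x1 x2 y1 y2 = rint f x1 x2 y1 y2 + rint g x1 x2 y1 y2.
Proof.
move=> [f1 f2 f3 f4] [g1 g2 g3 g4]; rewrite /rint.
rewrite !cID//; first ring; first [exact: hor_cint|exact: ver_cint].
Qed.

Lemma rintZ f (c : R[i]) x1 x2 y1 y2 : bcont f x1 x2 y1 y2 ->
  rint (fun z => c * f z) x1 x2 y1 y2 = c * rint f x1 x2 y1 y2.
Proof.
move=> [f1 f2 f3 f4]; rewrite /rint.
rewrite !cIZ//; first ring; first [exact: hor_cint|exact: ver_cint].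
Qed.

Lemma bcontD f g x1 x2 y1 y2 : bcont f x1 x2 y1 y2 -> bcont g x1 x2 y1 y2 ->
  bcont (fun z => f z + g z) x1 x2 y1 y2.
Proof.
by move=> [f1 f2 f3 f4] [g1 g2 g3 g4]; split=> t tt;
  apply: ccontD; auto.
Qed.

Lemma bcontZ f (c : R[i]) x1 x2 y1 y2 : bcont f x1 x2 y1 y2 ->
  bcont (fun z => c * f z) x1 x2 y1 y2.
Proof.
by move=> [f1 f2 f3 f4]; split=> t tt; apply: ccontM; auto; exact: ccont_cst.
Qed.

Lemma rintB f g x1 x2 y1 y2 : bcont f x1 x2 y1 y2 -> bcont g x1 x2 y1 y2 ->
  rint (fun z => f z - g z) x1 x2 y1 y2 = rint f x1 x2 y1 y2 - rint g x1 x2 y1 y2.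
Proof.
move=> cf cg.
have -> : (fun z => f z - g z) = (fun z => f z + (-1) * g z).
  by apply/funext => z; rewrite mulN1r.
by rewrite rintD ?rintZ ?mulN1r//; exact: bcontZ.
Qed.

Lemma eq_rint f g x1 x2 y1 y2 : x1 <= x2 -> y1 <= y2 ->
  (forall x, x1 <= x <= x2 -> f (x +i* y1) = g (x +i* y1)) ->
  (forall x, x1 <= x <= x2 -> f (x +i* y2) = g (x +i* y2)) ->
  (forall y, y1 <= y <= y2 -> f (x1 +i* y) = g (x1 +i* y)) ->
  (forall y, y1 <= y <= y2 -> f (x2 +i* y) = g (x2 +i* y)) ->
  rint f x1 x2 y1 y2 = rint g x1 x2 y1 y2.
Proof.
move=> x12 y12 h1 h2 h3 h4; rewrite /rint.
by congr (_ - _ + _ * (_ - _)); apply: eq_cI => t /=; rewrite in_itv/=; auto.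
Qed.

Lemma rint_le f x1 x2 y1 y2 M : x1 <= x2 -> y1 <= y2 -> bcont f x1 x2 y1 y2 ->
  (forall x, x1 <= x <= x2 -> nc (f (x +i* y1)) <= M) ->
  (forall x, x1 <= x <= x2 -> nc (f (x +i* y2)) <= M) ->
  (forall y, y1 <= y <= y2 -> nc (f (x1 +i* y)) <= M) ->
  (forall y, y1 <= y <= y2 -> nc (f (x2 +i* y)) <= M) ->
  nc (rint f x1 x2 y1 y2) <= 4 * M * (x2 - x1 + (y2 - y1)).
Proof.
move=> x12 y12 [c1 c2 c3 c4] h1 h2 h3 h4; rewrite /rint.
rewrite (le_trans (le_ncD _ _))// ncM nc_i mul1r.
have b1 := cI_le_cst x12 (hor_cint c1) h1.
have b2 := cI_le_cst x12 (hor_cint c2) h2.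
have b3 := cI_le_cst y12 (ver_cint c3) h3.
have b4 := cI_le_cst y12 (ver_cint c4) h4.
have {b1 b2} := le_trans (le_ncB _ _) (lerD b1 b2).
have {b3 b4} := le_trans (le_ncB _ _) (lerD b4 b3).
by move=> H1 H2; have := lerD H2 H1; move/le_trans; apply; rewrite le_eqVlt; apply/orP; left; apply/eqP; ring.
Qed.

Lemma rint_prim f g x1 x2 y1 y2 : x1 <= x2 -> y1 <= y2 -> bcont f x1 x2 y1 y2 ->
  (forall x y, x1 <= x <= x2 -> y1 <= y <= y2 -> cdiff g (x +i* y) (f (x +i* y))) ->
  rint f x1 x2 y1 y2 = 0.
Proof.
move=> x12 y12 [c1 c2 c3 c4] gf; rewrite /rint.
have xx1 : x1 <= x1 <= x2 by rewrite lexx.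
have xx2 : x1 <= x2 <= x2 by rewrite lexx andbT.
have yy1 : y1 <= y1 <= y2 by rewrite lexx.
have yy2 : y1 <= y2 <= y2 by rewrite lexx andbT.
rewrite (@cI_FTC R _ (fun x => g (x +i* y1)))//; first last.
- by move=> x /c1/ccont_hor.
- by move=> x xx; exact/cdiff_hor/gf.
rewrite (@cI_FTC R _ (fun x => g (x +i* y2)))//; first last.
- by move=> x /c2/ccont_hor.
- by move=> x xx; exact/cdiff_hor/gf.
rewrite mulrBr -!cIZ//; [|exact: ver_cint|exact: ver_cint].
rewrite (@cI_FTC R _ (fun y => g (x2 +i* y)))//; first last.
- move=> y yy; apply: (@ccont_ver R (fun w => 'i * f w)).
  by apply: ccontM; [exact: ccont_cst|exact: c4].
- by move=> y yy; rewrite mulrC; exact/cdiff_ver/gf.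
rewrite (@cI_FTC R _ (fun y => g (x1 +i* y)))//; first last.
- move=> y yy; apply: (@ccont_ver R (fun w => 'i * f w)).
  by apply: ccontM; [exact: ccont_cst|exact: c3].
- by move=> y yy; rewrite mulrC; exact/cdiff_ver/gf.
ring.
Qed.

Lemma mid_subl (a b : R) : (a + b) / 2 - a = (b - a) / 2.
Proof. by field. Qed.

Lemma mid_subr (a b : R) : b - (a + b) / 2 = (b - a) / 2.
Proof. by field. Qed.

Lemma mid_ge (a b : R) : a <= b -> a <= (a + b) / 2.
Proof. by move=> ab; rewrite -subr_ge0 mid_subl divr_ge0// subr_ge0. Qed.

Lemma mid_le (a b : R) : a <= b -> (a + b) / 2 <= b.
Proof. by move=> ab; rewrite -subr_ge0 mid_subr divr_ge0// subr_ge0. Qed.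

Lemma half_pow_lt (K d : R) : 0 < d -> exists n, K / 2 ^+ n < d.
Proof.
move=> d0; exists (Num.truncn (K / d)).+1.
rewrite ltr_pdivrMr ?exprn_gt0// mulrC -ltr_pdivrMr//.
rewrite (lt_trans (truncnS_gt _))// -natrX ltr_nat.
exact: ltn_expl.
Qed.

(** If [P] fails on the whole rectangle it fails on one of its quarters, and so on; the nested
    rectangles share a point, near which the local hypothesis gives [P], a contradiction. *)
Lemma bisection (P : R -> R -> R -> R -> Prop) (x1 x2 y1 y2 : R) :
  x1 <= x2 -> y1 <= y2 ->
  (forall a b c d : R, x1 <= a -> a <= b -> b <= x2 -> y1 <= c -> c <= d -> d <= y2 ->
    P a ((a + b) / 2) c ((c + d) / 2) -> P ((a + b) / 2) b c ((c + d) / 2) ->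
    P a ((a + b) / 2) ((c + d) / 2) d -> P ((a + b) / 2) b ((c + d) / 2) d ->
    P a b c d) ->
  (forall x y, x1 <= x <= x2 -> y1 <= y <= y2 -> exists2 r, 0 < r &
    forall a b c d : R, x1 <= a -> a <= x -> x <= b -> b <= x2 ->
      y1 <= c -> c <= y -> y <= d -> d <= y2 ->
      b - a < r -> d - c < r -> P a b c d) ->
  P x1 x2 y1 y2.
Proof.
move=> x12 y12 Pstep Ploc; apply: contrapT => nP.
pose ok (q : R * R * R * R) := let: (a, b, c, d) := q in
  [/\ x1 <= a, a <= b & b <= x2] /\ [/\ y1 <= c, c <= d & d <= y2] /\ ~ P a b c d.
pose nxt (q q' : R * R * R * R) := let: (a, b, c, d) := q in
  let: (a', b', c', d') := q' in
  [/\ a <= a', b' <= b & b' - a' = (b - a) / 2] /\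
  [/\ c <= c', d' <= d & d' - c' = (d - c) / 2].
(* The hypothesis sits under the existential so that [choice] yields a total function to iterate. *)
have : forall q, exists q', ok q -> ok q' /\ nxt q q'.
  move=> [[[a b] c] d]; have [okq|nok] := pselect (ok (a, b, c, d)); last first.
    by exists (a, b, c, d) => /nok.
  move: okq => [[xa ab bx] [[yc cd dy] nPq]].
  pose m := (a + b) / 2; pose n := (c + d) / 2.
  have am : a <= m by exact: mid_ge.
  have mb : m <= b by exact: mid_le.
  have cn : c <= n by exact: mid_ge.
  have nd : n <= d by exact: mid_le.
  have E1 : m - a = (b - a) / 2 by exact: mid_subl.
  have E2 : b - m = (b - a) / 2 by exact: mid_subr.
  have E3 : n - c = (d - c) / 2 by exact: mid_subl.
  have E4 : d - n = (d - c) / 2 by exact: mid_subr.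
  have mx : m <= x2 by exact: le_trans bx.
  have xm : x1 <= m by exact: le_trans am.
  have ny : n <= y2 by exact: le_trans dy.
  have yn : y1 <= n by exact: le_trans cn.
  have [p1|p1] := pselect (P a m c n); last by exists (a, m, c, n).
  have [p2|p2] := pselect (P m b c n); last by exists (m, b, c, n).
  have [p3|p3] := pselect (P a m n d); last by exists (a, m, n, d).
  have [p4|p4] := pselect (P m b n d); last by exists (m, b, n, d).
  by exfalso; apply: nPq; exact: Pstep.
move=> /choice[G HG].
pose u n := iter n G (x1, x2, y1, y2).
have oku n : ok (u n).
  by elim: n => [|n /HG[]//]; do !split => //=.
have nxu n : nxt (u n) (u n.+1) by have [] := HG _ (oku n).
pose A n := (u n).1.1.1; pose B n := (u n).1.1.2.
pose A' n := (u n).1.2; pose B' n := (u n).2.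
have uE n : u n = (A n, B n, A' n, B' n).
  by rewrite /A /B /A' /B'; case: (u n) => -[[]].
have lim (a b : nat -> R) : (forall n, a n <= b n) -> (forall n, a n <= a n.+1) ->
    (forall n, b n.+1 <= b n) -> exists x, forall n, a n <= x <= b n.
  move=> ab ia db.
  have ab' n m : a n <= b m.
    have ha k : a n <= a (n + k)%N.
      by elim: k => [|k IH]; rewrite ?addn0// addnS (le_trans IH).
    have hb k : b (m + k)%N <= b m.
      by elim: k => [|k IH]; rewrite ?addn0// addnS (le_trans _ IH).
    by rewrite (le_trans (ha m))// (le_trans (ab _))// addnC.
  exists (sup (range a)) => n; apply/andP; split.
    apply: ub_le_sup; last by exists n.
    by exists (b 0%N) => _ [k _ <-].
  apply: ge_sup; first by exists (a 0%N), 0%N.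
  by move=> _ [k _ <-].
have [x Hx] : exists x, forall n, A n <= x <= B n.
  apply: lim => n.
  - by have := oku n; rewrite uE => -[[]].
  - by have := nxu n; rewrite !uE => -[[]].
  - by have := nxu n; rewrite !uE => -[[]].
have [y Hy] : exists y, forall n, A' n <= y <= B' n.
  apply: lim => n.
  - by have := oku n; rewrite uE => -[_ [[]]].
  - by have := nxu n; rewrite !uE => -[_ []].
  - by have := nxu n; rewrite !uE => -[_ []].
have [r r0 Hr] := Ploc x y (Hx 0%N) (Hy 0%N).
have wA n : B n - A n = (x2 - x1) / 2 ^+ n.
  elim: n => [|n IH]; first by rewrite expr0 divr1.
  have := nxu n; rewrite !uE => -[[_ _ ->] _].
  by rewrite IH exprS invfM [_^-1 * _]mulrC mulrA.
have wA' n : B' n - A' n = (y2 - y1) / 2 ^+ n.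
  elim: n => [|n IH]; first by rewrite expr0 divr1.
  have := nxu n; rewrite !uE => -[_ [_ _ ->]].
  by rewrite IH exprS invfM [_^-1 * _]mulrC mulrA.
have [n Hn] := half_pow_lt (x2 - x1 + (y2 - y1)) r0.
have := oku n; rewrite uE => -[[h1 h2 h3] [[h4 h5 h6]]]; apply.
have /andP[h7 h8] := Hx n; have /andP[h9 h10] := Hy n.
have p0 : 0 < 2 ^+ n :> R by rewrite exprn_gt0.
apply: Hr => //; [rewrite wA|rewrite wA']; rewrite (le_lt_trans _ Hn)//
  ler_wpM2r ?invr_ge0 ?(ltW p0)//; lra.
Qed.

(** The bound |integral| <= e (width + height)^2 is preserved when four equal quarters are put
    together, as 4 (p/2)^2 = p^2. On small rectangles it holds because f differs from its affine
    approximation, whose contour integral is 0, by at most (e/4)(width + height). *)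
Theorem Goursat f x1 x2 y1 y2 : x1 <= x2 -> y1 <= y2 ->
  (forall x y, x1 <= x <= x2 -> y1 <= y <= y2 -> exists d, cdiff f (x +i* y) d) ->
  rint f x1 x2 y1 y2 = 0.
Proof.
move=> x12 y12 fd.
have cf x y : x1 <= x <= x2 -> y1 <= y <= y2 -> ccont f (x +i* y).
  by move=> xx yy; have [d /cdiff_cont] := fd _ _ xx yy.
have bf a b c d : x1 <= a -> a <= b -> b <= x2 -> y1 <= c -> c <= d -> d <= y2 ->
    bcont f a b c d.
  move=> h1 h2 h3 h4 h5 h6; split=> t /andP[t1 t2]; apply: cf; apply/andP; split;
    by [|exact: le_trans t1|exact: le_trans h3|exact: le_trans h6|
        exact: le_trans h5|exact: le_trans h2].
have main e : 0 < e ->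
    nc (rint f x1 x2 y1 y2) <= e * (x2 - x1 + (y2 - y1)) ^+ 2.
  move=> e0.
  apply: (@bisection (fun a b c d => nc (rint f a b c d) <= e * (b - a + (d - c)) ^+ 2)) => //.
    move=> a b c d h1 h2 h3 h4 h5 h6; set m := (a + b) / 2; set n := (c + d) / 2.
    have am : a <= m by exact: mid_ge.
    have mb : m <= b by exact: mid_le.
    have cn : c <= n by exact: mid_ge.
    have nd : n <= d by exact: mid_le.
    move=> p1 p2 p3 p4.
    have [c1 c2 c3 c4] := bf a b c d h1 h2 h3 h4 h5 h6.
    rewrite (rint_splitx am mb c1 c2).
    have cm t : c <= t <= d -> ccont f (m +i* t).
      move=> /andP[t1 t2]; apply: cf; apply/andP; split.
      - exact: le_trans am.
      - exact: le_trans h3.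
      - exact: le_trans t1.
      - exact: le_trans h6.
    rewrite (rint_splity cn nd c3 cm) (rint_splity cn nd cm c4).
    rewrite (le_trans (le_ncD _ _))//.
    have := lerD (le_trans (le_ncD _ _) (lerD p1 p3)) (le_trans (le_ncD _ _) (lerD p2 p4)).
    move=> /le_trans; apply.
    have E1 : m - a = (b - a) / 2 by exact: mid_subl.
    have E2 : b - m = (b - a) / 2 by exact: mid_subr.
    have E3 : n - c = (d - c) / 2 by exact: mid_subl.
    have E4 : d - n = (d - c) / 2 by exact: mid_subr.
    rewrite E1 E2 E3 E4 le_eqVlt; apply/orP; left; apply/eqP; by field.
  move=> x y xx yy; have [D /cdiffP H] := fd _ _ xx yy.
  have [r r0 Hr] := H (e / 4) ltac:(by rewrite divr_gt0).
  exists (r / 2); first by rewrite divr_gt0.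
  move=> a b c d h1 h2 h3 h4 h5 h6 h7 h8 ba dc.
  set z0 := x +i* y; pose L w := f z0 + D * (w - z0).
  have ab : a <= b by exact: le_trans h3.
  have cd : c <= d by exact: le_trans h7.
  have bL : bcont L a b c d.
    by split=> t _; apply: ccontD; [exact: ccont_cst|apply: ccontM; [exact: ccont_cst|
      apply: ccontB; [exact: ccont_id|exact: ccont_cst]]|exact: ccont_cst|
      apply: ccontM; [exact: ccont_cst|
      apply: ccontB; [exact: ccont_id|exact: ccont_cst]]|exact: ccont_cst|
      apply: ccontM; [exact: ccont_cst|
      apply: ccontB; [exact: ccont_id|exact: ccont_cst]]|exact: ccont_cst|
      apply: ccontM; [exact: ccont_cst|
      apply: ccontB; [exact: ccont_id|exact: ccont_cst]]].
  (* An affine function has a polynomial primitive. *)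
  have rL : rint L a b c d = 0.
    apply: (@rint_prim L (fun w => f z0 * w + D / 2 * (w - z0) ^+ 2)) => // s t _ _.
    have -> : L (s +i* t) = f z0 * 1 + D / 2 * (2%:R * (s +i* t - z0) ^+ 1 * (1 - 0)).
      by rewrite /L subr0 expr1; field.
    apply: cdiffD; first exact/cdiff_cstM/cdiff_id.
    apply/cdiff_cstM/(@cdiffX R (fun w => w - z0) 2).
    by apply: cdiffB; [exact: cdiff_id|exact: cdiff_cst].
  have bfq : bcont f a b c d by exact: bf.
  rewrite -(subr0 (rint f _ _ _ _)) -rL -rintB//.
  have near s t : a <= s <= b -> c <= t <= d ->
      nc (f (s +i* t) - L (s +i* t)) <= e / 4 * (b - a + (d - c)).
    move=> /andP[s1 s2] /andP[t1 t2].
    have wz : nc (s +i* t - z0) <= b - a + (d - c).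
      rewrite (le_trans (nc_le_ReIm _))// /z0/= lerD// ler_norml; apply/andP; split; lra.
    have wr : nc (s +i* t - z0) < r by rewrite (le_lt_trans wz)// (splitr r) ltrD.
    have := Hr _ wr; rewrite [z0 + _]addrC subrK -addrA -opprD => /le_trans; apply.
    by rewrite ler_wpM2l// divr_ge0// ltW.
  have aab : a <= a <= b by rewrite lexx.
  have bab : a <= b <= b by rewrite lexx andbT.
  have ccd : c <= c <= d by rewrite lexx.
  have dcd : c <= d <= d by rewrite lexx andbT.
  rewrite (le_trans (@rint_le _ a b c d (e / 4 * (b - a + (d - c))) ab cd _ _ _ _ _))//.
  - have -> : (fun z => f z - L z) = (fun z => f z + (-1) * L z).
      by apply/funext => z; rewrite mulN1r.
    by apply: bcontD => //; exact: bcontZ.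
  - by move=> t tt; exact: near.
  - by move=> t tt; exact: near.
  - by move=> t tt; exact: near.
  - by move=> t tt; exact: near.
  - by rewrite le_eqVlt; apply/orP; left; apply/eqP; by field.
apply/eqP; rewrite -nc_eq0; apply: contraT => n0.
have p0 : 0 < nc (rint f x1 x2 y1 y2) by rewrite lt_def n0 nc_ge0.
set K := (x2 - x1 + (y2 - y1)) ^+ 2 in main.
have K0 : 0 <= K by rewrite sqr_ge0.
have := main (nc (rint f x1 x2 y1 y2) / (K + 1)) ltac:(by rewrite divr_gt0// ltr_wpDl).
rewrite mulrAC ler_pdivlMr ?ltr_wpDl// mulrDr mulr1 gerDl.
by rewrite leNgt p0.
Qed.

End Rectangles.

(** * Residues at simple poles and Cauchy's formula *)

Section Residue.
Context {R : realType}.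
Implicit Types (f g : R[i] -> R[i]) (z w : R[i]) (x y e B : R).
Local Notation nc := (@ComplexField.Normc.normc R).
Local Notation mu := (@lebesgue_measure R).
Local Notation Re := (@complex.Re R).
Local Notation Im := (@complex.Im R).

Definition twopii : R[i] := (0 : R) +i* (2 * pi).

Lemma nc_twopii : nc twopii = 2 * pi.
Proof.
by rewrite /= expr0n/= add0r sqrtr_sqr ger0_norm// mulr_ge0 ?pi_ge0.
Qed.

Lemma twopii_neq0 : twopii != 0.
Proof. by rewrite -nc_gt0 nc_twopii mulr_gt0 ?pi_gt0. Qed.

Lemma cI_real (D : set (measurableTypeR R)) (u : R -> R) :
  cI D (fun x => (u x)%:C) = (\int[mu]_(x in D) u x)%:C.
Proof. by rewrite /cI /= {2}/Rintegral integral0. Qed.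

Lemma cintegrable_real (D : set (measurableTypeR R)) (u : R -> R) : measurable D ->
  mu.-integrable D (EFin \o u) -> cintegrable D (fun x => (u x)%:C).
Proof. by move=> mD iu; split => //; exact: integrable0. Qed.

Lemma is_derive_atan_scaled (a h x : R) : 0 < h ->
  is_derive x 1 (fun t => atan ((t - a) / h)) (h / ((x - a) ^+ 2 + h ^+ 2)).
Proof.
move=> h0.
have d1 : is_derive x 1 (fun t : R => (t - a) / h) h^-1.
  have -> : (fun t : R => (t - a) / h) = h^-1 \*: (id - cst a).
    by apply/funext => t; rewrite /= mulrC.
  by apply: is_derive_eq; rewrite subr0 -[_ *: _]/(_ * _) mulr1.
have := @is_derive1_comp R atan (fun t => (t - a) / h) x _ _ (is_derive1_atan _) d1.
move=> H; apply: is_derive_eq H _.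
have h1 : (x - a) ^+ 2 + h ^+ 2 != 0 by rewrite gt_eqF// ltr_wpDl ?sqr_ge0// exprn_gt0.
by field; rewrite h1 (gt_eqF h0).
Qed.

Lemma continuous_poisson (a h x : R) : 0 < h ->
  {for x, continuous (fun t => h / ((t - a) ^+ 2 + h ^+ 2))}.
Proof.
move=> h0.
have h1 : (x - a) ^+ 2 + h ^+ 2 != 0 by rewrite gt_eqF// ltr_wpDl ?sqr_ge0// exprn_gt0.
apply: cvgM; first exact: cvg_cst.
apply: cvgV => //; apply: cvgD; last exact: cvg_cst.
have c1 : (t - a) @[t --> x] --> x - a by apply: cvgB; [exact: cvg_id|exact: cvg_cst].
exact: (cvgM c1 c1).
Qed.

Lemma Rintegral_poisson (a h : R) : 0 < h ->
  \int[mu]_(x in `[a - h, a + h]) (h / ((x - a) ^+ 2 + h ^+ 2)) = pi / 2.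
Proof.
move=> h0.
have := @real_FTC R (fun t => atan ((t - a) / h))
  (fun t => h / ((t - a) ^+ 2 + h ^+ 2)) (a - h) (a + h).
rewrite /= addrAC subrr add0r addrAC subrr add0r mulNr divff ?gt_eqF//.
move=> H; apply: etrans (H _ _ _) _ => {H}.
- by lra.
- by move=> x _; exact: is_derive_atan_scaled.
- by move=> x _; exact: continuous_poisson.
- by rewrite atanN atan1; field.
Qed.

Lemma ccont_inv_sub z w : w != z -> ccont (fun t => (t - z)^-1) w.
Proof.
move=> wz; apply: ccontV; last by rewrite subr_eq0.
by apply: ccontB; [exact: ccont_id|exact: ccont_cst].
Qed.

Lemma neq_Re z w : Re z != Re w -> z != w.
Proof. by apply: contra => /eqP->. Qed.

Lemma neq_Im z w : Im z != Im w -> z != w.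
Proof. by apply: contra => /eqP->. Qed.

Lemma neq_bd_square z h : 0 < h ->
  [/\ forall x, x +i* (Im z - h) != z, forall x, x +i* (Im z + h) != z,
      forall y, (Re z - h) +i* y != z & forall y, (Re z + h) +i* y != z].
Proof.
move=> h0; split=> t.
- by apply: neq_Im => /=; rewrite lt_eqF//; lra.
- by apply: neq_Im => /=; rewrite gt_eqF//; lra.
- by apply: neq_Re => /=; rewrite lt_eqF//; lra.
- by apply: neq_Re => /=; rewrite gt_eqF//; lra.
Qed.

(** On two opposite sides the integrands combine into 2i times a Poisson kernel, whose primitive is
    an arctangent; each pair of sides contributes 2i (pi / 2). *)
Lemma rint_inv_square z h : 0 < h ->
  rint (fun w => (w - z)^-1) (Re z - h) (Re z + h) (Im z - h) (Im z + h) = twopii.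
Proof.
move=> h0; have [n1 n2 n3 n4] := neq_bd_square z h0.
pose c : R[i] := 'i * 2%:R.
have P (a t : R) : (t - a) ^+ 2 + h ^+ 2 != 0.
  by rewrite gt_eqF// ltr_wpDl ?sqr_ge0// exprn_gt0.
have I (a : R) : cI `[a - h, a + h]
    (fun t => c * (h / ((t - a) ^+ 2 + h ^+ 2))%:C) = c * (pi / 2)%:C.
  rewrite cIZ// ?cI_real ?Rintegral_poisson//.
  apply: cintegrable_real => //.
  apply: continuous_compact_integrable; first exact: segment_compact.
  by apply: within_itv_cont => x _; exact: continuous_poisson.
rewrite /rint -cIB//; last 2 first.
- by apply: (@hor_cint R (fun w => (w - z)^-1)) => x _; exact: ccont_inv_sub.
- by apply: (@hor_cint R (fun w => (w - z)^-1)) => x _; exact: ccont_inv_sub.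
rewrite -cIB//; last 2 first.
- by apply: (@ver_cint R (fun w => (w - z)^-1)) => x _; exact: ccont_inv_sub.
- by apply: (@ver_cint R (fun w => (w - z)^-1)) => x _; exact: ccont_inv_sub.
rewrite -cIZ//; last first.
  by apply: cintegrableB => //; apply: (@ver_cint R (fun w => (w - z)^-1)) => x _; exact: ccont_inv_sub.
have EX (a t : R) (p : R[i]) :
    (p = (t - a) +i* h) -> p != 0.
  by move=> ->; apply: (@neq_Im _ 0) => /=; rewrite gt_eqF.
have E1 x : ((x +i* (Im z - h)) - z)^-1 - ((x +i* (Im z + h)) - z)^-1 =
    c * (h / ((x - Re z) ^+ 2 + h ^+ 2))%:C.
  have -> : (x +i* (Im z - h)) - z = (x - Re z) +i* (- h).
    by rewrite [LHS]complex_eta ReD ImD ReN ImN /=; congr (_ +i* _); ring.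
  have -> : (x +i* (Im z + h)) - z = (x - Re z) +i* h.
    by rewrite [LHS]complex_eta ReD ImD ReN ImN /=; congr (_ +i* _); ring.
  rewrite /c; set u := x - Re z.
  have := P (Re z) x; rewrite -/u => {}P.
  rewrite [LHS]complex_eta [RHS]complex_eta /=.
  by congr (_ +i* _); field; rewrite P.
have E2 y : 'i * (((Re z + h) +i* y - z)^-1 - ((Re z - h) +i* y - z)^-1) =
    c * (h / ((y - Im z) ^+ 2 + h ^+ 2))%:C.
  have -> : (Re z + h) +i* y - z = h +i* (y - Im z).
    by rewrite [LHS]complex_eta ReD ImD ReN ImN /=; congr (_ +i* _); ring.
  have -> : (Re z - h) +i* y - z = (- h) +i* (y - Im z).
    by rewrite [LHS]complex_eta ReD ImD ReN ImN /=; congr (_ +i* _); ring.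
  rewrite /c; set u := y - Im z.
  have := P (Im z) y; rewrite -/u => {}P.
  rewrite [LHS]complex_eta [RHS]complex_eta /=.
  by congr (_ +i* _); field; rewrite P.
rewrite (eq_cI (g := fun t => c * (h / ((t - Re z) ^+ 2 + h ^+ 2))%:C)); last first.
  by move=> x _; exact: E1.
rewrite I (eq_cI (g := fun t => c * (h / ((t - Im z) ^+ 2 + h ^+ 2))%:C)); last first.
  by move=> x _; exact: E2.
rewrite I /c /twopii [LHS]complex_eta ReD ImD !ReM !ImM /=.
by congr (_ +i* _); field.
Qed.

(** Goursat's theorem on the pieces cut off around the pole shrinks the contour to a square of
    half-side h. There f differs from a / (w - z) by at most e / h, on a contour of length of order
    h, so the error is of order e. *)
Theorem residue_rect f z a (x1 x2 y1 y2 : R) :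
  x1 < Re z < x2 -> y1 < Im z < y2 ->
  (forall x y, x1 <= x <= x2 -> y1 <= y <= y2 -> x +i* y != z ->
    exists d, cdiff f (x +i* y) d) ->
  (forall e, 0 < e -> exists2 r, 0 < r &
    forall w, w != z -> nc (w - z) < r -> nc ((w - z) * f w - a) <= e) ->
  rint f x1 x2 y1 y2 = twopii * a.
Proof.
move=> /andP[xz1 xz2] /andP[yz1 yz2] fd fa.
have cf x y : x1 <= x <= x2 -> y1 <= y <= y2 -> x +i* y != z -> ccont f (x +i* y).
  by move=> xx yy xyz; have [d /cdiff_cont] := fd _ _ xx yy xyz.
(* Two vertical and two horizontal cuts remove four rectangles that avoid the pole. *)
have small h : 0 < h -> x1 <= Re z - h -> Re z + h <= x2 -> y1 <= Im z - h ->
    Im z + h <= y2 -> rint f x1 x2 y1 y2 =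
    rint f (Re z - h) (Re z + h) (Im z - h) (Im z + h).
  move=> h0 h1 h2 h3 h4.
  have [n1 n2 n3 n4] := neq_bd_square z h0.
  have l1 : Re z - h <= Re z + h by lra.
  have l2 : Im z - h <= Im z + h by lra.
  have l3 : Re z - h <= x2 by lra.
  have l4 : x1 <= Re z + h by lra.
  have l5 : Im z - h <= y2 by lra.
  have l6 : y1 <= Im z + h by lra.
  have l7 : x1 <= x2 by lra.
  have l8 : y1 <= y2 by lra.
  have cb y : y = y1 \/ y = y2 -> forall t, x1 <= t <= x2 -> ccont f (t +i* y).
    move=> yy t tt; apply: cf => //; first by case: yy => ->; rewrite lexx ?andbT.
    by apply: neq_Im => /=; case: yy => ->; [rewrite lt_eqF|rewrite gt_eqF].
  have cb1 t : Re z - h <= t <= x2 -> x1 <= t <= x2.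
    by move=> /andP[t1 ->]; rewrite (le_trans h1).
  rewrite (rint_splitx (x := Re z - h) h1 l3 (cb _ _) (cb _ _)); [|by left|by right].
  rewrite (rint_splitx (x1 := Re z - h) (x := Re z + h) l1 h2); last 2 first.
  - by move=> t /cb1; apply: cb; left.
  - by move=> t /cb1; apply: cb; right.
  rewrite [X in X + _]Goursat//; last first.
    move=> x y /andP[xx1 xx2] yy; apply: fd => //.
      by rewrite xx1 (le_trans xx2).
    by apply: neq_Re => /=; rewrite lt_eqF// (le_lt_trans xx2)//; lra.
  rewrite [X in _ + (_ + X)]Goursat//; last first.
    move=> x y /andP[xx1 xx2] yy; apply: fd => //.
      by rewrite xx2 (le_trans l4).
    by apply: neq_Re => /=; rewrite gt_eqF// (lt_le_trans _ xx1)//; lra.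
  have cl t : y1 <= t <= y2 -> ccont f ((Re z - h) +i* t).
    by move=> tt; apply: cf => //; rewrite h1.
  have cr t : y1 <= t <= y2 -> ccont f ((Re z + h) +i* t).
    by move=> tt; apply: cf => //; rewrite h2 l4.
  rewrite (rint_splity (y := Im z - h) h3 l5 cl cr).
  have cb2 t : Im z - h <= t <= y2 -> y1 <= t <= y2.
    by move=> /andP[t1 ->]; rewrite (le_trans h3).
  rewrite (rint_splity (y1 := Im z - h) (y := Im z + h) l2 h4); last 2 first.
  - by move=> t /cb2; exact: cl.
  - by move=> t /cb2; exact: cr.
  rewrite [X in _ + (X + _ + _)]Goursat//; last first.
    move=> x y /andP[xx1 xx2] /andP[yy1 yy2]; apply: fd => //.
    - by rewrite (le_trans h1)// (le_trans xx2).
    - by rewrite yy1 (le_trans yy2).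
    - by apply: neq_Im => /=; rewrite lt_eqF// (le_lt_trans yy2)//; lra.
  rewrite [X in _ + (_ + (_ + X) + _)]Goursat//; last first.
    move=> x y /andP[xx1 xx2] /andP[yy1 yy2]; apply: fd => //.
    - by rewrite (le_trans h1)// (le_trans xx2).
    - by rewrite yy2 (le_trans l6).
    - by apply: neq_Im => /=; rewrite gt_eqF// (lt_le_trans _ yy1)//; lra.
  by rewrite !add0r !addr0.
have main e : 0 < e -> nc (rint f x1 x2 y1 y2 - twopii * a) <= 32 * e.
  move=> e0; have [r r0 Hr] := fa e e0.
  pose h0 := Num.min (Num.min (Re z - x1) (x2 - Re z)) (Num.min (Im z - y1) (y2 - Im z)).
  pose h := Num.min h0 (r / 4).
  have hh0 : h <= h0 by rewrite ge_min lexx.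
  have hr : h <= r / 4 by rewrite ge_min lexx orbT.
  have [b1 b2 b3 b4] : [/\ h0 <= Re z - x1, h0 <= x2 - Re z, h0 <= Im z - y1 & h0 <= y2 - Im z].
    by rewrite /h0; split; rewrite !ge_min lexx ?orbT.
  have hp : 0 < h.
    by rewrite /h /h0 !lt_min !subr_gt0 xz1 xz2 yz1 yz2 divr_gt0.
  rewrite (small h)//; [|lra|lra|lra|lra].
  have [n1 n2 n3 n4] := neq_bd_square z hp.
  have inx t : Re z - h <= t <= Re z + h -> x1 <= t <= x2.
    by move=> /andP[t1 t2]; apply/andP; split; lra.
  have iny t : Im z - h <= t <= Im z + h -> y1 <= t <= y2.
    by move=> /andP[t1 t2]; apply/andP; split; lra.
  have l1 : Re z - h <= Re z + h by lra.
  have l2 : Im z - h <= Im z + h by lra.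
  have bf : bcont f (Re z - h) (Re z + h) (Im z - h) (Im z + h).
    split=> t tt; apply: cf => //; [exact: inx| |exact: inx| | |exact: iny| |exact: iny];
      apply/andP; split; lra.
  have bi : bcont (fun w => (w - z)^-1) (Re z - h) (Re z + h) (Im z - h) (Im z + h).
    by split=> t _; exact: ccont_inv_sub.
  rewrite -(rint_inv_square z hp) mulrC -rintZ// -rintB//; last exact: bcontZ.
  have bd x y : Re z - h <= x <= Re z + h -> Im z - h <= y <= Im z + h ->
      h <= nc (x +i* y - z) -> nc (f (x +i* y) - a * (x +i* y - z)^-1) <= e / h.
    move=> /andP[xx1 xx2] /andP[yy1 yy2] hn.
    have n0 : 0 < nc (x +i* y - z) by exact: lt_le_trans hn.
    have n0' : x +i* y - z != 0 by rewrite -nc_gt0.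
    have -> : f (x +i* y) - a * (x +i* y - z)^-1 =
        ((x +i* y - z) * f (x +i* y) - a) / (x +i* y - z) by field.
    rewrite ncM ncV ler_pM ?invr_ge0 ?nc_ge0//; last by rewrite lef_pV2 ?posrE.
    apply: Hr; first by rewrite -subr_eq0.
    rewrite (le_lt_trans (nc_le_ReIm _))// ReD ImD ReN ImN /=.
    have a1 : `|x - Re z| <= h by rewrite ler_norml; apply/andP; split; lra.
    have a2 : `|y - Im z| <= h by rewrite ler_norml; apply/andP; split; lra.
    by rewrite (le_lt_trans (lerD a1 a2))//; lra.
  have zx : Re z - h <= Re z - h <= Re z + h by rewrite lexx.
  have zx' : Re z - h <= Re z + h <= Re z + h by rewrite lexx andbT.
  have zy : Im z - h <= Im z - h <= Im z + h by rewrite lexx.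
  have zy' : Im z - h <= Im z + h <= Im z + h by rewrite lexx andbT.
  rewrite (le_trans (@rint_le R _ _ _ _ _ (e / h) l1 l2 _ _ _ _ _))//.
  - have -> : (fun w => f w - a * (w - z)^-1) = (fun w => f w + (- a) * (w - z)^-1).
      by apply/funext => w; rewrite mulNr.
    by apply: bcontD => //; exact: bcontZ.
  - move=> x xx; apply: bd => //; rewrite (le_trans _ (Im_le_nc _))// ImD ImN /=.
    by rewrite addrAC subrr add0r normrN ler_norm.
  - move=> x xx; apply: bd => //; rewrite (le_trans _ (Im_le_nc _))// ImD ImN /=.
    by rewrite addrAC subrr add0r ler_norm.
  - move=> y yy; apply: bd => //; rewrite (le_trans _ (Re_le_nc _))// ReD ReN /=.
    by rewrite addrAC subrr add0r normrN ler_norm.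
  - move=> y yy; apply: bd => //; rewrite (le_trans _ (Re_le_nc _))// ReD ReN /=.
    by rewrite addrAC subrr add0r ler_norm.
  - rewrite (_ : 4 * _ * _ = 16 * e) ?ler_pM2r ?ler_nat//.
    by field; rewrite gt_eqF.
apply/eqP; rewrite -subr_eq0 -nc_eq0; apply: contraT => n0.
have p0 : 0 < nc (rint f x1 x2 y1 y2 - twopii * a) by rewrite lt_def n0 nc_ge0.
have := main (nc (rint f x1 x2 y1 y2 - twopii * a) / 64) ltac:(by rewrite divr_gt0).
by move=> H; exfalso; move: H p0; set q := nc _; lra.
Qed.

Theorem Cauchy_formula f z (x1 x2 y1 y2 : R) :
  x1 < Re z < x2 -> y1 < Im z < y2 ->
  (forall x y, x1 <= x <= x2 -> y1 <= y <= y2 -> exists d, cdiff f (x +i* y) d) ->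
  rint (fun w => f w / (w - z)) x1 x2 y1 y2 = twopii * f z.
Proof.
move=> xz yz fd; apply: (@residue_rect _ z) => //.
- move=> x y xx yy xyz; have [d fxy] := fd x y xx yy.
  have dV : cdiff (fun w => (w - z)^-1) (x +i* y) (- (x +i* y - z) ^- 2 * (1 - 0)).
    apply: (@cdiffV R (fun w => w - z)); last by rewrite subr_eq0.
    by apply: cdiffB; [exact: cdiff_id|exact: cdiff_cst].
  by eexists; exact: cdiffM fxy dV.
- move=> e e0.
  have [xz1 xz2] := andP xz; have [yz1 yz2] := andP yz.
  have [d /cdiff_cont] := fd (Re z) (Im z) ltac:(by rewrite !ltW) ltac:(by rewrite !ltW).
  rewrite -complex_eta => /(_ e e0)[r r0 Hr]; exists r => // w wz /Hr.
  by rewrite mulrC divfK// subr_eq0.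
Qed.

End Residue.

(** * Cauchy estimates on squares and differentiability of the derivative *)

Section CauchyEstimates.
Context {R : realType}.
Implicit Types (f g : R[i] -> R[i]) (z w s h k d : R[i]) (x y e r B M : R).
Local Notation nc := (@ComplexField.Normc.normc R).
Local Notation Re := (@complex.Re R).
Local Notation Im := (@complex.Im R).

Definition insq z r w := `|Re (w - z)| <= r /\ `|Im (w - z)| <= r.

Definition onsq z r w := insq z r w /\ (`|Re (w - z)| = r \/ `|Im (w - z)| = r).

Definition rsq f z r := rint f (Re z - r) (Re z + r) (Im z - r) (Im z + r).

Lemma onsq_sides z r : 0 < r ->
  [/\ forall x, Re z - r <= x <= Re z + r -> onsq z r (x +i* (Im z - r)),
      forall x, Re z - r <= x <= Re z + r -> onsq z r (x +i* (Im z + r)),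
      forall y, Im z - r <= y <= Im z + r -> onsq z r ((Re z - r) +i* y) &
      forall y, Im z - r <= y <= Im z + r -> onsq z r ((Re z + r) +i* y)].
Proof.
move=> r0; have r0' := ltW r0.
have A (u v : R) : v - r <= u <= v + r -> `|u - v| <= r.
  by rewrite lerBlDl -lerBlDr -[v + r]/(_ + _) => /andP[u1 u2]; rewrite ler_norml lerBlDl u2 andbT; lra.
have B1 (v : R) : `|v - r - v| = r by rewrite addrAC subrr add0r normrN ger0_norm.
have B2 (v : R) : `|v + r - v| = r by rewrite addrAC subrr add0r ger0_norm.
by split=> t /A tt; rewrite /onsq /insq ReD ImD ReN ImN /= ?B1 ?B2; split=> //;
  [right|right|left|left].
Qed.

Lemma bcont_onsq f z r : 0 < r -> (forall w, onsq z r w -> ccont f w) ->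
  bcont f (Re z - r) (Re z + r) (Im z - r) (Im z + r).
Proof.
move=> r0 H; have [s1 s2 s3 s4] := onsq_sides z r0.
by split=> t tt; apply: H; auto.
Qed.

Lemma insqP z r x y : Re z - r <= x <= Re z + r -> Im z - r <= y <= Im z + r ->
  insq z r (x +i* y).
Proof.
move=> /andP[x1 x2] /andP[y1 y2]; rewrite /insq ReD ImD ReN ImN /=.
by rewrite !ler_norml; split; apply/andP; split; lra.
Qed.

Lemma eq_rsq f g z r : 0 < r -> (forall w, onsq z r w -> f w = g w) ->
  rsq f z r = rsq g z r.
Proof.
move=> r0 H; have [s1 s2 s3 s4] := onsq_sides z r0.
by apply: eq_rint; [lra|lra|..] => t tt; apply: H; auto.
Qed.

Lemma rsq_le f z r M : 0 < r -> (forall w, onsq z r w -> ccont f w) ->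
  (forall w, onsq z r w -> nc (f w) <= M) -> nc (rsq f z r) <= 16 * M * r.
Proof.
move=> r0 cf fM; have [s1 s2 s3 s4] := onsq_sides z r0.
rewrite (le_trans (rint_le (M := M) _ _ (bcont_onsq r0 cf) _ _ _ _)); auto; lra.
Qed.

Lemma rsqB f g z r : 0 < r -> (forall w, onsq z r w -> ccont f w) ->
  (forall w, onsq z r w -> ccont g w) ->
  rsq (fun w => f w - g w) z r = rsq f z r - rsq g z r.
Proof. by move=> r0 cf cg; rewrite /rsq rintB//; exact: bcont_onsq. Qed.

Lemma rsqZ f (c : R[i]) z r : 0 < r -> (forall w, onsq z r w -> ccont f w) ->
  rsq (fun w => c * f w) z r = c * rsq f z r.
Proof. by move=> r0 cf; rewrite /rsq rintZ//; exact: bcont_onsq. Qed.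

Lemma onsq_dist z r w : onsq z r w -> r <= nc (w - z).
Proof. by move=> [_ [<-|<-]]; [exact: Re_le_nc|exact: Im_le_nc]. Qed.

Lemma insq_dist z r w : insq z r w -> nc (w - z) <= 2 * r.
Proof.
by move=> [h1 h2]; rewrite (le_trans (nc_le_ReIm _))// mulr_natl mulr2n lerD.
Qed.

Lemma onsq_dist_half z r w s : onsq z r w -> nc (s - z) <= r / 2 -> r / 2 <= nc (w - s).
Proof.
move=> /onsq_dist wz sz.
have := nc_subl (w - z) (s - z); rewrite (_ : w - z - (s - z) = w - s); last by ring.
by move: wz sz; set a := nc _; set b := nc _; set c := nc _ => ? ? ?; lra.
Qed.

Lemma nc_insq z r w : nc (w - z) <= r -> insq z r w.
Proof.
by move=> wr; split; rewrite (le_trans _ wr)//; [exact: Re_le_nc|exact: Im_le_nc].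
Qed.

Lemma Cauchy_square f z r s : 0 < r ->
  (forall w, insq z r w -> exists d, cdiff f w d) -> nc (s - z) <= r / 2 ->
  rsq (fun w => f w / (w - s)) z r = twopii * f s.
Proof.
move=> r0 fd sz.
have h1 := le_trans (Re_le_nc _) sz; have h2 := le_trans (Im_le_nc _) sz.
move: h1 h2; rewrite ReD ImD ReN ImN !ler_norml => /andP[a1 a2] /andP[a3 a4].
apply: Cauchy_formula.
- by apply/andP; split; lra.
- by apply/andP; split; lra.
- by move=> x y xx yy; apply: fd; exact: insqP.
Qed.

Lemma ccont_kernel f z r s n : 0 < r ->
  (forall w, onsq z r w -> ccont f w) -> nc (s - z) <= r / 2 ->
  forall w, onsq z r w -> ccont (fun w => f w / (w - s) ^+ n) w.
Proof.
move=> r0 cf sz w ww; apply: ccontM; first exact: cf.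
apply: ccontV.
  by apply: ccontX; apply: ccontB; [exact: ccont_id|exact: ccont_cst].
rewrite expf_neq0// -nc_gt0 (lt_le_trans _ (onsq_dist_half ww sz))// divr_gt0//.
Qed.

Lemma twopii_le (a : R[i]) M : nc (twopii * a) <= M -> nc a <= M.
Proof.
rewrite ncM nc_twopii; apply: le_trans; rewrite ler_peMl ?nc_ge0//.
by have := @pi_ge2 R; lra.
Qed.

(* The [k^2] remainder of [1 / (w - s - k)] is
   [k^2 / ((w - s)^2 (w - s - k))]. *)
Lemma Taylor_kernel f z r s B k : 0 < r ->
  (forall w, insq z r w -> exists d, cdiff f w d) ->
  (forall w, onsq z r w -> nc (f w) <= B) ->
  nc (s - z) <= r / 4 -> nc k <= r / 4 ->
  nc (twopii * (f (s + k) - f s) - k * rsq (fun w => f w / (w - s) ^+ 2) z r) <=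
  128 * B / r ^+ 2 * nc k ^+ 2.
Proof.
move=> r0 fd fB sz kr.
have cf w : onsq z r w -> ccont f w.
  by move=> [/fd[d /cdiff_cont]].
have sz2 : nc (s - z) <= r / 2 by move: sz; set a := nc _ => ?; lra.
have skz : nc (s + k - z) <= r / 2.
  rewrite addrAC (le_trans (le_ncD _ _))//.
  by move: sz kr; set a := nc _; set b := nc _ => ? ?; lra.
have c1 w : onsq z r w -> ccont (fun w => f w / (w - s)) w.
  by move=> ww; have := ccont_kernel 1 r0 cf sz2 ww; under eq_fun do rewrite expr1.
have c1' w : onsq z r w -> ccont (fun w => f w / (w - (s + k))) w.
  by move=> ww; have := ccont_kernel 1 r0 cf skz ww; under eq_fun do rewrite expr1.
have c2 w : onsq z r w -> ccont (fun w => f w / (w - s) ^+ 2) w.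
  exact: ccont_kernel.
rewrite mulrBr -(Cauchy_square r0 fd skz) -(Cauchy_square r0 fd sz2).
rewrite -rsqB// -rsqZ// -rsqB//; last 2 first.
- by move=> w ww; apply: ccontB; auto.
- by move=> w ww; apply: ccontM; [exact: ccont_cst|exact: c2].
pose K w := f w * (k ^+ 2 / ((w - s) ^+ 2 * (w - (s + k)))).
have dn w : onsq z r w -> w - s != 0 /\ w - (s + k) != 0.
  move=> ww; rewrite -!nc_gt0; split.
    by rewrite (lt_le_trans _ (onsq_dist_half ww sz2))// divr_gt0.
  by rewrite (lt_le_trans _ (onsq_dist_half ww skz))// divr_gt0.
have EK w : onsq z r w -> f w / (w - (s + k)) - f w / (w - s) - k * (f w / (w - s) ^+ 2) = K w.
  move=> /dn[n1 n2]; rewrite /K; field.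
  by rewrite n1 n2.
rewrite (eq_rsq r0 EK).
rewrite (le_trans (@rsq_le _ _ _ (B * (8 / r ^+ 3 * nc k ^+ 2)) r0 _ _))//.
- move=> w ww; have [n1 n2] := dn w ww.
  apply: ccontM; first exact: cf.
  apply: ccontM; first exact: ccont_cst.
  apply: ccontV; last by rewrite mulf_neq0// expf_neq0.
  by apply: ccontM; [apply: ccontX|]; apply: ccontB; first [exact: ccont_id|exact: ccont_cst].
- move=> w ww; rewrite /K ncM ler_pM ?nc_ge0//; first exact: fB.
  have d1 := onsq_dist_half ww sz2; have d2 := onsq_dist_half ww skz.
  have r20 : 0 < r / 2 by rewrite divr_gt0.
  have p1 := lt_le_trans r20 d1; have p2 := lt_le_trans r20 d2.
  rewrite ncM ncV ncM !ncX mulrC ler_wpM2r ?sqr_ge0//.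
  have -> : 8 / r ^+ 3 = ((r / 2) ^+ 2 * (r / 2))^-1 by field; rewrite gt_eqF.
  rewrite lef_pV2 ?posrE ?mulr_gt0 ?exprn_gt0//.
  have q : (r / 2) ^+ 2 <= nc (w - s) ^+ 2 by rewrite ler_pXn2r ?nnegrE ?nc_ge0 ?(ltW r20).
  by apply: ler_pM => //; rewrite ?exprn_ge0 ?(ltW r20).
- rewrite le_eqVlt; apply/orP; left; apply/eqP; field.
  by rewrite gt_eqF.
Qed.

(** Derivatives that come from integrals are recognised by their quadratic remainder. *)
Lemma quadratic_cdiff f s d (M r0 : R) : 0 < r0 ->
  (forall k, nc k <= r0 -> nc (f (s + k) - f s - d * k) <= M * nc k ^+ 2) ->
  cdiff f s d.
Proof.
move=> r0p H; apply/cdiffP => e e0; pose M' := `|M| + 1.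
have M'0 : 0 < M' by rewrite ltr_wpDl.
exists (Num.min r0 (e / M')); first by rewrite lt_min r0p divr_gt0.
move=> k; rewrite lt_min => /andP[/ltW/H k1 k2]; rewrite (le_trans k1)//.
rewrite expr2 mulrA ler_wpM2r ?nc_ge0//.
move: k2; rewrite ltr_pdivlMr// => /ltW; apply: le_trans.
rewrite [leRHS]mulrC ler_wpM2r ?nc_ge0// (le_trans (ler_norm _))//.
by rewrite lerDl.
Qed.

(** By [Taylor_kernel] the contour integral divided by 2 pi i is a derivative of [f] at [s], and
    derivatives are unique. *)
Lemma Cauchy_deriv f z r s d : 0 < r ->
  (forall w, insq z r w -> exists d, cdiff f w d) ->
  (exists B, forall w, onsq z r w -> nc (f w) <= B) ->
  nc (s - z) <= r / 4 -> cdiff f s d ->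
  rsq (fun w => f w / (w - s) ^+ 2) z r = twopii * d.
Proof.
move=> r0 fd [B fB] sz fs.
pose D := twopii^-1 * rsq (fun w => f w / (w - s) ^+ 2) z r.
have fD : cdiff f s D.
  apply: (@quadratic_cdiff _ _ _ (128 * B / r ^+ 2) (r / 4)); first by rewrite divr_gt0.
  move=> k kr; apply: twopii_le.
  rewrite mulrBr /D mulrA mulrA [_ * _^-1]mulfV ?twopii_neq0// mul1r [_ * k]mulrC.
  exact: Taylor_kernel.
by rewrite (cdiff_uniq fs fD) /D mulrA mulfV ?twopii_neq0// mul1r.
Qed.

(** The remainder depends on [f] only through its bound on the contour; this uniformity permits
    differentiation under the integral sign in [conv_hol]. *)
Lemma Taylor1 f z r B d k : 0 < r ->
  (forall w, insq z r w -> exists d, cdiff f w d) ->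
  (forall w, onsq z r w -> nc (f w) <= B) -> cdiff f z d -> nc k <= r / 4 ->
  nc (f (z + k) - f z - d * k) <= 128 * B / r ^+ 2 * nc k ^+ 2.
Proof.
move=> r0 fd fB fz kr; apply: twopii_le.
have z0 : nc (z - z) <= r / 4 by rewrite subrr nc0 divr_ge0// ltW.
rewrite mulrBr mulrA -(Cauchy_deriv r0 fd _ z0 fz); last by exists B.
by rewrite [_ * k]mulrC; exact: Taylor_kernel.
Qed.

Lemma Cauchy_deriv_le f z r B d : 0 < r ->
  (forall w, insq z r w -> exists d, cdiff f w d) ->
  (forall w, onsq z r w -> nc (f w) <= B) -> cdiff f z d ->
  nc d <= 16 * B / r.
Proof.
move=> r0 fd fB fz; apply: twopii_le.
have z0 : nc (z - z) <= r / 4 by rewrite subrr nc0 divr_ge0// ltW.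
have z2 : nc (z - z) <= r / 2 by rewrite subrr nc0 divr_ge0// ltW.
have cf w : onsq z r w -> ccont f w.
  by move=> [/fd[D /cdiff_cont]].
rewrite -(Cauchy_deriv r0 fd _ z0 fz); last by exists B.
rewrite (le_trans (@rsq_le _ _ _ (B * r ^- 2) r0 _ _))//.
- exact: ccont_kernel.
- move=> w ww; rewrite ncM ler_pM ?nc_ge0//; first exact: fB.
  rewrite ncV ncX lef_pV2 ?posrE ?exprn_gt0 ?ler_pXn2r ?nnegrE ?nc_ge0 ?(ltW r0)//.
    exact: onsq_dist.
  by rewrite (lt_le_trans r0)// onsq_dist.
- by rewrite le_eqVlt; apply/orP; left; apply/eqP; field; rewrite gt_eqF.
Qed.

Lemma nc_dist z w : `|nc z - nc w| <= nc (z - w).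
Proof.
by rewrite ler_norml nc_subl andbT lerNl opprB ncB nc_subl.
Qed.

Lemma seg_bounded (p : R -> R[i]) (a b : R) : a <= b ->
  (forall t, a <= t <= b -> pcont p t) ->
  exists B, forall t, a <= t <= b -> nc (p t) <= B.
Proof.
move=> ab cp.
have cn : {within `[a, b], continuous (fun t => nc (p t))}.
  apply: within_itv_cont => x /cp px; apply: real_cont => e /px[d d0 pd].
  by exists d => // y /pd; apply: le_trans; exact: nc_dist.
have [c _ H] := EVT_max ab cn.
by exists (nc (p c)) => t tt; apply: H; rewrite in_itv.
Qed.

Lemma onsq_bounded f z r : 0 < r -> (forall w, onsq z r w -> ccont f w) ->
  exists B, forall w, onsq z r w -> nc (f w) <= B.
Proof.
move=> r0 cf; have [s1 s2 s3 s4] := onsq_sides z r0.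
have l1 : Re z - r <= Re z + r by lra.
have l2 : Im z - r <= Im z + r by lra.
have [B1 H1] := seg_bounded l1 (fun t tt => ccont_hor (cf _ (s1 t tt))).
have [B2 H2] := seg_bounded l1 (fun t tt => ccont_hor (cf _ (s2 t tt))).
have [B3 H3] := seg_bounded l2 (fun t tt => ccont_ver (cf _ (s3 t tt))).
have [B4 H4] := seg_bounded l2 (fun t tt => ccont_ver (cf _ (s4 t tt))).
exists (Num.max (Num.max B1 B2) (Num.max B3 B4)) => -[x y] [[]].
rewrite !ReD !ImD !ReN !ImN /= => xx yy h.
have xb : Re z - r <= x <= Re z + r.
  by move: xx; rewrite ler_norml => /andP[? ?]; apply/andP; split; lra.
have yb : Im z - r <= y <= Im z + r.
  by move: yy; rewrite ler_norml => /andP[? ?]; apply/andP; split; lra.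
have D (u v : R) : `|u - v| = r -> u = v - r \/ u = v + r.
  have [uv|uv] := leP 0 (u - v).
    by rewrite ger0_norm// => <-; right; lra.
  by rewrite ltr0_norm// => <-; left; lra.
rewrite !le_max; case: h => /D[->|->].
- by rewrite (H3 _ yb) !orbT.
- by rewrite (H4 _ yb) !orbT.
- by rewrite (H1 _ xb).
- by rewrite (H2 _ xb) !orbT.
Qed.

(* The kernel estimate is the expansion of [(w - z - k)^-2] to first order in [k]. *)
Lemma deriv_cdiff f fd z r : 0 < r ->
  (forall w, insq z r w -> cdiff f w (fd w)) -> exists d, cdiff fd z d.
Proof.
move=> r0 fdd.
have fd' w : insq z r w -> exists d, cdiff f w d by move=> /fdd; exists (fd w).
have cf w : onsq z r w -> ccont f w.
  by move=> [/fdd/cdiff_cont].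
have [B fB] := onsq_bounded r0 cf.
have z0 : nc (z - z) <= r / 2 by rewrite subrr nc0 divr_ge0// ltW.
exists (twopii^-1 * rsq (fun w => 2%:R * (f w / (w - z) ^+ 3)) z r).
apply: (@quadratic_cdiff _ _ _ (16 * (B * (4 * (3 * (2 * r) + 2 * r) / r ^+ 5)) * r) (r / 4)).
  by rewrite divr_gt0.
move=> k kr; apply: twopii_le.
have B0 : 0 <= B.
  have [_ _ _ /(_ (Im z)) H] := onsq_sides z r0.
  by apply: le_trans (fB _ (H _)); [exact: nc_ge0|apply/andP; split; lra].
have kz : nc (z + k - z) <= r / 4 by rewrite addrAC subrr add0r.
have kz2 : nc (z + k - z) <= r / 2 by rewrite addrAC subrr add0r (le_trans kr)//; lra.
have z4 : nc (z - z) <= r / 4 by rewrite subrr nc0 divr_ge0// ltW.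
have eB : exists B, forall w, onsq z r w -> nc (f w) <= B by exists B.
have r4 : r / 4 <= r by lra.
rewrite !mulrBr -(Cauchy_deriv r0 fd' eB kz); last first.
  by apply: fdd; apply: nc_insq; exact: le_trans r4.
rewrite -(Cauchy_deriv r0 fd' eB z4); last first.
  by apply: fdd; apply: nc_insq; exact: le_trans r4.
rewrite (_ : twopii * (twopii^-1 * _ * k) =
    k * rsq (fun w => 2%:R * (f w / (w - z) ^+ 3)) z r); last first.
  by rewrite mulrA mulrA mulfV ?twopii_neq0// mul1r mulrC.
have c3 w : onsq z r w -> ccont (fun w => 2%:R * (f w / (w - z) ^+ 3)) w.
  by move=> ww; apply: ccontM; [exact: ccont_cst|exact: (ccont_kernel 3 r0 cf z0 ww)].
have c2 w : onsq z r w -> ccont (fun w => f w / (w - z) ^+ 2) w by exact: ccont_kernel.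
have c2' w : onsq z r w -> ccont (fun w => f w / (w - (z + k)) ^+ 2) w by exact: ccont_kernel.
rewrite -rsqB// -rsqZ// -rsqB//; last 2 first.
- by move=> w ww; apply: ccontB; auto.
- by move=> w ww; apply: ccontM; [exact: ccont_cst|exact: c3].
pose K w := f w * (k ^+ 2 * (3%:R * (w - z) - 2%:R * k) / ((w - z) ^+ 3 * (w - (z + k)) ^+ 2)).
have dn w : onsq z r w -> w - z != 0 /\ w - (z + k) != 0.
  move=> ww; rewrite -!nc_gt0; split.
    by rewrite (lt_le_trans _ (onsq_dist_half ww z0))// divr_gt0.
  by rewrite (lt_le_trans _ (onsq_dist_half ww kz2))// divr_gt0.
have EK w : onsq z r w -> f w / (w - (z + k)) ^+ 2 - f w / (w - z) ^+ 2 -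
    k * (2%:R * (f w / (w - z) ^+ 3)) = K w.
  by move=> /dn[n1 n2]; rewrite /K; field; rewrite n1 n2.
rewrite (eq_rsq r0 EK).
set C := 4 * _ / _.
rewrite (le_trans (@rsq_le _ _ _ (B * (C * nc k ^+ 2)) r0 _ _))//.
- move=> w ww; have [n1 n2] := dn w ww.
  apply: ccontM; first exact: cf.
  apply: ccontM.
    apply: ccontM; first exact: ccont_cst.
    apply: ccontB; last exact: ccont_cst.
    apply: ccontM; first exact: ccont_cst.
    by apply: ccontB; [exact: ccont_id|exact: ccont_cst].
  apply: ccontV; last by rewrite mulf_neq0// expf_neq0.
  by apply: ccontM; apply: ccontX; apply: ccontB; first [exact: ccont_id|exact: ccont_cst].
- move=> w ww; rewrite /K ncM ler_pM ?nc_ge0//; first exact: fB.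
  have d1 := onsq_dist ww; have d2 := onsq_dist_half ww kz2.
  have d3 := insq_dist ww.1.
  have r20 : 0 < r / 2 by rewrite divr_gt0.
  have p1 := lt_le_trans r0 d1; have p2 := lt_le_trans r20 d2.
  rewrite !ncM ncV ncM !ncX /C -mulrA [leRHS]mulrC ler_wpM2l ?sqr_ge0//.
  have -> : 4 * (3 * (2 * r) + 2 * r) / r ^+ 5 =
      (3 * (2 * r) + 2 * r) / (r ^+ 3 * (r / 2) ^+ 2) by field; rewrite gt_eqF.
  apply: ler_pM; rewrite ?nc_ge0 ?invr_ge0 ?mulr_ge0 ?exprn_ge0 ?nc_ge0//.
    rewrite (le_trans (le_ncB _ _))// !ncM !nc_nat lerD// ler_wpM2l//.
    by rewrite (le_trans kr)//.
  rewrite lef_pV2 ?posrE ?mulr_gt0 ?exprn_gt0//.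
  have q : (r / 2) ^+ 2 <= nc (w - (z + k)) ^+ 2.
    by rewrite ler_pXn2r ?nnegrE ?nc_ge0 ?(ltW r20).
  have q3 : r ^+ 3 <= nc (w - z) ^+ 3 by rewrite ler_pXn2r ?nnegrE ?nc_ge0 ?(ltW r0).
  by apply: ler_pM => //; rewrite ?exprn_ge0 ?(ltW r20) ?(ltW r0).
- by rewrite le_eqVlt; apply/orP; left; apply/eqP; ring.
Qed.

Lemma hol_ex f fd w : hol f fd -> 0 < Im w -> exists d, cdiff f w d.
Proof. by move=> fdd w0; exists (fd w); exact: fdd. Qed.

Lemma insq_Im z r w : insq z r w -> Im z - r <= Im w <= Im z + r.
Proof.
by move=> [_]; rewrite ImD ImN ler_norml => /andP[? ?]; apply/andP; split; lra.
Qed.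

Lemma hol_deriv f fd : hol f fd -> exists fdd, hol fd fdd.
Proof.
move=> fh; have : forall z, exists d, 0 < Im z -> cdiff fd z d.
  move=> z; have [z0|z0] := ltP 0 (Im z); last by exists 0.
  have r0 : 0 < Im z / 2 by rewrite divr_gt0.
  have [|d dz] := @deriv_cdiff f fd z _ r0; last by exists d.
  by move=> w /insq_Im/andP[h _]; apply: fh; apply: lt_le_trans h; lra.
by move=> /choice[fdd H]; exists fdd => z /H.
Qed.

End CauchyEstimates.

(** * Measurability in the plane and translation invariance of integrals *)

Section PlaneMeasure.
Context {R : realType}.
Local Notation mu := (@lebesgue_measure R).
Local Notation TR := (measurableTypeR R).
Local Notation M2 := (mu \x mu)%E.
Implicit Types (p q : R * R) (x y e : R).

(** An open set is the union of the countably many rational boxes that it contains. *)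
Lemma open2_measurable (A : set (R * R)) :
  (forall p, A p -> exists2 d, 0 < d & forall q, `|q.1 - p.1| < d ->
    `|q.2 - p.2| < d -> A q) ->
  @measurable _ (TR * TR)%type A.
Proof.
move=> oA.
pose box (a b c d : rat) : set (R * R) :=
  `]ratr a, ratr b[%classic `*` `]ratr c, ratr d[%classic.
pose F a b c d := if pselect (box a b c d `<=` A) then box a b c d else set0.
have -> : A = \bigcup_(a : rat) \bigcup_(b : rat) \bigcup_(c : rat) \bigcup_(d : rat) F a b c d.
  apply/seteqP; split=> [p /[dup] Ap /oA[r r0 H]|p].
    have g (v : R) : exists ab : rat * rat, [/\ v - r < ratr ab.1, ratr ab.1 < v,
        v < ratr ab.2 & ratr ab.2 < v + r].
      have /rat_in_itvoo[a] : v - r < v by rewrite ltrBlDr ltrDl.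
      have /rat_in_itvoo[b] : v < v + r by rewrite ltrDl.
      by rewrite !in_itv/= => /andP[? ?] /andP[? ?]; exists (a, b).
    have [[a b] /= [a1 a2 a3 a4]] := g p.1; have [[c d] /= [c1 c2 c3 c4]] := g p.2.
    exists a => //; exists b => //; exists c => //; exists d => //.
    rewrite /F; case: (pselect (box a b c d `<=` A)) => [h|].
      by split => /=; rewrite in_itv/= ?a2 ?a3 ?c2 ?c3.
    case=> q [/=]; rewrite !in_itv/= => /andP[q1 q2] /andP[q3 q4]; apply: H; rewrite ltr_norml; apply/andP; split; lra.
  move=> [a _ [b _ [c _ [d _]]]]; rewrite /F.
  by case: pselect => // H; exact: H.
apply: bigcupT_measurable_rat => a; apply: bigcupT_measurable_rat => b.
apply: bigcupT_measurable_rat => c; apply: bigcupT_measurable_rat => d.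
rewrite /F; case: (pselect (box a b c d `<=` A)) => h; last exact: measurable0.
by apply: measurableX; exact: measurable_itv.
Qed.

Definition upper : set (R * R) := [set p | 0 < p.2].

Lemma measurable_upper : @measurable _ (TR * TR)%type upper.
Proof.
apply: open2_measurable => p p0; exists p.2 => // q _.
by rewrite ltr_norml /upper/= => /andP[+ _]; rewrite ltrBrDr addNr.
Qed.

Definition hcont (v : R * R -> R) := forall p, 0 < p.2 -> forall e, 0 < e ->
  exists2 d, 0 < d & forall q, `|q.1 - p.1| < d -> `|q.2 - p.2| < d ->
    `|v q - v p| <= e.

(** Extension by 0 below the real axis, so that measurability and Fubini are used on the whole
    plane. *)
Definition cut (v : R * R -> R) p : R := if 0 < p.2 then v p else 0.

Lemma measurable_cut_of (v : R * R -> R) :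
  measurable_fun (upper : set (TR * TR)%type) v ->
  measurable_fun [set: (TR * TR)%type] (cut v).
Proof.
move=> mv; have := (measurable_restrictT v measurable_upper).1 mv.
apply: eq_measurable_fun => p _; rewrite /cut patchE.
by case: ifPn => [/set_mem/= ->//|]; rewrite notin_setE /upper/= => /negP/negPf->.
Qed.

Lemma measurable_cut (v : R * R -> R) : hcont v ->
  measurable_fun [set: (TR * TR)%type] (cut v).
Proof.
move=> cv; apply: measurable_cut_of => mD.
apply: (measurability _ (RGenOInfty.measurableE R)) => // _ [_ [c ->] <-].
rewrite preimage_itvoy; apply: open2_measurable => p [p0 /= cp].
have [d d0 H] := cv p p0 ((v p - c) / 2) ltac:(by rewrite divr_gt0// subr_gt0).
exists (Num.min d p.2); first by rewrite lt_min d0.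
move=> q; rewrite !lt_min => /andP[q1 _] /andP[q2]; rewrite ltr_norml => /andP[+ _].
rewrite ltrBrDr addNr => q0; split => //=.
have := H q q1 q2; rewrite ler_norml => /andP[+ _].
by move: cp; lra.
Qed.

Definition translate (c x : TR) : TR := x + c.

Lemma measurable_translate c : measurable_fun [set: TR] (translate c).
Proof. by apply: measurable_funD => //; exact: measurable_cst. Qed.

HB.instance Definition _ c :=
  isMeasurableFun.Build _ _ TR TR (translate c) (measurable_translate c).

Lemma lebesgue_measure_translate c (A : set TR) : measurable A ->
  pushforward mu (translate c) A = mu A.
Proof.
move=> mA; apply/esym/lebesgue_measure_unique => //= _ [[a b]] _ <-.
rewrite /pushforward.
have -> : translate c @^-1` `]a, b]%classic = `]a - c, b - c]%classic.
  by apply/seteqP; split => x /=; rewrite !in_itv/= ltrBlDr lerBrDr.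
rewrite !lebesgue_measure_itv/= !lte_fin ltrD2r; case: ifP => // _.
by rewrite -!EFinB; congr EFin; ring.
Qed.

Lemma ge0_integral_shift (c : R) (f : R -> \bar R) : measurable_fun [set: TR] f ->
  (forall x, 0 <= f x)%E -> (\int[mu]_x f (x + c)%R = \int[mu]_x f x)%E.
Proof.
move=> mf f0.
rewrite [RHS](eq_measure_integral (pushforward mu (translate c))); last first.
  by move=> A mA _; exact/esym/lebesgue_measure_translate.
rewrite ge0_integral_pushforward//; exact: measurable_translate.
Qed.

Lemma integrable_shift (c : R) (f : R -> R) : mu.-integrable setT (EFin \o f) ->
  mu.-integrable setT (EFin \o (fun x => f (x + c))).
Proof.
move=> /integrableP[mf fi]; apply/integrableP; split.
  exact: (measurableT_comp mf (measurable_translate c)).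
have := @ge0_integral_shift c (fun x => `|(f x)%:E|%E) _ _.
move=> -> //; exact: measurableT_comp.
Qed.

Lemma Rintegral_shift (c : R) (f : R -> R) : mu.-integrable setT (EFin \o f) ->
  \int[mu]_x f (x + c) = \int[mu]_x f x.
Proof.
move=> fi; rewrite /Rintegral; congr fine.
rewrite [RHS](eq_measure_integral (pushforward mu (translate c))); last first.
  by move=> A mA _; exact/esym/lebesgue_measure_translate.
rewrite integral_pushforward//; first exact: measurable_int fi.
exact: integrable_shift.
Qed.

Lemma ge0_integral_reflect (c : R) (f : R -> \bar R) : measurable_fun [set: TR] f ->
  (forall x, 0 <= f x)%E -> (\int[mu]_x f (c - x)%R = \int[mu]_x f x)%E.
Proof.
move=> mf f0.
have mo : measurable_fun [set: TR] (-%R : TR -> TR) by exact: oppr_measurable.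
transitivity (\int[mu]_x f (x + c)%R)%E; last exact: ge0_integral_shift.
rewrite [RHS](eq_measure_integral (pushforward mu (-%R : TR -> TR))); last first.
  by move=> A mA _; exact/esym/lebesgue_measureN.
rewrite ge0_integral_pushforward//.
  by apply: eq_integral => x _ /=; rewrite addrC.
exact: (measurableT_comp mf (measurable_translate c)).
Qed.

End PlaneMeasure.

(** * The area mean inequality for holomorphic functions *)

Section AreaMean.
Context {R : realType}.
Local Notation nc := (@ComplexField.Normc.normc R).
Local Notation mu := (@lebesgue_measure R).
Local Notation TR := (measurableTypeR R).
Local Notation M2 := (mu \x mu)%E.
Local Notation Re := (@complex.Re R).
Local Notation Im := (@complex.Im R).
Implicit Types (p q : R * R) (x y e r a : R) (z w : R[i]) (f g : R[i] -> R[i]).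

(** In logarithms, |ln t - ln s| <= ln c; the exponent may have either sign. *)
Lemma powR_comp (c s t a : R) : 0 < s -> 1 <= c -> s / c <= t <= c * s ->
  t `^ a <= c `^ `|a| * s `^ a.
Proof.
move=> s0 c1 /andP[h1 h2].
have c0 : 0 < c by exact: lt_le_trans c1.
have t0 : 0 < t by rewrite (lt_le_trans _ h1)// divr_gt0.
rewrite /powR !gt_eqF// -expRD ler_expR.
have u : `|ln t - ln s| <= ln c.
  rewrite ler_norml; apply/andP; split.
    rewrite lerBrDr addrC -lnV ?posrE// -lnM ?posrE ?invr_gt0//.
    by rewrite ler_ln ?posrE// divr_gt0.
  by rewrite lerBlDr -lnM ?posrE// ler_ln ?posrE ?mulr_gt0.
rewrite -lerBlDr -mulrBr (le_trans (ler_norm _))// normrM.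
by rewrite ler_wpM2l.
Qed.

Definition atp g p : R[i] := g (p.1 +i* p.2).

Lemma hcont_atp g : (forall z, 0 < Im z -> ccont g z) ->
  forall p, 0 < p.2 -> forall e, 0 < e -> exists2 d, 0 < d &
    forall q, `|q.1 - p.1| < d -> `|q.2 - p.2| < d -> nc (atp g q - atp g p) <= e.
Proof.
move=> cg p p0 e e0; have [d d0 H] := cg (p.1 +i* p.2) p0 e e0.
exists (d / 2) => [|q q1 q2]; first by rewrite divr_gt0.
apply: H; rewrite (le_lt_trans (nc_le_ReIm _))// ReD ImD ReN ImN /=.
by rewrite (splitr d) ltrD.
Qed.

Lemma measurable_hol_nc g : (forall z, 0 < Im z -> ccont g z) ->
  measurable_fun [set: (TR * TR)%type] (cut (fun p => nc (atp g p))).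
Proof.
move=> cg; apply: measurable_cut => p p0 e /(hcont_atp cg p0)[d d0 H].
exists d => // q q1 q2; exact: le_trans (nc_dist _ _) (H q q1 q2).
Qed.

Lemma measurable_hol_Re g : (forall z, 0 < Im z -> ccont g z) ->
  measurable_fun [set: (TR * TR)%type] (cut (fun p => Re (atp g p))).
Proof.
move=> cg; apply: measurable_cut => p p0 e /(hcont_atp cg p0)[d d0 H].
exists d => // q q1 q2; apply: le_trans (H q q1 q2).
by rewrite -ReN -ReD Re_le_nc.
Qed.

Lemma measurable_hol_Im g : (forall z, 0 < Im z -> ccont g z) ->
  measurable_fun [set: (TR * TR)%type] (cut (fun p => Im (atp g p))).
Proof.
move=> cg; apply: measurable_cut => p p0 e /(hcont_atp cg p0)[d d0 H].
exists d => // q q1 q2; apply: le_trans (H q q1 q2).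
by rewrite -ImN -ImD Im_le_nc.
Qed.

Definition box x y r p : R := ((`|p.1 - x| <= r) && (`|p.2 - y| <= r))%:R.

Lemma box_ge0 x y r p : 0 <= box x y r p. Proof. exact: ler0n. Qed.
Lemma box_le1 x y r p : box x y r p <= 1. Proof. by rewrite /box; case: (_ && _). Qed.

Lemma measurable_nat_bool d (T : measurableType d) (b : T -> bool) :
  measurable_fun setT b -> measurable_fun setT (fun t => (b t)%:R : TR).
Proof.
move=> mb; have -> : (fun t => (b t)%:R : TR) = (fun t => if b t then 1 else 0).
  by apply/funext => t; case: (b t).
by apply: measurable_fun_ifT => //; exact: measurable_cst.
Qed.

Lemma measurable_fst_sub x : measurable_fun [set: (TR * TR)%type] (fun p => `|p.1 - x| : TR).
Proof.
apply: (measurableT_comp (@normr_measurable R setT)).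
by apply: measurable_funB; [exact: measurable_fst|exact: measurable_cst].
Qed.

Lemma measurable_snd_sub y : measurable_fun [set: (TR * TR)%type] (fun p => `|p.2 - y| : TR).
Proof.
apply: (measurableT_comp (@normr_measurable R setT)).
by apply: measurable_funB; [exact: measurable_snd|exact: measurable_cst].
Qed.

Lemma measurable_box x y r : measurable_fun [set: (TR * TR)%type] (box x y r).
Proof.
apply: measurable_nat_bool; apply: measurable_and; apply: measurable_fun_ler;
  by [exact: measurable_fst_sub|exact: measurable_snd_sub|exact: measurable_cst].
Qed.

Lemma Rintegral_le_itv (a b : R) (u : R -> R) (v : R -> \bar R) :
  (forall x, a <= x <= b -> {for x, continuous u}) ->
  measurable_fun [set: TR] v -> (forall x, 0 <= v x)%E ->
  (forall x, a <= x <= b -> 0 <= u x /\ ((u x)%:E <= v x)%E) ->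
  ((\int[mu]_(x in `[a, b]) u x)%:E <= \int[mu]_x v x)%E.
Proof.
move=> cu mv v0 uv.
have iu : mu.-integrable `[a, b] (EFin \o u).
  apply: continuous_compact_integrable; first exact: segment_compact.
  exact: within_itv_cont.
rewrite /Rintegral fineK; last exact: integrable_fin_num.
apply: (@le_trans _ _ (\int[mu]_(x in `[a, b]) v x)%E).
  apply: ge0_le_integral => //.
  - by move=> x /=; rewrite in_itv/= => /uv[].
  - by have /integrableP[] := iu.
  - exact: measurable_funS mv.
  - by move=> x /=; rewrite in_itv/= => /uv[].
exact: ge0_subset_integral.
Qed.

Lemma integral_itv_EFin_cst (a b c : R) : a <= b ->
  (\int[mu]_(x in `[a, b]) c%:E = (c * (b - a))%:E)%E.
Proof.
move=> ab; rewrite -(Rintegral_itv_cst c ab) /Rintegral fineK//.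
exact/integrable_fin_num/integrable_itv_cst.
Qed.

Lemma nc_cont (h : R -> R[i]) x : pcont h x -> {for x, continuous (fun t => nc (h t))}.
Proof.
move=> hx; apply: real_cont => e /hx[d d0 H]; exists d => // t /H.
by apply: le_trans; exact: nc_dist.
Qed.

Lemma ge0_muleD4 (k A B C D : \bar R) : (0 <= A -> 0 <= B -> 0 <= C -> 0 <= D ->
  k * (A + B + (C + D)) = k * A + k * B + (k * C + k * D))%E.
Proof. by move=> A0 B0 C0 D0; rewrite !ge0_muleDr ?adde_ge0. Qed.

(** Integration of the hypothesis over [a] in [r/2, r]: after a translation or reflection each of
    the four integrals is at most [I]. The left side gets the length r/2, which gives (2/r)(4/r) 4 =
    32 / r^2. *)
Lemma average_four (H V : R -> \bar R) (I : \bar R) (c0 x y r : R) :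
  0 < r -> 0 <= c0 ->
  measurable_fun [set: TR] H -> measurable_fun [set: TR] V ->
  (forall t, 0 <= H t)%E -> (forall t, 0 <= V t)%E ->
  (\int[mu]_t H t = I)%E -> (\int[mu]_t V t = I)%E ->
  (forall a, r / 2 <= a <= r -> (c0%:E <=
    (4 / r)%:E * (H (y - a)%R + H (y + a)%R + (V (x + a)%R + V (x - a)%R)))%E) ->
  (c0%:E <= (32 / r ^+ 2)%:E * I)%E.
Proof.
move=> r0 c00 mH mV H0 V0 IH IV key.
have S0 a : (0 <= H (y - a)%R + H (y + a)%R + (V (x + a)%R + V (x - a)%R))%E.
  by apply: adde_ge0; apply: adde_ge0.
have := @ge0_le_integral _ _ R mu `[r / 2, r] (measurable_itv _) (fun=> c0%:E)
  (fun a => (4 / r)%:E * (H (y - a)%R + H (y + a)%R + (V (x + a)%R + V (x - a)%R)))%E.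
have mHm : measurable_fun [set: TR] (fun a => H (y - a)%R).
  by apply: (measurableT_comp mH); apply: measurable_funB => //; exact: measurable_cst.
have mHp : measurable_fun [set: TR] (fun a => H (y + a)%R).
  by apply: (measurableT_comp mH); apply: measurable_funD => //; exact: measurable_cst.
have mVm : measurable_fun [set: TR] (fun a => V (x - a)%R).
  by apply: (measurableT_comp mV); apply: measurable_funB => //; exact: measurable_cst.
have mVp : measurable_fun [set: TR] (fun a => V (x + a)%R).
  by apply: (measurableT_comp mV); apply: measurable_funD => //; exact: measurable_cst.
have mS : measurable_fun [set: TR] (fun a => H (y - a)%R + H (y + a)%R + (V (x + a)%R + V (x - a)%R))%E.
  by apply: emeasurable_funD; apply: emeasurable_funD.
move=> /(_ _ _ _ _)/wrap[].
- by move=> a _; rewrite lee_fin.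
- exact: measurable_cst.
- by apply: measurable_funeM; exact: measurable_funTS.
- by move=> a /=; rewrite in_itv/=; exact: key.
rewrite integral_itv_EFin_cst; last by lra.
rewrite ge0_integralZl//; last 2 first.
- exact: measurable_funTS.
- by rewrite lee_fin divr_ge0// ltW.
have IS : (\int[mu]_(a in `[(r / 2)%R, r]) (H (y - a)%R + H (y + a)%R + (V (x + a)%R + V (x - a)%R)) <= 4%:R%:E * I)%E.
  apply: (@le_trans _ _ (\int[mu]_a (H (y - a)%R + H (y + a)%R + (V (x + a)%R + V (x - a)%R)))%E).
    exact: ge0_subset_integral.
  rewrite ge0_integralD//; last 4 first.
  - by move=> a _; exact: adde_ge0.
  - exact: emeasurable_funD.
  - by move=> a _; exact: adde_ge0.
  - exact: emeasurable_funD.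
  rewrite ge0_integralD// ge0_integralD//.
  rewrite (ge0_integral_reflect y mH H0) (ge0_integral_reflect x mV V0).
  under [X in (_ + X + _)%E]eq_integral do rewrite addrC.
  under [X in (_ + (X + _))%E]eq_integral do rewrite addrC.
  rewrite (ge0_integral_shift y mH H0) (ge0_integral_shift x mV V0) IH IV.
  rewrite -[X in (X + _ + _)%E]mul1e -[X in (_ + X + _)%E]mul1e.
  rewrite -[X in (_ + (X + _))%E]mul1e -[X in (_ + (_ + X))%E]mul1e.
  have I0 : (0 <= I)%E by rewrite -IH; apply: integral_ge0.
  rewrite -!ge0_muleDl ?adde_ge0 ?lee01//.
  by rewrite lee_wpmul2r// -!EFinD lee_fin; lra.
move=> h1.
have {h1 IS} := le_trans h1 (lee_wpmul2l _ IS).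
move=> /(_ ltac:(by rewrite lee_fin divr_ge0// ltW)).
have I0 : (0 <= I)%E by rewrite -IH; apply: integral_ge0.
rewrite muleA -EFinM => h2.
have rr : r - r / 2 = r / 2 by lra.
rewrite rr in h2.
have -> : (c0%:E = (2 / r)%:E * (c0 * (r / 2))%:E)%E.
  by rewrite -EFinM; congr EFin; field; rewrite gt_eqF.
apply: (le_trans (lee_wpmul2l _ h2)); first by rewrite lee_fin divr_ge0// ltW.
rewrite muleA -EFinM lee_wpmul2r// lee_fin le_eqVlt; apply/orP; left; apply/eqP.
by field; rewrite gt_eqF.
Qed.


(** Cauchy's formula on the concentric square of half-side a, with |w - center| >= a on the contour,
    bounds |g| at the center by 2/a times the integrals of |g| over the four sides. Averaging over a
    in [r/2, r] turns side integrals into an area integral. *)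
Lemma area_mean g gd x y r : hol g gd -> 0 < r -> r < y ->
  ((nc (g (x +i* y)))%:E <= (32 / r ^+ 2)%:E *
     \int[M2]_p (box x y r p * cut (fun p => nc (atp g p)) p)%:E)%E.
Proof.
move=> gh r0 ry.
have cg z : 0 < Im z -> ccont g z by move=> /gh/cdiff_cont.
set c0 := nc _.
pose Psi p : R := box x y r p * cut (fun p => nc (atp g p)) p.
have Psi0 p : 0 <= Psi p.
  by rewrite mulr_ge0 ?box_ge0// /cut; case: ifP => // _; exact: nc_ge0.
have mPsi : measurable_fun [set: (TR * TR)%type] (EFin \o Psi).
  apply/measurable_EFinP; apply: measurable_funM; first exact: measurable_box.
  exact: measurable_hol_nc.
have ePsi0 p : (0 <= (EFin \o Psi) p)%E by rewrite lee_fin.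
set I := (\int[M2]_p _)%E.
pose H (t : R) := (\int[mu]_s (Psi (s, t))%:E)%E.
pose V (s : R) := (\int[mu]_t (Psi (s, t))%:E)%E.
have mH : measurable_fun [set: TR] H.
  exact: (measurable_fun_fubini_tonelli_G (m1 := mu) (EFin \o Psi) mPsi ePsi0).
have mV : measurable_fun [set: TR] V.
  exact: (measurable_fun_fubini_tonelli_F (m2 := mu) (EFin \o Psi) mPsi ePsi0).
have H0 t : (0 <= H t)%E by apply: integral_ge0 => s _; rewrite lee_fin.
have V0 t : (0 <= V t)%E by apply: integral_ge0 => s _; rewrite lee_fin.
have IH : (\int[mu]_t H t = I)%E by exact/esym/(fubini_tonelli2 (m1 := mu) (m2 := mu) (EFin \o Psi)).
have IV : (\int[mu]_t V t = I)%E by exact/esym/(fubini_tonelli1 (m1 := mu) (m2 := mu) (EFin \o Psi)).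
have msec1 t : measurable_fun [set: TR] (fun s => (Psi (s, t))%:E).
  exact: (measurableT_comp mPsi (measurable_pair2 t)).
have msec2 s : measurable_fun [set: TR] (fun t => (Psi (s, t))%:E).
  exact: (measurableT_comp mPsi (measurable_pair1 s)).
have PsiE s t : `|s - x| <= r -> `|t - y| <= r -> Psi (s, t) = nc (g (s +i* t)).
  move=> sx ty; rewrite /Psi /box /cut /= sx ty mul1r.
  by move: ty; rewrite ler_norml => /andP[ty _]; rewrite ifT//; lra.
have S0 a : (0 <= H (y - a)%R + H (y + a)%R + (V (x + a)%R + V (x - a)%R))%E.
  by apply: adde_ge0; apply: adde_ge0.
have key a : r / 2 <= a <= r ->
    (c0%:E <= (4 / r)%:E * (H (y - a)%R + H (y + a)%R + (V (x + a)%R + V (x - a)%R)))%E.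
  move=> /andP[a1 a2].
  have a0 : 0 < a by rewrite (lt_le_trans _ a1)// divr_gt0.
  have gdq w : insq (x +i* y) a w -> exists d, cdiff g w d.
    by move=> /insq_Im/= /andP[wy _]; apply: (hol_ex gh); apply: lt_le_trans wy; lra.
  have := @Cauchy_square R g (x +i* y) a (x +i* y) a0 gdq.
  rewrite subrr nc0 => /(_ ltac:(by rewrite divr_ge0// ltW)) C.
  have [s1 s2 s3 s4] := @onsq_sides R (x +i* y) a a0; rewrite /= in s1 s2 s3 s4.
  have cq w : onsq (x +i* y) a w -> ccont g w.
    by move=> [/gdq[d /cdiff_cont]].
  have ck w : onsq (x +i* y) a w -> ccont (fun w => g w / (w - (x +i* y))) w.
    move=> ww; apply: ccontM; first exact: cq.
    by apply: ccont_inv_sub; rewrite -subr_eq0 -nc_gt0 (lt_le_trans a0)// onsq_dist.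
  have bk w : onsq (x +i* y) a w -> nc (g w / (w - (x +i* y))) <= a^-1 * nc (g w).
    move=> ww; rewrite ncM mulrC ler_wpM2r ?nc_ge0// ncV lef_pV2 ?posrE ?onsq_dist//.
    by rewrite (lt_le_trans a0)// onsq_dist.
  have side (h : R -> R[i]) (b c : R) (v : R -> \bar R) : b <= c ->
      (forall t, b <= t <= c -> onsq (x +i* y) a (h t)) ->
      (forall t, b <= t <= c -> pcont (fun t => g (h t)) t) ->
      (forall t, b <= t <= c -> pcont (fun t => g (h t) / (h t - (x +i* y))) t) ->
      measurable_fun [set: TR] v -> (forall t, 0 <= v t)%E ->
      (forall t, b <= t <= c -> (nc (g (h t)))%:E = v t) ->
      ((nc (cI `[b, c] (fun t => g (h t) / (h t - (x +i* y)))))%:E <=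
        (2 / a)%:E * \int[mu]_t v t)%E.
    move=> bc hs c1 c2 mv v0 hv.
    have ih : mu.-integrable `[b, c] (EFin \o (fun t => nc (g (h t)))).
      apply: continuous_compact_integrable; first exact: segment_compact.
      by apply: within_itv_cont => t /c1/nc_cont.
    have := @cI_le R `[b, c] (fun t => g (h t) / (h t - (x +i* y)))
      (fun t => a^-1 * nc (g (h t))) _ (pcont_cintegrable c2) _ _.
    rewrite RintegralZl// mulrA => H1.
    apply: (@le_trans _ _ (2 / a * \int[mu]_(t in `[b, c]) nc (g (h t)))%:E).
      rewrite lee_fin; apply: H1 => //; first exact: integrableZR.
      by move=> t /=; rewrite in_itv/= => tt; apply: bk; exact: hs.
    rewrite EFinM lee_wpmul2l//; first by rewrite lee_fin divr_ge0// ltW.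
    apply: Rintegral_le_itv => //; first by move=> t /c1/nc_cont.
    by move=> t tt; split; [exact: nc_ge0|rewrite hv].
  have l1 : x - a <= x + a by lra.
  have l2 : y - a <= y + a by lra.
  have aa (u t : R) : u - a <= t <= u + a -> `|t - u| <= r.
    by move=> /andP[? ?]; rewrite ler_norml; apply/andP; split; lra.
  have ar : `|a| <= r by rewrite ger0_norm// ltW.
  have b1 := side (fun t => t +i* (y - a)) (x - a) (x + a) (fun s => (Psi (s, y - a))%:E)
    l1 s1 (fun t tt => ccont_hor (cq _ (s1 t tt))) (fun t tt => ccont_hor (ck _ (s1 t tt)))
    (msec1 _) (fun t => ePsi0 _).
  have b2 := side (fun t => t +i* (y + a)) (x - a) (x + a) (fun s => (Psi (s, y + a))%:E)
    l1 s2 (fun t tt => ccont_hor (cq _ (s2 t tt))) (fun t tt => ccont_hor (ck _ (s2 t tt)))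
    (msec1 _) (fun t => ePsi0 _).
  have b3 := side (fun t => (x - a) +i* t) (y - a) (y + a) (fun t => (Psi (x - a, t))%:E)
    l2 s3 (fun t tt => ccont_ver (cq _ (s3 t tt))) (fun t tt => ccont_ver (ck _ (s3 t tt)))
    (msec2 _) (fun t => ePsi0 _).
  have b4 := side (fun t => (x + a) +i* t) (y - a) (y + a) (fun t => (Psi (x + a, t))%:E)
    l2 s4 (fun t tt => ccont_ver (cq _ (s4 t tt))) (fun t tt => ccont_ver (ck _ (s4 t tt)))
    (msec2 _) (fun t => ePsi0 _).
  have am (u : R) : `|u - a - u| <= r by rewrite addrAC subrr add0r normrN.
  have ap (u : R) : `|u + a - u| <= r by rewrite addrAC subrr add0r.
  have e1 t : x - a <= t <= x + a -> (nc (g (t +i* (y - a))))%:E = (Psi (t, y - a))%:E.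
    by move=> /aa tt; rewrite PsiE.
  have e2 t : x - a <= t <= x + a -> (nc (g (t +i* (y + a))))%:E = (Psi (t, y + a))%:E.
    by move=> /aa tt; rewrite PsiE.
  have e3 t : y - a <= t <= y + a -> (nc (g ((x - a) +i* t)))%:E = (Psi (x - a, t))%:E.
    by move=> /aa tt; rewrite PsiE.
  have e4 t : y - a <= t <= y + a -> (nc (g ((x + a) +i* t)))%:E = (Psi (x + a, t))%:E.
    by move=> /aa tt; rewrite PsiE.
  have {}b1 := b1 e1; have {}b2 := b2 e2; have {}b3 := b3 e3; have {}b4 := b4 e4.
  have c0C : c0 <= nc (rsq (fun w => g w / (w - (x +i* y))) (x +i* y) a).
    rewrite C ncM nc_twopii /c0 ler_peMl ?nc_ge0//.
    by have := @pi_ge2 R; lra.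
  have c0S := le_trans c0C (le_ncD _ _).
  rewrite ncM nc_i mul1r in c0S.
  have {}c0S := le_trans c0S (lerD (le_ncB _ _) (le_ncB _ _)).
  rewrite -lee_fin !EFinD in c0S; apply: (le_trans c0S).
  apply: (@le_trans _ _ ((2 / a)%:E * (H (y - a)%R + H (y + a)%R + (V (x + a)%R + V (x - a)%R)))%E).
    rewrite ge0_muleD4//.
    by apply: leeD; [apply: leeD; [exact: b1|exact: b2]|apply: leeD; [exact: b4|exact: b3]].
  apply: lee_wpmul2r; first exact: S0.
  rewrite lee_fin.
  by rewrite ler_pdivrMr// mulrAC ler_pdivlMr//; move: a1; lra.
exact: (average_four r0 (nc_ge0 _) mH mV H0 V0 IH IV key).
Qed.

End AreaMean.

(** * Nonnegative integrands and dominated convergence *)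

Section RealIntegrands.
Context d (T : measurableType d) (R : realType) (m : {measure set T -> \bar R}).
Implicit Types (u v : T -> R).

Lemma ge0_leR u v : measurable_fun setT u -> measurable_fun setT v ->
  (forall t, 0 <= u t) -> (forall t, u t <= v t) ->
  (\int[m]_t (u t)%:E <= \int[m]_t (v t)%:E)%E.
Proof.
move=> mf mv u0 uv; apply: ge0_le_integral => //.
- by move=> t _; rewrite lee_fin.
- exact/measurable_EFinP.
- exact/measurable_EFinP.
- by move=> t _; rewrite lee_fin.
Qed.

Lemma ge0_intZR (c : R) u : measurable_fun setT u -> (forall t, 0 <= u t) -> 0 <= c ->
  (\int[m]_t (c * u t)%:E = c%:E * \int[m]_t (u t)%:E)%E.
Proof.
move=> mf u0 c0; rewrite -ge0_integralZl//.
- exact/measurable_EFinP.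
- by move=> t _; rewrite lee_fin.
Qed.

Lemma ge0_intDR u v : measurable_fun setT u -> measurable_fun setT v ->
  (forall t, 0 <= u t) -> (forall t, 0 <= v t) ->
  (\int[m]_t (u t + v t)%:E = \int[m]_t (u t)%:E + \int[m]_t (v t)%:E)%E.
Proof.
move=> mf mv u0 v0; rewrite -ge0_integralD//.
- by move=> t _; rewrite lee_fin.
- exact/measurable_EFinP.
- by move=> t _; rewrite lee_fin.
- exact/measurable_EFinP.
Qed.

Lemma ge0_intR_ge0 u : (forall t, 0 <= u t) -> (0 <= \int[m]_t (u t)%:E)%E.
Proof. by move=> u0; apply: integral_ge0 => t _; rewrite lee_fin. Qed.

Lemma dominated_to0 (F : nat -> T -> R) (g : T -> R) :
  (forall n, measurable_fun setT (F n)) -> measurable_fun setT g ->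
  (forall n t, 0 <= F n t) -> (forall n t, F n t <= g t) ->
  (\int[m]_t (g t)%:E < +oo)%E ->
  (forall t (e : R), 0 < e -> exists N : nat, forall n : nat, (N <= n)%N -> F n t <= e) ->
  forall e : R, 0 < e -> exists N : nat, forall n : nat, (N <= n)%N ->
    (\int[m]_t (F n t)%:E < e%:E)%E.
Proof.
move=> mF mg F0 Fg gfin Fto e e0.
have g0 t : 0 <= g t by exact: le_trans (F0 0%N t) (Fg 0%N t).
have ig : m.-integrable setT (EFin \o g).
  apply/integrableP; split; first exact/measurable_EFinP.
  apply: le_lt_trans gfin; rewrite le_eqVlt; apply/orP; left; apply/eqP.
  by apply: eq_integral => t _; rewrite /= ger0_norm.
have mF' n : measurable_fun setT (fun t => (F n t)%:E) by exact/measurable_EFinP.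
have cF t : setT t -> (F n t)%:E @[n --> \oo] --> (0 : \bar R)%E.
  move=> _; apply/fine_cvgP; split; first by apply: nearW.
  apply/cvgrPdist_le => /= e1 /(Fto t)[N HN]; exists N => // n /= Nn.
  by rewrite sub0r normrN ger0_norm// HN.
have dF t n : setT t -> (`|(F n t)%:E| <= (g t)%:E)%E.
  by move=> _; rewrite abse_EFin lee_fin ger0_norm.
have [_ _] := @dominated_convergence _ T R m setT measurableT (fun n t => (F n t)%:E)
  (cst 0%E) (EFin \o g) mF' (measurable_cst _) (aeW m cF) ig (aeW m dF).
rewrite integral0 => /fine_cvgP[[N1 _ HN1]] /cvgrPdist_lt/(_ e e0)[N2 _ HN2].
exists (maxn N1 N2) => n; rewrite geq_max => /andP[n1 n2].
have := HN2 n n2; rewrite /= sub0r normrN; have := HN1 n n1; rewrite /=.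
by move=> fn; rewrite -(fineK fn) lte_fin; apply: le_lt_trans; exact: ler_norm.
Qed.

(** The indicators of w >= n tend to 0 pointwise. Used with w equal to |x| or to y, it says that
    little energy lies far out. *)
Lemma tail_small u (w : T -> R) : measurable_fun setT u -> measurable_fun setT w ->
  (forall t, 0 <= u t) -> (\int[m]_t (u t)%:E < +oo)%E ->
  forall e : R, 0 < e -> exists n : nat,
    (\int[m]_t ((n%:R <= w t)%R%:R * u t)%:E < e%:E)%E.
Proof.
move=> mf mw u0 ufin e e0.
have [//|//|//|//|t e1 e10|N HN] := @dominated_to0
  (fun n t => (n%:R <= w t)%R%:R * u t) u _ _ _ _ ufin _ e e0.
- move=> n; apply: measurable_funM => //; apply: measurable_nat_bool.
  by apply: measurable_fun_ler => //; exact: measurable_cst.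
- by move=> n t; rewrite mulr_ge0.
- by move=> n t; rewrite ler_piMl// lern1 leq_b1.
- exists (Num.truncn (w t)).+1 => n wn.
  suff -> : (n%:R <= w t) = false by rewrite mul0r ltW.
  by apply/negbTE; rewrite -ltNge (lt_le_trans (truncnS_gt _))// ler_nat.
- by exists N; exact: HN.
Qed.

End RealIntegrands.

(** * Weighted energy and the pointwise bounds it gives *)

Section Energy.
Context {R : realType}.
Local Notation nc := (@ComplexField.Normc.normc R).
Local Notation mu := (@lebesgue_measure R).
Local Notation TR := (measurableTypeR R).
Local Notation M2 := (mu \x mu)%E.
Local Notation Re := (@complex.Re R).
Local Notation Im := (@complex.Im R).
Implicit Types (p q : R * R) (x y e r a alpha : R) (z w u : R[i]) (f g : R[i] -> R[i]).

Definition dens alpha f p : R := cut (fun p => nc (atp f p) ^+ 2 * p.2 `^ alpha) p.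

(** Taken at the derivative of a function this is its squared Dirichlet norm. *)
Definition energy alpha f : \bar R := (\int[M2]_p (dens alpha f p)%:E)%E.

Lemma dens_ge0 alpha f p : 0 <= dens alpha f p.
Proof. by rewrite /dens /cut; case: ifP => // _; rewrite mulr_ge0 ?sqr_ge0 ?powR_ge0. Qed.

Lemma densE alpha f p : dens alpha f p = cut (fun p => nc (atp f p)) p ^+ 2 * p.2 `^ alpha.
Proof. by rewrite /dens /cut; case: ifP => // _; rewrite expr0n/= mul0r. Qed.

Lemma measurable_snd_powR alpha : measurable_fun [set: (TR * TR)%type] (fun p => p.2 `^ alpha).
Proof.
have mP : measurable_fun [set: TR] ((fun x => x `^ alpha) : TR -> TR) by exact: measurable_powR.
exact: (measurableT_comp mP measurable_snd).
Qed.

Lemma measurable_dens alpha f : (forall z, 0 < Im z -> ccont f z) ->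
  measurable_fun [set: (TR * TR)%type] (dens alpha f).
Proof.
move=> cf; have -> : dens alpha f = fun p => cut (fun p => nc (atp f p)) p ^+ 2 * p.2 `^ alpha.
  by apply/funext => p; exact: densE.
apply: measurable_funM; last exact: measurable_snd_powR.
by apply: measurable_funX; exact: measurable_hol_nc.
Qed.

Lemma hol_ccont f fd : hol f fd -> forall z, 0 < Im z -> ccont f z.
Proof. by move=> fh z /fh/cdiff_cont. Qed.

Lemma hol_sqr f fd : hol f fd -> hol (fun z => f z ^+ 2) (fun z => 2%:R * f z ^+ 1 * fd z).
Proof. by move=> fh z z0; exact: (cdiffX 2 (fh z z0)). Qed.

Lemma energy_ge0 alpha f : (0 <= energy alpha f)%E.
Proof. by apply: ge0_intR_ge0 => p; exact: dens_ge0. Qed.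

Lemma eq_energy alpha f g : (forall z, 0 < Im z -> f z = g z) -> energy alpha f = energy alpha g.
Proof.
move=> fg; apply: eq_integral => p _; rewrite /dens /cut /atp.
by case: ifPn => // p0; rewrite fg.
Qed.

Lemma box_boundsP x y r p : box x y r p != 0 ->
  (x - r <= p.1 <= x + r) /\ (y - r <= p.2 <= y + r).
Proof.
rewrite /box pnatr_eq0 eqb0 negbK !ler_norml => /andP[/andP[? ?] /andP[? ?]].
by split; apply/andP; split; lra.
Qed.

Definition wcst alpha : R := 128 * 2 `^ `|alpha|.

Lemma wcst_ge0 alpha : 0 <= wcst alpha.
Proof. by rewrite mulr_ge0// powR_ge0. Qed.

(** [area_mean] is applied to f^2 on the square of half-side y/2, where the weight is comparable to
    y^alpha; the area factor y^-2 and the weight give the power y^(-2 - alpha). *)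
Lemma pointwise_energy alpha f fd x y : hol f fd -> 0 < y ->
  ((nc (f (x +i* y)) ^+ 2)%:E <= (wcst alpha * y `^ (- 2 - alpha))%:E *
    \int[M2]_p (box x y (y / 2) p * dens alpha f p)%:E)%E.
Proof.
move=> fh y0; have y20 : 0 < y / 2 by rewrite divr_gt0.
have y2y : y / 2 < y by lra.
have := area_mean x (hol_sqr fh) y20 y2y.
rewrite ncX => /le_trans; apply.
have cf := hol_ccont fh.
have bd p : box x y (y / 2) p * cut (fun p => nc (atp (fun z => f z ^+ 2) p)) p <=
    2 `^ `|alpha| * y `^ (- alpha) * (box x y (y / 2) p * dens alpha f p).
  have [->|/box_boundsP[_ /andP[p1 p2]]] := eqVneq (box x y (y / 2) p) 0.
    by rewrite !mul0r mulr0.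
  rewrite mulrCA ler_wpM2l ?box_ge0// /dens /cut.
  have p0 : 0 < p.2 by lra.
  rewrite p0 /atp ncX mulrCA -[leLHS]mulr1 ler_wpM2l ?sqr_ge0//.
  rewrite powRN mulrAC ler_pdivlMr ?powR_gt0// mul1r.
  by apply: powR_comp => //; [rewrite ler1n|apply/andP; split; lra].
have mb : measurable_fun [set: (TR * TR)%type] (fun p => box x y (y / 2) p * dens alpha f p).
  by apply: measurable_funM; [exact: measurable_box|exact: measurable_dens].
have b0 p : 0 <= box x y (y / 2) p * dens alpha f p by rewrite mulr_ge0 ?box_ge0 ?dens_ge0.
have c0 : 0 <= 2 `^ `|alpha| * y `^ (- alpha) by rewrite mulr_ge0 ?powR_ge0.
apply: (@le_trans _ _ ((32 / (y / 2) ^+ 2)%:E * ((2 `^ `|alpha| * y `^ (- alpha))%:E *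
    \int[M2]_p (box x y (y / 2) p * dens alpha f p)%:E))%E).
  apply: lee_wpmul2l; first by rewrite lee_fin divr_ge0// exprn_ge0// ltW.
  rewrite -ge0_intZR//; apply: ge0_leR => //.
  - apply: measurable_funM; first exact: measurable_box.
    apply: measurable_hol_nc; exact: hol_ccont (hol_sqr fh).
  - by apply: measurable_funM => //; exact: measurable_cst.
  - by move=> p; rewrite mulr_ge0 ?box_ge0// /cut; case: ifP => // _; exact: nc_ge0.
rewrite muleA -EFinM; apply: lee_wpmul2r; first exact: ge0_intR_ge0.
rewrite lee_fin le_eqVlt; apply/orP; left; apply/eqP.
rewrite powRD; last by rewrite (gt_eqF y0) implybT.
rewrite powR_invn ?(ltW y0)// /wcst; field.
by rewrite gt_eqF.
Qed.

Lemma energy_sup alpha f fd x y : hol f fd -> 0 < y -> (energy alpha f < +oo)%E ->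
  nc (f (x +i* y)) ^+ 2 <= wcst alpha * y `^ (- 2 - alpha) * fine (energy alpha f).
Proof.
move=> fh y0 fin; rewrite -lee_fin.
apply: (le_trans (pointwise_energy alpha x fh y0)).
rewrite [leRHS]EFinM fineK ?ge0_fin_numE ?energy_ge0//.
apply: lee_wpmul2l; first by rewrite lee_fin mulr_ge0 ?wcst_ge0 ?powR_ge0.
have cf := hol_ccont fh.
apply: ge0_leR.
- by apply: measurable_funM; [exact: measurable_box|exact: measurable_dens].
- exact: measurable_dens.
- by move=> p; rewrite mulr_ge0 ?box_ge0 ?dens_ge0.
- by move=> p; rewrite ler_piMl ?dens_ge0 ?box_le1.
Qed.

(** The little-o form of [energy_sup]: when the square around the point lies where w >= n, only the
    tail of the energy enters. *)
Lemma energy_tail alpha f fd (w : R * R -> R) : hol f fd -> (energy alpha f < +oo)%E ->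
  measurable_fun [set: (TR * TR)%type] w ->
  forall e, 0 < e -> exists n : nat, forall x y, 0 < y ->
    (forall p, x - y / 2 <= p.1 <= x + y / 2 -> y - y / 2 <= p.2 <= y + y / 2 -> n%:R <= w p) ->
    nc (f (x +i* y)) ^+ 2 <= wcst alpha * y `^ (- 2 - alpha) * e.
Proof.
move=> fh fin mw e e0; have cf := hol_ccont fh.
have [n Hn] := tail_small (measurable_dens alpha cf) mw (dens_ge0 alpha f) fin e0.
exists n => x y y0 H; rewrite -lee_fin.
apply: (le_trans (pointwise_energy alpha x fh y0)).
rewrite [leRHS]EFinM.
apply: lee_wpmul2l; first by rewrite lee_fin mulr_ge0 ?wcst_ge0 ?powR_ge0.
apply: le_trans (ltW Hn); apply: ge0_leR.
- by apply: measurable_funM; [exact: measurable_box|exact: measurable_dens].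
- apply: measurable_funM; last exact: measurable_dens.
  by apply: measurable_nat_bool; apply: measurable_fun_ler => //; exact: measurable_cst.
- by move=> p; rewrite mulr_ge0 ?box_ge0 ?dens_ge0.
- move=> p; rewrite ler_wpM2r ?dens_ge0//.
  have [->//|b0] := eqVneq (box x y (y / 2) p) 0.
  have [h1 h2] := box_boundsP b0.
  by rewrite (H p h1 h2)// box_le1.
Qed.

Lemma nc_sqrD z w : nc (z + w) ^+ 2 <= 2 * (nc z ^+ 2 + nc w ^+ 2).
Proof.
rewrite (@le_trans _ _ ((nc z + nc w) ^+ 2))//.
  by rewrite ler_pXn2r ?nnegrE ?addr_ge0 ?nc_ge0// le_ncD.
by have := sqr_ge0 (nc z - nc w); nra.
Qed.

Lemma energyZ alpha c f fd : hol f fd ->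
  energy alpha (fun z => c * f z) = ((nc c ^+ 2)%:E * energy alpha f)%E.
Proof.
move=> fh; rewrite /energy -ge0_intZR ?sqr_ge0//; last 2 first.
- exact: measurable_dens (hol_ccont fh).
- by move=> p; exact: dens_ge0.
apply: eq_integral => p _; congr EFin; rewrite /dens /cut; case: ifP => _.
  by rewrite (_ : atp _ p = c * atp f p)// ncM exprMn -mulrA.
by rewrite mulr0.
Qed.

Lemma energyD alpha f fd g gd : hol f fd -> hol g gd ->
  (energy alpha (fun z => (f z + g z)%R) <= 2%:E * (energy alpha f + energy alpha g))%E.
Proof.
move=> fh gh; have cf := hol_ccont fh; have cg := hol_ccont gh.
have mf := measurable_dens alpha cf; have mg := measurable_dens alpha cg.
rewrite /energy -ge0_intDR//; [|exact: dens_ge0..].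
rewrite -ge0_intZR//; last 2 first.
- exact: measurable_funD.
- by move=> p; rewrite addr_ge0 ?dens_ge0.
apply: ge0_leR.
- by apply: measurable_dens => z z0; apply: ccontD; auto.
- by apply: measurable_funM; [exact: measurable_cst|exact: measurable_funD].
- by move=> p; exact: dens_ge0.
- move=> p; rewrite /dens /cut; case: ifP => _; last by rewrite addr0 mulr0.
  by rewrite -mulrDl mulrA ler_wpM2r ?powR_ge0// /atp nc_sqrD.
Qed.

End Energy.

(** * The weight near the real axis and translations of the plane *)

Section Translation.
Context {R : realType}.
Local Notation nc := (@ComplexField.Normc.normc R).
Local Notation mu := (@lebesgue_measure R).
Local Notation TR := (measurableTypeR R).
Local Notation M2 := (mu \x mu)%E.
Local Notation Re := (@complex.Re R).
Local Notation Im := (@complex.Im R).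
Implicit Types (p q : R * R) (x y e r a alpha : R) (z w u : R[i]) (f g : R[i] -> R[i]).

Lemma continuous_powR alpha x : 0 < x -> {for x, continuous (fun t => t `^ alpha)}.
Proof.
move=> x0; apply: differentiable_continuous; apply/derivable1_diffP.
by have [] := is_derive1_powR alpha x0.
Qed.

Lemma Rintegral_powR alpha (a b : R) : -1 < alpha -> 0 < a -> a <= b ->
  \int[mu]_(t in `[a, b]) t `^ alpha <= b `^ (alpha + 1) / (alpha + 1).
Proof.
move=> al a0 ab; have al0 : 0 < alpha + 1 by lra.
pose F : R -> R := (alpha + 1)^-1 \*: (fun t : R => t `^ (alpha + 1)).
rewrite (_ : \int[mu]_(t in `[a, b]) _ = F b - F a).
  rewrite /F /= -scalerBr [leRHS]mulrC -[_ *: _]/(_ * _) ler_wpM2l ?invr_ge0 ?(ltW al0)//.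
  by rewrite gerDl oppr_le0 powR_ge0.
apply: real_FTC => //.
- move=> x /andP[ax xb].
  have x0 : 0 < x by exact: lt_le_trans ax.
  have d1 := is_derive1_powR (alpha + 1) x0.
  apply: is_derive_eq.
  by rewrite addrK -[_ *: _]/(_ * _) mulrA mulVf ?mul1r// gt_eqF.
- by move=> x /andP[ax xb]; apply: continuous_powR; exact: lt_le_trans ax.
Qed.

(** Monotone convergence over [b / (n + 1), b], because the power may blow up at 0. *)
Lemma integral_powR_near0 alpha (b : R) : -1 < alpha -> 0 < b ->
  (\int[mu]_t (((0 < t) && (t <= b))%:R * t `^ alpha)%:E <=
    (b `^ (alpha + 1) / (alpha + 1))%:E)%E.
Proof.
move=> al b0; pose F (n : nat) : set TR := `[b / n.+1%:R, b]%classic.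
have mpow : measurable_fun [set: TR] ((fun t => (t `^ alpha)%:E) : TR -> \bar R).
  by apply/measurable_EFinP; exact: measurable_powR.
have le1 n : b / n.+1%:R <= b by rewrite ler_pdivrMr// ler_peMr ?(ltW b0)// ler1n.
have p0 n : 0 < b / n.+1%:R by rewrite divr_gt0.
have := @ge0_nondecreasing_set_cvg_integral _ TR R F (fun t => (t `^ alpha)%:E) mu.
move=> /(_ _ _ _ _)/wrap[].
- move=> n m nm; apply/subsetPset => t; rewrite /F /= !in_itv/= => /andP[t1 ->].
  rewrite andbT; apply: le_trans t1.
  by rewrite ler_pM2l// lef_pV2 ?posrE// ler_nat ltnS.
- by move=> n; exact: measurable_itv.
- by move=> n; exact: measurable_funTS.
- by move=> n t _; rewrite lee_fin powR_ge0.
move=> H.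
have -> : (\int[mu]_t (((0 < t) && (t <= b))%:R * t `^ alpha)%:E =
    \int[mu]_(t in \bigcup_n F n) (t `^ alpha)%:E)%E.
  rewrite [RHS]integral_mkcond; apply: eq_integral => t _.
  rewrite patchE; case: ifPn => [/set_mem[n _]|].
    rewrite /F /= in_itv/= => /andP[t1 ->]; rewrite (lt_le_trans (p0 n) t1)/=.
    by rewrite mul1r.
  rewrite notin_setE /= => tn; case: (boolP ((0 < t) && (t <= b))) => [/andP[t0 tb]|_]; rewrite ?mul0r//.
  exfalso; apply: tn; exists (Num.truncn (b / t)) => //.
  rewrite /F /= in_itv/= tb andbT ler_pdivrMr// mulrC -ler_pdivrMr//.
  by rewrite ltW// truncnS_gt.
apply: (cvge_le _ H); apply: nearW => n /=.
have cu x : b / n.+1%:R <= x <= b -> {for x, continuous (fun t => t `^ alpha)}.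
  by move=> /andP[h _]; apply: continuous_powR; exact: lt_le_trans h.
have ii : mu.-integrable `[b / n.+1%:R, b] (EFin \o (fun t => t `^ alpha)).
  apply: continuous_compact_integrable; first exact: segment_compact.
  exact: within_itv_cont.
have := Rintegral_powR al (p0 n) (le1 n); rewrite /Rintegral -lee_fin fineK//.
exact: integrable_fin_num.
Qed.

Lemma integral_window (s r : R) : 0 <= r ->
  (\int[mu]_t ((`|t - s| <= r)%R%:R)%:E <= (2 * r)%:E)%E.
Proof.
move=> r0.
have -> : (\int[mu]_t ((`|t - s| <= r)%R%:R)%:E = \int[mu]_(t in `[(s - r)%R, (s + r)%R]) 1%:E)%E.
  rewrite [RHS]integral_mkcond; apply: eq_integral => t _.
  rewrite patchE; have -> : (t \in `[s - r, s + r]%classic) = (`|t - s| <= r).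
    rewrite mem_setE in_itv/= ler_norml.
    by apply/idP/idP => /andP[? ?]; apply/andP; split; lra.
  by case: ifP.
rewrite integral_itv_EFin_cst; last by lra.
by rewrite lee_fin; lra.
Qed.

Lemma plane_shift (h : R * R -> R) (a b : R) :
  measurable_fun [set: (TR * TR)%type] h -> (forall p, 0 <= h p) ->
  (\int[M2]_p (h ((p.1 + a)%R, (p.2 + b)%R))%:E = \int[M2]_p (h p)%:E)%E.
Proof.
move=> mh h0.
have mH : measurable_fun [set: (TR * TR)%type] (EFin \o h) by exact/measurable_EFinP.
have H0 p : (0 <= (EFin \o h) p)%E by rewrite lee_fin.
have m1 : measurable_fun [set: (TR * TR)%type] (fun p => ((p.1 + a)%R, (p.2 + b)%R) : (TR * TR)%type).
  apply: measurable_fun_pair.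
    by apply: measurable_funD; [exact: measurable_fst|exact: measurable_cst].
  by apply: measurable_funD; [exact: measurable_snd|exact: measurable_cst].
rewrite (fubini_tonelli1 (m1 := mu) (m2 := mu)
  (fun p => (h ((p.1 + a)%R, (p.2 + b)%R))%:E)); last 2 first.
- exact: (measurableT_comp mH m1).
- by move=> p; rewrite lee_fin.
rewrite (fubini_tonelli1 (m1 := mu) (m2 := mu) (EFin \o h))//.
have msec x : measurable_fun [set: TR] (fun y => (h (x, y))%:E).
  exact: (measurableT_comp mH (measurable_pair1 x)).
pose V x := (\int[mu]_y (h (x, y))%:E)%E.
transitivity (\int[mu]_x V (x + a)%R)%E.
  apply: eq_integral => x _.
  by apply: (@ge0_integral_shift R b (fun y => (h ((x + a)%R, y))%:E)) => // y; rewrite lee_fin.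
apply: (@ge0_integral_shift R a V).
  exact: (measurable_fun_fubini_tonelli_F (m2 := mu) (EFin \o h)).
by move=> x; apply: ge0_intR_ge0.
Qed.

End Translation.

(** * Translations are uniformly bounded for the energy *)

Section TranslationBound.
Context {R : realType}.
Local Notation nc := (@ComplexField.Normc.normc R).
Local Notation mu := (@lebesgue_measure R).
Local Notation TR := (measurableTypeR R).
Local Notation T2 := (TR * TR)%type.
Local Notation M2 := (mu \x mu)%E.
Local Notation Re := (@complex.Re R).
Local Notation Im := (@complex.Im R).
Implicit Types (p q : R * R) (c x y e r a alpha : R) (z w u : R[i]) (f g : R[i] -> R[i]).

Lemma plane_sigma_finite : sigma_finite [set: (TR * TR)%type] (mu \x mu)%E.
Proof.
pose I n : set TR := [set` `]- n%:R, n%:R[%R].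
have mI n : measurable (I n) by exact: measurable_itv.
have lI n : mu (I n) \is a fin_num.
  by rewrite [mu _]lebesgue_measure_itv/=; case: ifP.
exists (fun n => I n `*` I n).
  apply/seteqP; split => // -[x y] _.
  exists (Num.bound (`|x| + `|y|)) => //=.
  have := archi_boundP (addr_ge0 (normr_ge0 x) (normr_ge0 y)).
  move=> h; rewrite /I /= !in_itv /= -!ltr_norml; split.
    by apply: le_lt_trans h; rewrite lerDl.
  by apply: le_lt_trans h; rewrite lerDr.
move=> n; split; first exact: measurableX.
rewrite (product_measure1E mu mu)// ltey_eq fin_numM//; exact: lI.
Qed.
(* The product of two sigma-finite measures is not recognized as such by the
   canonical structures of the library. *)
Definition plane_measure : {sigma_finite_measure set (TR * TR)%type -> \bar R} :=
  HB.pack (mu \x mu)%E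
    (Measure_isSigmaFinite.Build _ _ _ (mu \x mu)%E plane_sigma_finite).

Lemma hol_shift f fd u : hol f fd -> 0 <= Im u ->
  hol (fun z => f (z + u)) (fun z => fd (z + u)).
Proof.
move=> fh u0 z z0; apply: cdiff_shift; apply: fh.
by rewrite ImD ltr_pwDl.
Qed.

Lemma atp_shift f u p : atp (fun z => f (z + u)) p = atp f (p.1 + Re u, p.2 + Im u).
Proof. by rewrite /atp; congr f; case: u. Qed.

Definition strip b (t : R) : R := ((0 < t) && (t <= b))%:R.

Lemma measurable_strip b : measurable_fun [set: TR] (strip b : TR -> TR).
Proof.
apply: measurable_nat_bool; apply: measurable_and.
  by apply: measurable_fun_ltr => //; exact: measurable_cst.
by apply: measurable_fun_ler => //; exact: measurable_cst.
Qed.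

Definition strip_weight alpha b (t : R) : R := strip b t * t `^ alpha.

Definition window c r (t : R) : R := (`|t - c| <= r)%R%:R.

Lemma strip_weight_ge0 alpha b t : 0 <= strip_weight alpha b t.
Proof. by apply: mulr_ge0; [exact: ler0n|exact: powR_ge0]. Qed.

Lemma measurable_strip_weight alpha b :
  measurable_fun [set: TR] (strip_weight alpha b : TR -> TR).
Proof. by apply: measurable_funM; [exact: measurable_strip|exact: measurable_powR]. Qed.

Lemma measurable_window c r : measurable_fun [set: TR] (window c r : TR -> TR).
Proof.
apply: measurable_nat_bool; apply: measurable_fun_ler; last exact: measurable_cst.
apply: (measurableT_comp (@normr_measurable R setT)).
by apply: measurable_funB => //; exact: measurable_cst.
Qed.

Lemma measurable_strip_window alpha b c r : measurable_fun [set: T2]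
  (fun p : R * R => strip_weight alpha b p.2 * window c r p.1).
Proof.
apply: measurable_funM.
  exact: (measurableT_comp (measurable_strip_weight alpha b) measurable_snd).
exact: (measurableT_comp (measurable_window c r) measurable_fst).
Qed.

Lemma strip_window alpha b c : -1 < alpha -> 0 < b ->
  (\int[M2]_p (strip_weight alpha b p.2 * window c (b / 2)%R p.1)%:E <=
    (b * (b `^ (alpha + 1) / (alpha + 1)))%:E)%E.
Proof.
move=> al b0; have b20 : 0 < b / 2 by rewrite divr_gt0.
have ww0 (p : R * R) : (0 <= (strip_weight alpha b p.2 * window c (b / 2)%R p.1)%:E)%E.
  by rewrite lee_fin; apply: mulr_ge0; [exact: strip_weight_ge0|exact: ler0n].
have mww : measurable_fun [set: T2]
    (fun p : R * R => (strip_weight alpha b p.2 * window c (b / 2)%R p.1)%:E).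
  by apply/measurable_EFinP; exact: measurable_strip_window.
rewrite (fubini_tonelli2 (m1 := mu) (m2 := mu) (fun p : R * R =>
  (strip_weight alpha b p.2 * window c (b / 2)%R p.1)%:E) mww ww0).
apply: (@le_trans _ _ (\int[mu]_y (b * strip_weight alpha b y)%:E)%E).
  apply: ge0_le_integral => //.
  - by move=> y _; apply: integral_ge0 => x _; exact: (ww0 (x, y)).
  - exact: (measurable_fun_fubini_tonelli_G (m1 := mu) _ mww ww0).
  - apply/measurable_EFinP; apply: measurable_funM; first exact: measurable_cst.
    exact: measurable_strip_weight.
  - move=> y _; rewrite /fubini_G /= (ge0_intZR mu (u := window c (b / 2))).
    + rewrite [(b * strip_weight alpha b y)%R]mulrC (EFinM (strip_weight alpha b y) b); apply: lee_wpmul2l; first by rewrite lee_fin strip_weight_ge0.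
      apply: (le_trans (integral_window c (ltW b20))); rewrite lee_fin le_eqVlt; apply/orP; left.
      by apply/eqP; field.
    + exact: measurable_window.
    + by move=> t; exact: ler0n.
    + exact: strip_weight_ge0.
rewrite (ge0_intZR mu (u := strip_weight alpha b)).
- rewrite EFinM; apply: lee_wpmul2l; first by rewrite lee_fin ltW.
  exact: integral_powR_near0.
- exact: measurable_strip_weight.
- by move=> t; exact: strip_weight_ge0.
- exact: ltW.
Qed.

Lemma window_le alpha (b : R) a p q (g : R) : 0 <= g -> 0 < b ->
  strip_weight alpha b p.2 * (box (p.1 + a) (p.2 + b) (b / 2) q * g) <=
  ((b / 2 <= q.2) && (q.2 <= 5 * b / 2))%R%:R * g *
    (strip_weight alpha b p.2 * window (q.1 - a) (b / 2) p.1).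
Proof.
move=> g0 b0; rewrite [leRHS]mulrCA.
have [->|wp] := eqVneq (strip_weight alpha b p.2) 0; first by rewrite !mul0r.
apply: ler_wpM2l; first exact: strip_weight_ge0.
rewrite [leRHS]mulrAC; apply: ler_wpM2r => //.
have [->|/box_boundsP[/andP[h1 h2] /andP[h3 h4]]] :=
    eqVneq (box (p.1 + a) (p.2 + b) (b / 2) q) 0.
  by apply: mulr_ge0; exact: ler0n.
have /andP[p0 pb] : (0 < p.2) && (p.2 <= b).
  by move: wp; rewrite /strip_weight /strip; case: (_ && _) => //; rewrite mul0r eqxx.
apply: (le_trans (box_le1 _ _ _ _)).
have e1 : b / 2 <= q.2 by lra.
have e2 : q.2 <= 5 * b / 2 by lra.
have e3 : `|p.1 - (q.1 - a)| <= b / 2 by rewrite ler_norml; apply/andP; split; lra.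
by rewrite /window e1 e2 e3 /= mulr1.
Qed.

Lemma near_dens alpha f b q : 0 < b ->
  ((b / 2 <= q.2) && (q.2 <= 5 * b / 2))%R%:R *
    cut (fun p => nc (atp (fun z => f z ^+ 2) p)) q <=
  3 `^ `|alpha| * b `^ (- alpha) * dens alpha f q.
Proof.
move=> b0; case: (boolP ((b / 2 <= q.2) && (q.2 <= 5 * b / 2))) => [/andP[h1 h2]|_]; last first.
  by rewrite mul0r; apply: mulr_ge0; [apply: mulr_ge0; exact: powR_ge0|exact: dens_ge0].
have q0 : 0 < q.2 by apply: lt_le_trans h1; rewrite divr_gt0.
rewrite mul1r /dens /cut q0 (_ : atp _ q = atp f q ^+ 2)// ncX.
rewrite [leRHS]mulrCA -[leLHS]mulr1; apply: ler_wpM2l; first exact: sqr_ge0.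
rewrite powRN mulrAC ler_pdivlMr ?powR_gt0// mul1r.
by apply: powR_comp => //; [rewrite ler1n|apply/andP; split; lra].
Qed.

Lemma integral_dens alpha f c : (forall z, 0 < Im z -> ccont f z) -> 0 <= c ->
  (\int[M2]_p (c * dens alpha f p)%:E = c%:E * energy alpha f)%E.
Proof.
move=> cf c0; apply: ge0_intZR => //; first exact: measurable_dens.
by move=> p; exact: dens_ge0.
Qed.

(** At heights at most b = Im u, |f(z + u)|^2 is at most an area mean of |f|^2 over a square of
    half-side b/2 that stays above height b/2. By Fubini, for fixed q in that square the points z
    fill a window of width b in a strip of height b, of weighted area at most b^(alpha + 2) / (alpha
    + 1). All powers of b cancel, so the constant does not depend on u. *)
Lemma near_bound alpha f fd u : -1 < alpha -> hol f fd -> 0 < Im u ->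
  (\int[M2]_p (strip (Im u) p.2 *
      (p.2 `^ alpha * cut (fun p => nc (atp (fun z => f (z + u)) p)) p ^+ 2))%:E <=
    (128 * 3 `^ `|alpha| / (alpha + 1))%:E * energy alpha f)%E.
Proof.
move=> al fh b0; set b := Im u; set a := Re u.
have al0 : 0 < alpha + 1 by lra.
have cf := hol_ccont fh.
have cfs := hol_ccont (hol_shift fh (ltW b0)).
pose G q : R := cut (fun p => nc (atp (fun z => f z ^+ 2) p)) q.
have G0 q : 0 <= G q by rewrite /G /cut; case: ifP => // _; exact: nc_ge0.
have mG : measurable_fun [set: T2] G by exact: measurable_hol_nc (hol_ccont (hol_sqr fh)).
have m11 : measurable_fun [set: (T2 * T2)%type] (fun z : T2 * T2 => z.1.1 : TR).
  exact: (measurableT_comp measurable_fst measurable_fst).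
have m12 : measurable_fun [set: (T2 * T2)%type] (fun z : T2 * T2 => z.1.2 : TR).
  exact: (measurableT_comp measurable_snd measurable_fst).
have m21 : measurable_fun [set: (T2 * T2)%type] (fun z : T2 * T2 => z.2.1 : TR).
  exact: (measurableT_comp measurable_fst measurable_snd).
have m22 : measurable_fun [set: (T2 * T2)%type] (fun z : T2 * T2 => z.2.2 : TR).
  exact: (measurableT_comp measurable_snd measurable_snd).
have mpow : measurable_fun [set: TR] ((fun t => t `^ alpha) : TR -> TR).
  exact: measurable_powR.
pose wgt := strip_weight alpha b.
have wgt0 t : 0 <= wgt t by exact: strip_weight_ge0.
have mwgt : measurable_fun [set: TR] (wgt : TR -> TR).
  exact: measurable_strip_weight.
pose k (z : (R * R) * (R * R)) : R :=
  wgt z.1.2 * (box (z.1.1 + a) (z.1.2 + b) (b / 2) z.2 * G z.2).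
have k0 zz : 0 <= k zz.
  by apply: mulr_ge0 => //; apply: mulr_ge0 => //; exact: box_ge0.
have mk : measurable_fun [set: (T2 * T2)%type] k.
  apply: measurable_funM; first exact: (measurableT_comp mwgt m12).
  apply: measurable_funM; last exact: (measurableT_comp mG measurable_snd).
  apply: measurable_nat_bool; apply: measurable_and; apply: measurable_fun_ler;
    try exact: measurable_cst.
    apply: (measurableT_comp (@normr_measurable R setT)).
    apply: measurable_funB => //.
    by apply: measurable_funD => //; exact: measurable_cst.
  apply: (measurableT_comp (@normr_measurable R setT)).
  apply: measurable_funB => //.
  by apply: measurable_funD => //; exact: measurable_cst.
have mk1 p : measurable_fun [set: T2] (fun q => k (p, q)).
  exact: (measurableT_comp mk (measurable_pair1 p)).
have mk2 q : measurable_fun [set: T2] (fun p => k (p, q)).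
  exact: (measurableT_comp mk (measurable_pair2 q)).
pose near p : R := strip b p.2 *
  (p.2 `^ alpha * cut (fun p => nc (atp (fun z => f (z + u)) p)) p ^+ 2).
have near0 p : 0 <= near p.
  by apply: mulr_ge0; [exact: ler0n|apply: mulr_ge0; [exact: powR_ge0|exact: sqr_ge0]].
have b20 : 0 < b / 2 by rewrite divr_gt0.
have c1 : 0 <= 32 / (b / 2) ^+ 2 by rewrite divr_ge0// exprn_ge0// ltW.
have mnear : measurable_fun [set: T2] near.
  apply: measurable_funM; first exact: (measurableT_comp (measurable_strip b) measurable_snd).
  apply: measurable_funM; first exact: measurable_snd_powR.
  by apply: measurable_funX; exact: measurable_hol_nc.
have step1 p : ((near p)%:E <= (32 / (b / 2) ^+ 2)%:E * \int[M2]_q (k (p, q))%:E)%E.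
  rewrite /near /strip; case: (boolP ((0 < p.2) && (p.2 <= b))) => [/andP[p0 pb]|_]; last first.
    by rewrite mul0r; apply: mule_ge0; [rewrite lee_fin|exact: ge0_intR_ge0].
  have ry : b / 2 < p.2 + b by move: b0; rewrite -/b => ?; lra.
  have A := area_mean (p.1 + a) (hol_sqr fh) b20 ry.
  rewrite mul1r /cut p0 atp_shift.
  have -> : (\int[M2]_q (k (p, q))%:E = (p.2 `^ alpha)%:E *
      \int[M2]_q (box (p.1 + a)%R (p.2 + b)%R (b / 2)%R q * G q)%:E)%E.
    rewrite -ge0_intZR ?powR_ge0//.
    - by apply: eq_integral => q _; rewrite /k /wgt /strip_weight /strip /= p0 pb mul1r.
    - by apply: measurable_funM => //; exact: measurable_box.
    - by move=> q; rewrite mulr_ge0 ?box_ge0.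
  rewrite muleCA EFinM; apply: lee_wpmul2l; first by rewrite lee_fin powR_ge0.
  by rewrite -ncX.
have mek : measurable_fun [set: (T2 * T2)%type] (EFin \o k) by exact/measurable_EFinP.
have ek0 zz : (0 <= (EFin \o k) zz)%E by rewrite lee_fin.
pose K1 p : \bar R := (\int[M2]_q (k (p, q))%:E)%E.
have mK1 : measurable_fun [set: T2] K1.
  exact: (measurable_fun_fubini_tonelli_F (m2 := plane_measure) (EFin \o k) mek ek0).
have K10 p : (0 <= K1 p)%E by exact: ge0_intR_ge0.
have step2 : (\int[M2]_p (near p)%:E <= (32 / (b / 2) ^+ 2)%:E * \int[M2]_p K1 p)%E.
  rewrite -ge0_integralZl ?lee_fin//.
  apply: ge0_le_integral => //.
  - by move=> p _; rewrite lee_fin.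
  - exact/measurable_EFinP.
  - exact: measurable_funeM.
have step3 : (\int[M2]_p K1 p = \int[M2]_q \int[M2]_p (k (p, q))%:E)%E.
  exact: (fubini_tonelli (m1 := plane_measure) (m2 := plane_measure) (EFin \o k) mek ek0).
pose W : R := b `^ (alpha + 1) / (alpha + 1).
have W0 : 0 <= W by apply: divr_ge0; [exact: powR_ge0|exact: ltW].
pose ind q : R := ((b / 2 <= q.2) && (q.2 <= 5 * b / 2))%R%:R.
have mind : measurable_fun [set: T2] ind.
  apply: measurable_nat_bool; apply: measurable_and; apply: measurable_fun_ler => //;
    exact: measurable_cst.
have Gi0 q : 0 <= ind q * G q by rewrite mulr_ge0 ?ler0n.
have mGi : measurable_fun [set: T2] (fun q => ind q * G q) by exact: measurable_funM.
(* Inner integral over the points p whose translated square contains [q]. *)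
have step4 q : (\int[M2]_p (k (p, q))%:E <= (b * W * (ind q * G q))%:E)%E.
  apply: (@le_trans _ _ (\int[M2]_p (ind q * G q * (wgt p.2 * window (q.1 - a)%R (b / 2)%R p.1))%:E)%E).
    apply: ge0_leR.
    - exact: mk2.
    - apply: measurable_funM; [exact: measurable_cst|exact: measurable_strip_window].
    - by move=> p; exact: k0.
    move=> p; exact: window_le.
  rewrite (ge0_intZR M2 (u := fun p : R * R => wgt p.2 * window (q.1 - a)%R (b / 2)%R p.1)).
  - by rewrite [(b * W * _)%R]mulrC (EFinM (ind q * G q)%R (b * W)%R); apply: lee_wpmul2l; [rewrite lee_fin|exact: strip_window].
  - exact: measurable_strip_window.
  - by move=> p; apply: mulr_ge0; [exact: wgt0|exact: ler0n].
  - exact: Gi0.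
have step5 q : ind q * G q <= 3 `^ `|alpha| * b `^ (- alpha) * dens alpha f q.
  exact: near_dens.
rewrite step3 in step2; apply: (le_trans step2).
apply: (@le_trans _ _ ((32 / (b / 2) ^+ 2)%:E * ((b * W)%:E *
  ((3 `^ `|alpha| * b `^ (- alpha))%:E * energy alpha f)))%E).
  apply: lee_wpmul2l; first by rewrite lee_fin.
  have c0 : 0 <= 3 `^ `|alpha| * b `^ (- alpha) by apply: mulr_ge0; exact: powR_ge0.
  rewrite -(integral_dens alpha cf c0).
  have d0 q : 0 <= 3 `^ `|alpha| * b `^ (- alpha) * dens alpha f q.
    by apply: mulr_ge0 => //; exact: dens_ge0.
  have md : measurable_fun [set: T2] (fun q => 3 `^ `|alpha| * b `^ (- alpha) * dens alpha f q).
    by apply: measurable_funM; [exact: measurable_cst|exact: measurable_dens].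
  have bW0 : 0 <= b * W by apply: mulr_ge0 => //; exact: ltW.
  rewrite -(ge0_intZR M2 md d0 bW0).
  apply: ge0_le_integral.
  - exact: measurableT.
  - by move=> q _; apply: ge0_intR_ge0 => p; exact: k0.
  - exact: (measurable_fun_fubini_tonelli_G (m1 := plane_measure) (EFin \o k) mek ek0).
  - apply/measurable_EFinP; apply: measurable_funM; first exact: measurable_cst.
    exact: md.
  - move=> q _; apply: (le_trans (step4 q)); rewrite lee_fin; apply: ler_wpM2l => //.
rewrite !muleA -!EFinM; apply: lee_wpmul2r; first exact: energy_ge0.
rewrite lee_fin le_eqVlt; apply/orP; left; apply/eqP.
have b0' : 0 < b by exact: b0.
rewrite /W powRN powRD ?powRr1 ?(ltW b0')//; last by rewrite (gt_eqF b0') implybT.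
by field; rewrite (gt_eqF b0') (gt_eqF al0) gt_eqF// powR_gt0.
Qed.

Definition shift_cst alpha : R :=
  2 `^ `|alpha| + 128 * 3 `^ `|alpha| / (alpha + 1).

Lemma shift_cst_ge0 alpha : -1 < alpha -> 0 <= shift_cst alpha.
Proof.
move=> al; have al0 : 0 < alpha + 1 by lra.
by rewrite addr_ge0 ?powR_ge0// divr_ge0 ?mulr_ge0 ?powR_ge0// ltW.
Qed.

(** The half-plane is split at height Im u: above it the weight at z is comparable to the weight at
    z + u, and a change of variables suffices; below it [near_bound] applies. *)
Lemma energy_shift alpha f fd u : -1 < alpha -> hol f fd -> 0 <= Im u ->
  (energy alpha (fun z => f (z + u)%R) <= (shift_cst alpha)%:E * energy alpha f)%E.
Proof.
move=> al fh b0; set b := Im u; set a := Re u.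
have al0 : 0 < alpha + 1 by lra.
have cf := hol_ccont fh.
have cfs := hol_ccont (hol_shift fh b0).
pose near p : R := strip b p.2 *
  (p.2 `^ alpha * cut (fun p => nc (atp (fun z => f (z + u)) p)) p ^+ 2).
pose far p : R := 2 `^ `|alpha| * dens alpha f (p.1 + a, p.2 + b).
have near0 p : 0 <= near p.
  by apply: mulr_ge0; [exact: ler0n|apply: mulr_ge0; [exact: powR_ge0|exact: sqr_ge0]].
have far0 p : 0 <= far p by rewrite mulr_ge0 ?powR_ge0 ?dens_ge0.
have mnear : measurable_fun [set: T2] near.
  apply: measurable_funM; first exact: (measurableT_comp (measurable_strip b) measurable_snd).
  apply: measurable_funM; first exact: measurable_snd_powR.
  by apply: measurable_funX; exact: measurable_hol_nc.
have md := measurable_dens alpha cf.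
have msh : measurable_fun [set: T2] (fun p : R * R => (p.1 + a, p.2 + b) : T2).
  apply: measurable_fun_pair.
    by apply: measurable_funD; [exact: measurable_fst|exact: measurable_cst].
  by apply: measurable_funD; [exact: measurable_snd|exact: measurable_cst].
have mds : measurable_fun [set: T2] (fun p => dens alpha f (p.1 + a, p.2 + b)).
  exact: (measurableT_comp md msh).
have mfar : measurable_fun [set: T2] far.
  by apply: measurable_funM => //; exact: measurable_cst.
apply: (@le_trans _ _ (\int[M2]_p (far p + near p)%:E)%E).
  apply: ge0_leR.
  - exact: measurable_dens.
  - exact: measurable_funD.
  - by move=> p; exact: dens_ge0.
  move=> p; rewrite {1}/dens /cut; case: ifPn => p0; last exact: addr_ge0.
  (* Above height b one has p.2 <= p.2 + b <= 2 p.2, whence the constant 2^|alpha|. *)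
  have [pb|pb] := leP p.2 b.
    apply: ler_wpDl => //.
    by rewrite /near /strip p0 pb mul1r /cut p0 mulrC.
  apply: ler_wpDr => //; rewrite /far /dens /cut /=.
  have pb0 : 0 < p.2 + b by rewrite ltr_pwDl.
  rewrite pb0 atp_shift -/a -/b [leRHS]mulrCA ler_wpM2l ?sqr_ge0//.
  by apply: powR_comp => //; [rewrite ler1n|apply/andP; split; lra].
rewrite ge0_intDR// /shift_cst EFinD ge0_muleDl ?lee_fin ?powR_ge0//; last first.
  by rewrite divr_ge0 ?mulr_ge0 ?powR_ge0// ltW.
apply: leeD.
  rewrite ge0_intZR ?powR_ge0//; last by move=> p; exact: dens_ge0.
  by rewrite (plane_shift a b md (dens_ge0 alpha f)).
(* For Im u = 0 the strip below height Im u is empty. *)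
move: b0; rewrite le_eqVlt => /predU1P[bE|b0]; last exact: (near_bound al fh b0).
rewrite (_ : (\int[M2]_p _ = 0)%E).
  apply: mule_ge0; last exact: energy_ge0.
  by rewrite lee_fin divr_ge0 ?mulr_ge0 ?powR_ge0// ltW.
apply: integral0_eq => p _; rewrite /near /strip /b -bE.
by rewrite ltNge; case: (_ <= _); rewrite mul0r.
Qed.

End TranslationBound.

(** * From functions on the half-plane to functions on the complex numbers *)

Section Bridge.
Context {R : realType}.
Local Notation nc := (@ComplexField.Normc.normc R).
Local Notation mu := (@lebesgue_measure R).
Local Notation TR := (measurableTypeR R).
Local Notation T2 := (TR * TR)%type.
Local Notation M2 := (mu \x mu)%E.
Local Notation Re := (@complex.Re R).
Local Notation Im := (@complex.Im R).
Implicit Types (p q : R * R) (c x y e r a alpha : R) (z w u l : R[i]) (f g fd gd : R[i] -> R[i]).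
Implicit Types (F G : half_plane R -> R[i]^o).

Definition vdecay f := forall x e, 0 < e ->
  exists Y, forall y, Y <= y -> nc (f (x +i* y)) <= e.

(** The working form of membership in the space: functions on all of [R[i]], with their derivative
    as data, of which only the values on the half-plane matter ([indir_eq]). *)
Definition indir alpha f fd :=
  [/\ hol f fd, (energy alpha fd < +oo)%E & vdecay f].

Definition restr f : half_plane R -> R[i]^o := fun w : half_plane R => f (val w).

Lemma ext0_val F (w : half_plane R) : ext0 F (val w) = F w.
Proof. by rewrite /ext0 valK. Qed.

Lemma ext0_in F z (h : 0 < Im z) : ext0 F z = F (exist _ z h).
Proof. exact: (ext0_val F (exist _ z h)). Qed.

Lemma ext0_restr f z : 0 < Im z -> ext0 (restr f) z = f z.
Proof. by move=> h; rewrite (ext0_in (restr f) h). Qed.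

Lemma restr_ext0 F : restr (ext0 F) = F.
Proof. by apply/funext => w; exact: ext0_val. Qed.

Lemma upper_nbhd z : 0 < Im z ->
  exists2 r, 0 < r & forall w, nc (w - z) < r -> 0 < Im w.
Proof.
move=> z0; exists (Im z) => // w h.
have := le_lt_trans (Im_le_nc _) h; rewrite ImD ImN ltr_norml => /andP[+ _]; lra.
Qed.

Lemma hol_restr f fd : hol f fd -> hol (ext0 (restr f)) fd.
Proof.
move=> fh z z0; apply: cdiff_ext (fh z z0) _.
have [r r0 rh] := upper_nbhd z0; exists r => // w /rh wi.
by rewrite ext0_restr.
Qed.

Lemma hol_cderiv F fd : hol (ext0 F) fd -> forall z, 0 < Im z -> cderiv F z = fd z.
Proof.
move=> fh z z0; have /is_derive_cdiff dF := fh z z0.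
exact: (@derive_val _ _ _ _ _ _ _ dF).
Qed.

Lemma analytic_hol F : analytic F <-> hol (ext0 F) (cderiv F).
Proof.
split=> [aF z z0|aF w].
  apply/is_derive_cdiff; apply: derivableP.
  exact: (aF (exist _ z z0)).
have /is_derive_cdiff[] // := aF (val w) (valP w).
Qed.

Lemma dirichlet_energy alpha F : dirichlet_integral alpha F = energy alpha (cderiv F).
Proof.
rewrite /dirichlet_integral integral_mkcond; apply: eq_integral => p _.
rewrite /dens /cut /atp /patch; case: ifPn => [|]; rewrite ?in_setE ?notin_setE /=.
  by move=> ->.
by move=> /negP/negbTE ->.
Qed.

Lemma cvg_vdecay f x :
  (f (x +i* y) : R[i]^o) @[y --> +oo%R] --> (0 : R[i]^o) <->
  forall e, 0 < e -> exists Y, forall y, Y <= y -> nc (f (x +i* y)) <= e.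
Proof.
split=> [/cvgrPdist_lt H e e0|H].
  have /H : 0 < e%:C :> R[i] by rewrite ltcR.
  move=> [Y [_ HY]]; exists (Y + 1) => y Yy.
  have : Y < y by lra.
  move=> /HY; rewrite sub0r normrN => h.
  by move: h; rewrite ltcR => /ltW.
apply/cvgrPdist_le => e e0.
have eR : e = (Re e)%:C by move: e0; case: e => a b; rewrite ltcE/= => /andP[/eqP -> _].
have e0' : 0 < Re e by move: e0; rewrite eR ltcR.
have [Y HY] := H _ e0'; exists Y; split; first exact: num_real.
move=> y /ltW /HY h; rewrite sub0r normrN eR.
by rewrite lecR.
Qed.

Lemma dirichlet_indir alpha F :
  dirichlet_space alpha F <-> indir alpha (ext0 F) (cderiv F).
Proof.
split=> [[/analytic_hol aF iF dF]|[aF iF dF]]; split=> //.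
- by rewrite -dirichlet_energy.
- by move=> x; apply/cvg_vdecay; exact: dF.
- exact/analytic_hol.
- by rewrite dirichlet_energy.
- by move=> x; apply/cvg_vdecay; exact: dF.
Qed.

Lemma indir_restr alpha f fd : indir alpha f fd ->
  dirichlet_space alpha (restr f) /\ dirichlet_integral alpha (restr f) = energy alpha fd.
Proof.
move=> [fh fE fv]; have hr := hol_restr fh.
have dE : energy alpha (cderiv (restr f)) = energy alpha fd.
  by apply: eq_energy => z z0; exact: hol_cderiv hr _ z0.
rewrite dirichlet_energy; split=> //; apply/dirichlet_indir; split.
- by move=> z z0; rewrite (hol_cderiv hr z0); exact: hr.
- by rewrite dE.
(* The maximum with 1 keeps the point in the half-plane, where the extension agrees with [f]. *)
- move=> x e e0; have [Y HY] := fv x e e0; exists (Num.max Y 1) => y.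
  rewrite ge_max => /andP[Yy y1]; rewrite ext0_restr ?HY//=.
  exact: lt_le_trans y1.
Qed.

Lemma indir_dirichlet alpha f fd F : indir alpha f fd ->
  (forall w : half_plane R, F w = f (val w)) ->
  dirichlet_space alpha F /\ dirichlet_norm alpha F = Num.sqrt (fine (energy alpha fd)).
Proof.
move=> /indir_restr[DF IF] Ff.
have -> : F = restr f by apply/funext => w; rewrite Ff.
by rewrite /dirichlet_norm IF.
Qed.

Lemma holD f fd g gd : hol f fd -> hol g gd ->
  hol (fun z => f z + g z) (fun z => fd z + gd z).
Proof. by move=> hf hg z z0; apply: cdiffD; [exact: hf|exact: hg]. Qed.

Lemma holZ f fd l : hol f fd -> hol (fun z => l * f z) (fun z => l * fd z).
Proof. by move=> hf z z0; apply: cdiff_cstM; exact: hf. Qed.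

Lemma vdecayD f g : vdecay f -> vdecay g -> vdecay (fun z => f z + g z).
Proof.
move=> hf hg x e e0; have e20 : 0 < e / 2 by rewrite divr_gt0.
have [Y HY] := hf x _ e20; have [Z HZ] := hg x _ e20.
exists (Num.max Y Z) => y; rewrite ge_max => /andP[/HY h1 /HZ h2].
by apply: (le_trans (le_ncD _ _)); lra.
Qed.

Lemma vdecayZ l f : vdecay f -> vdecay (fun z => l * f z).
Proof.
move=> hf x e e0; have l0 : 0 < nc l + 1 by rewrite ltr_wpDl ?nc_ge0.
have [Y HY] := hf x (e / (nc l + 1)) (divr_gt0 e0 l0).
exists Y => y /HY h; rewrite ncM.
rewrite ler_pdivlMr// in h; rewrite mulrC (le_trans _ h)// ler_wpM2l ?nc_ge0//.
by rewrite lerDl.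
Qed.

Lemma indirD alpha f fd g gd : indir alpha f fd -> indir alpha g gd ->
  indir alpha (fun z => f z + g z) (fun z => fd z + gd z).
Proof.
move=> [hf ef vf] [hg eg vg]; split; [exact: holD| |exact: vdecayD].
have [[fdd hfd] [gdd hgd]] := (hol_deriv hf, hol_deriv hg).
apply: (le_lt_trans (energyD alpha hfd hgd)).
by rewrite lte_mul_pinfty ?lee_fin// lte_add_pinfty.
Qed.

Lemma indirZ alpha f fd l : indir alpha f fd ->
  indir alpha (fun z => l * f z) (fun z => l * fd z).
Proof.
move=> [hf ef vf]; split; [exact: holZ| |exact: vdecayZ].
have [fdd hfd] := hol_deriv hf.
by rewrite (energyZ alpha l hfd) lte_mul_pinfty ?lee_fin ?sqr_ge0.
Qed.

Lemma indir_eq alpha f fd g gd : indir alpha f fd ->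
  (forall z, 0 < Im z -> f z = g z) -> (forall z, 0 < Im z -> fd z = gd z) ->
  indir alpha g gd.
Proof.
move=> [hf ef vf] fg fgd; split.
- move=> z z0; rewrite -fgd//; apply: cdiff_ext (hf z z0) _.
  have [r r0 rh] := upper_nbhd z0; exists r => // w /rh; exact: fg.
- by rewrite -(eq_energy alpha fgd).
- move=> x e e0; have [Y HY] := vf x e e0; exists (Num.max Y 1) => y.
  rewrite ge_max => /andP[Yy y1]; rewrite -fg ?HY//=.
  exact: lt_le_trans y1.
Qed.

Lemma ext0_lin l F G z : 0 < Im z ->
  ext0 (l *: F + G) z = l * ext0 F z + ext0 G z.
Proof. by move=> h; rewrite !(ext0_in _ h). Qed.

Lemma dirichlet_lin alpha l F G : dirichlet_space alpha F -> dirichlet_space alpha G ->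
  dirichlet_space alpha (l *: F + G).
Proof.
move=> /dirichlet_indir hF /dirichlet_indir hG.
apply: (indir_dirichlet (indirD (indirZ l hF) hG) _).1 => w.
rewrite -(ext0_val (l *: F + G) w); by apply: ext0_lin; case: w.
Qed.

End Bridge.

(** * Averages of translates: measurability, integrability and growth *)

Section Convolution.
Context {R : realType}.
Local Notation nc := (@ComplexField.Normc.normc R).
Local Notation mu := (@lebesgue_measure R).
Local Notation TR := (measurableTypeR R).
Local Notation T2 := (TR * TR)%type.
Local Notation M2 := (mu \x mu)%E.
Local Notation Re := (@complex.Re R).
Local Notation Im := (@complex.Im R).
Implicit Types (p q : R * R) (c x y e r a s t alpha : R) (z w l u : R[i]) (f g fd gd : R[i] -> R[i]).
Implicit Types (h sg k : R -> R[i]) (kap : R -> R).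

Definition cmeas h :=
  measurable_fun [set: TR] (Re \o h) /\ measurable_fun [set: TR] (Im \o h).

Lemma cmeas_cst l : cmeas (fun=> l).
Proof. by split; exact: measurable_cst. Qed.

Lemma cmeasD h k : cmeas h -> cmeas k -> cmeas (fun s => h s + k s).
Proof.
move=> [mr mi] [nr ni]; split.
  by apply: (eq_measurable_fun (fun s => Re (h s) + Re (k s))) => [s _|];
    [rewrite /= ReD|exact: measurable_funD].
by apply: (eq_measurable_fun (fun s => Im (h s) + Im (k s))) => [s _|];
  [rewrite /= ImD|exact: measurable_funD].
Qed.

Lemma cmeasM h k : cmeas h -> cmeas k -> cmeas (fun s => h s * k s).
Proof.
move=> [mr mi] [nr ni]; split.
  apply: (eq_measurable_fun (fun s => Re (h s) * Re (k s) - Im (h s) * Im (k s))) => [s _|].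
    by rewrite /= ReM.
  by apply: measurable_funB; exact: measurable_funM.
apply: (eq_measurable_fun (fun s => Re (h s) * Im (k s) + Im (h s) * Re (k s))) => [s _|].
  by rewrite /= ImM.
by apply: measurable_funD; exact: measurable_funM.
Qed.

Lemma cmeas_comp f h : (forall z, 0 < Im z -> ccont f z) -> cmeas h ->
  (forall s, 0 < Im (h s)) -> cmeas (fun s => f (h s)).
Proof.
move=> cf [mr mi] h0.
have mp : measurable_fun [set: TR] (fun s => (Re (h s), Im (h s)) : T2).
  exact: measurable_fun_pair.
split.
  apply: (eq_measurable_fun (cut (fun p => Re (atp f p)) \o
    (fun s => (Re (h s), Im (h s))))) => [s _|].
    by rewrite /= /cut /= h0 /atp -complex_eta.
  exact: (measurableT_comp (measurable_hol_Re cf) mp).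
apply: (eq_measurable_fun (cut (fun p => Im (atp f p)) \o
  (fun s => (Re (h s), Im (h s))))) => [s _|].
  by rewrite /= /cut /= h0 /atp -complex_eta.
exact: (measurableT_comp (measurable_hol_Im cf) mp).
Qed.

Lemma cintegrable_dom h (u : R -> R) : cmeas h -> mu.-integrable setT (EFin \o u) ->
  (forall s, nc (h s) <= u s) -> cintegrable setT h.
Proof.
move=> [mr mi] iu hu.
have H (v : R -> R) : measurable_fun [set: TR] v -> (forall s, `|v s| <= u s) ->
    mu.-integrable setT (EFin \o v).
  move=> mv vu; apply: le_integrable iu => //; first exact/measurable_EFinP.
  move=> s _ /=; rewrite lee_fin (le_trans (vu s))//; exact: ler_norm.
by split; apply: H => // s; apply: le_trans (hu s); [exact: Re_le_nc|exact: Im_le_nc].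
Qed.

(** The factor 1 + |sg| pays for the growth of [f] along translations, which [indir_growth] shows to
    be at most linear. *)
Definition kernel_le sg k kap :=
  [/\ cmeas sg, cmeas k, mu.-integrable setT (EFin \o kap), (forall s, 0 <= Im (sg s)) &
    forall s, nc (k s) * (1 + nc (sg s)) <= kap s].

Definition conv sg k f z := cI setT (fun s => f (z + sg s) * k s).

Definition mass kap := \int[mu]_s kap s.

Section Kernel.
Variables (sg k : R -> R[i]) (kap : R -> R) (alpha : R) (f fd : R[i] -> R[i]).
Hypothesis al : -1 < alpha.
Hypothesis K : kernel_le sg k kap.

Let msg : cmeas sg. Proof. by case: K. Qed.
Let mk : cmeas k. Proof. by case: K. Qed.
Let ikap : mu.-integrable setT (EFin \o kap). Proof. by case: K. Qed.
Let sg0 s : 0 <= Im (sg s). Proof. by case: K. Qed.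
Let kkap s : nc (k s) * (1 + nc (sg s)) <= kap s. Proof. by case: K. Qed.

Let nsg s : 1 <= 1 + nc (sg s). Proof. by rewrite lerDl nc_ge0. Qed.

Let k_kap s : nc (k s) <= kap s.
Proof.
by apply: le_trans (kkap s); rewrite -[leLHS]mulr1; apply: ler_wpM2l; [exact: nc_ge0|].
Qed.

Let kap0 s : 0 <= kap s. Proof. exact: le_trans (nc_ge0 _) (k_kap s). Qed.

Lemma mass_ge0 : 0 <= mass kap.
Proof. by apply: Rintegral_ge0 => s _. Qed.

Let zs z s : 0 < Im z -> 0 < Im (z + sg s).
Proof. by move=> z0; rewrite ImD ltr_pwDl. Qed.

Let ikapZ c : mu.-integrable setT (EFin \o (fun s => c * kap s)).
Proof. exact: integrableZR. Qed.

Lemma conv_integrable g z A : (forall z, 0 < Im z -> ccont g z) -> 0 < Im z -> 0 <= A ->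
  (forall s, nc (g (z + sg s)) <= A * (1 + nc (sg s))) ->
  cintegrable setT (fun s => g (z + sg s) * k s) /\ nc (conv sg k g z) <= 2 * (A * mass kap).
Proof.
move=> cg z0 A0 gA.
have mg : cmeas (fun s => g (z + sg s) * k s).
  apply: cmeasM => //; apply: cmeas_comp => //; last by move=> s; exact: zs.
  by apply: cmeasD => //; exact: cmeas_cst.
have le s : nc (g (z + sg s) * k s) <= A * kap s.
  rewrite ncM (le_trans (ler_wpM2r (nc_ge0 _) (gA s)))//.
  by rewrite -mulrA ler_wpM2l// mulrC.
have ig := cintegrable_dom mg (ikapZ A) le; split=> //.
rewrite (_ : A * mass kap = \int[mu]_s (A * kap s)).
  by apply: cI_le => // s _.
by rewrite RintegralZl.
Qed.

Hypothesis Hf : indir alpha f fd.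

Let hf : hol f fd. Proof. by case: Hf. Qed.
Let ef : (energy alpha fd < +oo)%E. Proof. by case: Hf. Qed.

Let C := Num.sqrt (wcst alpha * fine (energy alpha fd)).

Lemma indir_dbound z : 0 < Im z -> nc (fd z) <= C * Im z `^ (- 1 - alpha / 2).
Proof.
move=> z0; have [fdd hfd] := hol_deriv hf.
have := energy_sup (Re z) hfd z0 ef; rewrite -complex_eta mulrAC => H.
have W : 0 <= wcst alpha * fine (energy alpha fd).
  by rewrite mulr_ge0 ?wcst_ge0//; exact/fine_ge0/energy_ge0.
rewrite -(@ler_pXn2r _ 2)// ?nnegrE ?nc_ge0 ?mulr_ge0 ?sqrtr_ge0 ?powR_ge0//.
rewrite exprMn sqr_sqrtr// -(powR_mulrn 2 (powR_ge0 _ _)) -powRrM.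
by rewrite (_ : (- 1 - alpha / 2) * 2%:R = - 2 - alpha)//; field.
Qed.

Lemma powR_anti y r : 0 < y -> y <= r -> r `^ (- 1 - alpha / 2) <= y `^ (- 1 - alpha / 2).
Proof.
move=> y0 yr; have r0 := lt_le_trans y0 yr.
have -> : - 1 - alpha / 2 = - (1 + alpha / 2) by ring.
rewrite !powRN lef_pV2 ?posrE ?powR_gt0//.
apply: ge0_ler_powR => //; last 2 first.
- by rewrite nnegrE ltW.
- by rewrite nnegrE ltW.
by move: al => ?; lra.
Qed.

Lemma indir_sup z w : 0 < Im z -> Im z <= Im w -> nc (fd w) <= C * Im z `^ (- 1 - alpha / 2).
Proof.
move=> z0 zw; have w0 := lt_le_trans z0 zw.
apply: (le_trans (indir_dbound w0)); apply: ler_wpM2l; first exact: sqrtr_ge0.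
exact: powR_anti.
Qed.

Lemma indir_lip z u : 0 < Im z -> 0 <= Im u ->
  nc (f (z + u) - f z) <= 2 * (C * Im z `^ (- 1 - alpha / 2) * nc u).
Proof.
move=> z0 u0.
have pos t : 0 <= t <= 1 -> Im z <= Im (z + u * t%:C).
  by move=> /andP[t0 _]; rewrite ImD ImM /= mulr0 add0r lerDl mulr_ge0.
apply: (@cdiff_MVI _ f fd) => t /pos H; last exact: indir_sup.
by apply: hf; exact: lt_le_trans H.
Qed.

(** The energy controls only f', which is bounded above any positive height; integrating it along
    segments gives linear growth of f. Uniformity for w near z is what Taylor's estimate in
    [conv_hol] requires. *)
Lemma indir_growth z : 0 < Im z -> exists2 A, 0 <= A &
  forall w u, Im z / 2 <= Im w -> 0 <= Im u -> nc (w - z) <= Im z / 2 ->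
  nc (f (w + u)) <= A * (1 + nc u).
Proof.
move=> z0; pose M := C * (Im z / 2) `^ (- 1 - alpha / 2).
have M0 : 0 <= M by rewrite mulr_ge0 ?sqrtr_ge0 ?powR_ge0.
have z20 : 0 < Im z / 2 by rewrite divr_gt0.
exists (nc (f z) + 2 * M * (Im z / 2) + 2 * M) => [|w u zw u0 wz].
  have M20 : 0 <= 2 * M by apply: mulr_ge0.
  by apply: addr_ge0 => //; apply: addr_ge0; [exact: nc_ge0|apply: mulr_ge0 => //; exact: ltW].
(* The point at half the height of [z]; the bound on f' there holds at every greater height. *)
pose v := z - 'i * (Im z / 2)%:C.
have vi : Im v = Im z / 2.
  by rewrite /v ImD ImN ImM /= mul0r mul1r add0r; field.
have w0 : 0 < Im w by exact: lt_le_trans zw.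
have b1 : nc (f (w + u) - f w) <= 2 * (M * nc u).
  apply: (le_trans (indir_lip w0 u0)); rewrite ler_wpM2l// ler_wpM2r ?nc_ge0//.
  rewrite ler_wpM2l ?sqrtr_ge0//.
  exact: powR_anti.
have b2 : nc (f w - f z) <= 2 * (M * (Im z / 2)).
  have H t : 0 <= t <= 1 -> Im z / 2 <= Im (z + (w - z) * t%:C).
    move=> /andP[t0 t1]; rewrite ImD ImM /= mulr0 add0r ImD ImN; nra.
  rewrite -[w in f w](subrK z) [w - z + z]addrC.
  apply: (le_trans (@cdiff_MVI _ f fd z (w - z) M _ _)) => [t /H h|t /H h|].
  - by apply: hf; exact: lt_le_trans h.
  - by rewrite /M -vi; apply: indir_sup; rewrite vi.
  - by rewrite ler_wpM2l// ler_wpM2l.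
have -> : f (w + u) = f z + (f w - f z) + (f (w + u) - f w) by ring.
apply: (le_trans (le_ncD _ _)); have := le_ncD (f z) (f w - f z).
move: b1 b2; have := nc_ge0 u; have := nc_ge0 (f z).
set a1 := nc (f (w + u) - f w); set a2 := nc (f w - f z).
set a3 := nc (f z); set a4 := nc u; set a5 := nc (f z + _).
move=> ? ? ? ? ?; have ? : 0 <= M * a4 by rewrite mulr_ge0.
have ? : 0 <= a3 * a4 by rewrite mulr_ge0.
have ? : 0 <= M * (Im z / 2) * a4.
  by apply: mulr_ge0 => //; apply: mulr_ge0 => //; exact: ltW.
nra.
Qed.

End Kernel.

End Convolution.

(** * Averages of translates act on the Dirichlet space *)

Section ConvolutionSpace.
Context {R : realType}.
Local Notation nc := (@ComplexField.Normc.normc R).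
Local Notation mu := (@lebesgue_measure R).
Local Notation TR := (measurableTypeR R).
Local Notation T2 := (TR * TR)%type.
Local Notation M2 := (mu \x mu)%E.
Local Notation Re := (@complex.Re R).
Local Notation Im := (@complex.Im R).
Implicit Types (p q : R * R) (c x y e r a s t alpha : R) (z w l u : R[i]) (f g fd gd : R[i] -> R[i]).
Implicit Types (h sg k : R -> R[i]) (kap : R -> R).

(** Cauchy-Schwarz for the measure with density kap, from the nonnegativity of the integral of (v -
    t)^2 kap at the value t = m / K. When the right-hand integral is infinite there is nothing to
    prove. *)
Lemma integral_sqr_le (v kap : R -> R) (K : R) : 0 < K ->
  measurable_fun [set: TR] v -> (forall s, 0 <= kap s) ->
  mu.-integrable setT (EFin \o kap) -> mass kap <= K ->
  mu.-integrable setT (EFin \o (fun s => v s * kap s)) ->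
  (((\int[mu]_s (v s * kap s)) ^+ 2)%:E <= K%:E * \int[mu]_s (v s ^+ 2 * kap s)%:E)%E.
Proof.
move=> K0 mv kap0 ik mK iv; set m := \int[mu]_s (v s * kap s).
have mk : measurable_fun [set: TR] kap by have /integrableP[/measurable_EFinP] := ik.
have mvk : measurable_fun [set: TR] (fun s => v s ^+ 2 * kap s).
  by apply: measurable_funM => //; exact: measurable_funX.
have vk0 s : 0 <= v s ^+ 2 * kap s by apply: mulr_ge0 => //; exact: sqr_ge0.
set I := (\int[mu]_s (v s ^+ 2 * kap s)%:E)%E.
have I0 : (0 <= I)%E by apply: ge0_intR_ge0.
have [Ioo|] := ltP I +oo%E; last by rewrite leye_eq => /eqP ->; rewrite gt0_muley ?lte_fin// leey.
have iI : mu.-integrable setT (EFin \o (fun s => v s ^+ 2 * kap s)).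
  apply/integrableP; split; first exact/measurable_EFinP.
  rewrite (_ : (\int[mu]_s _)%E = I)//; apply: eq_integral => s _.
  by rewrite /= ger0_norm.
have Ifin : I = (\int[mu]_s (v s ^+ 2 * kap s))%:E.
  by rewrite /Rintegral fineK// ge0_fin_numE.
rewrite Ifin -EFinM lee_fin; set J := \int[mu]_s _.
have H t : 2 * t * m <= J + t ^+ 2 * mass kap.
  have i2 := integrableZR (t ^+ 2) measurableT ik.
  rewrite /m -RintegralZl// /mass -[X in _ + X]RintegralZl// -RintegralD//.
  apply: le_Rintegral => //.
  - exact: (integrableZR (2 * t) measurableT iv).
  - exact: (integrableDR measurableT iI i2).
  - move=> s _; have := mulr_ge0 (sqr_ge0 (v s - t)) (kap0 s); nra.
have := H (m / K); move: mK; set M := mass kap => MK.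
have M2K : (m / K) ^+ 2 * M <= (m / K) ^+ 2 * K by apply: ler_wpM2l => //; exact: sqr_ge0.
move=> h; have {}h : 2 * (m / K) * m <= J + (m / K) ^+ 2 * K by apply: (le_trans h); rewrite lerD2l.
have e1 : 2 * (m / K) * m = 2 * m ^+ 2 / K by field; rewrite gt_eqF.
have e2 : (m / K) ^+ 2 * K = m ^+ 2 / K by field; rewrite gt_eqF.
have : m ^+ 2 / K <= J by rewrite e1 e2 in h; lra.
by rewrite ler_pdivrMr// mulrC.
Qed.

Section Kernel.
Variables (sg k : R -> R[i]) (kap : R -> R) (alpha : R) (f fd : R[i] -> R[i]).
Hypothesis al : -1 < alpha.
Hypothesis K : kernel_le sg k kap.
Hypothesis Hf : indir alpha f fd.

Let msg : cmeas sg. Proof. by case: K. Qed.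
Let mk : cmeas k. Proof. by case: K. Qed.
Let ikap : mu.-integrable setT (EFin \o kap). Proof. by case: K. Qed.
Let sg0 s : 0 <= Im (sg s). Proof. by case: K. Qed.
Let kkap s : nc (k s) * (1 + nc (sg s)) <= kap s. Proof. by case: K. Qed.
Let nsg s : 1 <= 1 + nc (sg s). Proof. by rewrite lerDl nc_ge0. Qed.
Let nsg0 s : 0 <= 1 + nc (sg s). Proof. exact: le_trans (nsg s). Qed.
Let k_kap s : nc (k s) <= kap s.
Proof.
by apply: le_trans (kkap s); rewrite -[leLHS]mulr1; apply: ler_wpM2l; [exact: nc_ge0|].
Qed.
Let kap0 s : 0 <= kap s. Proof. exact: le_trans (nc_ge0 _) (k_kap s). Qed.
Let zs z s : 0 < Im z -> 0 < Im (z + sg s).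
Proof. by move=> z0; rewrite ImD ltr_pwDl. Qed.
Let ikapZ c : mu.-integrable setT (EFin \o (fun s => c * kap s)).
Proof. exact: integrableZR. Qed.
Let hf : hol f fd. Proof. by case: Hf. Qed.
Let ef : (energy alpha fd < +oo)%E. Proof. by case: Hf. Qed.
Let vf : vdecay f. Proof. by case: Hf. Qed.
Let C := Num.sqrt (wcst alpha * fine (energy alpha fd)).
Let C0 : 0 <= C. Proof. exact: sqrtr_ge0. Qed.

Lemma conv_fint z : 0 < Im z -> cintegrable setT (fun s => f (z + sg s) * k s).
Proof.
move=> z0; have [A A0 H] := indir_growth al Hf z0.
apply: (@conv_integrable R sg k kap K f z A (hol_ccont hf) z0 A0 _).1 => s.
apply: H => //; first by move: z0 => ?; lra.
by rewrite subrr nc0; move: z0 => ?; lra.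
Qed.

Lemma conv_fdint z : 0 < Im z -> cintegrable setT (fun s => fd (z + sg s) * k s).
Proof.
move=> z0; have [fdd hfd] := hol_deriv hf.
have A0 : 0 <= C * Im z `^ (- 1 - alpha / 2) by apply: mulr_ge0 => //; exact: powR_ge0.
apply: (@conv_integrable R sg k kap K fd z _ (hol_ccont hfd) z0 A0 _).1 => s.
have H : nc (fd (z + sg s)) <= C * Im z `^ (- 1 - alpha / 2).
  by apply: (indir_sup al Hf z0); rewrite ImD lerDl.
by apply: (le_trans H); rewrite -[leLHS]mulr1; apply: ler_wpM2l.
Qed.

(** Differentiation under the integral sign: [Taylor1] on squares of half-side Im z / 4 about z + sg
    s has a remainder at most a constant times (1 + |sg s|) |h|^2, which is integrable against k. *)
Lemma conv_hol : hol (conv sg k f) (conv sg k fd).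
Proof.
move=> z z0; have [A A0 H] := indir_growth al Hf z0.
pose r := Im z / 4; have r0 : 0 < r by rewrite divr_gt0.
pose c := 128 * A / r ^+ 2.
have c0 : 0 <= c by apply: divr_ge0; [exact: mulr_ge0|exact: sqr_ge0].
apply: (@quadratic_cdiff _ _ _ _ (2 * (c * mass kap)) (r / 4)); first by rewrite divr_gt0.
move=> h hr.
have zh0 : 0 < Im (z + h).
  rewrite ImD; have := le_trans (Im_le_nc h) hr; rewrite ler_norml => /andP[h1 _].
  by move: z0 h1; rewrite /r => ? ?; lra.
have i1 := conv_fint zh0; have i2 := conv_fint z0; have i3 := conv_fdint z0.
have i3' := cintegrableZ h measurableT i3.
have i12 := cintegrableB measurableT i1 i2.
rewrite /conv -cIB// mulrC -cIZ// -cIB//.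
rewrite (_ : 2 * (c * mass kap) * nc h ^+ 2 = 2 * \int[mu]_s ((c * nc h ^+ 2) * kap s)); last first.
  by rewrite RintegralZl// /mass; ring.
apply: cI_le => //; first exact: (cintegrableB measurableT i12 i3').
move=> s _.
have -> : f (z + h + sg s) * k s - f (z + sg s) * k s - h * (fd (z + sg s) * k s) =
    (f (z + sg s + h) - f (z + sg s) - fd (z + sg s) * h) * k s.
  by rewrite (addrAC z h); ring.
have zr w : insq (z + sg s) r w -> 0 < Im w.
  by move=> /insq_Im/andP[+ _]; rewrite ImD /r; have := sg0 s; lra.
rewrite ncM.
have T : nc (f (z + sg s + h) - f (z + sg s) - fd (z + sg s) * h) <=
    128 * (A * (1 + nc (sg s))) / r ^+ 2 * nc h ^+ 2.
  apply: Taylor1 => //.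
  - by move=> w /zr w0; exists (fd w); exact: hf.
  - move=> w [wi _]; rewrite -[w](subrK (sg s)); apply: H => //.
    + by move: (insq_Im wi) => /andP[+ _]; rewrite !ImD ImN /r; lra.
    + have -> : w - sg s - z = w - (z + sg s) by ring.
      by apply: (le_trans (insq_dist wi)); rewrite /r; lra.
  - by apply: hf; exact: zs.
apply: (le_trans (ler_wpM2r (nc_ge0 _) T)).
have -> : 128 * (A * (1 + nc (sg s))) / r ^+ 2 * nc h ^+ 2 * nc (k s) =
   c * nc h ^+ 2 * (nc (k s) * (1 + nc (sg s))) by rewrite /c; ring.
by apply: ler_wpM2l => //; apply: mulr_ge0 => //; exact: sqr_ge0.
Qed.

(** At height y the values f(z + sg s) and f(z) differ by O(y^(-1 - alpha/2)) |sg s|, and the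
    exponent is negative as alpha > -1; so f(z + sg s) is at most a small multiple of 1 + |sg s|. *)
Lemma conv_vdecay : vdecay (conv sg k f).
Proof.
move=> x e e0; pose M1 := mass kap + 1.
have M1p : 0 < M1 by rewrite ltr_wpDl// (mass_ge0 K).
pose e1 := e / (10 * M1).
have e10 : 0 < e1 by rewrite divr_gt0// mulr_gt0.
have [Y HY] := vf x e10.
have C1 : 0 < C + 1 by rewrite ltr_wpDl.
pose b := 1 + alpha / 2; have b0 : 0 < b by rewrite /b; move: al => ?; lra.
(* The height at which (C + 1) y^-b equals e1. *)
pose Y2 := ((C + 1) / e1) `^ (b^-1).
have q0 : 0 < (C + 1) / e1 by rewrite divr_gt0.
have Y20 : 0 < Y2 by rewrite powR_gt0.
exists (Num.max Y Y2) => y; rewrite ge_max => /andP[yY yY2].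
have y0 : 0 < y by exact: lt_le_trans yY2.
have My : C * y `^ (- 1 - alpha / 2) <= e1.
  apply: (@le_trans _ _ (C * Y2 `^ (- 1 - alpha / 2))).
    by apply: ler_wpM2l => //; exact: powR_anti.
  rewrite (_ : - 1 - alpha / 2 = - b); last by rewrite /b; ring.
  rewrite powRN /Y2 -powRrM mulVf ?gt_eqF// powRr1 ?(ltW q0)// invf_div mulrA ler_pdivrMr//.
  by rewrite mulrC ler_wpM2l ?(ltW e10)// lerDl.
pose z := x +i* y.
have z0 : 0 < Im z by [].
have bd s : nc (f (z + sg s)) <= (3 * e1) * (1 + nc (sg s)).
  have := indir_lip al Hf z0 (sg0 s); rewrite -/C /= => L.
  have {}L : nc (f (z + sg s) - f z) <= 2 * (e1 * nc (sg s)).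
    by apply: (le_trans L); rewrite ler_wpM2l// ler_wpM2r ?nc_ge0.
  have Z : nc (f z) <= e1 by exact: HY.
  have -> : f (z + sg s) = f z + (f (z + sg s) - f z) by ring.
  apply: (le_trans (le_ncD _ _)).
  have := mulr_ge0 (ltW e10) (nc_ge0 (sg s)); move: L Z e10; lra.
have e30 : 0 <= 3 * e1 by rewrite mulr_ge0// ltW.
apply: le_trans (@conv_integrable R sg k kap K f z _ (hol_ccont hf) z0 e30 bd).2 _.
have := mass_ge0 K => m0.
apply: (@le_trans _ _ (6 * e1 * M1)).
  rewrite (_ : 2 * _ = 6 * e1 * mass kap); last by ring.
  apply: ler_wpM2l; last by rewrite /M1 lerDl.
  by apply: mulr_ge0 => //; exact: ltW.
by rewrite /e1 (_ : 6 * (e / (10 * M1)) * M1 = e * (6 / 10)); [lra|field; rewrite gt_eqF].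
Qed.

(** Cauchy-Schwarz in s against the density kap, then Fubini, then [energy_shift] for each
    translate, whose constant is uniform in s. The 4 is the square of the factor in [cI_le], and the
    mass is increased by 1 to make the Cauchy-Schwarz constant positive. *)
Lemma conv_energy : (energy alpha (conv sg k fd) <=
  (4 * (mass kap + 1) * mass kap * shift_cst alpha)%:E * energy alpha fd)%E.
Proof.
have [fdd hfd] := hol_deriv hf; have cfd := hol_ccont hfd.
have [cdd hcd] := hol_deriv conv_hol; have ccd := hol_ccont hcd.
have m0 := mass_ge0 K; pose M1 := mass kap + 1.
have M1p : 0 < M1 by rewrite ltr_wpDl.
have mM1 : mass kap <= M1 by rewrite lerDl.
have mkap : measurable_fun [set: TR] kap by have /integrableP[/measurable_EFinP] := ikap.
pose H := cut (fun p => nc (atp fd p)).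
have mH : measurable_fun [set: T2] H by exact: measurable_hol_nc.
pose Psi (z : (R * R) * R) : R := H (z.1.1 + Re (sg z.2), z.1.2 + Im (sg z.2)).
have mPsi : measurable_fun [set: (T2 * TR)%type] Psi.
  apply: (measurableT_comp mH); apply: measurable_fun_pair; apply: measurable_funD.
  - exact: (measurableT_comp measurable_fst measurable_fst).
  - exact: (measurableT_comp msg.1 measurable_snd).
  - exact: (measurableT_comp measurable_snd measurable_fst).
  - exact: (measurableT_comp msg.2 measurable_snd).
pose Phi (z : (R * R) * R) : R :=
  (0 < z.1.2)%R%:R * (z.1.2 `^ alpha * (Psi z ^+ 2 * kap z.2)).
have mPhi : measurable_fun [set: (T2 * TR)%type] Phi.
  apply: measurable_funM.
    apply: measurable_nat_bool; apply: measurable_fun_ltr; first exact: measurable_cst.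
    exact: (measurableT_comp measurable_snd measurable_fst).
  apply: measurable_funM.
    exact: (measurableT_comp (measurable_snd_powR alpha) measurable_fst).
  apply: measurable_funM; first exact: measurable_funX.
  exact: (measurableT_comp mkap measurable_snd).
have Phi0 (ps : (R * R) * R) : 0 <= Phi ps.
  apply: mulr_ge0; first exact: ler0n.
  apply: mulr_ge0; first exact: powR_ge0.
  by apply: mulr_ge0 => //; exact: sqr_ge0.
have meP : measurable_fun [set: (T2 * TR)%type] (EFin \o Phi) by exact/measurable_EFinP.
have eP0 (ps : (R * R) * R) : (0 <= (EFin \o Phi) ps)%E by rewrite lee_fin.
have PsiE p s : 0 < p.2 -> Psi (p, s) = nc (fd (p.1 +i* p.2 + sg s)).
  move=> p0; rewrite /Psi /H /cut /= ltr_pwDl// /atp; congr (nc (fd _)).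
  by case: (sg s).
have mPs p : measurable_fun [set: TR] (fun s => Psi (p, s)).
  exact: (measurableT_comp mPsi (measurable_pair1 p)).
have step1 p : ((dens alpha (conv sg k fd) p)%:E <=
    (4 * M1)%:E * \int[mu]_s (Phi (p, s))%:E)%E.
  rewrite /dens /cut; case: ifPn => p0; last first.
    by apply: mule_ge0; [rewrite lee_fin; apply: mulr_ge0 => //; exact: ltW|exact: ge0_intR_ge0].
  pose v s := Psi (p, s).
  have v0 s : 0 <= v s by rewrite /v PsiE// nc_ge0.
  pose z := p.1 +i* p.2; have z0 : 0 < Im z by [].
  pose A := C * Im z `^ (- 1 - alpha / 2).
  have A0 : 0 <= A by apply: mulr_ge0 => //; exact: powR_ge0.
  have vA s : v s <= A.
    by rewrite /v PsiE//; apply: (indir_sup al Hf z0); rewrite ImD lerDl.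
  have iv : mu.-integrable setT (EFin \o (fun s => v s * kap s)).
    apply: le_integrable (ikapZ A) => //.
      by apply/measurable_EFinP; apply: measurable_funM => //; exact: mPs.
    move=> s _ /=; rewrite lee_fin !ger0_norm; last 2 first.
    - exact: mulr_ge0.
    - exact: mulr_ge0.
    by apply: ler_wpM2r.
  have le1 : nc (conv sg k fd z) <= 2 * \int[mu]_s (v s * kap s).
    apply: cI_le => //; first exact: conv_fdint.
    move=> s _; rewrite ncM /v PsiE//; apply: ler_wpM2l => //; exact: nc_ge0.
  have m2 := integral_sqr_le M1p (mPs p) kap0 ikap mM1 iv.
  have -> : (\int[mu]_s (Phi (p, s))%:E = (p.2 `^ alpha)%:E *
      \int[mu]_s (v s ^+ 2 * kap s)%:E)%E.
    rewrite -(@ge0_intZR _ _ _ mu _ (fun s => v s ^+ 2 * kap s)); last 3 first.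
    - by apply: measurable_funM => //; apply: measurable_funX; exact: mPs.
    - by move=> s; apply: mulr_ge0 => //; exact: sqr_ge0.
    - exact: powR_ge0.
    by apply: eq_integral => s _; rewrite /Phi /= p0 mul1r.
  rewrite muleCA mulrC (EFinM (p.2 `^ alpha)); apply: lee_wpmul2l.
    by rewrite lee_fin powR_ge0.
  rewrite EFinM -muleA; apply: (@le_trans _ _ (4%:E * ((\int[mu]_s (v s * kap s)) ^+ 2)%:E)%E).
    rewrite -EFinM lee_fin.
    rewrite (_ : 4 * _ = (2 * \int[mu]_s (v s * kap s)) ^+ 2); last by ring.
    by rewrite ler_pXn2r ?nnegrE// ?nc_ge0//; exact: le_trans (nc_ge0 _) le1.
  by apply: lee_wpmul2l; [rewrite lee_fin|exact: m2].
pose K1 p : \bar R := (\int[mu]_s (Phi (p, s))%:E)%E.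
have mK1 : measurable_fun [set: T2] K1.
  exact: (measurable_fun_fubini_tonelli_F (m2 := mu) (EFin \o Phi) meP eP0).
have K10 p : (0 <= K1 p)%E by exact: ge0_intR_ge0.
have M40 : (0 <= (4 * M1)%:E)%E by rewrite lee_fin; apply: mulr_ge0 => //; exact: ltW.
have step2 : (energy alpha (conv sg k fd) <= (4 * M1)%:E * \int[M2]_p K1 p)%E.
  rewrite -ge0_integralZl//; apply: ge0_le_integral.
  - exact: measurableT.
  - by move=> p _; rewrite lee_fin dens_ge0.
  - by apply/measurable_EFinP; apply: measurable_dens.
  - exact: measurable_funeM.
  - by move=> p _; exact: step1.
have step3 : (\int[M2]_p K1 p = \int[mu]_s \int[M2]_p (Phi (p, s))%:E)%E.
  exact: (fubini_tonelli (m1 := plane_measure) (m2 := mu) (EFin \o Phi) meP eP0).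
pose E : \bar R := ((shift_cst alpha)%:E * energy alpha fd)%E.
have E0 : (0 <= E)%E by apply: mule_ge0; [rewrite lee_fin shift_cst_ge0|exact: energy_ge0].
have Efin : (E < +oo)%E by rewrite /E lte_mul_pinfty// lee_fin shift_cst_ge0.
have step4 s : (\int[M2]_p (Phi (p, s))%:E <= (kap s * fine E)%:E)%E.
  apply: (@le_trans _ _ ((kap s)%:E * energy alpha (fun z => fd (z + sg s)%R))%E); last first.
    rewrite EFinM fineK ?ge0_fin_numE//; apply: lee_wpmul2l; first by rewrite lee_fin.
    exact: energy_shift al hfd (sg0 s).
  rewrite le_eqVlt; apply/orP; left; apply/eqP.
  rewrite -(integral_dens alpha (hol_ccont (hol_shift hfd (sg0 s))) (kap0 s)).
  apply: eq_integral => p _; rewrite /Phi /dens /cut /=.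
  case: ifPn => p0; last by rewrite mul0r mulr0.
  by rewrite PsiE// mul1r /atp; congr EFin; ring.
apply: (le_trans step2); rewrite step3.
have -> : ((4 * (mass kap + 1) * mass kap * shift_cst alpha)%:E * energy alpha fd =
   (4 * M1)%:E * ((mass kap)%:E * E))%E by rewrite /E !muleA -!EFinM.
apply: lee_wpmul2l => //.
apply: (@le_trans _ _ (\int[mu]_s (fine E * kap s)%:E)%E).
  apply: ge0_le_integral.
  - exact: measurableT.
  - by move=> s _; exact: ge0_intR_ge0.
  - exact: (measurable_fun_fubini_tonelli_G (m1 := plane_measure) (EFin \o Phi) meP eP0).
  - by apply/measurable_EFinP; apply: measurable_funM; first exact: measurable_cst.
  - by move=> s _; rewrite mulrC.
rewrite (@ge0_intZR _ _ _ mu _ kap mkap kap0 (fine_ge0 E0)).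
rewrite fineK ?ge0_fin_numE// muleC; apply: lee_wpmul2r => //.
rewrite le_eqVlt; apply/orP; left; apply/eqP.
rewrite /mass /Rintegral fineK//; exact: integral_fune_fin_num.
Qed.

Lemma conv_indir : indir alpha (conv sg k f) (conv sg k fd).
Proof.
split; [exact: conv_hol| |exact: conv_vdecay].
apply: (le_lt_trans conv_energy); rewrite lte_mul_pinfty// lee_fin.
have m0 := mass_ge0 K.
apply: mulr_ge0; last exact: shift_cst_ge0.
by apply: mulr_ge0 => //; apply: mulr_ge0 => //; apply: addr_ge0.
Qed.

End Kernel.

End ConvolutionSpace.

(** * Kernel operators and the criterion for invertibility *)

Section Operators.
Context {R : realType}.
Local Notation nc := (@ComplexField.Normc.normc R).
Local Notation mu := (@lebesgue_measure R).
Local Notation TR := (measurableTypeR R).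
Local Notation Re := (@complex.Re R).
Local Notation Im := (@complex.Im R).
Implicit Types (c x y e r s t alpha : R) (a b z w l u lam : R[i]) (f g fd gd : R[i] -> R[i]).
Implicit Types (h sg k : R -> R[i]) (kap : R -> R) (F G : half_plane R -> R[i]^o).

Lemma indir_shift alpha f fd u : -1 < alpha -> indir alpha f fd -> 0 <= Im u ->
  indir alpha (fun z => f (z + u)) (fun z => fd (z + u)).
Proof.
move=> al [hf ef vf] u0; split.
- exact: hol_shift.
- have [fdd hfd] := hol_deriv hf.
  apply: (le_lt_trans (energy_shift al hfd u0)).
  by rewrite lte_mul_pinfty// lee_fin shift_cst_ge0.
- move=> x e e0; have [Y HY] := vf (x + Re u) e e0.
  exists Y => y Yy; have := HY (y + Im u); rewrite (_ : x +i* y + u = (x + Re u) +i* (y + Im u)).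
    by apply; apply: (le_trans Yy); rewrite lerDl.
  by case: u {u0 HY}.
Qed.

Definition bounded_map alpha (T Td : (R[i] -> R[i]) -> R[i] -> R[i]) (M : R) :=
  forall f fd, indir alpha f fd ->
    indir alpha (T f) (Td fd) /\ (energy alpha (Td fd) <= M%:E * energy alpha fd)%E.

(** The common shape of [C] and of all the inverses constructed below; it acts on derivatives by the
    same formula. *)
Definition kernel_map sg k a b u f z := a * conv sg k f (z + u) + b * f (z + u).

Lemma kernel_map_bounded alpha sg k kap a b u : -1 < alpha -> kernel_le sg k kap ->
  0 <= Im u -> exists2 M, 0 <= M &
    bounded_map alpha (kernel_map sg k a b u) (kernel_map sg k a b u) M.
Proof.
move=> al K u0; have m0 := mass_ge0 K; have S0 := shift_cst_ge0 al.
pose M1 := 4 * (mass kap + 1) * mass kap * shift_cst alpha.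
have M10 : 0 <= M1 by rewrite !mulr_ge0// addr_ge0.
pose Ma := nc a ^+ 2 * (shift_cst alpha * M1); pose Mb := nc b ^+ 2 * shift_cst alpha.
have Ma0 : 0 <= Ma by apply: mulr_ge0; [exact: sqr_ge0|exact: mulr_ge0].
have Mb0 : 0 <= Mb by apply: mulr_ge0; [exact: sqr_ge0|].
exists (2 * (Ma + Mb)) => [|f fd Hf]; first by apply: mulr_ge0 => //; exact: addr_ge0.
have Hc := conv_indir al K Hf; have Hcu := indir_shift al Hc u0; have Hfu := indir_shift al Hf u0.
have [[hc _ _] [hf _ _]] := (Hc, Hf); have [[hcu _ _] [hfu _ _]] := (Hcu, Hfu).
split; first exact: indirD (indirZ a Hcu) (indirZ b Hfu).
have [cdd hcd] := hol_deriv hc; have [fdd hfd] := hol_deriv hf.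
have [cudd hcud] := hol_deriv hcu; have [fudd hfud] := hol_deriv hfu.
apply: (le_trans (energyD alpha (holZ a hcud) (holZ b hfud))).
rewrite EFinM -muleA; apply: lee_wpmul2l; first by rewrite lee_fin.
rewrite EFinD ge0_muleDl ?lee_fin// (energyZ alpha a hcud) (energyZ alpha b hfud).
apply: leeD.
  rewrite /Ma (EFinM (nc a ^+ 2)) -muleA; apply: lee_wpmul2l; first by rewrite lee_fin sqr_ge0.
  apply: (le_trans (energy_shift al hcd u0)).
  rewrite (EFinM (shift_cst alpha)) -muleA; apply: lee_wpmul2l; first by rewrite lee_fin.
  exact: (conv_energy al K Hf).
rewrite /Mb (EFinM (nc b ^+ 2)) -muleA; apply: lee_wpmul2l; first by rewrite lee_fin sqr_ge0.
exact: (energy_shift al hfd u0).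
Qed.

Lemma eq_conv sg k f g z : (forall s, 0 <= Im (sg s)) -> 0 < Im z ->
  (forall z, 0 < Im z -> f z = g z) -> conv sg k f z = conv sg k g z.
Proof.
move=> sg0 z0 fg; apply: eq_cI => s _; rewrite fg// ImD ltr_pwDl//.
Qed.

Lemma convD alpha sg k kap f fd g gd l z : -1 < alpha -> kernel_le sg k kap ->
  indir alpha f fd -> indir alpha g gd -> 0 < Im z ->
  conv sg k (fun z => l * f z + g z) z = l * conv sg k f z + conv sg k g z.
Proof.
move=> al K Hf Hg z0; have If := conv_fint al K Hf z0; have Ig := conv_fint al K Hg z0.
rewrite /conv -cIZ// -cID//; last exact: cintegrableZ.
by apply: eq_cI => s _; ring.
Qed.

Definition kernel_op sg k a b u F : half_plane R -> R[i]^o :=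
  restr (kernel_map sg k a b u (ext0 F)).

Lemma indir_norm_le alpha f fd g gd (M : R) : 0 <= M -> indir alpha f fd -> indir alpha g gd ->
  (energy alpha gd <= M%:E * energy alpha fd)%E ->
  dirichlet_norm alpha (restr g) <= Num.sqrt M * dirichlet_norm alpha (restr f).
Proof.
move=> M0 Hf Hg H; have [_ ef _] := Hf; have [_ eg _] := Hg.
rewrite (indir_dirichlet Hf (fun=> erefl)).2 (indir_dirichlet Hg (fun=> erefl)).2.
rewrite -sqrtrM//; apply: ler_wsqrtr; rewrite -lee_fin EFinM !fineK//.
  by rewrite ge0_fin_numE// energy_ge0.
by rewrite ge0_fin_numE// energy_ge0.
Qed.

Lemma kernel_op_bounded alpha sg k kap a b u : -1 < alpha -> kernel_le sg k kap ->
  0 <= Im u -> bounded_operator (@dirichlet_space R alpha) (@dirichlet_norm R alpha)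
    (kernel_op sg k a b u).
Proof.
move=> al K u0; have [M M0 B] := kernel_map_bounded a b al K u0.
have sg0 s : 0 <= Im (sg s) by case: K.
split.
- by move=> F /dirichlet_indir/B[/indir_restr[]].
- move=> l F G DF DG; apply/funext => w.
  have /dirichlet_indir HF := DF; have /dirichlet_indir HG := DG.
  have w0 : 0 < Im (val w) by case: w.
  have wu : 0 < Im (val w + u) by rewrite ImD ltr_pwDl.
  rewrite /kernel_op /restr /kernel_map ext0_lin//.
  rewrite (@eq_conv _ _ _ (fun z => l * ext0 F z + ext0 G z))//; last by move=> z; exact: ext0_lin.
  rewrite (convD l al K HF HG wu).
  set c1 := conv _ _ _ _; set c2 := conv _ _ _ _; set d1 := ext0 _ _; set d2 := ext0 _ _.
  rewrite -[RHS]/(l * (a * c1 + b * d1) + (a * c2 + b * d2)); ring.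
- exists (Num.sqrt M) => F /dirichlet_indir HF; have [Hg Eg] := B _ _ HF.
  by have := indir_norm_le M0 HF Hg Eg; rewrite restr_ext0.
Qed.

Lemma kernel_le0 : kernel_le (fun=> 0) (fun=> 0) (fun=> 0 : R).
Proof.
split=> //; [exact: cmeas_cst|exact: cmeas_cst| |].
  by apply: eq_integrable (integrable0 mu setT).
by move=> s; rewrite nc0 mul0r.
Qed.

Section Translation.
Variables (tau : half_plane R -> half_plane R) (w0 : R[i]) (alpha : R).
Hypothesis al : -1 < alpha.
Hypothesis htau : parabolic_self_map tau w0.

Let D := @dirichlet_space R alpha.
Let nrm := @dirichlet_norm R alpha.
Let C := @composition_operator R tau.

Lemma parabolic_im : 0 <= Im w0. Proof. by case: htau. Qed.

Lemma composition_kernel : C = kernel_op (fun=> 0) (fun=> 0) 0 1 w0.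
Proof.
apply/funext => F; apply/funext => w; rewrite /kernel_op /restr /kernel_map mul0r add0r mul1r.
have [_ _ tE] := htau.
by rewrite /C /composition_operator /= -(ext0_val F) tE.
Qed.

Lemma composition_bounded : bounded_operator D nrm C.
Proof.
by rewrite composition_kernel; apply: (kernel_op_bounded _ _ al kernel_le0 parabolic_im).
Qed.

Lemma shift_opE lam F (w : half_plane R) : shift_op C lam F w = ext0 F (val w + w0) - lam * ext0 F (val w).
Proof.
have [_ _ tE] := htau.
rewrite -tE !ext0_val; by [].
Qed.

Lemma ext0_shift_op lam F z : 0 < Im z ->
  ext0 (shift_op C lam F) z = ext0 F (z + w0) - lam * ext0 F z.
Proof. by move=> z0; rewrite (ext0_in _ z0) shift_opE. Qed.

(** A kernel map commutes with translation by [w0] and is linear, so the identity that makes it a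
    right inverse of C - lam makes it a left inverse as well. *)
Lemma kernel_invertible sg k kap a b u lam : kernel_le sg k kap -> 0 <= Im u ->
  (forall f fd, indir alpha f fd -> forall z, 0 < Im z ->
    kernel_map sg k a b u f (z + w0) - lam * kernel_map sg k a b u f z = f z) ->
  invertible D nrm (shift_op C lam).
Proof.
move=> K u0 H; exists (kernel_op sg k a b u); split.
  exact: (kernel_op_bounded a b al K u0).
have sg0 s : 0 <= Im (sg s) by case: K.
have im0 := parabolic_im.
move=> F DF; have /dirichlet_indir HF := DF; split; apply/funext => w;
  have v0 : 0 < Im (val w) by case: w.
- have HC := indir_shift al HF im0.
  have wu : 0 < Im (val w + u) by rewrite ImD ltr_pwDl.
  have E z : 0 < Im z -> ext0 (shift_op C lam F) z = - lam * ext0 F z + ext0 F (z + w0).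
    by move=> z0; rewrite ext0_shift_op//; ring.
  rewrite /kernel_op /restr /kernel_map E// (@eq_conv _ _ _ _ _ sg0 wu E).
  rewrite (convD (- lam) al K HF HC wu) -[RHS]ext0_val -[RHS](H _ _ HF)// /kernel_map.
  have -> : conv sg k (fun z => ext0 F (z + w0)) (val w + u) = conv sg k (ext0 F) (val w + w0 + u).
    by apply: eq_cI => s _; congr (ext0 F _ * _); ring.
  have -> : val w + u + w0 = val w + w0 + u by ring.
  by ring.
- rewrite shift_opE /kernel_op !ext0_restr//; last by rewrite ImD ltr_pwDl.
  by rewrite (H _ _ HF)// ext0_val.
Qed.

End Translation.

End Operators.

(** * The complex exponential, its logarithms and its period *)

Section ComplexExponential.
Context {R : realType}.
Local Notation nc := (@ComplexField.Normc.normc R).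
Local Notation Re := (@complex.Re R).
Local Notation Im := (@complex.Im R).
Local Notation pi := (@trigo.pi R).
Implicit Types (c x y e r s t : R) (z w l u : R[i]).

Lemma cexpD z w : cexp (z + w) = cexp z * cexp w.
Proof.
case: z w => [a b] [c d]; rewrite [RHS]complex_eta ReM ImM /cexp /= expRD cosD sinD.
by congr (_ +i* _); ring.
Qed.

Lemma cexp0 : cexp 0 = 1 :> R[i].
Proof. by rewrite /cexp /= expR0 cos0 sin0 mul1r. Qed.

Lemma nc_cexp z : nc (cexp z) = expR (Re z).
Proof.
rewrite ncM nc_real ger0_norm ?expR_ge0// -[RHS]mulr1; congr (_ * _).
by rewrite /= cos2Dsin2 sqrtr1.
Qed.

Lemma cexp_neq0 z : cexp z != 0.
Proof. by rewrite -nc_gt0 nc_cexp expR_gt0. Qed.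

Lemma cexpN z : cexp (- z) = (cexp z)^-1.
Proof.
apply: (mulIf (cexp_neq0 z)); rewrite -cexpD addNr cexp0 mulVf//; exact: cexp_neq0.
Qed.

Lemma cexpMn z n : cexp (z * n%:R) = cexp z ^+ n.
Proof.
elim: n => [|n IH]; first by rewrite mulr0 cexp0 expr0.
by rewrite -natr1 mulrDr mulr1 cexpD IH exprSr.
Qed.

Lemma real_slope (f : R -> R) x d : is_derive x 1 f d ->
  forall e, 0 < e -> exists2 r, 0 < r & forall h, `|h| < r ->
    `|f (x + h) - f x - d * h| <= e * `|h|.
Proof.
move=> fd e e0; have cf : derivable f x 1 by apply: ex_derive.
have fdE : 'D_1 f x = d by apply: derive_val.
have /cvgrPdist_le/(_ _ e0) : (fun h => h^-1 *: ((f \o shift x) (h *: 1) - f x)) @ 0^' --> d.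
  by rewrite -fdE; exact: cf.
move=> [r /= r0 H]; exists r => // h hr.
have [->|h0] := eqVneq h 0; first by rewrite addr0 subrr mulr0 subrr normr0 mulr0.
have := H h; rewrite /= sub0r normrN => /(_ hr h0).
rewrite /GRing.scale /= mulr1 => H1.
have -> : f (x + h) - f x - d * h = - ((d - h^-1 * (f (h + x) - f x)) * h).
  by rewrite (addrC h x); field.
by rewrite normrN normrM ler_wpM2r.
Qed.

Lemma cdiff_cexp0 : cdiff (@cexp R) 0 1.
Proof.
(* Six is the sum 1 + 4 + 1 of the coefficients of the three error terms below. *)
apply/cdiffP => e e0.
have [d [d0 d6 d1]] : exists d, [/\ 0 < d, d <= e / 6 & d <= 1].
  by exists (Num.min (e / 6) 1); split; rewrite ?lt_min ?divr_gt0 ?ge_min ?lexx ?orbT//=.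
have [r1 r10 H1] := real_slope (is_derive_expR 0) d0.
have [r2 r20 H2] := real_slope (is_derive_cos 0) d0.
have [r3 r30 H3] := real_slope (is_derive_sin 0) d0.
exists (Num.min d (Num.min r1 (Num.min r2 r3))); first by rewrite !lt_min d0 r10 r20 r30.
move=> h; rewrite !lt_min => /and4P[hd h1 h2 h3].
have ah := Re_le_nc h; have bh := Im_le_nc h.
have {}H1 : `|expR (Re h) - 1 - Re h| <= d * `|Re h|.
  by have := H1 (Re h) (le_lt_trans ah h1); rewrite add0r expR0 [1 * Re h]mul1r.
have {}H2 : `|cos (Im h) - 1| <= d * `|Im h|.
  by have := H2 (Im h) (le_lt_trans bh h2); rewrite add0r cos0 sin0 oppr0 [0 * Im h]mul0r subr0.
have {}H3 : `|sin (Im h) - Im h| <= d * `|Im h|.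
  by have := H3 (Im h) (le_lt_trans bh h3); rewrite add0r cos0 sin0 [1 * Im h]mul1r subr0.
rewrite add0r cexp0 [1 * h]mul1r.
set a := Re h in ah H1; set b := Im h in bh H2 H3; set n := nc h in ah bh hd *.
have n0 : 0 <= n by exact: nc_ge0.
have a1 : `|a| <= 1 by lra.
(* Isolates the first-order errors of the real exponential, of cosine and of sine; what is left, i a
   b, is quadratic. *)
have E : cexp h - 1 - h =
    (expR a - 1 - a)%:C * (cos b +i* sin b) +
    (1 + a)%:C * ((cos b - 1)%:C + 'i * (sin b - b)%:C) + 'i * (a * b)%:C.
  rewrite [LHS]complex_eta [RHS]complex_eta !(ReD, ImD, ReM, ImM, ReN, ImN) /= -/a -/b.
  by congr (_ +i* _); ring.
rewrite E; apply: (le_trans (le_ncD _ _)).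
have t1 : nc ((expR a - 1 - a)%:C * (cos b +i* sin b)) <= d * n.
  rewrite ncM nc_real [X in _ * X](_ : _ = 1) ?mulr1; last by rewrite /= cos2Dsin2 sqrtr1.
  by apply: (le_trans H1); rewrite ler_wpM2l// ltW.
have t2 : nc ((1 + a)%:C * ((cos b - 1)%:C + 'i * (sin b - b)%:C)) <= 2 * (2 * (d * n)).
  rewrite ncM nc_real; apply: ler_pM; rewrite ?nc_ge0//.
    by apply: (le_trans (ler_normD _ _)); rewrite normr1; lra.
  apply: (le_trans (le_ncD _ _)); rewrite ncM nc_i mul1r !nc_real mulr_natl mulr2n.
  by apply: lerD; [apply: (le_trans H2)|apply: (le_trans H3)]; rewrite ler_wpM2l// ltW.
have t3 : nc ('i * (a * b)%:C) <= d * n.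
  rewrite ncM nc_i mul1r nc_real normrM; apply: ler_pM => //.
  by apply: (le_trans ah); exact: ltW.
have := le_ncD ((expR a - 1 - a)%:C * (cos b +i* sin b))
  ((1 + a)%:C * ((cos b - 1)%:C + 'i * (sin b - b)%:C)).
have dn : 6 * (d * n) <= e * n by rewrite mulrA ler_wpM2r//; lra.
move: t1 t2 t3 dn; move: (nc _) (nc _) (nc _) (nc _) (d * n) (e * n) => ? ? ? ? ? ?; lra.
Qed.

Lemma cdiff_cexp z : cdiff (@cexp R) z (cexp z).
Proof.
have H : cdiff (fun w => cexp z * cexp (w - z)) z (cexp z * 1).
  by apply/cdiff_cstM/cdiff_shift; rewrite subrr; exact: cdiff_cexp0.
rewrite mulr1 in H; apply: cdiff_ext H _; exists 1 => // w _.
by rewrite -cexpD addrC subrK.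
Qed.

Lemma cdiff_cexp_lin l z : cdiff (fun w => cexp (l * w)) z (l * cexp (l * z)).
Proof.
rewrite mulrC; apply: (@cdiff_comp _ (@cexp R) (fun w => l * w)); last exact: cdiff_cexp.
by have := cdiff_cstM l (cdiff_id z); rewrite mulr1.
Qed.

Lemma cexp_log z : z != 0 -> exists w, cexp w = z.
Proof.
move=> z0; have n0 : 0 < nc z by rewrite nc_gt0.
pose a := Re z / nc z; pose b := Im z / nc z.
have ab : a ^+ 2 + b ^+ 2 = 1.
  rewrite /a /b !exprMn -mulrDl -nc_sqr -exprMn divff ?expr1n//; exact: lt0r_neq0.
have a1 : -1 <= a <= 1 by rewrite -ler_norml -(@ler_pXn2r _ 2)// ?nnegrE// expr1n real_normK ?num_real// -ab lerDl sqr_ge0.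
have sa : sin (acos a) = `|b|.
  by rewrite sin_acos// -sqrtr_sqr; congr Num.sqrt; rewrite -ab; ring.
have [t [ct st]] : exists t, cos t = a /\ sin t = b.
  have ca : cos (acos a) = a by apply: acosK; rewrite in_itv.
  (* The arccosine fixes the argument up to sign, and the sign of the imaginary part decides. *)
  have [b0|b0] := leP 0 b; first by exists (acos a); rewrite sa ger0_norm.
  by exists (- acos a); rewrite cosN sinN sa ltr0_norm// opprK.
exists (ln (nc z) +i* t); rewrite /cexp /= lnK ?posrE// ct st.
rewrite [LHS]complex_eta ReM ImM /= !mul0r subr0 addr0 /a /b.
by rewrite [RHS]complex_eta; congr (_ +i* _); rewrite mulrC divfK// gt_eqF.
Qed.

Lemma cexp_twopii : cexp twopii = 1 :> R[i].
Proof.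
by rewrite /twopii /cexp /= expR0 mul1r mulr_natl cos2pi sin2pi.
Qed.

Lemma cexp_twopii_int (n : int) : cexp (n%:~R * twopii) = 1 :> R[i].
Proof.
have nat (m : nat) : cexp (m%:R * twopii) = 1 :> R[i].
  by rewrite mulrC cexpMn cexp_twopii expr1n.
case: n => n; first exact: nat.
by rewrite NegzE rmorphN mulNr cexpN [_ * _](_ : _ = n.+1%:R * twopii)// nat invr1.
Qed.

(** The real part vanishes by taking moduli. Subtracting a multiple of the period puts the imaginary
    part in [0, 2 pi), where cosine is 1 only at 0, by the half-angle formula. *)
Lemma cexp_eq1 z : cexp z = 1 -> exists n : int, z = n%:~R * twopii.
Proof.
move=> z1; have pi2 : 0 < 2 * pi by rewrite mulr_gt0 ?pi_gt0.
have Rz : Re z = 0.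
  by have := nc_cexp z; rewrite z1 nc1 => /(congr1 (@ln R)); rewrite ln1 expRK.
pose n := Num.floor (Im z / (2 * pi)).
exists n; pose v := z - n%:~R * twopii.
have nI : n%:~R * twopii = 0 +i* (n%:~R * (2 * pi)) :> R[i].
  rewrite /twopii -(rmorph_int (real_complex R)) [LHS]complex_eta ReM ImM /=.
  by congr (_ +i* _); ring.
have v1 : cexp v = 1.
  by rewrite /v -mulNr -rmorphN cexpD cexp_twopii_int z1 mulr1.
have Rv : Re v = 0 by rewrite /v ReD ReN nI /= Rz subr0.
have Iv : 0 <= Im v < 2 * pi.
  have /andP[f1 f2] := floor_itv (Im z / (2 * pi)).
  rewrite /v ImD ImN nI /=; apply/andP; split.
    by rewrite subr_ge0 -ler_pdivlMr.
  by rewrite ltrBlDr -[X in X + _]mul1r -mulrDl -ltr_pdivrMr// addrC -intrD1.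
have : cos (Im v) = 1.
  by move/(congr1 Re): v1; rewrite /cexp Rv expR0 mul1r.
have [v0|v0] := eqVneq (Im v) 0.
  by move=> _; apply/eqP; rewrite -subr_eq0 -/v [v]complex_eta Rv v0.
move=> c1; exfalso; move: Iv => /andP[Iv1 Iv2].
have s0 : 0 < sin (Im v / 2).
  have Iv0 : 0 < Im v by rewrite lt_neqAle eq_sym v0.
  by apply: sin_gt0_pi; apply/andP; split; lra.
have : cos (Im v) = 1 - 2 * sin (Im v / 2) ^+ 2.
  rewrite {1}(_ : Im v = (Im v / 2) *+ 2); last by rewrite -mulr_natr; field.
  by rewrite cos_mulr2n cos2sin2; ring.
rewrite c1; have := exprn_gt0 2 s0; lra.
Qed.

(** e^{tx} is the cube of e^{tx/3} >= 1 + tx/3. Of the three powers of 1 + x, one pays for 1 + |sg|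
    in [kernel_le] and two for the integrable majorant [cauchy]. *)
Lemma expR_decay t : 0 < t -> exists2 K, 0 <= K &
  forall x, 0 <= x -> expR (- (t * x)) * (1 + x) ^+ 3 <= K.
Proof.
move=> t0; pose M := 1 + 3 / t; have M0 : 0 < M by rewrite ltr_wpDr ?divr_ge0 ?ltW.
exists (M ^+ 3); first by rewrite exprn_ge0// ltW.
move=> x x0; rewrite expRN mulrC ler_pdivrMr ?expR_gt0//.
have -> : expR (t * x) = expR (t * x / 3) ^+ 3.
  rewrite -expRM_natl; congr expR; by field.
rewrite -exprMn ler_pXn2r ?nnegrE ?addr_ge0 ?mulr_ge0 ?(ltW M0) ?expR_ge0//.
apply: (@le_trans _ _ (M * (1 + t * x / 3))).
  rewrite /M; have -> : (1 + 3 / t) * (1 + t * x / 3) = 1 + x + (t * x / 3 + 3 / t).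
    by field; rewrite gt_eqF.
  have p1 : 0 <= t * x / 3 by apply: divr_ge0 => //; apply: mulr_ge0 => //; exact: ltW.
  have p2 : 0 <= 3 / t by apply: divr_ge0 => //; exact: ltW.
  by lra.
by rewrite ler_wpM2l ?(ltW M0)// expR_ge1Dx.
Qed.

End ComplexExponential.

(** * An integrable majorant for kernels, and measurability of step functions *)

Section NeumannInverse.
Context {R : realType}.
Local Notation nc := (@ComplexField.Normc.normc R).
Local Notation mu := (@lebesgue_measure R).
Local Notation TR := (measurableTypeR R).
Local Notation Re := (@complex.Re R).
Local Notation Im := (@complex.Im R).
Local Notation pi := (@trigo.pi R).
Implicit Types (c x y e r s t alpha : R) (a b z w l u lam : R[i]) (f g fd gd : R[i] -> R[i]).
Implicit Types (h sg k : R -> R[i]) (kap v : R -> R) (m n : nat).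

Lemma integral_exhaust v (B : R) : continuous v -> (forall x, 0 <= v x) ->
  (forall n, \int[mu]_(x in `[(- n%:R), n%:R]) v x <= B) ->
  (\int[mu]_x (v x)%:E <= B%:E)%E.
Proof.
move=> cv v0 vB; pose F n : set TR := `[(- n%:R)%R, n%:R%R]%classic.
have mv : measurable_fun [set: TR] ((EFin \o v) : TR -> \bar R).
  by apply/measurable_EFinP; exact: continuous_measurable_fun.
have := @ge0_nondecreasing_set_cvg_integral _ TR R F (EFin \o v) mu.
move=> /(_ _ _ _ _)/wrap[].
- move=> n m nm; apply/subsetPset => t; rewrite /F /= !in_itv/= => /andP[t1 t2].
  have nm' : n%:R <= m%:R :> R by rewrite ler_nat.
  by apply/andP; split; lra.
- by move=> n; exact: measurable_itv.
- by move=> n; exact: measurable_funTS.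
- by move=> n t _; rewrite lee_fin.
move=> H.
have -> : (\int[mu]_x (v x)%:E = \int[mu]_(t in \bigcup_n F n) (v t)%:E)%E.
  congr integral; apply/esym/seteqP; split => // t _.
  exists (Num.bound `|t|) => //=; rewrite /F /= in_itv/= -ler_norml.
  exact/ltW/archi_boundP.
apply: (cvge_le _ H); apply: nearW => n /=.
have ii : mu.-integrable (F n) (EFin \o v).
  apply: continuous_compact_integrable; first exact: segment_compact.
  exact: continuous_subspaceT.
have := vB n; rewrite /Rintegral -lee_fin fineK//.
exact: integrable_fin_num.
Qed.

Definition cauchy c x : R := (x ^+ 2 + c ^+ 2)^-1.

Lemma cauchy_den c x : 0 < c -> 0 < x ^+ 2 + c ^+ 2.
Proof. by move=> c0; rewrite ltr_wpDl ?sqr_ge0 ?exprn_gt0. Qed.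

Lemma cauchy_ge0 c x : 0 <= cauchy c x.
Proof. by rewrite invr_ge0 addr_ge0 ?sqr_ge0. Qed.

Lemma continuous_cauchy c : 0 < c -> continuous (cauchy c).
Proof.
move=> c0 x; apply: cvgV; first by rewrite gt_eqF// cauchy_den.
by apply: cvgD; [exact: exprn_continuous|exact: cvg_cst].
Qed.

Lemma integral_cauchy c : 0 < c -> (\int[mu]_x (cauchy c x)%:E <= (pi / c)%:E)%E.
Proof.
move=> c0; apply: integral_exhaust; [exact: continuous_cauchy|exact: cauchy_ge0|].
move=> n; pose u : R -> R := c^-1 \*: (fun x : R => atan (c^-1 * x)).
have du x : is_derive x 1 u (cauchy c x).
  have dl : is_derive x 1 (fun x : R => c^-1 * x) c^-1.
    by apply: is_derive_eq; rewrite -[RHS]mulr1.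
  have da := is_derive1_atan (c^-1 * x).
  apply: is_derive_eq (is_deriveZ _ (is_derive1_comp da dl)) _.
  rewrite /cauchy /GRing.scale /=; field.
  by rewrite (gt_eqF c0) !gt_eqF// ?cauchy_den// addrC cauchy_den.
have E : \int[mu]_(x in `[(- n%:R), n%:R]) cauchy c x = u n%:R - u (- n%:R).
  apply: real_FTC => //; first by apply: (@le_trans _ _ 0); rewrite ?oppr_le0 ?ler0n.
  by move=> x _; exact: continuous_cauchy.
rewrite E /u /= -scalerBr [leRHS]mulrC; apply: ler_wpM2l; first by rewrite invr_ge0 ltW.
have := atan_ltpi2 (c^-1 * n%:R); have := atan_gtNpi2 (c^-1 * - n%:R); lra.
Qed.

Lemma integrable_cauchy c (K : R) : 0 < c ->
  mu.-integrable setT (EFin \o (fun x => K * cauchy c x)).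
Proof.
move=> c0; apply: integrableZR => //; apply/integrableP; split.
  by apply/measurable_EFinP; apply: continuous_measurable_fun; exact: continuous_cauchy.
apply: le_lt_trans (ltry (pi / c)); apply: le_trans (integral_cauchy c0).
rewrite le_eqVlt; apply/orP; left; apply/eqP; apply: eq_integral => x _.
by rewrite /= ger0_norm// cauchy_ge0.
Qed.

(** The level sets of the integer part are intervals; the one for 0 contains all negative reals. *)
Lemma measurable_truncn (phi : nat -> R) :
  measurable_fun [set: TR] ((fun s => phi (Num.truncn s)) : TR -> TR).
Proof.
move=> _ Y mY; rewrite setTI.
rewrite (_ : _ @^-1` Y = \bigcup_(n in [set n | Y (phi n)])
    (if n is 0%N then `]-oo, 1%R[%classic else `[n%:R, n.+1%:R[%classic)).
  apply: bigcup_measurable => n _.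
  by case: n => [|n]; exact: measurable_itv.
apply/seteqP; split => [s /= Ys|s [n /= Yn]].
  exists (Num.truncn s) => //; case E: (Num.truncn s) => [|n] /=; rewrite in_itv/=.
    by have := truncnS_gt s; rewrite E.
  by rewrite -truncn_gt_nat E ltnSn -E truncnS_gt.
case: n Yn => [|n] Yn /=; rewrite in_itv/= => sn.
  by rewrite (_ : Num.truncn s = 0%N)//; apply/truncn0Pn; rewrite -ltNge.
have -> : Num.truncn s = n.+1 by exact: truncn_def.
by [].
Qed.

End NeumannInverse.

(** * The Neumann series as an average of translates *)

Section Neumann.
Context {R : realType}.
Local Notation nc := (@ComplexField.Normc.normc R).
Local Notation mu := (@lebesgue_measure R).
Local Notation TR := (measurableTypeR R).
Local Notation Re := (@complex.Re R).
Local Notation Im := (@complex.Im R).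
Implicit Types (c x y e r s t alpha : R) (a b z w l u lam : R[i]) (f g fd gd : R[i] -> R[i]).
Implicit Types (h sg k : R -> R[i]) (kap v : R -> R) (m n : nat).

Lemma cI_shift c h : cintegrable setT h -> cI setT (fun s => h (s + c)) = cI setT h.
Proof.
by move=> [hr hi]; rewrite /cI; congr (_ +i* _);
  [exact: (Rintegral_shift c hr)|exact: (Rintegral_shift c hi)].
Qed.

Lemma cintegrable_shift c h : cintegrable setT h -> cintegrable setT (fun s => h (s + c)).
Proof.
by move=> [hr hi]; split; [exact: (integrable_shift c hr)|exact: (integrable_shift c hi)].
Qed.

Lemma cI_indic (p q : R) l : p <= q ->
  cintegrable setT (fun s => (p <= s < q)%R%:R%:C * l) /\
  cI setT (fun s => (p <= s < q)%R%:R%:C * l) = (q - p)%:C * l.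
Proof.
move=> pq; pose I : set TR := `[p, q[%classic.
have iI M : mu.-integrable setT (EFin \o (fun s => (p <= s < q)%R%:R * M)).
  have mI : measurable I by exact: measurable_itv.
  have i0 : mu.-integrable I (EFin \o (fun=> M)).
    apply: (integrableS _ mI _ (integrable_itv_cst p q M)); first exact: measurable_itv.
    by move=> s; rewrite /I /= !in_itv/= => /andP[s1 s2]; rewrite s1 ltW.
  rewrite (_ : EFin \o _ = (EFin \o (fun=> M)) \_ I).
    by have [H _] := integrable_mkcond (mu := mu) (EFin \o (fun=> M)) mI; exact: H.
  apply/funext => s; rewrite patchE /I /=; case: ifPn; rewrite ?in_setE ?notin_setE /= in_itv/=.
    by move=> ->; rewrite mul1r.
  by move=> /negP/negbTE ->; rewrite mul0r.
have RI M : \int[mu]_s ((p <= s < q)%R%:R * M) = (q - p) * M.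
  have -> : \int[mu]_s ((p <= s < q)%R%:R * M) = \int[mu]_(s in I) M.
    rewrite /Rintegral [in RHS]integral_mkcond; congr fine; apply: eq_integral => s _.
    rewrite patchE /I /=; case: ifPn; rewrite ?in_setE ?notin_setE /= in_itv/=.
      by move=> ->; rewrite mul1r.
    by move=> /negP/negbTE ->; rewrite mul0r.
  rewrite Rintegral_cst//=; last exact: measurable_itv.
  rewrite /I lebesgue_measure_itv/= lte_fin; move: pq; rewrite le_eqVlt => /predU1P[->|->].
    by rewrite ltxx subrr mulr0 mul0r.
  by rewrite mulrC.
split; first split.
- apply: eq_integrable (iI (Re l)) => // s _ /=; congr EFin.
  by rewrite ReM /= mul0r subr0.
- apply: eq_integrable (iI (Im l)) => // s _ /=; congr EFin.
  by rewrite ImM /= mul0r addr0.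
rewrite /cI [RHS]complex_eta ReM ImM /= !mul0r subr0 addr0 -!RI; congr (_ +i* _);
  by apply: eq_Rintegral => s _; rewrite (ReM, ImM) /= !mul0r ?subr0 ?addr0.
Qed.

(** With [neumann_k], encodes the series of the terms - lam^-(n + 1) f(z + n w0) as the integral
    over s >= 0 of a step function with one step for each n. *)
Definition neumann_sg w0 s : R[i] := (Num.truncn s)%:R * w0.

Definition neumann_k lam s : R[i] := (0 <= s)%R%:R%:C * (- lam ^- (Num.truncn s).+1).

Lemma neumann_kernel w0 lam : 0 <= Im w0 -> 1 < nc lam ->
  exists K, kernel_le (neumann_sg w0) (neumann_k lam) (fun s => K * cauchy 1 s).
Proof.
move=> w00 l1; pose t := ln (nc lam); have t0 : 0 < t by rewrite ln_gt0.
have n0 : 0 < nc lam by exact: lt_trans l1.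
have [K K0 H] := expR_decay t0.
exists ((1 + nc w0) * K); split.
- split; first exact: (measurable_truncn (fun n => Re (n%:R * w0))).
  exact: (measurable_truncn (fun n => Im (n%:R * w0))).
- apply: cmeasM.
    split; last exact: measurable_cst.
    apply: measurable_nat_bool; apply: measurable_fun_ler => //; exact: measurable_cst.
  split; first exact: (measurable_truncn (fun n => Re (- lam ^- n.+1))).
  exact: (measurable_truncn (fun n => Im (- lam ^- n.+1))).
- exact: integrable_cauchy.
- move=> s; rewrite /neumann_sg -(rmorph_nat (real_complex R)) ImM /= mul0r addr0.
  exact: mulr_ge0.
move=> s; rewrite /neumann_k ncM nc_real normr_nat.
have [s0|_] := leP 0 s; last first.
  by rewrite mul0r mul0r; apply: mulr_ge0; [apply: mulr_ge0 => //; apply: addr_ge0 => //; exact: nc_ge0|exact: cauchy_ge0].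
rewrite mul1r ncN ncV ncX /neumann_sg ncM nc_nat.
have /andP[n1 n2] := truncn_itv s0; set n := Num.truncn s in n1 n2 *.
have E : (nc lam ^+ n.+1)^-1 = expR (- (t * n.+1%:R)).
  by rewrite expRN mulrC expRM_natl /t lnK ?posrE.
have e1 : expR (- (t * n.+1%:R)) <= expR (- (t * s)).
  by rewrite ler_expR lerN2; apply: ler_wpM2l; exact: ltW.
have e2 : 1 + n%:R * nc w0 <= (1 + nc w0) * (1 + s).
  have := ler_wpM2r (nc_ge0 w0) n1; have := mulr_ge0 (nc_ge0 w0) s0; have := nc_ge0 w0; nra.
have e3 : expR (- (t * s)) * (1 + s) <= K * cauchy 1 s.
  have := H s s0; rewrite /cauchy expr1n => Hs.
  have q0 : 0 < s ^+ 2 + 1 by rewrite ltr_wpDl ?sqr_ge0.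
  rewrite ler_pdivlMr//; apply: le_trans Hs.
  rewrite -mulrA; apply: ler_wpM2l; first exact: expR_ge0.
  rewrite (exprS _ 2); apply: ler_wpM2l; first exact: addr_ge0.
  by nra.
rewrite E -mulrA; apply: (@le_trans _ _ (expR (- (t * s)) * ((1 + nc w0) * (1 + s)))).
  apply: ler_pM => //.
  by apply: addr_ge0 => //; apply: mulr_ge0 => //; exact: nc_ge0.
rewrite mulrCA; apply: ler_wpM2l => //; apply: addr_ge0 => //; exact: nc_ge0.
Qed.

(** Replacing s by s + 1 sends each term to the next one and divides it by lam; the interval [-1, 0)
    then carries the term n = 0, which is - lam^-1 f z. *)
Lemma neumann_conv alpha w0 lam f fd z : -1 < alpha -> 0 <= Im w0 -> 1 < nc lam ->
  indir alpha f fd -> 0 < Im z ->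
  conv (neumann_sg w0) (neumann_k lam) f (z + w0) -
    lam * conv (neumann_sg w0) (neumann_k lam) f z = f z.
Proof.
move=> al w00 l1 Hf z0; have [K HK] := neumann_kernel w00 l1.
have lam0 : lam != 0 by rewrite -nc_gt0; exact: lt_trans l1.
have zw0 : 0 < Im (z + w0) by rewrite ImD ltr_pwDl.
have I1 := conv_fint al HK Hf z0; have I2 := conv_fint al HK Hf zw0.
set H := (fun s => f (z + neumann_sg w0 s) * neumann_k lam s) in I1.
have [I3 E3] := cI_indic (- lam^-1 * f z) (lerN10 R : -1 <= 0).
have HE s : H (s + 1) = lam^-1 * (f (z + w0 + neumann_sg w0 s) * neumann_k lam s) +
    (-1 <= s < 0)%R%:R%:C * (- lam^-1 * f z).
  rewrite /H /neumann_sg /neumann_k.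
  have [s0|s0] := leP 0 s.
    have -> : Num.truncn (s + 1) = (Num.truncn s).+1.
      have /andP[n1 n2] := truncn_itv s0; apply: truncn_def.
      by rewrite -!natr1 lerD2r ltrD2r n1 natr1 n2.
    rewrite (_ : 0 <= s + 1) ?addr_ge0//= andbF mul0r addr0 !mul1r.
    rewrite -natr1 mulrDl mul1r addrA (addrAC z).
    by rewrite (exprS _ (Num.truncn s).+1) invfM; ring.
  have [s1|s1] := leP (-1) s.
    have -> : Num.truncn (s + 1) = 0%N by apply/truncn0Pn; rewrite -ltNge; lra.
    rewrite (_ : 0 <= s + 1) ?(_ : true = true)//=; last by lra.
    by rewrite !mul0r mulr0 addr0 mulr0 add0r !mul1r expr1; ring.
  rewrite (_ : (0 <= s + 1) = false); last by apply/negbTE; rewrite -ltNge; lra.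
  by rewrite /= !mul0r !mulr0 addr0.
have : cI setT H = lam^-1 * conv (neumann_sg w0) (neumann_k lam) f (z + w0) - lam^-1 * f z.
  rewrite -(cI_shift 1 I1) (eq_cI (g := fun s => lam^-1 * (f (z + w0 + neumann_sg w0 s) * neumann_k lam s) +
    (-1 <= s < 0)%R%:R%:C * (- lam^-1 * f z))); last by move=> s _; exact: HE.
  rewrite cID//; last exact: cintegrableZ.
  by rewrite cIZ// E3 opprK add0r mul1r mulNr.
rewrite -/(conv (neumann_sg w0) (neumann_k lam) f z) => ->.
by field.
Qed.

Section Spectrum.
Variables (tau : half_plane R -> half_plane R) (w0 : R[i]) (alpha : R).
Hypothesis al : -1 < alpha.
Hypothesis htau : parabolic_self_map tau w0.

Let D := @dirichlet_space R alpha.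
Let nrm := @dirichlet_norm R alpha.
Let C := @composition_operator R tau.

Lemma invertible_gt1 lam : 1 < nc lam -> invertible D nrm (shift_op C lam).
Proof.
move=> l1; have [K HK] := neumann_kernel (parabolic_im htau) l1.
apply: (kernel_invertible (a := 1) (b := 0) (u := 0) al htau HK) => // f fd Hf z z0.
rewrite /kernel_map !addr0 !mul0r !addr0 !mul1r.
exact: (neumann_conv al (parabolic_im htau) l1 Hf z0).
Qed.

(** A real translation has the translation by - w0 as inverse. For lam = 0 this is the answer;
    otherwise C - lam = - lam C (C^-1 - lam^-1), and the Neumann series inverts the last factor. *)
Lemma invertible_real lam : Im w0 = 0 -> nc lam < 1 -> invertible D nrm (shift_op C lam).
Proof.
move=> w00 l1; have u0 : 0 <= Im (- w0) by rewrite ImN w00 oppr0.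
have [l0|l0] := eqVneq lam 0.
  apply: (kernel_invertible (a := 0) (b := 1) (u := - w0) al htau kernel_le0) => // f fd Hf z z0.
  by rewrite /kernel_map l0 !mul0r !mul1r !add0r subr0 addrK.
have li1 : 1 < nc lam^-1 by rewrite ncV invf_gt1 ?nc_gt0.
have [K HK] := neumann_kernel u0 li1.
apply: (kernel_invertible (a := - lam^-1) (b := 0) (u := - w0) al htau HK) => // f fd Hf z z0.
rewrite /kernel_map !mul0r !addr0.
have := neumann_conv al u0 li1 Hf z0; rewrite addrK.
set c1 := conv _ _ _ _; set c2 := conv _ _ _ _ => <-.
by field.
Qed.

End Spectrum.

End Neumann.

(** * The contour kernel: poles, residue and decay *)

Section ContourKernel.
Context {R : realType}.
Local Notation nc := (@ComplexField.Normc.normc R).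
Local Notation mu := (@lebesgue_measure R).
Local Notation TR := (measurableTypeR R).
Local Notation Re := (@complex.Re R).
Local Notation Im := (@complex.Im R).
Local Notation pi := (@trigo.pi R).
Implicit Types (c x y e r s t alpha : R) (z w l u lam : R[i]) (f g fd gd : R[i] -> R[i]).
Implicit Types (h sg k : R -> R[i]) (kap v : R -> R) (m n : nat).

Lemma Rintegral_tail v : mu.-integrable setT (EFin \o v) -> forall e, 0 < e ->
  exists N : nat, forall n, (N <= n)%N ->
    `|\int[mu]_s v s - \int[mu]_(s in `[(- n%:R), n%:R]) v s| <= e.
Proof.
move=> iv e e0; have ia := integrable_abse iv.
have /integrableP[/measurable_EFinP mv vfin] := iv.
have mabs : measurable_fun [set: TR] (fun s : TR => `|s| : TR) by exact: normr_measurable.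
have mav : measurable_fun [set: TR] (fun s : TR => `|v s| : TR).
  exact: (measurableT_comp (@normr_measurable R setT) mv).
have av0 s : 0 <= `|v s| by exact: normr_ge0.
have [N HN] := tail_small mav mabs av0 vfin e0.
exists N => n Nn; pose I : set TR := `[(- n%:R), n%:R]%classic.
have mI : measurable I by exact: measurable_itv.
have iI : mu.-integrable setT (EFin \o (v \_ I)).
  rewrite (_ : EFin \o _ = (EFin \o v) \_ I); last first.
    by apply/funext => s; rewrite /= !patchE; case: ifP.
  have [H _] := integrable_mkcond (mu := mu) (EFin \o v) mI; apply: H.
  exact: (integrableS measurableT mI _ iv).
have -> : \int[mu]_(s in `[(- n%:R), n%:R]) v s = \int[mu]_s (v \_ I) s.
  rewrite /Rintegral [in LHS]integral_mkcond; congr fine; apply: eq_integral => s _.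
  by rewrite !patchE; case: ifP.
have iB : mu.-integrable setT (EFin \o (fun s => v s - (v \_ I) s)).
  by apply: eq_integrable (integrableB measurableT iv iI).
rewrite -RintegralB//; apply: (le_trans (le_normr_Rintegral _ iB)) => //.
rewrite /Rintegral -lee_fin fineK; last first.
  by apply: integrable_fin_num => //; exact: (integrable_abse iB).
apply: (le_trans _ (ltW HN)); apply: ge0_leR.
- by apply: (measurableT_comp (@normr_measurable R setT)); have /integrableP[/measurable_EFinP] := iB.
- apply: measurable_funM => //; apply: measurable_nat_bool.
  by apply: measurable_fun_ler => //; exact: measurable_cst.
- by [].
- move=> s; rewrite patchE; case: ifPn => [_|]; first by rewrite subrr normr0 mulr_ge0.
  rewrite notin_setE /I /= in_itv/= -ler_norml => /negP; rewrite -ltNge => ns.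
  rewrite subr0 (_ : (N%:R <= `|s|) = true) ?mul1r//.
  by apply: le_trans (ltW ns); rewrite ler_nat.
Qed.

Lemma cI_tail h : cintegrable setT h -> forall e, 0 < e ->
  exists N : nat, forall n, (N <= n)%N ->
    nc (cI setT h - cI `[(- n%:R), n%:R] h) <= e.
Proof.
move=> [hr hi] e e0; have e20 : 0 < e / 2 by rewrite divr_gt0.
have [N1 H1] := Rintegral_tail hr e20; have [N2 H2] := Rintegral_tail hi e20.
exists (maxn N1 N2) => n; rewrite geq_max => /andP[/H1 h1 /H2 h2].
apply: (le_trans (nc_le_ReIm _)); rewrite /cI !ReD !ImD ReN ImN /=.
by move: h1 h2; rewrite /=; lra.
Qed.

Section Kernel.
Variables (w0 c0 : R[i]).
Let a := Re w0.
Let b := Im w0.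
Hypothesis b0 : 0 < Im w0.

Let nw0 : w0 != 0.
Proof. by apply: contraTneq b0 => ->; rewrite ltxx. Qed.

Let n0 : 0 < nc w0. Proof. by rewrite nc_gt0. Qed.

(** The real part of 2 pi i / w0, which is the exponential growth rate of |contour_q| in the real
    direction. *)
Definition contour_period : R := 2 * pi * Im w0 / nc w0 ^+ 2.

Hypothesis c00 : 0 < Re c0.
Hypothesis c0P : Re c0 < contour_period.

Definition contour_q z := cexp (twopii / w0 * z).

(** The poles are the integer multiples of [w0], of which only [w0] lies in the strip from Im w0 / 2
    to 3 Im w0 / 2. The bounds 0 < Re c0 < contour_period make the kernel decay at both ends of the
    strip, and translation by [w0] multiplies it by e^{c0 w0}. *)
Definition contour_k z := cexp (c0 * z) / (contour_q z - 1).

Let th := 2 * pi / nc w0 ^+ 2.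

Lemma Re_contour z : Re (twopii / w0 * z) = th * (b * Re z - a * Im z).
Proof.
have n2 : nc w0 ^+ 2 != 0 by rewrite expf_neq0// gt_eqF.
have -> : twopii / w0 = (th * b) +i* (th * a).
  apply: (mulIf nw0); rewrite divfK// [RHS]complex_eta ReM ImM /= /twopii -/a -/b.
  congr (_ +i* _); first by ring.
  rewrite /th (_ : 2 * pi / _ * b * b + _ = 2 * pi / nc w0 ^+ 2 * (a ^+ 2 + b ^+ 2)); last by ring.
  by rewrite /a /b -nc_sqr divfK.
by rewrite ReM /=; ring.
Qed.

Lemma contour_q_eq1 z : b / 2 <= Im z <= 3 * b / 2 -> contour_q z = 1 -> z = w0.
Proof.
move=> /andP[z1 z2] /cexp_eq1[n]; have tp := @twopii_neq0 R.
have H : z = w0 * (twopii / w0 * z) / twopii.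
  by rewrite -!mulrA mulVKf// mulrAC mulfV// mul1r || (field; rewrite nw0 tp).
move=> E; rewrite E in H; have {}H : z = n%:~R * w0 by rewrite H; field.
move: z1 z2; rewrite H -(rmorph_int (real_complex R)) ImM /= mul0r addr0 -/b => z1 z2.
have n1 : 0 < n.
  by rewrite -(ltr0z R) -(pmulr_lgt0 _ b0); apply: lt_le_trans z1; rewrite divr_gt0.
have n2 : n < 2.
  rewrite -(ltr_int R) -(ltr_pM2r b0); apply: (le_lt_trans z2).
  by have := b0; rewrite -/b => ?; lra.
have -> : n = 1 by apply/eqP; rewrite eq_le -ltzD1 n2 -gtz0_ge1 n1.
by rewrite mul1r.
Qed.

Lemma cdiff_contour_q z : cdiff contour_q z (twopii / w0 * contour_q z).
Proof. exact: cdiff_cexp_lin. Qed.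

Lemma cdiff_contour_k z : contour_q z != 1 -> exists d, cdiff contour_k z d.
Proof.
move=> qz; have dq : cdiff (fun w => contour_q w - 1) z (twopii / w0 * contour_q z - 0).
  by apply: cdiffB; [exact: cdiff_contour_q|exact: cdiff_cst].
have q1 : contour_q z - 1 != 0 by rewrite subr_eq0.
by eexists; exact: cdiffM (cdiff_cexp_lin c0 z) (cdiffV dq q1).
Qed.

Lemma contour_residue g : ccont g w0 -> forall e, 0 < e -> exists2 r, 0 < r &
  forall w, w != w0 -> nc (w - w0) < r ->
    nc ((w - w0) * (g w * contour_k w) - g w0 * (cexp (c0 * w0) * (w0 / twopii))) <= e.
Proof.
move=> cg; have tp := @twopii_neq0 R; pose d : R[i] := twopii / w0.
have qw0 : contour_q w0 = 1 by rewrite /contour_q divfK// cexp_twopii.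
have dq : cdiff contour_q w0 d by have := cdiff_contour_q w0; rewrite qw0 mulr1.
have cs : ccont (fun w => g w * (cexp (c0 * w) * (slope contour_q w0 d w)^-1)) w0.
  apply: ccontM => //; apply: ccontM; first exact: cdiff_cont (cdiff_cexp_lin c0 w0).
  by apply: ccontV => //; rewrite slopexx mulf_neq0// invr_neq0.
move=> e /cs[r r0 H]; exists r => // w ww wr; have := H w wr.
rewrite slopexx /d invf_div; rewrite (_ : (w - w0) * (g w * contour_k w) =
  g w * (cexp (c0 * w) * (slope contour_q w0 (twopii / w0) w)^-1))//.
by rewrite /slope (negbTE ww) qw0 invf_div /contour_k; ring.
Qed.

(** The slower of the two decay rates, to the left and to the right. *)
Let de := Num.min (Re c0) (contour_period - Re c0).

Let de0 : 0 < de. Proof. by rewrite lt_min c00 subr_gt0. Qed.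

Let th0 : 0 < th. Proof. by rewrite divr_gt0 ?exprn_gt0// mulr_gt0 ?pi_gt0. Qed.

(** To the right |q| is large and the kernel is of the order of e^{c0 z} / q; to the left |q| is
    small and it is of the order of e^{c0 z}. *)
Lemma contour_far : exists X K, [/\ 0 < X, 0 <= K &
  forall z, b / 2 <= Im z <= 3 * b / 2 -> X <= `|Re z| ->
    contour_q z != 1 /\ nc (contour_k z) <= K * expR (- (de * `|Re z|))].
Proof.
pose Y := 3 * b / 2; have Y0 : 0 < Y by rewrite divr_gt0// mulr_gt0.
have bp : 0 < b by exact: b0.
(* Beyond [X] the exponent of |q| has absolute value at least 1, so that |q| >= 2 or |q| <= 1/2, and
   |q - 1| is bounded below accordingly. *)
pose X := (`|a| * Y + 1 / th) / b + 1.
have X0 : 0 < X.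
  rewrite ltr_wpDl// divr_ge0 ?(ltW bp)//; apply: addr_ge0; first by rewrite mulr_ge0// ltW.
  by rewrite divr_ge0// ltW.
pose K := 2 * expR ((th * `|a| + `|Im c0|) * Y).
exists X, K; split=> //; first by rewrite mulr_ge0// expR_ge0.
move=> z /andP[z1 z2] zX; set x := Re z in zX *; set y := Im z in z1 z2.
have y0 : 0 <= y by apply: le_trans z1; rewrite divr_ge0// ltW.
have ay : `|a * y| <= `|a| * Y by rewrite normrM ler_wpM2l// ger0_norm.
have iy : `|Im c0 * y| <= `|Im c0| * Y by rewrite normrM ler_wpM2l// ger0_norm.
have bX : 1 / th + `|a| * Y <= b * `|x|.
  have : b * X <= b * `|x| by rewrite ler_wpM2l// ltW.
  by rewrite /X mulrDr mulrC divfK ?gt_eqF// => h; lra.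
have th1 : th * (1 / th) = 1 by rewrite mul1r mulfV// gt_eqF.
have Rq : Re (twopii / w0 * z) = th * (b * x) - th * (a * y) by rewrite Re_contour; ring.
have tay : `|th * (a * y)| <= th * `|a| * Y.
  by rewrite normrM gtr0_norm// -mulrA ler_wpM2l// ltW.
have Rc : Re (c0 * z) = Re c0 * x - Im c0 * y by rewrite ReM.
have e2 : 2 <= expR 1 :> R by have := @expR_ge1Dx R 1; lra.
have Pth : contour_period = th * b by rewrite /contour_period /th -/b; ring.
have [d1 d2] : de <= Re c0 /\ de <= contour_period - Re c0.
  by rewrite /de !ge_min !lexx orbT.
have nq : nc (contour_q z) = expR (th * (b * x) - th * (a * y)) by rewrite nc_cexp Rq.
have nk : nc (contour_k z) = expR (Re c0 * x - Im c0 * y) / nc (contour_q z - 1).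
  by rewrite /contour_k ncM ncV nc_cexp Rc.
have [x0|x0] := leP 0 x.
  have v1 : 1 <= th * (b * x) - th * (a * y).
    have : th * (1 / th + `|a| * Y) <= th * (b * x).
      by apply: ler_wpM2l; [exact: ltW|rewrite -(ger0_norm x0)].
    by rewrite mulrDr th1; move: tay; rewrite ler_norml => /andP[_ h]; lra.
  have q2 : 2 <= nc (contour_q z) by rewrite nq; apply: (le_trans e2); rewrite ler_expR.
  have qm : nc (contour_q z) / 2 <= nc (contour_q z - 1).
    by have := nc_subl (contour_q z) 1; rewrite nc1; lra.
  have q0 : 0 < nc (contour_q z - 1) by apply: lt_le_trans qm; lra.
  split; first by rewrite -subr_eq0 -nc_gt0.
  rewrite nk ler_pdivrMr//.
  apply: (@le_trans _ _ (K * expR (- (de * `|x|)) * (nc (contour_q z) / 2))); last first.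
    by rewrite ler_wpM2l// !mulr_ge0 ?expR_ge0.
  rewrite nq /K (_ : 2 * _ * _ * (_ / 2) = expR ((th * `|a| + `|Im c0|) * Y) *
    expR (- (de * `|x|)) * expR (th * (b * x) - th * (a * y))); last by field.
  rewrite -!expRD ler_expR (ger0_norm x0).
  have h1 : de * x <= (contour_period - Re c0) * x by rewrite ler_wpM2r.
  rewrite Pth in h1; move: tay iy; rewrite !ler_norml => /andP[t1 t2] /andP[t3 t4].
  rewrite mulrDl; move: h1; rewrite mulrBl -mulrA; lra.
have x0' : `|x| = - x by rewrite ltr0_norm.
have v1 : th * (b * x) - th * (a * y) <= -1.
  have : th * (1 / th + `|a| * Y) <= th * (b * - x).
    by apply: ler_wpM2l; [exact: ltW|rewrite -x0'].
  by rewrite mulrDr th1 !mulrN; move: tay; rewrite ler_norml => /andP[h _]; lra.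
have q2 : nc (contour_q z) <= 1 / 2.
  rewrite nq; apply: (@le_trans _ _ (expR (-1))); first by rewrite ler_expR.
  by rewrite expRN div1r lef_pV2 ?posrE ?expR_gt0.
have qm : 1 / 2 <= nc (contour_q z - 1).
  by have := nc_subl 1 (contour_q z); rewrite nc1 ncB; lra.
have q0 : 0 < nc (contour_q z - 1) by apply: lt_le_trans qm; lra.
split; first by rewrite -subr_eq0 -nc_gt0.
rewrite nk ler_pdivrMr//.
apply: (@le_trans _ _ (K * expR (- (de * `|x|)) * (1 / 2))); last first.
  by rewrite ler_wpM2l// !mulr_ge0 ?expR_ge0.
rewrite /K (_ : 2 * _ * _ * (1 / 2) = expR ((th * `|a| + `|Im c0|) * Y) *
  expR (- (de * `|x|))); last by field.
rewrite -!expRD ler_expR x0'.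
have h1 : de * - x <= Re c0 * - x by rewrite ler_wpM2r// oppr_ge0 ltW.
have h2 : 0 <= th * `|a| * Y.
  by apply: mulr_ge0; [apply: mulr_ge0 => //; exact: ltW|exact: ltW].
move: iy; rewrite !ler_norml => /andP[t3 t4].
rewrite mulrDl; move: h1; rewrite !mulrN; lra.
Qed.

(** Far out, exponential decay beats the polynomial factors, throughout the strip. On its two
    boundary lines, which avoid the pole, the remaining segments are compact. *)
Lemma contour_decay : exists2 K, 0 <= K &
  (forall z, b / 2 <= Im z <= 3 * b / 2 -> Im z = b / 2 \/ Im z = 3 * b / 2 ->
    nc (contour_k z) * (1 + nc z) <= K * cauchy 1 (Re z)) /\
  exists X, forall z, b / 2 <= Im z <= 3 * b / 2 -> X <= `|Re z| ->
    contour_q z != 1 /\ nc (contour_k z) * (1 + nc z) <= K * cauchy 1 (Re z).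
Proof.
have bp : 0 < b by exact: b0.
have [X [K1 [X0 K10 far]]] := contour_far; have [K0 K00 dec] := expR_decay de0.
pose Y := 3 * b / 2; have Y0 : 0 < Y by rewrite divr_gt0// mulr_gt0.
have line y : y = b / 2 \/ y = 3 * b / 2 -> exists B, forall x, - X <= x <= X -> nc (contour_k (x +i* y)) <= B.
  move=> yb; apply: seg_bounded; first by lra.
  move=> x _; apply: ccont_hor.
  have yy : b / 2 <= Im (x +i* y) <= 3 * b / 2 by rewrite /=; case: yb => ->; apply/andP; split; lra.
  have [|d /cdiff_cont//] := @cdiff_contour_k (x +i* y).
  apply/negP => /eqP/(contour_q_eq1 yy)/(congr1 Im) /= E.
  by move: yb; rewrite E -/b; case; lra.
have [B1 H1] := line _ (or_introl erefl); have [B2 H2] := line _ (or_intror erefl).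
have nz z : b / 2 <= Im z <= 3 * b / 2 -> nc z <= `|Re z| + Y.
  move=> /andP[z1 z2]; apply: (le_trans (nc_le_ReIm _)); rewrite lerD2l ger0_norm//.
  by apply: le_trans z1; rewrite divr_ge0// ltW.
pose Ka := K1 * (1 + Y) * K0; pose Kb := (`|B1| + `|B2|) * (1 + X + Y) * (X ^+ 2 + 1).
have Y1 : 0 <= 1 + Y by apply: addr_ge0 => //; exact: ltW.
have Ka0 : 0 <= Ka by apply: mulr_ge0 => //; apply: mulr_ge0.
have Kb0 : 0 <= Kb.
  apply: mulr_ge0; last by apply: addr_ge0 => //; exact: sqr_ge0.
  by apply: mulr_ge0; [exact: addr_ge0|move: X0 Y0; lra].
have cden x : 0 < x ^+ 2 + 1 :> R by rewrite ltr_wpDl ?sqr_ge0.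
have farK z : b / 2 <= Im z <= 3 * b / 2 -> X <= `|Re z| ->
    contour_q z != 1 /\ nc (contour_k z) * (1 + nc z) <= (Ka + Kb) * cauchy 1 (Re z).
  move=> zb zX; have [q1 k1] := far z zb zX; split => //.
  apply: (@le_trans _ _ (Ka * cauchy 1 (Re z))); last first.
    by apply: ler_wpM2r; [exact: cauchy_ge0|rewrite lerDl].
  have := dec _ (normr_ge0 (Re z)); set x := `|Re z| => Hx.
  have x0 : 0 <= x by exact: normr_ge0.
  have xx : (Re z) ^+ 2 = x ^+ 2 by rewrite real_normK// num_real.
  rewrite /cauchy expr1n xx ler_pdivlMr//.
  have n1 : 1 + nc z <= (1 + Y) * (1 + x).
    have := nz z zb; rewrite -/x => ?; have := mulr_ge0 (ltW Y0) x0; nra.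
  have s1 : x ^+ 2 + 1 <= (1 + x) ^+ 2 by nra.
  apply: (@le_trans _ _ ((K1 * expR (- (de * x))) * ((1 + Y) * (1 + x)) * (1 + x) ^+ 2)).
    apply: ler_pM => //; [by rewrite mulr_ge0 ?nc_ge0// addr_ge0 ?nc_ge0|exact: ltW|].
    by apply: ler_pM => //; [exact: nc_ge0|rewrite addr_ge0 ?nc_ge0].
  rewrite /Ka (_ : K1 * _ * _ * _ = K1 * (1 + Y) * (expR (- (de * x)) * (1 + x) ^+ 3)); last by ring.
  by apply: ler_wpM2l => //; exact: mulr_ge0.
exists (Ka + Kb); first exact: addr_ge0.
split; last by exists X.
move=> z zb zl; have [zX|zX] := leP X `|Re z|; first by have [] := farK z zb zX.
apply: (@le_trans _ _ (Kb * cauchy 1 (Re z))); last first.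
  by apply: ler_wpM2r; [exact: cauchy_ge0|rewrite lerDr].
have zX' : - X <= Re z <= X by rewrite -ler_norml ltW.
have kz : nc (contour_k z) <= `|B1| + `|B2|.
  case: zl => zl; have := complex_eta z; rewrite zl => ->.
    by apply: (le_trans (H1 _ zX')); apply: (le_trans (ler_norm B1)); rewrite lerDl.
  by apply: (le_trans (H2 _ zX')); apply: (le_trans (ler_norm B2)); rewrite lerDr.
have nz2 : 1 + nc z <= 1 + X + Y by have := nz z zb; lra.
rewrite /cauchy expr1n ler_pdivlMr//.
apply: ler_pM; [by rewrite mulr_ge0 ?nc_ge0// addr_ge0 ?nc_ge0|exact: ltW| |].
  by apply: ler_pM => //; [exact: nc_ge0|rewrite addr_ge0 ?nc_ge0].
rewrite lerD2r -(real_normK (num_real (Re z))) ler_pXn2r ?nnegrE//; exact: ltW.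
Qed.

End Kernel.

End ContourKernel.

(** * The resolvent inside the unit disc off the spiral *)

Section ContourInverse.
Context {R : realType}.
Local Notation nc := (@ComplexField.Normc.normc R).
Local Notation mu := (@lebesgue_measure R).
Local Notation TR := (measurableTypeR R).
Local Notation Re := (@complex.Re R).
Local Notation Im := (@complex.Im R).
Local Notation pi := (@trigo.pi R).
Implicit Types (c x y e r s t alpha : R) (z w l u lam : R[i]) (f g fd gd : R[i] -> R[i]).
Implicit Types (h sg k : R -> R[i]) (kap v : R -> R) (m n : nat).

Lemma cmeas_pcont h : (forall s, pcont h s) -> cmeas h.
Proof.
by move=> ch; split; apply: continuous_measurable_fun => s; [exact: pcont_Re|exact: pcont_Im].
Qed.

Lemma eps_eq z w : (forall e, 0 < e -> nc (z - w) <= e) -> z = w.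
Proof.
move=> H; apply/eqP; rewrite -subr_eq0 -nc_eq0; apply/eqP/le_anti; rewrite nc_ge0 andbT.
by apply/ler_addgt0Pr => e /H; rewrite add0r.
Qed.

Lemma contour_error (g1 g2 i1 i2 i3 i4 : R[i]) e :
  nc (g1 - i1) <= e / 4 -> nc (g2 - i2) <= e / 4 -> nc i3 <= e / 4 -> nc i4 <= e / 4 ->
  nc (g1 - g2 - (i1 - i2 + 'i * (i3 - i4))) <= e.
Proof.
move=> b1 b2 b3 b4.
have -> : g1 - g2 - (i1 - i2 + 'i * (i3 - i4)) = (g1 - i1) - (g2 - i2) - 'i * (i3 - i4) by ring.
apply: (le_trans (le_ncB _ _)); rewrite ncM nc_i mul1r.
by have := le_ncB (g1 - i1) (g2 - i2); have := le_ncB i3 i4; lra.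
Qed.

Section Kernel.
Variables (w0 c0 : R[i]).
Let a := Re w0.
Let b := Im w0.
Hypothesis b0 : 0 < Im w0.
Hypothesis c00 : 0 < Re c0.
Hypothesis c0P : Re c0 < contour_period w0.

Let nw0 : w0 != 0.
Proof. by apply: contraTneq b0 => ->; rewrite ltxx. Qed.

Definition line_sg y s : R[i] := s +i* y.

Definition line_k y s : R[i] := contour_k w0 c0 (s +i* y).

Let lam := cexp (- (c0 * w0)).

Let lam0 : lam != 0. Proof. exact: cexp_neq0. Qed.

Lemma line_strip y s : y = b / 2 \/ y = 3 * b / 2 -> b / 2 <= Im (s +i* y) <= 3 * b / 2.
Proof.
by have bp : 0 < b := b0; rewrite /=; case=> ->; apply/andP; split; lra.
Qed.

Lemma line_q y s : y = b / 2 \/ y = 3 * b / 2 -> contour_q w0 (s +i* y) != 1.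
Proof.
move=> yb; apply/negP => /eqP/(contour_q_eq1 b0 (line_strip s yb))/(congr1 Im) /= E.
by have bp : 0 < b := b0; move: yb; rewrite E -/b; case; lra.
Qed.

Lemma line_kernel : exists2 K, 0 <= K & forall y, y = b / 2 \/ y = 3 * b / 2 ->
  kernel_le (line_sg y) (line_k y) (fun s => K * cauchy 1 s).
Proof.
have [K K0 [H _]] := contour_decay b0 c00 c0P; exists K => // y yb; split.
- by split; [exact: measurable_id|exact: measurable_cst].
- apply: cmeas_pcont => s; apply: (@ccont_hor R (contour_k w0 c0)).
  by have [d /cdiff_cont] := cdiff_contour_k c0 (line_q s yb).
- exact: integrable_cauchy.
- move=> s; rewrite /line_sg; have /andP[h _] := line_strip s yb.
  by apply: le_trans h; rewrite divr_ge0// ltW.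
- by move=> s; apply: (H (s +i* y)) => //; exact: line_strip.
Qed.

Lemma contour_k_period z : contour_k w0 c0 (z + w0) = lam^-1 * contour_k w0 c0 z.
Proof.
rewrite /contour_k /contour_q !mulrDr !cexpD divfK// cexp_twopii mulr1.
by rewrite /lam cexpN invrK; ring.
Qed.

(** Translation by [w0] carries the lower line onto the upper one, up to the real translation Re w0
    of the parameter, and multiplies the kernel by lam^-1. *)
Lemma contour_shift alpha f fd z : -1 < alpha -> indir alpha f fd -> 0 < Im z ->
  conv (line_sg (b / 2)) (line_k (b / 2)) f (z + w0) =
  lam * conv (line_sg (3 * b / 2)) (line_k (3 * b / 2)) f z.
Proof.
move=> al Hf z0; have [K K0 HK] := line_kernel.
have zw0 : 0 < Im (z + w0) by rewrite ImD ltr_pwDl// ltW.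
have I1 := conv_fint al (HK _ (or_introl erefl)) Hf zw0.
have I2 := conv_fint al (HK _ (or_intror erefl)) Hf z0.
rewrite {2}/conv -(cI_shift a I2) -cIZ//; last exact: (cintegrable_shift a I2).
apply: eq_cI => s _; rewrite /line_sg /line_k.
have E : (s + a) +i* (3 * b / 2) = (s +i* (b / 2)) + w0.
  by rewrite [RHS]complex_eta ReD ImD /= -/a -/b; congr (_ +i* _); field.
rewrite E contour_k_period (_ : z + (_ + w0) = z + w0 + (s +i* (b / 2))); last by ring.
set X := f _; set Y := contour_k _ _ _.
by rewrite [RHS]mulrCA mulVKf.
Qed.

(** The residue theorem for f(z + s) times the kernel on the rectangle with -n <= Re s <= n between
    the two lines, with its single pole at s = w0; the vertical sides disappear as n grows. *)
Lemma contour_jump alpha f fd z : -1 < alpha -> indir alpha f fd -> 0 < Im z ->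
  conv (line_sg (b / 2)) (line_k (b / 2)) f z -
  conv (line_sg (3 * b / 2)) (line_k (3 * b / 2)) f z = w0 * lam^-1 * f (z + w0).
Proof.
move=> al Hf z0; have bp : 0 < b := b0; have [hf _ _] := Hf; have tp := @twopii_neq0 R.
have [A A0 HA] := indir_growth al Hf z0.
have zA u : 0 <= Im u -> nc (f (z + u)) <= A * (1 + nc u).
  by move=> u0; apply: HA => //; [lra|rewrite subrr nc0; lra].
have [K' K'0 HK'] := line_kernel.
have I1 := conv_fint al (HK' _ (or_introl erefl)) Hf z0.
have I2 := conv_fint al (HK' _ (or_intror erefl)) Hf z0.
have [K K0 [_ [X HX]]] := contour_decay b0 c00 c0P.
pose Phi (s : R[i]) := f (z + s) * contour_k w0 c0 s.
have Phid (s : R[i]) : b / 2 <= Im s <= 3 * b / 2 -> s != w0 -> exists d, cdiff Phi s d.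
  move=> sb sw; have /andP[sb1 _] := sb.
  have qs : contour_q w0 s != 1.
    by apply/negP => /eqP/(contour_q_eq1 b0 sb) E; rewrite E eqxx in sw.
  have [d dk] := cdiff_contour_k c0 qs.
  have df : cdiff (fun s : R[i] => f (z + s)) s (fd (z + s)).
    have : cdiff (fun s : R[i] => f (s + z)) s (fd (z + s)).
      by rewrite (addrC z s); apply/cdiff_shift/hf; rewrite ImD; lra.
    move=> H; apply: cdiff_ext H _; exists 1 => // v _; by rewrite addrC.
  by eexists; exact: cdiffM df dk.
have cf : ccont (fun s : R[i] => f (z + s)) w0.
  have : ccont (fun s : R[i] => f (s + z)) w0.
    by apply: (cdiff_cont (d := fd (w0 + z))); apply/cdiff_shift/hf; rewrite ImD; lra.
  move=> H; apply: ccont_ext H _; exists 1 => // v _; by rewrite addrC.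
have res := contour_residue c0 b0 cf.
apply: eps_eq => e e0; have e40 : 0 < e / 4 by rewrite divr_gt0.
have [N1 H1] := cI_tail I1 e40; have [N2 H2] := cI_tail I2 e40.
(* Bound for the integrand on the vertical sides, from the linear growth of f and the decay of the
   kernel. *)
pose M n := A * K * cauchy 1 n%:R.
have [N3 H3] : exists N3 : nat, forall n, (N3 <= n)%N -> 2 * (M n * b) <= e / 4.
  pose B := 2 * (A * K * b) / (e / 4).
  have B0 : 0 <= B by apply: divr_ge0; [rewrite !mulr_ge0// ltW|exact: ltW].
  exists (Num.bound B) => n nB.
  have Bn : B < n%:R by apply: lt_le_trans (archi_boundP B0) _; rewrite ler_nat.
  rewrite /M /cauchy expr1n (_ : 2 * _ = 2 * (A * K * b) / (n%:R ^+ 2 + 1)); last by ring.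
  have q0 : 0 < n%:R ^+ 2 + 1 :> R by rewrite ltr_wpDl ?sqr_ge0.
  rewrite ler_pdivrMr//; move: Bn; rewrite /B ltr_pdivrMr// => /ltW Bn; apply: (le_trans Bn).
  rewrite mulrC; apply: ler_wpM2l; first exact: ltW.
  by have := ler0n R n; nra.
(* Large enough for both tails, for the vertical sides, and for the pole to lie inside while the
   sides lie where the decay estimate holds. *)
pose n := maxn (maxn N1 N2) (maxn N3 (Num.bound (`|a| + `|X| + 1))).
have [n1 n2 n3 n4] : [/\ (N1 <= n)%N, (N2 <= n)%N, (N3 <= n)%N &
    (Num.bound (`|a| + `|X| + 1) <= n)%N].
  by split; rewrite /n !leq_max leqnn ?orbT.
have nX : `|a| + `|X| + 1 < n%:R :> R.
  by apply: lt_le_trans (archi_boundP _) _; rewrite ?ler_nat// !addr_ge0.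
have bo := H1 n n1; have to := H2 n n2; have Mn := H3 n n3.
have an : - n%:R < Re w0 < n%:R.
  by rewrite -ltr_norml; apply: le_lt_trans nX; rewrite -addrA lerDl addr_ge0.
have ab : b / 2 < Im w0 < 3 * b / 2 by rewrite -/b; apply/andP; split; lra.
have bb : b / 2 <= 3 * b / 2 by lra.
have PhiD x y : - n%:R <= x <= n%:R -> b / 2 <= y <= 3 * b / 2 -> x +i* y != w0 ->
    exists d, cdiff Phi (x +i* y) d by move=> _ yb; exact: Phid.
have := residue_rect an ab PhiD res; rewrite /rint.
have vert x : `|x| = n%:R -> nc (cI `[b / 2, 3 * b / 2] (fun y => Phi (x +i* y))) <= e / 4.
  move=> xn; apply: le_trans Mn.
  have xX y : b / 2 <= y <= 3 * b / 2 -> X <= `|Re (x +i* y)|.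
    by move=> _; rewrite /= xn; have := normr_ge0 a; have := ler_norm X; move: nX; lra.
  have -> : M n * b = M n * (3 * b / 2 - b / 2) by congr (_ * _); field.
  apply: cI_le_cst => //.
    apply: ver_cint => y yb; have [q1 _] := HX (x +i* y) yb (xX y yb).
    have [|d /cdiff_cont//] := Phid (x +i* y) yb.
    apply: contraNneq q1 => ->; by rewrite /contour_q divfK// cexp_twopii.
  move=> y yb; have [_ k1] := HX (x +i* y) yb (xX y yb).
  have /andP[yb1 _] := yb.
  have y0 : 0 <= Im (x +i* y) by rewrite /=; lra.
  rewrite /Phi ncM /M; apply: (@le_trans _ _ (A * (1 + nc (x +i* y)) * nc (contour_k w0 c0 (x +i* y)))).
    by apply: ler_wpM2r; [exact: nc_ge0|exact: zA].
  rewrite -!mulrA; apply: ler_wpM2l => //; rewrite mulrC; apply: (le_trans k1).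
  by rewrite /cauchy /= -(real_normK (num_real x)) xn.
have v1 := vert n%:R (ger0_norm (ler0n _ n)).
have v2 : nc (cI `[b / 2, 3 * b / 2] (fun y => Phi ((- n%:R) +i* y))) <= e / 4.
  by apply: vert; rewrite normrN ger0_norm.
have -> : twopii * (f (z + w0) * (cexp (c0 * w0) * (w0 / twopii))) = w0 * lam^-1 * f (z + w0).
  by rewrite /lam cexpN invrK; field.
by move=> <-; exact: (contour_error bo to v1 v2).
Qed.

End Kernel.

(** A solution c0 of e^{- c0 w0} = lam is determined up to multiples of 2 pi i / w0, so Re c0 can be
    reduced to [0, contour_period). Re c0 = 0 would write lam as e^{i w0 t} with t real; |lam| <= 1
    excludes t < 0, and the hypothesis excludes t >= 0. *)
Lemma contour_exponent w0 lam : 0 < Im w0 -> lam != 0 -> nc lam <= 1 ->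
  (forall t, 0 <= t -> cexp ((0 +i* 1) * w0 * t%:C) <> lam) ->
  exists c0 : R[i], [/\ cexp (- (c0 * w0)) = lam, 0 < Re c0 & Re c0 < contour_period w0].
Proof.
move=> b0 l0 l1 lt; have w00 : w0 != 0 by apply: contraTneq b0 => ->; rewrite ltxx.
have n0 : 0 < nc w0 by rewrite nc_gt0.
have [v vl] := cexp_log l0.
have P0 : 0 < contour_period w0.
  by rewrite /contour_period divr_gt0 ?exprn_gt0// !mulr_gt0 ?pi_gt0.
have RP : Re (twopii / w0) = contour_period w0.
  by rewrite -[twopii / w0]mulr1 (Re_contour b0) /= /contour_period; ring.
pose c := - v / w0; pose n := Num.floor (Re c / contour_period w0).
pose c0 := c - n%:~R * (twopii / w0).
have cE : cexp (- (c0 * w0)) = lam.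
  have -> : - (c0 * w0) = v + n%:~R * twopii by rewrite /c0 /c; field.
  by rewrite cexpD cexp_twopii_int mulr1.
have Rc0 : Re c0 = Re c - n%:~R * contour_period w0.
  by rewrite /c0 ReD ReN -(rmorph_int (real_complex R)) [in X in _ - X]ReM RP /=; ring.
have /andP[f1 f2] := floor_itv (Re c / contour_period w0).
have c1 : 0 <= Re c0 by rewrite Rc0 subr_ge0 -ler_pdivlMr.
have c2 : Re c0 < contour_period w0.
  rewrite Rc0 ltrBlDr -[X in X + _]mul1r -mulrDl -ltr_pdivrMr// addrC.
  by move: f2; rewrite -/n intrD1.
exists c0; split=> //; rewrite lt_neqAle c1 andbT eq_sym; apply/eqP => R0.
(* For t < 0 the modulus of the exponential exceeds 1. *)
have E t : cexp ((0 +i* 1) * w0 * t%:C) = lam -> False.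
  have [t0|t0] := leP 0 t; first exact: lt.
  move/(congr1 nc); rewrite nc_cexp => H; move: l1; rewrite -H leNgt.
  rewrite (_ : Re _ = - (Im w0 * t)); last by rewrite !ReM !ImM /=; ring.
  by rewrite -expR0 ltr_expR oppr_gt0 pmulr_rlt0// t0.
apply: (E (- Im c0)); rewrite -cE; congr cexp.
rewrite [in RHS](complex_eta c0) R0 [LHS]complex_eta [RHS]complex_eta !(ReN, ImN, ReM, ImM) /=.
by congr (_ +i* _); rewrite ?(ReM, ImM) /=; ring.
Qed.

Section Spectrum.
Variables (tau : half_plane R -> half_plane R) (w0 : R[i]) (alpha : R).
Hypothesis al : -1 < alpha.
Hypothesis htau : parabolic_self_map tau w0.

Let D := @dirichlet_space R alpha.
Let nrm := @dirichlet_norm R alpha.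
Let C := @composition_operator R tau.

(** Let A and B be the averages along the lower and upper line. Then A(z + w0) = lam B(z) and A(z) -
    B(z) = w0 lam^-1 f(z + w0); eliminating B gives A(z + w0) - lam A(z) = - w0 f(z + w0). The
    coefficients a and b are chosen so that the multiples of f(z + w0) cancel and f(z) is left. *)
Lemma invertible_contour lam : 0 < Im w0 -> lam != 0 -> nc lam <= 1 ->
  (forall t, 0 <= t -> cexp ((0 +i* 1) * w0 * t%:C) <> lam) ->
  invertible D nrm (shift_op C lam).
Proof.
move=> b0 l0 l1 lt; have [c0 [cE c00 c0P]] := contour_exponent b0 l0 l1 lt.
have w00 : w0 != 0 by apply: contraTneq b0 => ->; rewrite ltxx.
have [K K0 HK] := line_kernel b0 c00 c0P.
apply: (kernel_invertible (a := - lam^-1 / w0) (b := - lam^-1) (u := 0) al htau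
  (HK _ (or_introl erefl))) => // f fd Hf z z0.
have := contour_jump b0 c00 c0P al Hf z0; have := contour_shift b0 c00 c0P al Hf z0.
rewrite cE /kernel_map !addr0; move=> -> /eqP; rewrite subr_eq => /eqP ->.
by field; rewrite l0 w00.
Qed.

End Spectrum.

End ContourInverse.

(** * A limit functional that vanishes on the range *)

Section RangeFunctional.
Context {R : realType}.
Local Notation nc := (@ComplexField.Normc.normc R).
Local Notation mu := (@lebesgue_measure R).
Local Notation TR := (measurableTypeR R).
Local Notation Re := (@complex.Re R).
Local Notation Im := (@complex.Im R).
Implicit Types (x y e r s t alpha : R) (a b c z w l u v lam : R[i]) (f g fd gd : R[i] -> R[i]).
Implicit Types (h p : R -> R[i]) (m n : nat) (U V : nat -> R[i]).

Definition clim U l := forall e, 0 < e ->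
  exists N : nat, forall n, (N <= n)%N -> nc (U n - l) <= e.

Lemma climD U V l u : clim U l -> clim V u -> clim (fun n => U n + V n) (l + u).
Proof.
move=> Ul Vu e e0; have e20 : 0 < e / 2 by rewrite divr_gt0.
have [N HN] := Ul _ e20; have [M HM] := Vu _ e20.
exists (maxn N M) => n; rewrite geq_max => /andP[/HN h1 /HM h2].
rewrite (_ : _ - _ = (U n - l) + (V n - u)); last by ring.
by apply: (le_trans (le_ncD _ _)); lra.
Qed.

Lemma climZ U l c : clim U l -> clim (fun n => c * U n) (c * l).
Proof.
move=> Ul e e0; have c0 : 0 < nc c + 1 by rewrite ltr_wpDl ?nc_ge0.
have [N HN] := Ul _ (divr_gt0 e0 c0); exists N => n /HN.
rewrite ler_pdivlMr// => H; rewrite -mulrBr ncM mulrC; apply: (le_trans _ H).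
by apply: ler_wpM2l; [exact: nc_ge0|rewrite lerDl].
Qed.

Lemma clim_cst l : clim (fun=> l) l.
Proof. by move=> e e0; exists 0%N => n _; rewrite subrr nc0 ltW. Qed.

Lemma eq_clim U V l : U =1 V -> clim U l -> clim V l.
Proof. by move=> UV Ul e /Ul[N HN]; exists N => n /HN; rewrite UV. Qed.

Lemma clim_sum n (U : 'I_n -> nat -> R[i]) (l : 'I_n -> R[i]) :
  (forall i, clim (U i) (l i)) -> clim (fun m => \sum_(i < n) U i m) (\sum_(i < n) l i).
Proof.
elim: n U l => [|n IH] U l H.
  by rewrite big_ord0; apply: eq_clim (clim_cst 0) => m; rewrite big_ord0.
rewrite big_ord_recl; apply: (@eq_clim (fun m => U ord0 m + \sum_(i < n) U (lift ord0 i) m)).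
  by move=> m; rewrite big_ord_recl.
by apply: climD => //; exact: (IH (fun i => U (lift ord0 i)) (fun i => l (lift ord0 i))).
Qed.

Lemma cI_mkcond (p q : R) h :
  cI `[p, q] h = cI setT (fun s => if p <= s <= q then h s else 0).
Proof.
have H (v : R -> R) (v' : R -> R) : (forall s, v' s = if p <= s <= q then v s else 0) ->
    \int[mu]_(s in `[p, q]) v s = \int[mu]_s v' s.
  move=> vv; rewrite /Rintegral [in LHS]integral_mkcond; congr fine.
  apply: eq_integral => s _; rewrite vv patchE; case: ifPn; rewrite ?in_setE ?notin_setE /= in_itv/=.
    by move=> ->.
  by move=> /negP/negbTE ->.
by rewrite /cI; congr (_ +i* _); apply: H => s; case: ifP.
Qed.

Lemma cintegrable_mkcond (p q : R) h : cintegrable `[p, q] h ->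
  cintegrable setT (fun s => if p <= s <= q then h s else 0).
Proof.
have mI : measurable (`[p, q]%classic : set TR) by exact: measurable_itv.
have H (v : R -> R) (v' : R -> R) : (forall s, v' s = if p <= s <= q then v s else 0) ->
    mu.-integrable `[p, q] (EFin \o v) -> mu.-integrable setT (EFin \o v').
  move=> vv iv; have [K _] := integrable_mkcond (mu := mu) (EFin \o v) mI.
  have := K iv; apply: eq_integrable => // s _ /=; rewrite vv patchE.
  case: ifPn; rewrite ?in_setE ?notin_setE /= in_itv/=; first by move=> ->.
  by move=> /negP/negbTE ->.
by move=> [hr hi]; split; [apply: H hr|apply: H hi] => s /=; case: ifP.
Qed.

Lemma cI_itv_shift (p q x : R) h : cintegrable `[p + x, q + x] h ->
  cI `[p, q] (fun s => h (s + x)) = cI `[p + x, q + x] h.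
Proof.
move=> /cintegrable_mkcond ih; rewrite !cI_mkcond -(cI_shift x ih).
by apply: eq_cI => s _; rewrite !lerD2r.
Qed.

(** Sliding the window of integration by x exchanges only two end pieces of length x, on which p is
    small. *)
Lemma cI_slide_pos p (x X e : R) n : (forall s, pcont p s) -> 0 <= x ->
  (forall s, X <= `|s| -> nc (p s) <= e) -> `|X| + x <= n%:R ->
  nc (cI `[(- n%:R), n%:R] (fun s => p (s + x)) - cI `[(- n%:R), n%:R] p) <= 4 * (e * x).
Proof.
move=> cp x0 pX nX; have XX := ler_norm X; have X0 := normr_ge0 X.
have ip y1 y2 : cintegrable `[y1, y2] p by apply: pcont_cintegrable.
rewrite cI_itv_shift//.
rewrite (@cI_split _ (- n%:R + x) n%:R (n%:R + x)) ?(@cI_split _ (- n%:R) (- n%:R + x) n%:R)//; try lra.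
set A := cI _ p; set B := cI _ p; set C := cI _ p.
have BE : nc B <= 2 * (e * x).
  have -> : e * x = e * (n%:R + x - n%:R) by ring.
  apply: cI_le_cst => // [|s /andP[s1 s2]]; first by lra.
  by apply: pX; rewrite ger0_norm; lra.
have CE : nc C <= 2 * (e * x).
  have -> : e * x = e * (- n%:R + x - - n%:R) by ring.
  apply: cI_le_cst => // [|s /andP[s1 s2]]; first by lra.
  by apply: pX; rewrite ler0_norm; lra.
have -> : A + B - (C + A) = B - C by ring.
by apply: (le_trans (le_ncB _ _)); lra.
Qed.

Lemma cI_slide p x (X e : R) n : (forall s, pcont p s) ->
  (forall s, X <= `|s| -> nc (p s) <= e) -> `|X| + 2 * `|x| <= n%:R ->
  nc (cI `[(- n%:R), n%:R] (fun s => p (s + x)) - cI `[(- n%:R), n%:R] p) <= 4 * (e * `|x|).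
Proof.
move=> cp pX nX; have [x0|x0] := leP 0 x.
  by rewrite ger0_norm//; apply: (@cI_slide_pos _ _ X) => //; move: nX; rewrite (ger0_norm x0); lra.
rewrite (ltr0_norm x0) in nX *; rewrite ncB.
pose q s := p (s + x).
have cq s : pcont q s.
  move=> d /(cp (s + x))[r r0 H]; exists r => // s' ss; apply: H.
  by rewrite (_ : s' + x - (s + x) = s' - s)//; ring.
have X0 := normr_ge0 X.
have qX s : `|X| - x <= `|s| -> nc (q s) <= e.
  move=> sX; apply: pX; have := lerB_normD s x; rewrite (ltr0_norm x0).
  by have := ler_norm X; lra.
have := @cI_slide_pos q (- x) (`|X| - x) e n cq _ qX.
rewrite (_ : cI _ (fun s => q (s + - x)) = cI `[(- n%:R), n%:R] p); last first.
  by apply: eq_cI => s _; rewrite /q subrK.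
apply; first by rewrite oppr_ge0 ltW.
have -> : `| `|X| - x | = `|X| - x by rewrite ger0_norm; lra.
by lra.
Qed.

Lemma powR_antitone x y r : 0 < x -> x <= y -> 0 <= r -> y `^ (- r) <= x `^ (- r).
Proof.
move=> x0 xy r0; have y0 := lt_le_trans x0 xy.
rewrite !powRN lef_pV2 ?posrE ?powR_gt0//.
by apply: ge0_ler_powR => //; rewrite nnegrE ltW.
Qed.

(** [energy_tail] with w = |x|: in a horizontal strip the squares of half-side y/2 have bounded
    size, so they move out to infinity with x. *)
Lemma indir_tail_x alpha f fd (y0 y1 : R) : -1 < alpha -> indir alpha f fd -> 0 < y0 ->
  forall e, 0 < e -> exists X, forall x y, y0 <= y <= y1 -> X <= `|x| -> nc (fd (x +i* y)) <= e.
Proof.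
move=> al [hf ef _] y00 e e0; have [fdd hfd] := hol_deriv hf.
pose W := wcst alpha * y0 `^ (- (2 + alpha)) + 1.
have w0 := wcst_ge0 alpha.
have W0 : 0 < W by rewrite ltr_wpDl// mulr_ge0// powR_ge0.
have e'0 : 0 < e ^+ 2 / W by rewrite divr_gt0// exprn_gt0.
have mw : measurable_fun [set: (TR * TR)%type] (fun p : R * R => `|p.1|).
  exact: (measurableT_comp (@normr_measurable R setT) measurable_fst).
have [n Hn] := energy_tail hfd ef mw e'0.
exists (n%:R + y1 / 2) => x y /andP[yy1 yy2] xX.
have yp : 0 < y by exact: lt_le_trans yy1.
have H : nc (fd (x +i* y)) ^+ 2 <= wcst alpha * y `^ (- 2 - alpha) * (e ^+ 2 / W).
  apply: Hn => // p /andP[p1 p2] _.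
  have := lerB_dist x p.1.
  have : `|x - p.1| <= y / 2 by rewrite ler_norml; apply/andP; split; lra.
  by lra.
rewrite -(@ler_pXn2r _ 2)// ?nnegrE ?nc_ge0 ?(ltW e0)//; apply: (le_trans H).
rewrite mulrA ler_pdivrMr// mulrC; apply: ler_wpM2l; first exact: sqr_ge0.
rewrite /W; apply: (@le_trans _ _ (wcst alpha * y0 `^ (- (2 + alpha)))); last by rewrite lerDl.
apply: ler_wpM2l => //; rewrite (_ : - 2 - alpha = - (2 + alpha)); last by ring.
by apply: powR_antitone => //; lra.
Qed.

(** With phi(z) = f'(z) e^{-itz} and lam = e^{i t w0}, the integrand is lam (phi(z + w0) - phi(z)).
    The integrals of phi along the lines at heights 1 and 1 + Im w0 agree up to the vertical sides,
    by Goursat, and the horizontal shift by Re w0 only affects the ends; phi tends to 0 in the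
    strip. *)
Lemma range_functional alpha f fd w0 (t : R) : -1 < alpha -> indir alpha f fd -> 0 <= Im w0 ->
  clim (fun n => cI `[(- n%:R), n%:R] (fun x =>
     (fd (x +i* 1 + w0) - cexp ((0 +i* t) * w0) * fd (x +i* 1)) *
       cexp (- (0 +i* t) * (x +i* 1)))) 0.
Proof.
move=> al Hf b0; have [hf ef _] := Hf; have [fdd hfd] := hol_deriv hf.
set a := Re w0; set b := Im w0 in b0 *; set lam := cexp ((0 +i* t) * w0).
pose phi z := fd z * cexp (- (0 +i* t) * z).
have hphi z : 0 < Im z -> exists d, cdiff phi z d.
  by move=> z0; eexists; exact: cdiffM (hfd z z0) (cdiff_cexp_lin _ z).
pose E := expR (`|t| * (1 + b)); have E0 : 0 < E by exact: expR_gt0.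
have phiE x y : 1 <= y <= 1 + b -> nc (phi (x +i* y)) <= E * nc (fd (x +i* y)).
  move=> /andP[y1 y2]; rewrite ncM mulrC nc_cexp; apply: ler_wpM2r; first exact: nc_ge0.
  rewrite /E ler_expR ReM /=; have -> : - 0 * x - - t * y = t * y by ring.
  apply: (le_trans (ler_norm _)); rewrite normrM; apply: ler_wpM2l => //.
  by rewrite ger0_norm//; lra.
move=> e e0; pose e' := e / (nc lam * (4 * `|a| + 4 * b) + 1).
have q0 : 0 < nc lam * (4 * `|a| + 4 * b) + 1.
  by rewrite ltr_wpDl// mulr_ge0 ?nc_ge0// addr_ge0// mulr_ge0.
have e'0 : 0 < e' by rewrite divr_gt0.
have [X HX] := indir_tail_x (1 + b) al Hf ltr01 (divr_gt0 e'0 E0).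
have phiX x y : 1 <= y <= 1 + b -> X <= `|x| -> nc (phi (x +i* y)) <= e'.
  move=> yb xX; apply: (le_trans (phiE x y yb)).
  by have := HX x y yb xX; rewrite ler_pdivlMr// mulrC.
exists (Num.bound (`|X| + 2 * `|a|)) => n nN.
have nX : `|X| + 2 * `|a| < n%:R.
  apply: lt_le_trans (archi_boundP _) _; last by rewrite ler_nat.
  by rewrite addr_ge0// mulr_ge0.
rewrite subr0.
have pos (x y : R) : 1 <= y -> 0 < Im (x +i* y) by rewrite /=; lra.
have cphi (x y : R) : 1 <= y -> ccont phi (x +i* y).
  by move=> /(pos x)/hphi[d /cdiff_cont].
have c1 : 1 <= 1 + b by rewrite lerDl.
have cp1 s : pcont (fun x => phi (x +i* 1)) s by apply: (@ccont_hor R phi); exact: cphi.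
have cp2 s : pcont (fun x => phi (x +i* (1 + b))) s by apply: (@ccont_hor R phi); apply: cphi; rewrite lerDl.
set I := `[(- n%:R), n%:R]%classic.
have i1 : cintegrable I (fun x => phi (x +i* 1)) by exact: pcont_cintegrable.
have i2 : cintegrable I (fun x => phi (x +i* (1 + b))) by exact: pcont_cintegrable.
have i3 : cintegrable I (fun x => phi ((x + a) +i* (1 + b))).
  apply: pcont_cintegrable => s _ d /(cp2 (s + a))[r r0 H]; exists r => // s' ss; apply: H.
  by rewrite (_ : s' + a - (s + a) = s' - s)//; ring.
have mI : measurable (I : set TR) by exact: measurable_itv.
have -> : cI I (fun x => (fd (x +i* 1 + w0) - lam * fd (x +i* 1)) * cexp (- (0 +i* t) * (x +i* 1))) =
    lam * ((cI I (fun x => phi ((x + a) +i* (1 + b))) - cI I (fun x => phi (x +i* (1 + b)))) +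
      (cI I (fun x => phi (x +i* (1 + b))) - cI I (fun x => phi (x +i* 1)))).
  rewrite addrA subrK -cIB// -cIZ//; last exact: cintegrableB.
  apply: eq_cI => x _; rewrite /phi.
  have -> : (x + a) +i* (1 + b) = x +i* 1 + w0.
    by rewrite [RHS]complex_eta ReD ImD.
  have -> : cexp (- (0 +i* t) * (x +i* 1 + w0)) = cexp (- (0 +i* t) * (x +i* 1)) / lam.
    by rewrite mulrDr cexpD [- _ * w0]mulNr cexpN.
  by field; exact: cexp_neq0.
have S1 : nc (cI I (fun x => phi ((x + a) +i* (1 + b))) - cI I (fun x => phi (x +i* (1 + b)))) <=
    4 * (e' * `|a|).
  apply: (@cI_slide _ _ X) => // [s sX|]; last exact: ltW.
  by apply: phiX => //; apply/andP; split; rewrite ?lerDl.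
have S2 : nc (cI I (fun x => phi (x +i* (1 + b))) - cI I (fun x => phi (x +i* 1))) <= 4 * (e' * b).
  have nn : - n%:R <= n%:R :> R by have := ler0n R n; lra.
  have := @Goursat _ phi (- n%:R) n%:R 1 (1 + b) nn c1 _; rewrite /rint -/I.
  move=> /(_ (fun x y _ yb => hphi _ (pos x y (proj1 (andP yb))))) /eqP.
  rewrite addr_eq0 => /eqP Hr; rewrite ncB Hr ncN ncM nc_i mul1r.
  have side x : `|x| = n%:R -> nc (cI `[1, 1 + b] (fun y => phi (x +i* y))) <= 2 * (e' * b).
    move=> xn; have -> : e' * b = e' * (1 + b - 1) by ring.
    apply: cI_le_cst => //.
      by apply: ver_cint => y /andP[y1 _]; exact: cphi.
    move=> y yb; apply: phiX => //; rewrite xn; have := ler_norm X; have := normr_ge0 a; move: nX; lra.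
  apply: (le_trans (le_ncB _ _)).
  have := side n%:R (ger0_norm (ler0n _ n)); have := side (- n%:R).
  by rewrite normrN ger0_norm// => /(_ erefl); lra.
rewrite ncM; apply: (@le_trans _ _ (nc lam * (4 * (e' * `|a|) + 4 * (e' * b)))).
  apply: ler_wpM2l; first exact: nc_ge0.
  by apply: (le_trans (le_ncD _ _)); exact: lerD.
have -> : nc lam * (4 * (e' * `|a|) + 4 * (e' * b)) = e' * (nc lam * (4 * `|a| + 4 * b)) by ring.
rewrite -[leRHS](@divfK _ (nc lam * (4 * `|a| + 4 * b) + 1)) ?gt_eqF// -/e'.
by apply: ler_wpM2l; [exact: ltW|rewrite lerDl].
Qed.

End RangeFunctional.

(** * The functional evaluated on exponential test functions *)

Section TestFunctions.
Context {R : realType}.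
Local Notation nc := (@ComplexField.Normc.normc R).
Local Notation mu := (@lebesgue_measure R).
Local Notation TR := (measurableTypeR R).
Local Notation Re := (@complex.Re R).
Local Notation Im := (@complex.Im R).
Implicit Types (x y e r s t tau delta : R) (a b c z w l u lam : R[i]) (m n : nat).

Local Notation I1 := (0 +i* 1 : R[i]).

Lemma Im_plus_i w : 0 <= Im w -> 0 < Im (w + I1).
Proof. by move=> w0; rewrite ImD /= ltr_wpDl. Qed.

Lemma plus_i_neq0 w : 0 <= Im w -> w + I1 != 0.
Proof. by move=> /Im_plus_i; apply: contraTneq => ->; rewrite ltxx. Qed.

Lemma nc_cexp_i (delta : R) w : 0 <= delta -> 0 <= Im w -> nc (cexp ((0 +i* delta) * w)) <= 1.
Proof.
move=> d0 w0; rewrite nc_cexp -expR0 ler_expR ReM /= mul0r sub0r oppr_le0.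
exact: mulr_ge0.
Qed.

Lemma nc_inv_plus_i w r : 0 < r -> r <= nc (w + I1) -> nc (w + I1)^-1 <= r^-1.
Proof. by move=> r0 rw; rewrite ncV lef_pV2// posrE//; exact: lt_le_trans rw. Qed.

Definition testf (tau : R) w := cexp ((0 +i* tau) * w) / (w + I1).

Definition testfd (tau : R) w :=
  cexp ((0 +i* tau) * w) * ((0 +i* tau) / (w + I1) - (w + I1) ^- 2).

Lemma cdiff_inv_plus_i w : 0 <= Im w -> cdiff (fun w => (w + I1)^-1) w (- (w + I1) ^- 2).
Proof.
move=> w0; rewrite -[X in cdiff _ _ X]mulr1.
apply: (@cdiffV R (fun w => w + I1)); last exact: plus_i_neq0.
by have := cdiffD (cdiff_id w) (cdiff_cst I1 w); rewrite addr0.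
Qed.

Lemma cdiff_testf tau w : 0 <= Im w -> cdiff (testf tau) w (testfd tau w).
Proof.
move=> w0; have := cdiffM (cdiff_cexp_lin (0 +i* tau) w) (cdiff_inv_plus_i w0).
rewrite (_ : _ + _ = testfd tau w)// /testfd; ring.
Qed.

Definition qint (delta : R) w := cexp ((0 +i* delta) * w) * (w + I1) ^- 2.

Lemma cdiff_qint delta w : 0 <= Im w -> exists d, cdiff (qint delta) w d.
Proof.
move=> w0; eexists; apply: cdiffM (cdiff_cexp_lin _ w) _.
apply: cdiff_ext (cdiffX 2 (cdiff_inv_plus_i w0)) _; exists 1 => // v _.
by rewrite exprVn.
Qed.

Lemma nc_qint delta w r : 0 <= delta -> 0 <= Im w -> 0 < r -> r <= nc (w + I1) ->
  nc (qint delta w) <= (r ^+ 2)^-1.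
Proof.
move=> d0 w0 r0 rw; rewrite ncM -[leRHS]mul1r; apply: ler_pM; rewrite ?nc_ge0//.
  exact: nc_cexp_i.
rewrite ncV ncX lef_pV2 ?posrE ?exprn_gt0//; last exact: lt_le_trans rw.
by rewrite ler_pXn2r ?nnegrE ?nc_ge0// ltW.
Qed.

Lemma clim_bound (U : nat -> R[i]) (K : R) : 0 <= K ->
  (forall n, (0 < n)%N -> nc (U n) <= K / n%:R) -> clim U 0.
Proof.
move=> K0 H e e0; exists (Num.bound (K / e)).+1 => n nN.
have np : (0 < n)%N by exact: leq_trans nN.
have n0 : 0 < n%:R :> R by rewrite ltr0n.
rewrite subr0; apply: (le_trans (H n np)); rewrite ler_pdivrMr//.
have Kn : K / e < n%:R.
  apply: lt_le_trans (archi_boundP (divr_ge0 K0 (ltW e0))) _.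
  by rewrite ler_nat ltnW.
by rewrite mulrC -ler_pdivrMr// ltW.
Qed.

(** The contour is closed in the half-plane by a rectangle of height n: for delta >= 0 the integrand
    is at most n^-2 on the three other sides, whose total length is of order n. *)
Lemma qint_lim delta : 0 <= delta ->
  clim (fun n => cI `[(- n%:R), n%:R] (fun x => qint delta (x +i* 1))) 0.
Proof.
move=> d0; apply: (@clim_bound _ 8) => // n np.
have n0 : 0 < n%:R :> R by rewrite ltr0n.
have nn : - n%:R <= n%:R :> R by lra.
have n1 : 1 <= 1 + n%:R :> R by lra.
have pos (x y : R) : 1 <= y -> 0 <= Im (x +i* y) by rewrite /=; lra.
have cq (x y : R) : 1 <= y -> ccont (qint delta) (x +i* y).
  by move=> /(pos x)/(cdiff_qint delta)[d /cdiff_cont].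
have := @Goursat _ (qint delta) (- n%:R) n%:R 1 (1 + n%:R) nn n1 _; rewrite /rint.
move=> /(_ (fun x y _ yb => cdiff_qint delta (pos x y (proj1 (andP yb))))).
set A := cI _ _; set B := cI _ _; set C := cI _ _; set E := cI _ _ => H.
have -> : A = B - 'i * (C - E) by apply/eqP; rewrite -subr_eq0 -H; apply/eqP; ring.
have q2 : (n%:R ^+ 2)^-1 * n%:R = n%:R^-1 :> R by field; rewrite gt_eqF.
have BE : nc B <= 2 * ((n%:R ^+ 2)^-1 * (n%:R - - n%:R)).
  apply: cI_le_cst => //; first by apply: hor_cint => x _; exact: cq.
  move=> x _; apply: nc_qint => //; first exact: pos.
  by apply: le_trans (Im_le_nc _); rewrite ImD /= ger0_norm; lra.
have side x : `|x| = n%:R -> nc (cI `[1, 1 + n%:R] (fun y => qint delta (x +i* y))) <=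
    2 * ((n%:R ^+ 2)^-1 * (1 + n%:R - 1)).
  move=> xn; apply: cI_le_cst => //; first by apply: ver_cint => y /andP[y1 _]; exact: cq.
  move=> y /andP[y1 _]; apply: nc_qint => //; first exact: pos.
  by apply: le_trans (Re_le_nc _); rewrite ReD /= addr0 xn.
have CE : nc C <= _ := side n%:R (ger0_norm (ltW n0)).
have EE : nc E <= 2 * ((n%:R ^+ 2)^-1 * (1 + n%:R - 1)).
  by apply: side; rewrite normrN ger0_norm// ltW.
apply: (le_trans (le_ncB _ _)); rewrite ncM nc_i mul1r.
have := le_ncB C E; move: BE CE EE.
rewrite opprK mulrDr q2 (addrC 1) addrK q2; lra.
Qed.

Lemma cexp_sub t tau w :
  cexp ((0 +i* (tau - t)) * w) = cexp ((0 +i* tau) * w) * cexp (- (0 +i* t) * w).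
Proof.
rewrite -cexpD; congr cexp; rewrite [LHS]complex_eta [RHS]complex_eta.
by rewrite !(ReD, ImD, ReM, ImM, ReN, ImN) /=; congr (_ +i* _); ring.
Qed.

Lemma testfd_integrand t tau w : testfd tau w * cexp (- (0 +i* t) * w) =
  (0 +i* tau) * (cexp ((0 +i* (tau - t)) * w) / (w + I1)) - qint (tau - t) w.
Proof.
by rewrite /testfd /qint cexp_sub; ring.
Qed.

Definition test_functional t tau n :=
  cI `[(- n%:R), n%:R] (fun x => testfd tau (x +i* 1) * cexp (- (0 +i* t) * (x +i* 1))).

Lemma ccont_testf tau w : 0 <= Im w -> ccont (testf tau) w.
Proof. by move=> /(cdiff_testf tau)/cdiff_cont. Qed.

(** With delta = tau - t > 0 the integrand is a combination of the derivative of [testf delta],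
    whose values at the two ends tend to 0, and of [qint delta]. The coefficient tau / delta is the
    reason for the strict inequality. *)
Lemma test_functional_gt t tau : t < tau -> clim (test_functional t tau) 0.
Proof.
move=> tt; pose delta := tau - t; have d0 : 0 < delta by rewrite subr_gt0.
have dn : (0 +i* delta : R[i]) != 0.
  by apply/eqP => /(congr1 Im) /= E; rewrite E ltxx in d0.
pose B n := cI `[(- n%:R), n%:R] (fun x => testfd delta (x +i* 1)).
pose Q n := cI `[(- n%:R), n%:R] (fun x => qint delta (x +i* 1)).
have pos (x : R) : 0 <= Im (x +i* 1) by rewrite /=.
have cq x : ccont (qint delta) (x +i* 1) by have [d /cdiff_cont] := cdiff_qint delta (pos x).
have ct x : ccont (testf delta) (x +i* 1) by exact: ccont_testf.
have cB x : ccont (testfd delta) (x +i* 1).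
  apply: ccont_ext (ccontB (ccontM (ccont_cst (0 +i* delta) _) (ct x)) (cq x)) _.
  by exists 1 => // v _; rewrite /testf /qint /testfd; ring.
have iB n : cintegrable `[(- n%:R), n%:R] (fun x => testfd delta (x +i* 1)).
  by apply: hor_cint => x _.
have iQ n : cintegrable `[(- n%:R), n%:R] (fun x => qint delta (x +i* 1)).
  by apply: hor_cint => x _.
pose c := (0 +i* tau) / (0 +i* delta).
have E n : c * B n + (c - 1) * Q n = test_functional t tau n.
  rewrite -!cIZ// -cID//; try exact: cintegrableZ.
  apply: eq_cI => x _; rewrite testfd_integrand -/delta /testfd /qint /c.
  by field; rewrite dn plus_i_neq0.
apply: (eq_clim E); rewrite -[0](_ : c * 0 + (c - 1) * 0 = 0); last by rewrite !mulr0 addr0.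
apply: climD; apply: climZ; last exact: qint_lim (ltW d0).
apply: (@clim_bound _ 2) => // n np; have n0 : 0 < n%:R :> R by rewrite ltr0n.
have -> : B n = testf delta (n%:R +i* 1) - testf delta ((- n%:R) +i* 1).
  rewrite /B; apply: (@cI_FTC R _ (fun x => testf delta (x +i* 1))); first by lra.
    by move=> x _; apply: (@cdiff_hor R (testf delta)); exact: cdiff_testf.
  by move=> x _; apply: (@ccont_hor R (testfd delta)).
have side x : `|x| = n%:R -> nc (testf delta (x +i* 1)) <= n%:R^-1.
  move=> xn; rewrite ncM -[leRHS]mul1r; apply: ler_pM; rewrite ?nc_ge0//.
    by apply: nc_cexp_i => //; exact: ltW.
  by apply: nc_inv_plus_i => //; apply: le_trans (Re_le_nc _); rewrite ReD /= addr0 xn.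
apply: (le_trans (le_ncB _ _)); rewrite mulrDl mul1r.
by apply: lerD; apply: side; rewrite ?normrN ger0_norm// ltW.
Qed.

Lemma four_fifths : 2 / 5 * (1 - - 1) = 4 / 5 :> R.
Proof. by field. Qed.

Lemma fifth_absurd t : 0 < t -> t * (4 / 5) <= t / 5 -> False.
Proof. by move=> ? ?; lra. Qed.

Lemma inv_fifth x : -1 <= x -> x <= 1 -> 5^-1 <= (x ^+ 2 + 4)^-1.
Proof. by move=> ? ?; rewrite lef_pV2 ?posrE; nra. Qed.

(** At equal frequencies the exponentials cancel and, up to [qint 0], the integrand is it / (x +
    2i). The imaginary part of 1 / (x + 2i) is - 2 / (x^2 + 4), of constant sign, so the integrals
    stay away from 0. *)
Lemma test_functional_eq t c : 0 < t -> clim (fun n => c * test_functional t t n) 0 -> c = 0.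
Proof.
move=> t0 H; apply/eqP; apply: contraT => cn; exfalso.
have : clim (test_functional t t) 0.
  have := climZ c^-1 H; rewrite mulr0; apply: eq_clim => n; by rewrite mulKf.
move=> {}H; pose J n := cI `[(- n%:R), n%:R] (fun x => (x +i* 1 + I1)^-1).
have pos (x : R) : 0 <= Im (x +i* 1) by rewrite /=.
have iJ n : cintegrable `[(- n%:R), n%:R] (fun x => (x +i* 1 + I1)^-1).
  by apply: (@hor_cint R (fun w => (w + I1)^-1)) => x _; exact: cdiff_cont (cdiff_inv_plus_i (pos x)).
have iQ n : cintegrable `[(- n%:R), n%:R] (fun x => qint 0 (x +i* 1)).
  by apply: hor_cint => x _; have [d /cdiff_cont] := cdiff_qint 0 (pos x).
have E n : test_functional t t n + cI `[(- n%:R), n%:R] (fun x => qint 0 (x +i* 1)) = (0 +i* t) * J n.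
  have -> : test_functional t t n = (0 +i* t) * J n - cI `[(- n%:R), n%:R] (fun x => qint 0 (x +i* 1)).
    rewrite /J -cIZ// -cIB//; last exact: cintegrableZ.
    apply: eq_cI => x _; rewrite testfd_integrand subrr.
    have -> : (0 +i* 0) * (x +i* 1) = 0 :> R[i] by rewrite (_ : 0 +i* 0 = 0)// mul0r.
    by rewrite cexp0 mul1r.
  by rewrite subrK.
have := climD H (qint_lim (lexx 0)); rewrite addr0.
have e0 : 0 < t / 5 by rewrite divr_gt0.
move=> /(_ _ e0)[N HN]; have := HN N.+1 (leqnSn N); rewrite subr0 E ncM => L.
pose v (x : R) : R := 2 / (x ^+ 2 + 4).
have den (x : R) : 0 < x ^+ 2 + 4 by rewrite ltr_wpDl ?sqr_ge0.
have vE (x : R) : Im (x +i* 1 + I1)^-1 = - v x.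
  rewrite /= addr0 /v (_ : 1 + 1 = 2); last by ring.
  by rewrite (_ : 2 ^+ 2 = 4)//; ring.
have cv x : {for x, continuous v}.
  rewrite /v; apply: cvgM; first exact: cvg_cst.
  apply: cvgV; first by rewrite gt_eqF.
  by apply: cvgD; [exact: exprn_continuous|exact: cvg_cst].
have iv (p q : R) : mu.-integrable `[p, q] (EFin \o v).
  apply: continuous_compact_integrable; first exact: segment_compact.
  by apply: continuous_subspaceT => x; exact: cv.
have v0 x : 0 <= v x by rewrite divr_ge0// ltW.
pose M : R := N.+1%:R; have M1 : 1 <= M by rewrite ler1n.
have split3 : \int[mu]_(x in `[(- M), M]) v x =
    \int[mu]_(x in `[(- M), -1]) v x + (\int[mu]_(x in `[-1, 1]) v x + \int[mu]_(x in `[1, M]) v x).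
  have h1 : - M <= -1 by rewrite lerN2.
  have h2 : -1 <= 1 :> R by exact: le_trans (lerN10 R) ler01.
  by rewrite (Rintegral_split h1 (le_trans h2 M1) (iv _ _)) (Rintegral_split h2 M1 (iv _ _)).
have g1 : 0 <= \int[mu]_(x in `[(- M), -1]) v x by apply: Rintegral_ge0.
have g2 : 0 <= \int[mu]_(x in `[1, M]) v x by apply: Rintegral_ge0.
(* The interval [-1, 1] alone contributes 4/5, more than the tolerance t/5 allows after
   multiplication by t. *)
have g3 : 4 / 5 <= \int[mu]_(x in `[-1, 1]) v x.
  have -> : 4 / 5 = \int[mu]_(x in `[-1, 1]) (2 / 5 : R).
    by rewrite Rintegral_itv_cst ?four_fifths//; exact: le_trans (lerN10 R) ler01.
  apply: le_Rintegral => //; first exact: integrable_itv_cst.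
  move=> x; rewrite /= in_itv/= => /andP[x1 x2]; rewrite /v; apply: ler_wpM2l => //.
  exact: inv_fifth.
have JI : 4 / 5 <= `|Im (J N.+1)|.
  have -> : Im (J N.+1) = \int[mu]_(x in `[(- M), M]) (-1 * v x).
    by apply: eq_Rintegral => x _; rewrite mulN1r; exact: vE.
  rewrite RintegralZl// mulN1r.
  rewrite normrN; apply: le_trans (ler_norm _); rewrite split3.
  by apply: ler_wpDl => //; apply: ler_wpDr.
have := le_trans JI (Im_le_nc _) => JN.
have tn : nc (0 +i* t) = t.
  by rewrite /= expr0n /= add0r sqrtr_sqr gtr0_norm.
move: L; rewrite tn => L.
exact: (fifth_absurd t0 (le_trans (ler_wpM2l (ltW t0) JN) L)).
Qed.

End TestFunctions.

(** * Energy bounds for explicit functions *)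

Section Membership.
Context {R : realType}.
Local Notation nc := (@ComplexField.Normc.normc R).
Local Notation mu := (@lebesgue_measure R).
Local Notation TR := (measurableTypeR R).
Local Notation T2 := (TR * TR)%type.
Local Notation M2 := (mu \x mu)%E.
Local Notation Re := (@complex.Re R).
Local Notation Im := (@complex.Im R).
Local Notation pi := (@trigo.pi R).
Implicit Types (x y e r s t p q alpha : R) (a b z w l u v lam : R[i]) (f g : R[i] -> R[i]) (m n : nat).

Lemma integral_exhaust_ray (h : R -> R) (B : R) : (forall x, 1 <= x -> {for x, continuous h}) ->
  measurable_fun [set: TR] h -> (forall x, 0 <= h x) ->
  (forall n, \int[mu]_(x in `[1, 1 + n%:R]) h x <= B) ->
  (\int[mu]_x ((1 <= x)%R%:R * h x)%:E <= B%:E)%E.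
Proof.
move=> ch mh h0 hB; pose F n : set TR := `[1%R, (1 + n%:R)%R]%classic.
have := @ge0_nondecreasing_set_cvg_integral _ TR R F (EFin \o h) mu.
move=> /(_ _ _ _ _)/wrap[].
- move=> n m nm; apply/subsetPset => t; rewrite /F /= !in_itv/= => /andP[-> t2] /=.
  by apply: (le_trans t2); rewrite lerD2l ler_nat.
- by move=> n; exact: measurable_itv.
- by move=> n; apply: measurable_funTS; exact/measurable_EFinP.
- by move=> n t _; rewrite lee_fin.
move=> H.
have -> : (\int[mu]_x ((1 <= x)%R%:R * h x)%:E = \int[mu]_(t in \bigcup_n F n) (h t)%:E)%E.
  rewrite [RHS]integral_mkcond; apply: eq_integral => t _.
  rewrite patchE; case: ifPn => [/set_mem[n _]|].
    by rewrite /F /= in_itv/= => /andP[-> _]; rewrite mul1r.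
  rewrite notin_setE /= => tn; have [t1|_] := leP 1 t; last by rewrite mul0r.
  exfalso; apply: tn; exists (Num.bound `|t|) => //.
  rewrite /F /= in_itv/= t1 /=; have := archi_boundP (normr_ge0 t).
  by have := ler_norm t; lra.
apply: (cvge_le _ H); apply: nearW => n /=.
have cu x : 1 <= x <= 1 + n%:R -> {for x, continuous h} by move=> /andP[/ch].
have ii : mu.-integrable (F n) (EFin \o h).
  by apply: continuous_compact_integrable; [exact: segment_compact|exact: within_itv_cont].
have := hB n; rewrite /Rintegral -lee_fin fineK//.
exact: integrable_fin_num.
Qed.

Lemma integral_powR_ray q : 1 < q ->
  (\int[mu]_x ((1 <= x)%R%:R * x `^ (- q))%:E <= ((q - 1)^-1)%:E)%E.
Proof.
move=> q1; have q0 : 0 < q - 1 by rewrite subr_gt0.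
apply: integral_exhaust_ray.
- by move=> x x1; apply: continuous_powR; exact: lt_le_trans x1.
- exact: measurable_powR.
- by move=> x; exact: powR_ge0.
move=> n; pose F : R -> R := (- (q - 1)^-1) \*: (fun t : R => t `^ (1 - q)).
have n1 : 1 <= 1 + n%:R :> R by rewrite lerDl.
have -> : \int[mu]_(x in `[1, 1 + n%:R]) x `^ (- q) = F (1 + n%:R) - F 1.
  apply: real_FTC => //.
  - move=> x /andP[x1 _]; have x0 : 0 < x by exact: lt_le_trans x1.
    have d1 := is_derive1_powR (1 - q) x0.
    apply: is_derive_eq.
    rewrite -[_ *: _]/(_ * _) mulrA (_ : - (q - 1)^-1 * (1 - q) = 1); last by field; rewrite gt_eqF.
    by rewrite mul1r; congr powR; ring.
  - by move=> x /andP[x1 _]; apply: continuous_powR; exact: lt_le_trans x1.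
rewrite /F /= -![_ *: _]/(_ * _) powR1 mulr1 opprK mulNr addrC gerBl.
by apply: mulr_ge0; [rewrite invr_ge0 ltW|exact: powR_ge0].
Qed.

Definition ray_weight alpha p y : R := (0 < y)%R%:R * (y `^ alpha * (1 + y) `^ (- p)).

Definition ray_cst alpha p : R := (alpha + 1)^-1 + (p - alpha - 1)^-1.

Lemma ray_weight_ge0 alpha p y : 0 <= ray_weight alpha p y.
Proof. by apply: mulr_ge0; [exact: ler0n|apply: mulr_ge0; exact: powR_ge0]. Qed.

Lemma measurable_ray_weight alpha p : measurable_fun [set: TR] (ray_weight alpha p : TR -> TR).
Proof.
apply: measurable_funM.
  by apply: measurable_nat_bool; apply: measurable_fun_ltr => //; exact: measurable_cst.
apply: measurable_funM; first exact: measurable_powR.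
have mD : measurable_fun [set: TR] ((fun t : TR => 1 + t : TR) : TR -> TR).
  by apply: measurable_funD => //; exact: measurable_cst.
have mP : measurable_fun [set: TR] ((fun t : TR => t `^ (- p) : TR) : TR -> TR) by exact: measurable_powR.
exact: (measurableT_comp mP mD).
Qed.

Lemma integral_ray_weight alpha p : -1 < alpha -> alpha + 1 < p ->
  (\int[mu]_y (ray_weight alpha p y)%:E <= (ray_cst alpha p)%:E)%E.
Proof.
move=> al ap; have p0 : 0 <= p by lra.
pose A y : R := ((0 < y) && (y <= 1))%R%:R * y `^ alpha.
pose B y : R := (1 <= y)%R%:R * y `^ (- (p - alpha)).
have mA : measurable_fun [set: TR] (A : TR -> TR) by exact: (measurable_strip_weight alpha 1).
have mB : measurable_fun [set: TR] (B : TR -> TR).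
  apply: measurable_funM; last exact: measurable_powR.
  by apply: measurable_nat_bool; apply: measurable_fun_ler => //; exact: measurable_cst.
have A0 y : 0 <= A y by apply: mulr_ge0; [exact: ler0n|exact: powR_ge0].
have B0 y : 0 <= B y by apply: mulr_ge0; [exact: ler0n|exact: powR_ge0].
apply: (@le_trans _ _ (\int[mu]_y (A y + B y)%:E)%E).
  apply: ge0_leR; [exact: measurable_ray_weight|exact: measurable_funD|exact: ray_weight_ge0|].
  move=> y; rewrite /ray_weight; have [y0|_] := ltP 0 y; last by rewrite mul0r addr_ge0.
  rewrite mul1r; have [y1|y1] := leP y 1.
    rewrite ler_wpDr// /A y0 y1 mul1r -[leRHS]mulr1; apply: ler_wpM2l; first exact: powR_ge0.
    apply: (@le_trans _ _ (1 `^ (- p))); last by rewrite powR1.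
    by apply: powR_antitone => //; lra.
  rewrite ler_wpDl// /B (ltW y1) mul1r (_ : - (p - alpha) = alpha + - p); last by ring.
  rewrite powRD ?(gt_eqF y0) ?implybT//; apply: ler_wpM2l; first exact: powR_ge0.
  by apply: powR_antitone => //; lra.
rewrite ge0_intDR// /ray_cst EFinD; apply: leeD.
  by have := integral_powR_near0 al ltr01; rewrite powR1 mul1r.
by apply: integral_powR_ray; lra.
Qed.

Lemma inv_shift_sqr v w : nc (w + v)^-1 ^+ 2 = cauchy (Im w + Im v) (Re w + Re v).
Proof. by rewrite ncV exprVn nc_sqr ReD ImD. Qed.

(** The x-integral of |z + v|^-2 is at most pi / (y + Im v). What remains is at most B times the
    integral of y^alpha (1 + y)^-p, which converges at 0 because alpha > -1 and at infinity because
    p > alpha + 1. *)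
Lemma energy_majorant alpha p f (rho : R -> R) v (B : R) : -1 < alpha -> alpha + 1 < p ->
  0 < Im v -> 0 <= B -> (forall z, 0 < Im z -> ccont f z) ->
  measurable_fun [set: TR] (rho : TR -> TR) -> (forall y, 0 <= rho y) ->
  (forall z, 0 < Im z -> nc (f z) ^+ 2 <= rho (Im z) * nc (z + v)^-1 ^+ 2) ->
  (forall y, 0 < y -> rho y * (pi / (y + Im v)) <= B * (1 + y) `^ (- p)) ->
  (energy alpha f <= (B * ray_cst alpha p)%:E)%E.
Proof.
move=> al ap v0 B0 cf mrho rho0 fr rB.
have nz z : 0 < Im z -> z + v != 0.
  move=> z0; have : 0 < Im (z + v) by rewrite ImD addr_gt0.
  by apply: contraTneq => ->; rewrite ltxx.
have ci z : 0 < Im z -> ccont (fun z => (z + v)^-1) z.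
  by move=> z0; apply: ccontV; [apply: ccontD; [exact: ccont_id|exact: ccont_cst]|exact: nz].
pose H := cut (fun q : R * R => nc (atp (fun z => (z + v)^-1) q)).
have mH : measurable_fun [set: T2] H by exact: measurable_hol_nc.
pose Phi (q : R * R) : R := H q ^+ 2 * (rho q.2 * q.2 `^ alpha).
have Phi0 (q : R * R) : 0 <= Phi q.
  by apply: mulr_ge0; [exact: sqr_ge0|apply: mulr_ge0 => //; exact: powR_ge0].
have mPhi : measurable_fun [set: T2] Phi.
  apply: measurable_funM; first exact: measurable_funX.
  by apply: measurable_funM; [exact: (measurableT_comp mrho measurable_snd)|exact: measurable_snd_powR].
have meP : measurable_fun [set: T2] (EFin \o Phi) by exact/measurable_EFinP.
have eP0 (q : R * R) : (0 <= (EFin \o Phi) q)%E by rewrite lee_fin.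
apply: (@le_trans _ _ (\int[M2]_q (Phi q)%:E)%E).
  apply: ge0_leR => //; [exact: measurable_dens|exact: dens_ge0|].
  move=> q; rewrite /dens /Phi /H /cut; case: ifPn => q0; last by rewrite expr0n mul0r.
  rewrite mulrA [_ * rho _]mulrC; apply: ler_wpM2r; first exact: powR_ge0.
  exact: (fr (q.1 +i* q.2)).
rewrite [leLHS](fubini_tonelli2 (m1 := mu) (m2 := mu) (EFin \o Phi) meP eP0).
apply: (@le_trans _ _ (\int[mu]_y (B * ray_weight alpha p y)%:E)%E); last first.
  rewrite (ge0_intZR mu (measurable_ray_weight alpha p) (ray_weight_ge0 alpha p) B0) EFinM.
  by apply: lee_wpmul2l; [rewrite lee_fin|exact: integral_ray_weight].
have mrw := measurable_ray_weight alpha p.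
apply: ge0_le_integral.
- exact: measurableT.
- by move=> y _; apply: integral_ge0 => x _; exact: (eP0 (x, y)).
- exact: (measurable_fun_fubini_tonelli_G (m1 := mu) (EFin \o Phi) meP eP0).
- by apply/measurable_EFinP; apply: measurable_funM; first exact: measurable_cst.
move=> y _; rewrite /fubini_G /Phi /H /cut /ray_weight /=.
have [y0|y0] := ltP 0 y; last first.
  by rewrite integral0_eq ?mul0r ?mulr0// => x _; rewrite expr0n mul0r.
have Y0 : 0 < y + Im v by rewrite addr_gt0.
have C0 : 0 <= rho y * y `^ alpha by apply: mulr_ge0 => //; exact: powR_ge0.
have mc : measurable_fun [set: TR] ((fun x => cauchy (y + Im v) (x + Re v)) : TR -> TR).
  have mcc : measurable_fun [set: TR] ((cauchy (y + Im v)) : TR -> TR).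
    by apply: continuous_measurable_fun; exact: continuous_cauchy.
  apply: (measurableT_comp mcc).
  by apply: measurable_funD => //; exact: measurable_cst.
have c0 x : 0 <= cauchy (y + Im v) (x + Re v) by exact: cauchy_ge0.
rewrite (_ : (\int[mu]_x _ = \int[mu]_x ((rho y * y `^ alpha) * cauchy (y + Im v) (x + Re v))%:E)%E); last first.
  apply: eq_integral => x _; congr EFin; rewrite mulrC; congr (_ * _).
  exact: (inv_shift_sqr v (x +i* y)).
rewrite (ge0_intZR mu mc c0 C0) mul1r.
have -> : (\int[mu]_x (cauchy (y + Im v) (x + Re v))%:E = \int[mu]_x (cauchy (y + Im v) x)%:E)%E.
  apply: (ge0_integral_shift (Re v) (f := fun x => (cauchy (y + Im v) x)%:E)).
    apply/measurable_EFinP; apply: continuous_measurable_fun; exact: continuous_cauchy.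
  by move=> x; rewrite lee_fin cauchy_ge0.
apply: (@le_trans _ _ ((rho y * y `^ alpha)%:E * (pi / (y + Im v))%:E)%E).
  by apply: lee_wpmul2l; [rewrite lee_fin|exact: integral_cauchy].
rewrite -EFinM lee_fin mulrAC; apply: (@le_trans _ _ (B * (1 + y) `^ (- p) * y `^ alpha)).
  by apply: ler_wpM2r; [exact: powR_ge0|exact: rB].
by rewrite -mulrA ler_wpM2l// mulrC.
Qed.

Lemma vdecay_inv f : (forall x y, 1 <= y -> nc (f (x +i* y)) <= y^-1) -> vdecay f.
Proof.
move=> H x e e0; exists (Num.max 1 e^-1) => y; rewrite ge_max => /andP[y1 ye].
apply: (le_trans (H x y y1)); rewrite -[leRHS]invrK lef_pV2// posrE ?invr_gt0//.
exact: lt_le_trans y1.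
Qed.

Lemma nc_inv_shift v w : 0 < Im v -> 0 < Im w -> nc (w + v)^-1 <= (Im w + Im v)^-1.
Proof.
move=> v0 w0; have Y0 : 0 < Im w + Im v by rewrite addr_gt0.
have h : Im w + Im v <= nc (w + v).
  by apply: le_trans (Im_le_nc _); rewrite ImD; exact: ler_norm.
by rewrite ncV lef_pV2// posrE//; exact: lt_le_trans h.
Qed.

Lemma cdiff_inv_shift v w : 0 < Im v -> 0 < Im w ->
  cdiff (fun w => (w + v)^-1) w (- ((w + v)^-1 ^+ 2)).
Proof.
move=> v0 w0; have nz : w + v != 0.
  have : 0 < Im (w + v) by rewrite ImD addr_gt0.
  by apply: contraTneq => ->; rewrite ltxx.
have := @cdiffV R (fun w => w + v) w _ (cdiffD (cdiff_id w) (cdiff_cst v w)) nz.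
by rewrite addr0 mulr1 exprVn.
Qed.

(** [expR_decay] at rate t / N, raised to the power N, gives decay of order 3 N >= p. *)
Lemma expR_decay_powR t p : 0 < t -> exists2 K, 0 <= K &
  forall y, 0 <= y -> expR (- (t * y)) <= K * (1 + y) `^ (- p).
Proof.
move=> t0; pose N := (Num.bound `|p|).+1.
have N0 : 0 < N%:R :> R by rewrite ltr0n.
have [K K0 H] := expR_decay (divr_gt0 t0 N0).
exists (K ^+ N); first exact: exprn_ge0.
move=> y y0; have y1 : 1 <= 1 + y by rewrite lerDl.
have yp : 0 < 1 + y by exact: lt_le_trans y1.
rewrite powRN ler_pdivlMr ?powR_gt0//.
apply: (@le_trans _ _ (expR (- (t * y)) * (1 + y) ^+ (3 * N))).
  apply: ler_wpM2l; first exact: expR_ge0.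
  rewrite -powR_mulrn ?(ltW yp)//; apply: ler_powR => //.
  apply: (le_trans (ler_norm p)); apply: (le_trans (ltW (archi_boundP (normr_ge0 p)))).
  by rewrite ler_nat /N; apply: (leq_trans (leqnSn _)); rewrite leq_pmull.
have -> : expR (- (t * y)) = expR (- (t / N%:R * y)) ^+ N.
  by rewrite -expRM_natl; congr expR; field; rewrite gt_eqF.
rewrite exprM -exprMn; apply: lerXn2r; rewrite ?nnegrE//.
  by apply: mulr_ge0; [exact: expR_ge0|rewrite exprn_ge0// ltW].
exact: H.
Qed.

(** For v = i this is [testf]; the other values of v arise from its translates by multiples of
    [w0]. *)
Definition expf (t : R) v w := cexp ((0 +i* t) * w) * (w + v)^-1.

Definition expfd (t : R) v w := cexp ((0 +i* t) * w) * ((0 +i* t) * (w + v)^-1 - (w + v)^-1 ^+ 2).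

Lemma hol_expf t v : 0 < Im v -> hol (expf t v) (expfd t v).
Proof.
move=> v0 w w0; have := cdiffM (cdiff_cexp_lin (0 +i* t) w) (cdiff_inv_shift v0 w0).
rewrite (_ : _ + _ = expfd t v w)// /expfd; ring.
Qed.

Lemma nc_imag t : nc (0 +i* t) ^+ 2 = t ^+ 2.
Proof. by rewrite nc_sqr /= expr0n /= add0r. Qed.

Lemma nc_cexp_imag t w : nc (cexp ((0 +i* t) * w)) = expR (- (t * Im w)).
Proof. by rewrite nc_cexp ReM /= mul0r sub0r. Qed.

(** The constant K does not depend on v, so the energy tends to 0 as Im v grows; the exponential
    factor takes care of every alpha. *)
Lemma expf_indir alpha t : -1 < alpha -> 0 < t -> exists2 K, 0 <= K &
  forall v, 1 <= Im v -> indir alpha (expf t v) (expfd t v) /\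
    (energy alpha (expfd t v) <= (K / Im v)%:E)%E.
Proof.
move=> al t0; pose p := alpha + 2; have ap : alpha + 1 < p by rewrite /p; lra.
have t20 : 0 < 2 * t by rewrite mulr_gt0.
have [K K0 H] := expR_decay_powR p t20.
have r0 : 0 <= ray_cst alpha p.
  by apply: addr_ge0; rewrite invr_ge0; lra.
pose L := 2 * (t ^+ 2 + 1) * K * pi.
have L0 : 0 <= L.
  apply: mulr_ge0; last exact: pi_ge0.
  by apply: mulr_ge0 => //; apply: mulr_ge0 => //; rewrite addr_ge0// sqr_ge0.
exists (L * ray_cst alpha p); first exact: mulr_ge0.
move=> v v1; have v0 : 0 < Im v by exact: lt_le_trans v1.
have hf := hol_expf t v0; have [fdd hfd] := hol_deriv hf.
have E : (energy alpha (expfd t v) <= (L * ray_cst alpha p / Im v)%:E)%E.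
  rewrite mulrAC.
  apply: (@energy_majorant _ p _ (fun y => 2 * (t ^+ 2 + 1) * expR (- (2 * t * y))) v) => //.
  - by rewrite divr_ge0// ltW.
  - exact: hol_ccont hfd.
  - apply: measurable_funM; first exact: measurable_cst.
    apply: (measurableT_comp (@measurable_expR R)).
    apply: measurable_funN.
    by apply: measurable_funM => //; exact: measurable_cst.
  - by move=> y; apply: mulr_ge0; [rewrite mulr_ge0// addr_ge0// sqr_ge0|exact: expR_ge0].
  - move=> z z0; rewrite /expfd ncM exprMn nc_cexp_imag.
    have -> : expR (- (t * Im z)) ^+ 2 = expR (- (2 * t * Im z)).
      by rewrite -expRM_natl; congr expR; ring.
    rewrite [leRHS]mulrAC mulrC; apply: ler_wpM2r; first exact: expR_ge0.
    apply: (le_trans (nc_sqrD _ _)); rewrite ncN ncM exprMn nc_imag -[leRHS]mulrA.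
    apply: ler_wpM2l => //; rewrite mulrDl mul1r lerD2l ncX.
    have r1 : nc (z + v)^-1 <= 1.
      apply: (le_trans (nc_inv_shift v0 z0)); rewrite invf_le1 ?addr_gt0//.
      by apply: (le_trans v1); rewrite lerDr ltW.
    have r2 : nc (z + v)^-1 ^+ 2 <= 1 by rewrite exprn_ile1 ?nc_ge0.
    by rewrite -[leRHS]mulr1 (expr2 (_ ^+ 2)); apply: ler_wpM2l; [exact: sqr_ge0|].
  - move=> y y0; have h1 := H y (ltW y0).
    have h2 : pi / (y + Im v) <= pi / Im v.
      apply: ler_wpM2l; first exact: pi_ge0.
      by rewrite lef_pV2 ?posrE ?addr_gt0// lerDr ltW.
    apply: (@le_trans _ _ (2 * (t ^+ 2 + 1) * (K * (1 + y) `^ (- p)) * (pi / Im v))).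
      have c0 : 0 <= 2 * (t ^+ 2 + 1) by rewrite mulr_ge0// addr_ge0// sqr_ge0.
      apply: ler_pM => //; first by apply: mulr_ge0 => //; exact: expR_ge0.
        by rewrite divr_ge0 ?pi_ge0// addr_ge0 ?ltW.
      by apply: ler_wpM2l.
    rewrite /L le_eqVlt; apply/orP; left; apply/eqP; ring.
split; last exact: E.
split => //; first by apply: (le_lt_trans E); rewrite ltry.
apply: vdecay_inv => x y y1; have y0 : 0 < y by exact: lt_le_trans y1.
rewrite /expf ncM nc_cexp_imag -[leRHS]mul1r; apply: ler_pM; rewrite ?expR_ge0 ?nc_ge0//.
  by rewrite -expR0 ler_expR oppr_le0 mulr_ge0// ltW.
apply: (le_trans (@nc_inv_shift v (x +i* y) v0 y0)).
by rewrite lef_pV2 ?posrE ?addr_gt0//= lerDl ltW.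
Qed.

End Membership.

(** * Solvability under closed range, and the points of the spiral other than 0 and 1 *)

Section ClosedRange.
Context {R : realType}.
Local Notation nc := (@ComplexField.Normc.normc R).
Local Notation TR := (measurableTypeR R).
Local Notation Re := (@complex.Re R).
Local Notation Im := (@complex.Im R).
Local Notation pi := (@trigo.pi R).
Local Notation I1 := (0 +i* 1 : R[i]).
Implicit Types (x y e r s t p q alpha : R) (a b z w l u v lam : R[i]) (f g fd gd : R[i] -> R[i]) (m n : nat).

Definition ratf m v w : R[i] := (w + v)^-1 ^+ m.

Definition ratfd m v w : R[i] := - (m%:R * (w + v)^-1 ^+ m.+1).

Lemma hol_ratf m v : 0 < Im v -> hol (ratf m v) (ratfd m v).
Proof.
move=> v0 w w0; have := cdiffX m (cdiff_inv_shift v0 w0).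
rewrite (_ : _ * _ = ratfd m v w)// /ratfd mulrN; congr (- _).
by case: m => [|m]; rewrite ?mul0r// -mulrA -exprD addn2.
Qed.

Definition ratf_eps alpha m : R := m%:R - alpha / 2.

Definition ratf_pow alpha m : R := 2 * m%:R + 1 - ratf_eps alpha m.

(** The total power 2m + 1 of 1 / (y + Im v) is split in two: the exponent [ratf_eps] > 0 yields
    decay in Im v, and [ratf_pow] > alpha + 1 yields convergence in y. Both inequalities amount to
    alpha / 2 < m. *)
Lemma ratf_indir alpha m v : -1 < alpha -> (0 < m)%N -> alpha / 2 < m%:R -> 0 < Im v ->
  indir alpha (ratf m v) (ratfd m v) /\
  (energy alpha (ratfd m v) <= (m%:R ^+ 2 * pi * ray_cst alpha (ratf_pow alpha m) *
     (Im v `^ (- ratf_eps alpha m) * Num.min 1 (Im v) `^ (- ratf_pow alpha m)))%:E)%E.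
Proof.
move=> al m0 am v0; set eps := ratf_eps alpha m; set p := ratf_pow alpha m.
have m1 : 1 <= m%:R :> R by rewrite ler1n.
have e0 : 0 < eps by rewrite subr_gt0.
have pE : p = m%:R + alpha / 2 + 1 by rewrite /p /ratf_pow /ratf_eps; ring.
have ap : alpha + 1 < p by rewrite pE; lra.
have p0 : 0 <= p by rewrite pE; lra.
have hf := hol_ratf m v0; have [fdd hfd] := hol_deriv hf.
pose mu0 := Num.min 1 (Im v).
have mu00 : 0 < mu0 by rewrite lt_min ltr01 v0.
have mu1 : mu0 <= 1 by rewrite ge_min lexx.
have muv : mu0 <= Im v by rewrite ge_min lexx orbT.
have C0 : 0 <= m%:R ^+ 2 * pi * (Im v `^ (- eps) * mu0 `^ (- p)).
  apply: mulr_ge0; first by apply: mulr_ge0; [exact: sqr_ge0|exact: pi_ge0].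
  by apply: mulr_ge0; exact: powR_ge0.
have E : (energy alpha (ratfd m v) <= (m%:R ^+ 2 * pi * ray_cst alpha p *
     (Im v `^ (- eps) * mu0 `^ (- p)))%:E)%E.
  rewrite mulrAC.
  apply: (@energy_majorant _ _ p _ (fun y => m%:R ^+ 2 * (y + Im v) `^ (- (2 * m)%:R)) v) => //.
  - exact: hol_ccont hfd.
  - apply: measurable_funM; first exact: measurable_cst.
    have mP : measurable_fun [set: TR] ((fun t : TR => t `^ (- (2 * m)%:R) : TR) : TR -> TR) by exact: measurable_powR.
    have mD : measurable_fun [set: TR] ((fun t : TR => t + Im v : TR) : TR -> TR).
      by apply: measurable_funD => //; exact: measurable_cst.
    exact: (measurableT_comp mP mD).
  - by move=> y; apply: mulr_ge0; [exact: sqr_ge0|exact: powR_ge0].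
  - move=> z z0; have Y0 : 0 < Im z + Im v by rewrite addr_gt0.
    rewrite /ratfd ncN ncM nc_nat exprMn -mulrA; apply: ler_wpM2l; first exact: sqr_ge0.
    rewrite [(z + v)^-1 ^+ m.+1]exprS ncM exprMn mulrC; apply: ler_wpM2r; first exact: sqr_ge0.
    rewrite powRN powR_mulrn ?(ltW Y0)// exprM -exprVn ncX -exprM mulnC exprM.
    apply: lerXn2r; rewrite ?nnegrE ?sqr_ge0 ?invr_ge0 ?sqr_ge0//.
    rewrite -exprVn; apply: lerXn2r; rewrite ?nnegrE ?nc_ge0 ?invr_ge0 ?(ltW Y0)//.
    exact: nc_inv_shift.
  - move=> y y0; have Y0 : 0 < y + Im v by rewrite addr_gt0.
    have -> : m%:R ^+ 2 * (y + Im v) `^ (- (2 * m)%:R) * (pi / (y + Im v)) =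
        m%:R ^+ 2 * pi * ((y + Im v) `^ (- eps) * (y + Im v) `^ (- p)).
      rewrite -powRD ?(gt_eqF Y0) ?implybT// (_ : - eps + - p = - (2 * m)%:R + -1); last first.
        by rewrite /p /ratf_pow -/eps natrM; ring.
      rewrite powRD ?(gt_eqF Y0) ?implybT// [_ `^ (-1)]powR_inv1 ?(ltW Y0)//; ring.
    rewrite -[leRHS]mulrA; apply: ler_wpM2l; first by apply: mulr_ge0; [exact: sqr_ge0|exact: pi_ge0].
    rewrite -mulrA; apply: ler_pM; rewrite ?powR_ge0//.
      by apply: powR_antitone => //; [rewrite lerDr ltW|exact: ltW].
    rewrite -powRM ?(ltW mu00) ?addr_ge0 ?(ltW y0)//.
    apply: powR_antitone => //; first by rewrite mulr_gt0// addr_gt0.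
    by rewrite mulrDr mulr1 addrC; apply: lerD => //; rewrite ler_piMl// ltW.
split; last exact: E.
split => //; first by apply: (le_lt_trans E); rewrite ltry.
apply: vdecay_inv => x y y1; have y0 : 0 < y by exact: lt_le_trans y1.
have h := @nc_inv_shift _ v (x +i* y) v0 y0.
have h2 : (y + Im v)^-1 <= y^-1 by rewrite lef_pV2 ?posrE ?addr_gt0// lerDl ltW.
have h3 : nc (x +i* y + v)^-1 <= 1.
  apply: (le_trans h); apply: (le_trans h2); rewrite invf_le1//.
rewrite /ratf ncX -(prednK m0) exprS; apply: le_trans (le_trans h h2).
by rewrite -[leRHS]mulr1; apply: ler_wpM2l; [exact: nc_ge0|rewrite exprn_ile1 ?nc_ge0].
Qed.

Lemma indir_sum alpha n (f fd : nat -> R[i] -> R[i]) : indir alpha (fun=> 0) (fun=> 0) ->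
  (forall j, indir alpha (f j) (fd j)) ->
  indir alpha (fun z => \sum_(j < n) f j z) (fun z => \sum_(j < n) fd j z).
Proof.
move=> H0 H; elim: n => [|n IH].
  by apply: (indir_eq H0) => z _; rewrite big_ord0.
by apply: (indir_eq (indirD IH (H n))) => z _; rewrite big_ord_recr.
Qed.

Lemma indir0 alpha f fd : indir alpha f fd -> indir alpha (fun=> 0) (fun=> 0).
Proof. by move=> H; apply: (indir_eq (indirZ 0 H)) => z _; rewrite mul0r. Qed.

Section Spectrum.
Variables (tau : half_plane R -> half_plane R) (w0 : R[i]) (alpha : R).
Hypothesis al : -1 < alpha.
Hypothesis htau : parabolic_self_map tau w0.

Let D := @dirichlet_space R alpha.
Let nrm := @dirichlet_norm R alpha.
Let C := @composition_operator R tau.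

Lemma shift_op_restr lam f (w : half_plane R) :
  shift_op C lam (restr f) w = f (val w + w0) - lam * f (val w).
Proof.
have w1 : 0 < Im (val w) by case: w.
rewrite (shift_opE htau) !ext0_restr//.
by rewrite ImD ltr_pwDl// (parabolic_im htau).
Qed.

Lemma range_indir lam g F : D F -> (forall w : half_plane R, shift_op C lam F w = g (val w)) ->
  indir alpha (ext0 F) (cderiv F) /\
  forall z, 0 < Im z -> ext0 F (z + w0) - lam * ext0 F z = g z.
Proof.
move=> /dirichlet_indir HF H; split=> // z z0.
by have := H (exist _ z z0); rewrite (shift_opE htau).
Qed.

(** As g_(n+1) is lam^-1 times the translate of g_n, the image under C - lam of - lam^-1 (g_0 + ...
    + g_(n-1)) telescopes to g_0 - g_n. Small energy of some g_n puts g_0 in the closure of the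
    range. *)
Lemma closed_range_solution lam (g gd : nat -> R[i] -> R[i]) : lam != 0 ->
  closed_range D nrm (shift_op C lam) ->
  (forall n, indir alpha (g n) (gd n)) ->
  (forall n z, 0 < Im z -> g n.+1 z = lam^-1 * g n (z + w0)) ->
  (forall e, 0 < e -> exists n, (energy alpha (gd n) <= e%:E)%E) ->
  exists f fd, indir alpha f fd /\ forall z, 0 < Im z -> f (z + w0) - lam * f z = g 0%N z.
Proof.
move=> l0 cr Hg gS ge.
have [D0 _] := indir_restr (Hg 0%N).
have [e e0|F DF FE] := cr _ D0.
  (* The norm is the square root of the energy, and the half makes the inequality strict. *)
  have e20 : 0 < e ^+ 2 / 2 by rewrite divr_gt0// exprn_gt0.
  have [n En] := ge _ e20.
  pose S z := - lam^-1 * \sum_(j < n) g j z.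
  have HS := indirZ (- lam^-1) (indir_sum n (indir0 (Hg 0%N)) Hg).
  have [DS _] := indir_restr HS.
  exists (restr S) => //.
  have tele (z : R[i]) : 0 < Im z -> \sum_(j < n) g j (z + w0) = lam * (\sum_(j < n) g j z + g n z - g 0%N z).
    move=> z0; elim: (n) => [|k IH]; first by rewrite !big_ord0 add0r subrr mulr0.
    by rewrite !big_ord_recr /= IH gS//; field.
  have EE : forall w : half_plane R, (restr (g 0%N) - shift_op C lam (restr S)) w = g n (val w).
    move=> w; have w1 : 0 < Im (val w) by case: w.
    rewrite -[LHS]/(g 0%N (val w) - shift_op C lam (restr S) w) shift_op_restr /S tele//.
    by field.
  have [_ nE] := indir_dirichlet (Hg n) EE.
  rewrite /nrm nE -[ltRHS]ger0_norm ?(ltW e0)// -sqrtr_sqr ltr_sqrt ?exprn_gt0//.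
  apply: (@le_lt_trans _ _ (e ^+ 2 / 2)); last by have := exprn_gt0 2 e0; lra.
  have [_ fin _] := Hg n.
  by rewrite -lee_fin fineK// ge0_fin_numE// energy_ge0.
have [HF Fz] := @range_indir lam (g 0%N) F DF (fun w : half_plane R => congr1 (fun G => G w) FE).
by exists (ext0 F), (cderiv F).
Qed.

Lemma equation_deriv lam f fd g gd : indir alpha f fd -> hol g gd ->
  (forall z, 0 < Im z -> f (z + w0) - lam * f z = g z) ->
  forall z, 0 < Im z -> fd (z + w0) - lam * fd z = gd z.
Proof.
move=> [hf _ _] hg H z z0; have hs := hol_shift hf (parabolic_im htau).
apply: cdiff_uniq (cdiffB (hs z z0) (cdiff_cstM lam (hf z z0))) _.
apply: cdiff_ext (hg z z0) _; have [r r0 rh] := upper_nbhd z0.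
by exists r => // w /rh/H.
Qed.

(** Translating e^{itw} / (w + i) by n w0 and dividing by lam^n gives e^{itw} / (w + i + n w0),
    whose energy tends to 0. A closed range would therefore contain e^{itw} / (w + i), against
    [range_functional] and [test_functional_eq]. *)
Lemma not_closed_exp t : 0 < Im w0 -> 0 < t ->
  ~ closed_range D nrm (shift_op C (cexp ((0 +i* t) * w0))).
Proof.
move=> b0 t0 cr; set lam := cexp _ in cr.
have [K K0 HK] := expf_indir al t0.
have v1 n : 1 <= Im (I1 + n%:R * w0).
  by rewrite ImD -(rmorph_nat (real_complex R)) ImM /= mul0r addr0 lerDl mulr_ge0// ltW.
have [n|n z z0|e e0|f [fd [Hf fE]]] := @closed_range_solution lam
  (fun n => expf t (I1 + n%:R * w0)) (fun n => expfd t (I1 + n%:R * w0)) (cexp_neq0 _) cr.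
- exact: (HK _ (v1 n)).1.
- have E : z + w0 + (I1 + n%:R * w0) = z + (I1 + n.+1%:R * w0) by rewrite -natr1; ring.
  have l0 : lam != 0 by exact: cexp_neq0.
  rewrite /expf E mulrDr cexpD -/lam; set X := cexp _; set Y := (_ + _)^-1.
  by rewrite mulrA mulrCA mulVf// mulr1.
- exists (Num.bound (K / (e * Im w0))) => /=; apply: (le_trans (HK _ (v1 _)).2).
  rewrite lee_fin ImD -(rmorph_nat (real_complex R)) ImM /= mul0r addr0; set N := Num.bound _.
  have Kn : K / (e * Im w0) < N%:R.
    by apply: archi_boundP; apply: divr_ge0 => //; apply: mulr_ge0; exact: ltW.
  have eb : 0 < e * Im w0 by rewrite mulr_gt0.
  move: Kn; rewrite ltr_pdivrMr// => Kn.
  rewrite ler_pdivrMr; first by nra.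
  by rewrite ltr_pwDl// mulr_ge0// ltW.
have fdE := equation_deriv Hf (hol_expf t (ltr01 : 0 < Im I1)) _.
have {}fdE : forall z, 0 < Im z -> fd (z + w0) - lam * fd z = testfd t z.
  move=> z z0; rewrite -[RHS]/(cexp _ * _) -exprVn; apply: fdE => //.
  by move=> u u0; rewrite fE// mul0r addr0.
have := range_functional t al Hf (ltW b0); rewrite -/lam => H.
have E := @test_functional_eq R t 1 t0.
have : (1 : R[i]) = 0.
  apply: E; apply: eq_clim H => n; rewrite mul1r; apply: eq_cI => x _.
  by rewrite fdE//=; exact: ltr01.
by move/eqP; rewrite oner_eq0.
Qed.

End Spectrum.

End ClosedRange.

(** * The point 1 of the spectrum *)

Section One.
Context {R : realType}.
Local Notation nc := (@ComplexField.Normc.normc R).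
Local Notation mu := (@lebesgue_measure R).
Local Notation TR := (measurableTypeR R).
Local Notation Re := (@complex.Re R).
Local Notation Im := (@complex.Im R).
Local Notation pi := (@trigo.pi R).
Local Notation I1 := (0 +i* 1 : R[i]).
Implicit Types (x y e r s t p q alpha : R) (a b z w l u lam : R[i]) (f g fd gd : R[i] -> R[i]) (m n : nat).

(** The order of magnitude of f' at height y that finite energy allows. *)
Definition dec alpha y : R := y `^ (- (1 + alpha / 2)).

Lemma decE alpha y : y `^ (- 1 - alpha / 2) = dec alpha y.
Proof. by rewrite /dec; congr powR; ring. Qed.

Lemma dec_scale alpha (c y : R) : 0 < c -> 0 < y -> dec alpha (c * y) = dec alpha c * dec alpha y.
Proof. by move=> c0 y0; rewrite /dec powRM// ltW. Qed.

Lemma dec_small alpha : -1 < alpha -> forall e, 0 < e ->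
  exists2 Y, 0 < Y & forall y, Y <= y -> dec alpha y <= e.
Proof.
move=> al e e0; pose b := 1 + alpha / 2; have b0 : 0 < b by rewrite /b; lra.
exists (e `^ (- b^-1)); first exact: powR_gt0.
move=> y Yy; apply: (@le_trans _ _ ((e `^ (- b^-1)) `^ (- b))).
  by apply: powR_antitone => //; [exact: powR_gt0|exact: ltW].
by rewrite -powRrM mulrNN mulVf ?gt_eqF// powRr1// ltW.
Qed.

Section Solution.
Variables (w0 : R[i]) (alpha : R) (f fd : R[i] -> R[i]).
Hypothesis al : -1 < alpha.
Hypothesis b0 : 0 < Im w0.
Hypothesis Hf : indir alpha f fd.

Let hf : hol f fd. Proof. by case: Hf. Qed.
Let C := Num.sqrt (wcst alpha * fine (energy alpha fd)).

Lemma second_deriv_le fdd z y : hol fd fdd -> 0 < y -> y <= Im z ->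
  nc (fdd z) <= 32 * C * dec alpha (y / 2) / y.
Proof.
move=> hfd y0 yz; have z0 : 0 < Im z by exact: lt_le_trans yz.
have y20 : 0 < y / 2 by rewrite divr_gt0.
have : nc (fdd z) <= 16 * (C * dec alpha (y / 2)) / (y / 2).
  apply: (@Cauchy_deriv_le R fd z (y / 2)) => //.
  - move=> w /insq_Im/andP[h _]; exists (fdd w); apply: hfd; lra.
  - move=> w [/insq_Im/andP[h _] _].
    have v0 : 0 < Im (0 +i* (y / 2) : R[i]) by [].
    rewrite -decE; apply: (indir_sup al Hf v0) => /=; lra.
  - exact: hfd.
by rewrite (_ : 16 * _ / (y / 2) = 32 * C * dec alpha (y / 2) / y)//; field; rewrite gt_eqF.
Qed.

(** Cauchy's estimate on a square of half-side y/2 makes f'' smaller than f' by a factor 1/y, so f(z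
    + w0) - f(z) is f'(z) w0 up to such a term. *)
Lemma increment_remainder : exists2 K, 0 <= K & forall x y, 0 < y ->
  nc (f (x +i* y + w0) - f (x +i* y) - fd (x +i* y) * w0) <= K / y * dec alpha (y / 2).
Proof.
have [fdd hfd] := hol_deriv hf.
have C0 : 0 <= C by exact: sqrtr_ge0.
exists (4 * (32 * C) * nc w0 ^+ 2); first by apply: mulr_ge0; [apply: mulr_ge0 => //; exact: mulr_ge0|exact: sqr_ge0].
move=> x y y0; set z := x +i* y; pose M := 32 * C * dec alpha (y / 2) / y.
have M0 : 0 <= M.
  apply: divr_ge0; last exact: ltW.
  by apply: mulr_ge0; [exact: mulr_ge0|exact: powR_ge0].
have im t : 0 <= t <= 1 -> y <= Im (z + w0 * t%:C).
  move=> /andP[t0 _]; rewrite ImD ImM /= mulr0 add0r lerDl; apply: mulr_ge0 => //; exact: ltW.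
have d1 t : 0 <= t <= 1 -> nc (fd (z + w0 * t%:C) - fd z) <= 2 * (M * nc w0).
  move=> t01; apply: (@le_trans _ _ (2 * (M * nc (w0 * t%:C)))).
    apply: (@cdiff_MVI R fd fdd) => s /andP[s0 s1].
      apply: hfd; apply: (lt_le_trans y0); rewrite -mulrA -rmorphM.
      by apply: im; case/andP: t01 => t0 t1; rewrite mulr_ge0//= mulr_ile1.
    apply: second_deriv_le => //; rewrite -mulrA -rmorphM.
    by apply: im; case/andP: t01 => t0 t1; rewrite mulr_ge0//= mulr_ile1.
  case/andP: t01 => t0 t1; rewrite ncM nc_real ger0_norm//.
  apply: ler_wpM2l => //; apply: ler_wpM2l => //.
  by rewrite -[leRHS]mulr1; apply: ler_wpM2l => //; exact: nc_ge0.
have := @cdiff_MVI R (fun u => f u - fd z * u) (fun u => fd u - fd z) z w0 (2 * (M * nc w0)).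
rewrite (_ : f (z + w0) - fd z * (z + w0) - (f z - fd z * z) =
  f (z + w0) - f z - fd z * w0); last by ring.
move=> H; apply: le_trans (H _ _) _.
- move=> t /im yt; apply: cdiffB; first by apply: hf; exact: lt_le_trans yt.
  by have := cdiff_cstM (fd z) (cdiff_id (z + w0 * t%:C)); rewrite mulr1.
- exact: d1.
- by rewrite /M le_eqVlt; apply/orP; left; apply/eqP; ring.
Qed.

(** [energy_tail] with w = y: high up, only a small part of the energy is seen. *)
Lemma vertical_little_o : forall e, 0 < e -> exists Y, forall x y, 0 < y -> Y <= y ->
  nc (fd (x +i* y)) <= e * dec alpha y.
Proof.
move=> e e0; have [fdd hfd] := hol_deriv hf; have [_ ef _] := Hf.
have w1 := wcst_ge0 alpha; have W0 : 0 < wcst alpha + 1 by rewrite ltr_wpDl.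
have e'0 : 0 < e ^+ 2 / (wcst alpha + 1) by rewrite divr_gt0// exprn_gt0.
have [n Hn] := energy_tail hfd ef (measurable_snd : measurable_fun [set: (TR * TR)%type] (fun p : R * R => p.2)) e'0.
exists (2 * n%:R) => x y y0 ny.
have H : nc (fd (x +i* y)) ^+ 2 <= wcst alpha * y `^ (- 2 - alpha) * (e ^+ 2 / (wcst alpha + 1)).
  by apply: Hn => // q _ /andP[q1 _]; lra.
have d0 : 0 <= dec alpha y by exact: powR_ge0.
rewrite -(@ler_pXn2r _ 2)// ?nnegrE ?nc_ge0 ?mulr_ge0 ?(ltW e0)//; apply: (le_trans H).
have -> : y `^ (- 2 - alpha) = dec alpha y ^+ 2.
  by rewrite /dec -(powR_mulrn 2 (powR_ge0 _ _)) -powRrM; congr powR; field.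
have -> : wcst alpha * dec alpha y ^+ 2 * (e ^+ 2 / (wcst alpha + 1)) =
  (e * dec alpha y) ^+ 2 * (wcst alpha / (wcst alpha + 1)) by field; rewrite gt_eqF.
rewrite -[leRHS]mulr1; apply: ler_wpM2l; first exact: sqr_ge0.
by rewrite ler_pdivrMr// mul1r lerDl.
Qed.

(** High on the imaginary axis f(z + w0) - f(z) is o(y^(-1 - alpha/2)) by the two preceding lemmas,
    whereas |z + i|^-m is at least of the order of y^(-1 - alpha/2). *)
Lemma no_solution_ge0 m : m%:R <= 1 + alpha / 2 ->
  ~ (forall z, 0 < Im z -> f (z + w0) - 1 * f z = ratf m I1 z).
Proof.
move=> ma H; have [K K0 HK] := increment_remainder.
have n0 : 0 < nc w0 by rewrite nc_gt0; apply: contraTneq b0 => ->; rewrite ltxx.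
have d2 : 0 < dec alpha 2 by exact: powR_gt0.
have dh : 0 < dec alpha 2^-1 by apply: powR_gt0; rewrite invr_gt0.
pose e := dec alpha 2 / 4 / nc w0; have e0 : 0 < e by rewrite !divr_gt0.
have [Y HY] := vertical_little_o e0.
(* At this height the remainder and the main term are each at most a quarter of dec 2 times dec V,
   the lower bound for the right-hand side. *)
pose V := 1 + `|Y| + 4 * K * dec alpha 2^-1 / dec alpha 2.
have B0 : 0 <= 4 * K * dec alpha 2^-1 / dec alpha 2.
  by apply: divr_ge0; [apply: mulr_ge0; [exact: mulr_ge0|exact: ltW]|exact: ltW].
have V1 : 1 <= V by rewrite /V; have := normr_ge0 Y; lra.
have V0 : 0 < V by exact: lt_le_trans V1.
have dV : 0 < dec alpha V by exact: powR_gt0.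
have YV : Y <= V by rewrite /V; have := ler_norm Y; lra.
have h1 := HY 0 V V0 YV; have h2 := HK 0 V V0.
have yl : dec alpha (2 * V) <= nc (ratf m I1 (0 +i* V)).
  have E : nc (ratf m I1 (0 +i* V)) = (V + 1) `^ (- m%:R).
    have V10 : 0 <= V + 1 by rewrite addr_ge0// ltW.
    rewrite /ratf ncX ncV powRN powR_mulrn// exprVn; congr ((_ ^+ _)^-1).
    by rewrite /= addr0 expr0n /= add0r sqrtr_sqr ger0_norm.
  rewrite E /dec; apply: (@le_trans _ _ ((V + 1) `^ (- (1 + alpha / 2)))).
    by apply: powR_antitone; move: al => ?; lra.
  by apply: ler_powR; [lra|rewrite lerN2].
have := H (0 +i* V) V0; rewrite mul1r => HE.
have tri : nc (ratf m I1 (0 +i* V)) <= K / V * dec alpha (V / 2) + e * dec alpha V * nc w0.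
  rewrite -HE -[f _ - f _](subrK (fd (0 +i* V) * w0)).
  apply: (le_trans (le_ncD _ _)); apply: lerD => //.
  by rewrite ncM; apply: ler_wpM2r => //; exact: nc_ge0.
have := le_trans yl tri; rewrite [V / 2]mulrC !dec_scale ?invr_gt0//.
have -> : e * dec alpha V * nc w0 = dec alpha 2 / 4 * dec alpha V.
  by rewrite /e; field; rewrite gt_eqF.
have kv : K / V * (dec alpha 2^-1 * dec alpha V) <= dec alpha 2 / 4 * dec alpha V.
  rewrite mulrA; apply: ler_wpM2r; first exact: ltW.
  rewrite mulrAC ler_pdivrMr//.
  have : 4 * K * dec alpha 2^-1 / dec alpha 2 <= V by rewrite /V; have := normr_ge0 Y; lra.
  by rewrite ler_pdivrMr// => ?; lra.
by have := mulr_gt0 d2 dV; lra.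
Qed.

(** A solution would satisfy w0 f'(z) = 1 / (z + i) + o(1 / y) on the imaginary axis, so w0 f(iy)
    would grow like a logarithm: its increment from V to 2V stays at least 1/8, against the decay of
    f. *)
Lemma no_solution_lt0 : ~ (forall z, 0 < Im z -> f (z + w0) - 1 * f z = ratf 1 I1 z).
Proof.
move=> H; have [K K0 HK] := increment_remainder; have [_ _ vf] := Hf.
have [fdd hfd] := hol_deriv hf.
have n0 : 0 < nc w0 by rewrite nc_gt0; apply: contraTneq b0 => ->; rewrite ltxx.
have K1 : 0 < 4 * (K + 1) by rewrite mulr_gt0// ltr_wpDl.
have [Y1 Y10 HY1] := dec_small al (divr_gt0 ltr01 K1).
(* Both endpoint values of w0 f are at most 1/32, so the increment is at most 1/16. *)
have e0 : 0 < (32 * nc w0)^-1 by rewrite invr_gt0 mulr_gt0.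
have [Y2 HY2] := vf 0 _ e0.
pose V := 1 + 2 * Y1 + `|Y2|.
have V1 : 1 <= V by rewrite /V; have := normr_ge0 Y2; lra.
have V0 : 0 < V by lra.
have VY1 : Y1 <= V / 2 by rewrite /V; have := normr_ge0 Y2; lra.
have VY2 : Y2 <= V by rewrite /V; have := ler_norm Y2; lra.
(* On [V, 2V] the real part of the derivative of w0 f(iy) is at least 1/(2y) - 1/(4y) = 1/(4y) >=
   1/(8V). *)
have der y : V <= y -> 1 / (8 * V) <= Re (w0 * (fd (0 +i* y) * 'i)) \/ 2 * V < y.
  move=> Vy; have [y2|] := leP y (2 * V); last by right.
  left; have y0 : 0 < y by exact: lt_le_trans Vy.
  have := H (0 +i* y) y0; rewrite mul1r => HE.
  have R1 := HK 0 y y0; rewrite HE in R1.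
  have R2 : nc (ratf 1 I1 (0 +i* y) - fd (0 +i* y) * w0) <= 1 / (4 * y).
    apply: (le_trans R1).
    have h : dec alpha (y / 2) <= 1 / (4 * (K + 1)) by apply: HY1; lra.
    apply: (@le_trans _ _ (K / y * (1 / (4 * (K + 1))))).
      by apply: ler_wpM2l => //; rewrite divr_ge0// ltW.
    have -> : K / y * (1 / (4 * (K + 1))) = K / (K + 1) * (1 / (4 * y)).
      by field; rewrite (gt_eqF y0) /= gt_eqF// ltr_wpDl.
    rewrite -[leRHS]mul1r; apply: ler_wpM2r; first by rewrite divr_ge0// mulr_ge0// ltW.
    by rewrite ler_pdivrMr ?ltr_wpDl// mul1r lerDl.
  have E : 'i * ratf 1 I1 (0 +i* y) = ((y + 1)^-1)%:C.
    have y10 : y + 1 != 0 by rewrite gt_eqF// ltr_pwDl.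
    rewrite /ratf expr1; have -> : (0 +i* y : R[i]) + I1 = 'i * (y + 1)%:C.
      by rewrite [LHS]complex_eta [RHS]complex_eta !(ReD, ImD, ReM, ImM) /=; congr (_ +i* _); ring.
    rewrite invfM mulrA divff ?mul1r ?fmorphV//.
    by rewrite -nc_eq0 nc_i oner_eq0.
  have -> : w0 * (fd (0 +i* y) * 'i) = ((y + 1)^-1)%:C - 'i * (ratf 1 I1 (0 +i* y) - fd (0 +i* y) * w0).
    by rewrite -E; ring.
  rewrite ReD ReN; have := Re_le_nc ('i * (ratf 1 I1 (0 +i* y) - fd (0 +i* y) * w0)).
  have ni z : nc ('i * z) = nc z by rewrite ncM nc_i mul1r.
  rewrite ni ler_norml => /andP[_ h].
  have {}h := le_trans h R2.
  have y1 : 1 / (2 * y) <= (y + 1)^-1.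
    by rewrite div1r lef_pV2 ?posrE ?mulr_gt0//; lra.
  have y3 : 1 / (8 * V) <= 1 / (4 * y).
    by rewrite !div1r lef_pV2 ?posrE ?mulr_gt0//; lra.
  have y4 : 1 / (2 * y) = 1 / (4 * y) + 1 / (4 * y) by field; rewrite gt_eqF.
  by rewrite /=; lra.
have VV : V <= 2 * V by lra.
have cd y : V <= y <= 2 * V -> cdiff f (0 +i* y) (fd (0 +i* y)).
  by move=> /andP[Vy _]; apply: hf => /=; exact: lt_le_trans Vy.
pose G y := w0 * (fd (0 +i* y) * 'i).
have pG y : V <= y <= 2 * V -> pcont G y.
  move=> /andP[Vy _]; have y0 : 0 < y by exact: lt_le_trans Vy.
  apply: (@ccont_ver R (fun z => w0 * (fd z * 'i))).
  apply: ccontM; first exact: ccont_cst.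
  by apply: ccontM; [exact: (hol_ccont hfd)|exact: ccont_cst].
have FT : cI `[V, 2 * V] G = w0 * f (0 +i* (2 * V)) - w0 * f (0 +i* V).
  apply: (@cI_FTC R _ (fun y => w0 * f (0 +i* y))) => //.
  move=> y yV; have := @cdiff_ver R (fun z => w0 * f z) 0 y _ (cdiff_cstM w0 (cd y yV)).
  by rewrite /G mulrA.
have low : 1 / 8 <= Re (cI `[V, 2 * V] G).
  have -> : 1 / 8 = \int[mu]_(s in `[V, 2 * V]) (1 / (8 * V)).
    rewrite Rintegral_itv_cst//; field; rewrite gt_eqF//.
  rewrite /cI; have [ig _] := pcont_cintegrable pG.
  apply: le_Rintegral => //; first exact: integrable_itv_cst.
  move=> y; rewrite /= in_itv/= => /andP[Vy y2]; have [//|] := der y Vy.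
  by rewrite ltNge y2.
have f1 := HY2 V VY2; have f2 := HY2 (2 * V) (le_trans VY2 VV).
have := le_trans low (le_trans (ler_norm _) (Re_le_nc _)); rewrite FT => low2.
have := le_trans low2 (le_ncB _ _); rewrite !ncM.
have g1 := ler_wpM2l (ltW n0) f1; have g2 := ler_wpM2l (ltW n0) f2.
have E : nc w0 * (32 * nc w0)^-1 = 1 / 32 by field; rewrite gt_eqF.
rewrite E in g1 g2; lra.
Qed.

End Solution.

Section Spectrum.
Variables (tau : half_plane R -> half_plane R) (w0 : R[i]) (alpha : R).
Hypothesis al : -1 < alpha.
Hypothesis htau : parabolic_self_map tau w0.

Let D := @dirichlet_space R alpha.
Let nrm := @dirichlet_norm R alpha.
Let C := @composition_operator R tau.

Lemma not_closed_one : 0 < Im w0 -> ~ closed_range D nrm (shift_op C 1).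
Proof.
move=> b0 cr.
(* alpha / 2 < m puts (w + i)^-m in the space. For alpha >= 0 the integer m can also be taken at
   most 1 + alpha / 2, as [no_solution_ge0] requires; for alpha < 0 it is 1, the case of
   [no_solution_lt0]. *)
have [m [m0 m1 m2]] : exists m : nat, [/\ (0 < m)%N, alpha / 2 < m%:R &
    (m%:R <= 1 + alpha / 2 \/ m = 1%N)].
  have [a0|a0] := leP 0 alpha; last by exists 1%N; split; [|lra|right].
  exists (Num.truncn (alpha / 2)).+1.
  have /andP[t1 t2] := truncn_itv (divr_ge0 a0 (ler0n R 2)).
  by split=> //; left; rewrite -natr1 addrC lerD2l.
have v1 n : 1 <= Im (I1 + n%:R * w0).
  by rewrite ImD -(rmorph_nat (real_complex R)) ImM /= mul0r addr0 lerDl mulr_ge0// ltW.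
have v0 n : 0 < Im (I1 + n%:R * w0) by exact: lt_le_trans (v1 n).
have [n|n z z0|e e0|f [fd [Hf fE]]] := @closed_range_solution R tau w0 alpha htau 1
  (fun n => ratf m (I1 + n%:R * w0)) (fun n => ratfd m (I1 + n%:R * w0)) (oner_neq0 _) cr.
- exact: (ratf_indir al m0 m1 (v0 n)).1.
- by rewrite invr1 mul1r /ratf; congr (_^-1 ^+ _); rewrite -natr1; ring.
- pose K := m%:R ^+ 2 * pi * ray_cst alpha (ratf_pow alpha m).
  have eps0 : 0 < ratf_eps alpha m by rewrite subr_gt0.
  (* The height c at which (|K| + 1) c^(- ratf_eps) equals e. *)
  pose c := ((`|K| + 1) / e) `^ (ratf_eps alpha m)^-1.
  have q0 : 0 < (`|K| + 1) / e by rewrite divr_gt0// ltr_wpDl.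
  have c0 : 0 < c by exact: powR_gt0.
  exists (Num.bound (c / Im w0)); set N := Num.bound _.
  have Nc : c <= Im (I1 + N%:R * w0).
    rewrite ImD -(rmorph_nat (real_complex R)) ImM /= mul0r addr0.
    have := archi_boundP (divr_ge0 (ltW c0) (ltW b0)); rewrite ltr_pdivrMr// -/N => h.
    by apply: (le_trans (ltW h)); rewrite lerDr.
  apply: (le_trans (ratf_indir al m0 m1 (v0 N)).2); rewrite lee_fin -/K.
  rewrite (min_idPl (v1 N)) powR1 mulr1.
  apply: (@le_trans _ _ (`|K| * c `^ (- ratf_eps alpha m))).
    apply: (@le_trans _ _ (`|K| * Im (I1 + N%:R * w0) `^ (- ratf_eps alpha m))).
      by apply: ler_wpM2r; [exact: powR_ge0|exact: ler_norm].
    apply: ler_wpM2l; first exact: normr_ge0.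
    by apply: powR_antitone => //; exact: ltW.
  rewrite /c -powRrM mulrN mulVf ?gt_eqF// powRN powRr1 ?(ltW q0)// invf_div mulrA ler_pdivrMr ?ltr_wpDl//.
  by rewrite mulrC ler_wpM2l ?(ltW e0)// lerDl.
have fE' z : 0 < Im z -> f (z + w0) - 1 * f z = ratf m I1 z.
  by move=> z0; rewrite fE// mul0r addr0.
case: m2 => [m2|mE]; first exact: (no_solution_ge0 al b0 Hf m2 fE').
by apply: (no_solution_lt0 al b0 Hf) => z; rewrite mE in fE' *; exact: fE'.
Qed.

End Spectrum.

End One.

(** * A criterion for infinite codimension of the range *)

Section InfiniteCodimension.
Context {R : realType} {V : lmodType R[i]}.
Variables (H : set V) (T : V -> V).
Hypothesis Hlin : forall (l : R[i]) x y, H x -> H y -> H (l *: x + y).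
Hypothesis Tlin : forall (l : R[i]) x y, H x -> H y -> T (l *: x + y) = l *: T x + T y.

Lemma not_finite_codim (y : nat -> V) : (forall k, H (y k)) ->
  (forall n (a : nat -> R[i]) x, H x -> T x = \sum_(k < n) a k *: y k ->
    forall k, (k < n)%N -> a k = 0) ->
  ~ finite_codim_range H T.
Proof.
move=> Hy free [s Hs fin]; set n := size s.
have H0 : H 0 by have := Hlin (-1) (Hy 0%N) (Hy 0%N); rewrite scaleN1r addNr.
have T0 : T 0 = 0.
  by have := Tlin (-1) H0 H0; rewrite scaleN1r addNr scaleN1r addNr.
have /choice[x Hx] : forall k, exists x, H x /\ exists c, y k = T x + lin_comb s c.
  by move=> k; have [x ? [c ?]] := fin _ (Hy k); exists x; split=> //; exists c.
have /choice[c Hc] : forall k, exists c, y k = T (x k) + lin_comb s c.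
  by move=> k; case: (Hx k).
pose A : 'M[R[i]]_(n.+1, n) := \matrix_(k, i) c k i.
(* There are n + 1 rows and n columns, so some nonzero row vector annihilates the matrix. *)
have /rowV0Pn[u uA u0] : kermx A != 0.
  rewrite -mxrank_eq0 mxrank_ker subn_eq0 -ltnNge ltnS; exact: rank_leq_col.
have {}uA : u *m A = 0 by apply/sub_kermxP.
have HT (r : seq 'I_n.+1) : H (\sum_(k <- r) u 0 k *: x k) /\
    T (\sum_(k <- r) u 0 k *: x k) = \sum_(k <- r) u 0 k *: T (x k).
  elim: r => [|k r [IH1 IH2]]; first by rewrite !big_nil.
  have Hk : H (x k) by case: (Hx k).
  by rewrite !big_cons; split; [exact: Hlin|rewrite Tlin// IH2].
have [HX TX] := HT (index_enum _).
have key : T (\sum_(k < n.+1) u 0 k *: x k) = \sum_(k < n.+1) u 0 (inord k) *: y k.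
  rewrite TX [RHS](eq_bigr (fun k : 'I_n.+1 => u 0 k *: T (x k) + u 0 k *: lin_comb s (c k))).
    rewrite big_split /= (_ : \sum_(k < n.+1) u 0 k *: lin_comb s (c k) = 0) ?addr0//.
    under eq_bigr do rewrite /lin_comb scaler_sumr.
    rewrite exchange_big /= big1// => i _.
    under eq_bigr do rewrite scalerA.
    rewrite -scaler_suml; have := congr1 (fun B : 'rV[R[i]]_n => B 0 i) uA.
    rewrite !mxE (eq_bigr (fun k => u 0 k * c k i)); last by move=> k _; rewrite mxE.
    by move=> ->; rewrite scale0r.
  by move=> k _; rewrite inord_val -scalerDr -Hc.
have uz := free _ (fun k => u 0 (inord k)) _ HX key.
move/eqP: u0; apply; apply/rowP => k; rewrite !mxE.
by have := uz k (ltn_ord k); rewrite inord_val.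
Qed.

End InfiniteCodimension.

(** * Infinite codimension on the unit circle for real translations *)

Section NotFredholm.
Context {R : realType}.
Local Notation nc := (@ComplexField.Normc.normc R).
Local Notation Re := (@complex.Re R).
Local Notation Im := (@complex.Im R).
Local Notation pi := (@trigo.pi R).
Local Notation I1 := (0 +i* 1 : R[i]).
Implicit Types (x y e r t alpha : R) (b z w l u v s lam : R[i]) (f g fd gd : R[i] -> R[i]) (m n k j : nat).

Lemma hol_sum n (a : nat -> R[i]) (f fd : nat -> R[i] -> R[i]) : (forall k, hol (f k) (fd k)) ->
  hol (fun z => \sum_(k < n) a k * f k z) (fun z => \sum_(k < n) a k * fd k z).
Proof.
move=> H; elim: n => [|n IH] z z0.
  rewrite big_ord0; apply: cdiff_ext (cdiff_cst 0 z) _; exists 1 => // w _.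
  by rewrite big_ord0.
rewrite big_ord_recr /=.
apply: cdiff_ext (cdiffD (IH z z0) (cdiff_cstM (a n) (H n z z0))) _.
by exists 1 => // w _; rewrite big_ord_recr.
Qed.

(* Dividing by high powers of [w - z0], which is harmless as [E] vanishes near
   [z0], makes the Cauchy bound at [s] arbitrarily small. *)
Lemma vanish_near (E : R[i] -> R[i]) (b r : R) z0 s : 0 < r -> r < Im z0 -> b < Im z0 ->
  (forall z, 0 < Im z -> exists d, cdiff E z d) -> (forall z, b < Im z -> E z = 0) ->
  nc (s - z0) <= r / 2 -> E s = 0.
Proof.
move=> r0 rz bz hE Eb sz.
have pos w : insq z0 r w -> 0 < Im w by move=> /insq_Im/andP[h _]; lra.
have Ez : exists2 d, 0 < d & forall w, nc (w - z0) < d -> E w = 0.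
  exists (Im z0 - b) => [|w h]; first by rewrite subr_gt0.
  apply: Eb; have := le_lt_trans (Im_le_nc _) h; rewrite ImD ImN ltr_norml => /andP[+ _]; lra.
have cE w : onsq z0 r w -> ccont E w.
  by move=> [/pos/hE[d /cdiff_cont]].
have [B HB] := onsq_bounded r0 cE.
have [->|sz0] := eqVneq s z0; first exact: Eb.
have B0 : 0 <= B.
  have [side1 _ _ _] := onsq_sides z0 r0; apply: le_trans (nc_ge0 _) (HB _ (side1 (Re z0) _)).
  by apply/andP; split; lra.
apply: eps_eq => e e0; rewrite subr0.
have bound n : nc (E s) <= 32 * B * (2 ^+ n)^-1.
  pose g w := E w * (w - z0)^-1 ^+ n.
  have gd w : insq z0 r w -> exists d, cdiff g w d.
    move=> wi; have [d dE] := hE w (pos w wi); have [->|wz] := eqVneq w z0.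
      exists 0; apply: cdiff_ext (cdiff_cst 0 z0) _; have [q q0 H] := Ez.
      by exists q => // u /H uE; rewrite /g uE mul0r.
    have wz' : w - z0 != 0 by rewrite subr_eq0.
    have dV := @cdiffV R (fun w => w - z0) w _ (cdiffB (cdiff_id w) (cdiff_cst z0 w)) wz'.
    by eexists; exact: cdiffM dE (cdiffX n dV).
  have cg w : onsq z0 r w -> ccont (fun w => g w / (w - s)) w.
    move=> wo; have [d /cdiff_cont cgw] := gd w wo.1.
    apply: ccontM => //; apply: ccontV; first by apply: ccontB; [exact: ccont_id|exact: ccont_cst].
    by rewrite -nc_gt0; apply: lt_le_trans (onsq_dist_half wo sz); rewrite divr_gt0.
  have gs : nc (g s) <= 32 * (B / r ^+ n).
    apply: twopii_le; rewrite -(Cauchy_square r0 gd sz).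
    rewrite (_ : 32 * (B / r ^+ n) = 16 * (B / r ^+ n / (r / 2)) * r); last first.
      by field; rewrite (gt_eqF r0) gt_eqF// exprn_gt0.
    apply: (rsq_le r0 cg) => w wo; rewrite ncM ncV /g ncM ncX ncV.
    have w1 := onsq_dist wo; have w2 := onsq_dist_half wo sz.
    have w0 : 0 < nc (w - z0) by exact: lt_le_trans w1.
    apply: ler_pM; rewrite ?invr_ge0 ?nc_ge0//; first by rewrite mulr_ge0 ?nc_ge0// exprn_ge0// invr_ge0 nc_ge0.
      apply: ler_pM; rewrite ?nc_ge0 ?exprn_ge0 ?invr_ge0 ?nc_ge0//; first exact: HB.
      by rewrite exprVn lef_pV2 ?posrE ?exprn_gt0//; apply: lerXn2r; rewrite ?nnegrE ?nc_ge0// ltW.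
    by rewrite lef_pV2// posrE ?divr_gt0//; apply: lt_le_trans w2; rewrite divr_gt0.
  have sn : s - z0 != 0 by rewrite subr_eq0.
  have -> : E s = g s * (s - z0) ^+ n by rewrite /g -mulrA -exprMn mulVf// expr1n mulr1.
  rewrite ncM ncX; apply: (@le_trans _ _ (32 * (B / r ^+ n) * (r / 2) ^+ n)).
    apply: ler_pM => //; rewrite ?nc_ge0 ?exprn_ge0 ?nc_ge0//.
    by apply: lerXn2r; rewrite ?nnegrE ?nc_ge0// divr_ge0// ltW.
  rewrite exprMn exprVn le_eqVlt; apply/orP; left; apply/eqP.
  by field; rewrite !gt_eqF// exprn_gt0.
have [n Hn] : exists n : nat, 32 * B / e < n%:R.
  by exists (Num.bound (32 * B / e)); apply: archi_boundP; rewrite divr_ge0 ?mulr_ge0// ltW.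
apply: (le_trans (bound n)); rewrite ler_pdivrMr ?exprn_gt0//.
move: Hn; rewrite ltr_pdivrMr// => /ltW Hn; apply: (le_trans Hn).
rewrite mulrC; apply: ler_wpM2l; first exact: ltW.
by rewrite -natrX ler_nat ltnW// ltn_expl.
Qed.

Section Spectrum.
Variables (tau : half_plane R -> half_plane R) (w0 : R[i]) (alpha : R).
Hypothesis al : -1 < alpha.
Hypothesis htau : parabolic_self_map tau w0.

Let D := @dirichlet_space R alpha.
Let nrm := @dirichlet_norm R alpha.
Let C := @composition_operator R tau.

Lemma shift_op_linear lam l F G : D F -> D G ->
  shift_op C lam (l *: F + G) = l *: shift_op C lam F + shift_op C lam G.
Proof.
move=> DF DG; have [_ Clin _] := composition_bounded al htau.
have E : C (l *: F + G) = l *: C F + C G by exact: Clin.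
by rewrite /shift_op E !scalerBr scalerDr !scalerA (mulrC lam l) opprD addrACA.
Qed.

Lemma sum_restr n (a : nat -> R[i]) (g : nat -> R[i] -> R[i]) (w : half_plane R) :
  (\sum_(k < n) a k *: restr (g k)) w = \sum_(k < n) a k * g k (val w).
Proof.
elim: n => [|n IH]; first by rewrite !big_ord0.
by rewrite !big_ord_recr /= -IH.
Qed.

(** Infinitely many t_k > 0 satisfy e^{i t_k w0} = lam, and each gives a functional vanishing on the
    range. The functional at t_j tends to 0 on the function of frequency t_k when t_k > t_j and does
    not when k = j, so the functions are independent modulo the range by a triangular argument. *)
Lemma not_codim_real lam : Im w0 = 0 -> nc lam = 1 ->
  ~ finite_codim_range D (shift_op C lam).
Proof.
move=> w1 l1; have [_ w00 _] := htau; set a := Re w0.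
have wE : w0 = a%:C by rewrite [LHS]complex_eta w1.
have a0 : a != 0 by apply/eqP => aE; apply: w00; rewrite wE aE.
have na0 : 0 < `|a| by rewrite normr_gt0.
have lam0 : lam != 0 by rewrite -nc_gt0 l1.
have [v vl] := cexp_log lam0.
have Rv : Re v = 0.
  by have := nc_cexp v; rewrite vl l1 => /(congr1 (@ln R)); rewrite ln1 expRK.
pose th := Im v; pose N := Num.bound `|th|.
have p2 : 2 <= 2 * pi by rewrite ler_peMr//; have := @pi_ge2 R; lra.
(* The solutions of e^{ita} = lam differ by multiples of 2 pi / |a|; starting from N > |th| makes
   them positive, and they increase with k whatever the sign of a. *)
pose t k : R := th / a + 2 * pi * (N + k)%:R / `|a|.
have t0 k : 0 < t k.
  have : `|th / a| < N%:R / `|a|.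
    by rewrite normrM normfV ltr_pM2r ?invr_gt0//; apply: archi_boundP.
  rewrite ltr_norml => /andP[h _]; rewrite /t.
  have : N%:R / `|a| <= 2 * pi * (N + k)%:R / `|a|.
    apply: ler_wpM2r; first by rewrite invr_ge0 ltW.
    by rewrite natrD; have := ler0n R N; have := ler0n R k; nra.
  lra.
have tlt j k : (j < k)%N -> t j < t k.
  move=> jk; rewrite /t ltrD2l ltr_pM2r ?invr_gt0// ltr_pM2l; last by lra.
  by rewrite ltr_nat ltn_add2l.
have lE k : lam = cexp ((0 +i* t k) * w0).
  have -> : (0 +i* t k) * w0 = v + (if 0 <= a then (N + k)%:Z else - (N + k)%:Z)%:~R * twopii.
    rewrite wE /twopii [v]complex_eta Rv -/th.
    have -> : ((if 0 <= a then (N + k)%:Z else - (N + k)%:Z)%:~R : R[i]) =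
        ((if 0 <= a then (N + k)%:R else - (N + k)%:R) : R)%:C.
      by case: ifP => _; rewrite ?rmorphN /= -?pmulrn rmorph_nat.
    rewrite [LHS]complex_eta [RHS]complex_eta !(ReD, ImD, ReM, ImM) /=.
    congr (_ +i* _); first by ring.
    rewrite /t; case: ifPn => a1; first by rewrite ger0_norm//; field.
    by rewrite ltr0_norm ?ltNge//; field.
  by rewrite cexpD cexp_twopii_int mulr1.
have im1 : 1 <= Im I1 by [].
have mem k : indir alpha (expf (t k) I1) (expfd (t k) I1).
  by have [K _ HK] := expf_indir al (t0 k); exact: (HK _ im1).1.
apply: (@not_finite_codim _ _ D (shift_op C lam) _ _ (fun k => restr (expf (t k) I1))).
- by move=> l x y; exact: dirichlet_lin.
- exact: shift_op_linear.
- by move=> k; have [] := indir_restr (mem k).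
move=> n c F DF FE.
have [HF Fz] := range_indir htau (lam := lam) (g := fun z => \sum_(k < n) c k * expf (t k) I1 z) DF
  (fun w : half_plane R => etrans (congr1 (fun G => G w) FE) (sum_restr n c (fun k => expf (t k) I1) w)).
have Fd := equation_deriv htau HF (hol_sum n c (fun k => hol_expf (t k) (ltr01 : 0 < Im I1))) Fz.
have lim j : clim (fun m => \sum_(k < n) c k * test_functional (t j) (t k) m) 0.
  have := range_functional (t j) al HF (parabolic_im htau); rewrite -lE; apply: eq_clim => m.
  have icc k : cintegrable `[(- m%:R), m%:R]%classic (fun x => testfd (t k) (x +i* 1) * cexp (- (0 +i* t j) * (x +i* 1))).
    apply: (@hor_cint R (fun z => testfd (t k) z * cexp (- (0 +i* t j) * z))) => x _.
    have [_ [gdd hg]] : True /\ exists gdd, hol (testfd (t k)) gdd.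
      split=> //; apply: (@hol_deriv R (testf (t k))) => z z0; apply: cdiff_testf; exact: ltW.
    apply: ccontM; last exact: cdiff_cont (cdiff_cexp_lin _ _).
    by apply: (hol_ccont hg) => /=; exact: ltr01.
  rewrite (@eq_cI _ _ _ (fun x => \sum_(k < n) c k * (testfd (t k) (x +i* 1) * cexp (- (0 +i* t j) * (x +i* 1))))).
    rewrite /test_functional; elim: (n) => [|q IH].
      rewrite big_ord0 (@eq_cI _ _ _ (fun=> 0 * (testfd (t 0) (0 +i* 1)))); last by move=> x _; rewrite big_ord0 mul0r.
      by rewrite /cI; congr (_ +i* _); rewrite mul0r /Rintegral integral0_eq.
    rewrite big_ord_recr /= -IH -cIZ// -cID//; last first.
    - exact: cintegrableZ.
    - elim: (q) => [|q' IH'].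
        apply: eq_cintegrable (cintegrableZ 0 _ (icc 0%N)) => // x _; by rewrite mul0r big_ord0.
      apply: eq_cintegrable (cintegrableD _ IH' (cintegrableZ (c q') _ (icc q'))) => // x _.
      by rewrite big_ord_recr.
    by apply: eq_cI => x _; rewrite big_ord_recr.
  move=> x _; rewrite Fd; last exact: ltr01.
  by rewrite mulr_suml; apply: eq_bigr => k _; rewrite -mulrA /expfd /testfd exprVn.
(* Coefficients are treated by increasing frequency: at t_j the earlier ones are already 0 and the
   later terms vanish in the limit. *)
elim/ltn_ind => j IH jn.
apply: (test_functional_eq (t0 j)).
pose U (k : 'I_n) (m : nat) : R[i] := if k == j :> nat then 0 else c k * test_functional (t j) (t k) m.
have lUk (k : 'I_n) : clim (U k) 0.
  rewrite /U; have [kj|jk|_] := ltngtP k j.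
  - by rewrite (IH k kj (ltn_ord k)); apply: eq_clim (clim_cst 0) => m; rewrite mul0r.
  - rewrite -(mulr0 (c k)); apply: climZ; apply: test_functional_gt; exact: tlt.
  - exact: clim_cst.
have lU := clim_sum lUk; rewrite big1// in lU.
have := climD (lim j) (climZ (-1) lU); rewrite mulr0 addr0; apply: eq_clim => m.
rewrite mulN1r -sumrB (bigD1 (Ordinal jn))//= /U eqxx subr0 big1 ?addr0// => k kj.
by rewrite ifN ?subrr//; apply: contra kj => /eqP kj; apply/eqP/val_inj.
Qed.

End Spectrum.

End NotFredholm.

(** * The point 0 and determination of the spectra *)

Section Final.
Context {R : realType}.
Local Notation nc := (@ComplexField.Normc.normc R).
Local Notation Re := (@complex.Re R).
Local Notation Im := (@complex.Im R).
Implicit Types (x y e r t alpha : R) (z w l u v s lam : R[i]) (f g fd gd : R[i] -> R[i]) (m n k j : nat).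

(** In the variable u = z + w0 the right side has its only pole at u = w0 - v, inside the half-plane
    where f is holomorphic. Clearing denominators gives a holomorphic E that vanishes above height
    Im w0, hence also at that point, where only the coefficient of highest order survives. *)
Lemma pole_free f fd w0 m n (c : nat -> R[i]) : 0 < Im w0 -> (0 < m)%N -> hol f fd ->
  (forall z, 0 < Im z ->
    f (z + w0) = \sum_(k < n) c k * ratf (m + k) (0 +i* (Im w0 / 4)) z) ->
  forall k, (k < n)%N -> c k = 0.
Proof.
move=> b0 m0 hf; set b := Im w0 in b0 *; set v := 0 +i* (b / 4).
elim: n => [|n IH] // H.
have nz z : 0 < Im z -> z + v != 0.
  move=> z0; have : 0 < Im (z + v) by rewrite ImD /=; lra.
  by apply: contraTneq => ->; rewrite ltxx.
pose E u := (u - w0 + v) ^+ (m + n) * f u - \sum_(k < n.+1) c k * (u - w0 + v) ^+ (n - k).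
have dv u : cdiff (fun u => u - w0 + v) u 1.
  have := cdiffD (cdiffB (cdiff_id u) (cdiff_cst w0 u)) (cdiff_cst v u).
  by rewrite subr0 addr0.
have hE z : 0 < Im z -> exists d, cdiff E z d.
  move=> z0.
  have [d ds] : exists d, cdiff (fun u => \sum_(k < n.+1) c k * (u - w0 + v) ^+ (n - k)) z d.
    elim: (n.+1) => [|q [d IHq]].
      exists 0; apply: cdiff_ext (cdiff_cst 0 z) _; exists 1 => // u _.
      by rewrite big_ord0.
    eexists; apply: cdiff_ext (cdiffD IHq (cdiff_cstM (c q) (cdiffX (n - q) (dv z)))) _.
    by exists 1 => // u _; rewrite big_ord_recr.
  eexists; apply: cdiffB ds.
  by apply: (cdiffM (cdiffX (m + n) (dv z))); exact: hf.
have E0 z : b < Im z -> E z = 0.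
  move=> bz; have w1 : 0 < Im (z - w0) by rewrite ImD ImN subr_gt0.
  have := H _ w1; rewrite subrK /E => ->.
  rewrite mulr_sumr -sumrB big1// => k _; rewrite /ratf mulrCA -mulrBr.
  have kn : (k <= n)%N by rewrite -ltnS.
  have -> : (m + n = (n - k) + (m + k))%N by rewrite addnCA subnK.
  by rewrite exprD -mulrA -exprMn mulfV ?nz// expr1n mulr1 subrr mulr0.
(* [z0] lies in the region where E is known to vanish, at height 9b/8, and [s] is the pole, at
   distance 3b/8 <= b/2 from it; so the square of half-side b about [z0] stays in the half-plane. *)
pose z0 := w0 + (0 +i* (b / 8)); pose s := w0 - v.
have z0E : Im z0 = b + b / 8 by rewrite ImD.
have cn : c n = 0.
  have : E s = 0.
    apply: (@vanish_near R E b b z0) => //; rewrite ?z0E; [lra|lra|].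
    have -> : s - z0 = - (0 +i* (b / 4 + b / 8)).
      rewrite /s /z0 /v [LHS]complex_eta [RHS]complex_eta !(ReD, ImD, ReN, ImN) /=.
      by congr (_ +i* _); ring.
    by rewrite ncN /= expr0n /= add0r sqrtr_sqr ger0_norm; lra.
  rewrite /E (_ : s - w0 + v = 0); last by rewrite /s; ring.
  rewrite expr0n addn_eq0 eqn0Ngt m0 /= mul0r sub0r big_ord_recr /= subnn expr0 mulr1.
  rewrite big1 ?add0r; first by move=> /eqP; rewrite oppr_eq0 => /eqP.
  by move=> k _; rewrite expr0n subn_eq0 leqNgt ltn_ord /= mulr0.
move=> k; rewrite ltnS leq_eqVlt => /predU1P[->//|kn]; apply: IH => // z z1.
by rewrite H// big_ord_recr /= cn mul0r addr0.
Qed.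

Lemma invertible_fredholm (V : lmodType R[i]) (H : set V) (nrm : V -> R) (T : V -> V) :
  (forall (l : R[i]) (x y : V), H x -> H y -> H (l *: x + y)) ->
  invertible H nrm T -> fredholm H nrm T.
Proof.
move=> Hlin [S [[SH Slin _] ST]].
have H0 (x : V) : H x -> H 0 by move=> Hx; have := Hlin (-1) _ _ Hx Hx; rewrite scaleN1r addNr.
have nil0 (c : nat -> R[i]) : lin_comb [::] c = 0 :> V by rewrite /lin_comb big_ord0.
split.
- exists [::] => // x Hx Tx; exists (fun=> 0); rewrite nil0.
  have S0 : S 0 = 0.
    by have := Slin (-1) _ _ (H0 x Hx) (H0 x Hx); rewrite scaleN1r addNr scaleN1r addNr.
  by have [<- _] := ST x Hx; rewrite Tx S0.
- by move=> y Hy _; exists (S y); [exact: SH|have [] := ST y Hy].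
- exists [::] => // y Hy; exists (S y); first exact: SH.
  by exists (fun=> 0); rewrite nil0 addr0; have [] := ST y Hy.
Qed.

Section Spectrum.
Variables (tau : half_plane R -> half_plane R) (w0 : R[i]) (alpha : R).
Hypothesis al : -1 < alpha.
Hypothesis htau : parabolic_self_map tau w0.

Let D := @dirichlet_space R alpha.
Let nrm := @dirichlet_norm R alpha.
Let C := @composition_operator R tau.

(** An element of the range of C is z -> F(z + w0), holomorphic for Im z > - Im w0, while nontrivial
    combinations of the chosen functions have a pole at height - Im w0 / 4. *)
Lemma not_codim_zero : 0 < Im w0 -> ~ finite_codim_range D (shift_op C 0).
Proof.
move=> b0; pose m := (Num.bound `|alpha|).+1.
have v0 : 0 < Im (0 +i* (Im w0 / 4)) by rewrite /=; lra.
have mem k : indir alpha (ratf (m + k) (0 +i* (Im w0 / 4))) (ratfd (m + k) (0 +i* (Im w0 / 4))).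
  apply: (ratf_indir al _ _ v0).1 => //.
  have h1 := archi_boundP (normr_ge0 alpha); have h2 := ler_norm alpha; have h3 := normr_ge0 alpha.
  apply: (@lt_le_trans _ _ (Num.bound `|alpha|)%:R); first by lra.
  by rewrite ler_nat /m addSn ltnW// ltnS leq_addr.
apply: (@not_finite_codim _ _ D (shift_op C 0) _ _ (fun k => restr (ratf (m + k) (0 +i* (Im w0 / 4))))).
- by move=> l x y; exact: dirichlet_lin.
- exact: (shift_op_linear al htau).
- by move=> k; have [] := indir_restr (mem k).
move=> n c F DF FE.
have [HF Fz] := range_indir htau (lam := 0) (g := fun z => \sum_(k < n) c k * ratf (m + k) (0 +i* (Im w0 / 4)) z) DF
  (fun w : half_plane R => etrans (congr1 (fun G => G w) FE)
    (sum_restr n c (fun k => ratf (m + k) (0 +i* (Im w0 / 4))) w)).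
have [hF _ _] := HF.
apply: (@pole_free (ext0 F) _ w0 m n c b0 _ hF) => // z z0.
by rewrite -Fz// mul0r subr0.
Qed.

Lemma essential_le_spectrum : essential_spectrum D nrm C `<=` spectrum D nrm C.
Proof.
move=> lam nf inv; apply: nf; apply: invertible_fredholm inv.
by move=> l x y; exact: dirichlet_lin.
Qed.

Lemma spectrum_real : Im w0 = 0 -> spectrum D nrm C = @unit_circle R /\
  essential_spectrum D nrm C = @unit_circle R.
Proof.
move=> w1.
have s1 : spectrum D nrm C `<=` @unit_circle R.
  move=> lam ninv; have [l1|l1|//] := ltgtP (nc lam) 1; exfalso; apply: ninv.
    exact: (invertible_real al htau).
  exact: (invertible_gt1 al htau).
have s2 : @unit_circle R `<=` essential_spectrum D nrm C.
  by move=> lam l1 [_ _ fc]; exact: (not_codim_real al htau w1 l1 fc).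
have s3 := essential_le_spectrum.
by split; apply/seteqP; split => // lam h; [exact/s3/s2|exact/s1/s3].
Qed.

Definition spiral : set R[i] :=
  [set cexp ((0 +i* 1) * w0 * t%:C) | t in [set t : R | 0 <= t]] `|` [set 0].

Lemma spectrum_upper : 0 < Im w0 -> spectrum D nrm C = spiral /\
  essential_spectrum D nrm C = spiral.
Proof.
move=> b0.
have s1 : spectrum D nrm C `<=` spiral.
  move=> lam ninv; apply: contrapT => nl; apply: ninv.
  have [l1|l1] := leP (nc lam) 1; last exact: (invertible_gt1 al htau).
  apply: (invertible_contour al htau) => //.
    by apply/eqP => l0; apply: nl; right.
  by move=> t t0 tl; apply: nl; left; exists t.
have s2 : spiral `<=` essential_spectrum D nrm C.
  move=> lam [[t t0 <-]|->]; last by move=> [_ _ fc]; exact: (not_codim_zero b0 fc).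
  move=> [_ cr _]; move: t0; rewrite /= le_eqVlt => /predU1P[tE|t0].
    by move: cr; rewrite -tE mulr0 cexp0; exact: (not_closed_one al htau b0).
  move: cr; rewrite (_ : (0 +i* 1) * w0 * t%:C = (0 +i* t) * w0).
    exact: (not_closed_exp al htau b0 t0).
  by rewrite [LHS]complex_eta [RHS]complex_eta !(ReM, ImM) /=; congr (_ +i* _); ring.
have s3 := essential_le_spectrum.
by split; apply/seteqP; split => // lam h; [exact/s3/s2|exact/s1/s3].
Qed.

End Spectrum.

End Final.

Theorem theorem5p2 (R : realType) (tau : half_plane R -> half_plane R)
    (w0 : R[i]) (htau : parabolic_self_map tau w0)
    (alpha : R) (halpha : -1 < alpha) :
  let D := @dirichlet_space R alpha in
  let nrm := @dirichlet_norm R alpha in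
  let C := @composition_operator R tau in
  [/\ bounded_operator D nrm C,
      complex.Im w0 = 0 ->
        spectrum D nrm C = @unit_circle R /\
        essential_spectrum D nrm C = @unit_circle R,
      0 < complex.Im w0 ->
        spectrum D nrm C =
          [set cexp ((0 +i* 1) * w0 * t%:C) | t in [set t : R | 0 <= t]]
            `|` [set 0] &
      essential_spectrum D nrm C = spectrum D nrm C].
Proof.
move=> D nrm C; split.
- exact: (composition_bounded halpha htau).
- by move=> w1; exact: (spectrum_real halpha htau).
- by move=> b0; exact: (spectrum_upper halpha htau b0).1.
- have := parabolic_im htau; rewrite le_eqVlt => /predU1P[w1|b0].
    by have [-> ->] := spectrum_real halpha htau (esym w1).
  by have [-> ->] := spectrum_upper halpha htau b0.
Qed.
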